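(* Let $\mu>0$, $b>0$, $\gamma\in\mathbb{R}$ with $\gamma\notin\{-1,-3,-5,\ldots\}$, put $\chi=b^2/4$ and $$S_{0,\gamma}^{\mu}(a,b)=\sum_{n=1}^\infty \frac{n^\gamma K_0(nb/a)}{(n^2+a^2)^\mu}.$$ Then, as $|a|\to\infty$ in $|\arg a|<\tfrac12\pi$, $$S^\mu_{0,\gamma}(a,b)-a^{\gamma-2\mu+1}H_{0,\gamma}^\mu(1)\sim a^{-2\mu}\sum_{k=0}^\infty \frac{(-1)^k}{k!} (\mu)_k\, \zeta(-\gamma-2k)\, F_k^{(\mu)}(0;\chi)\, a^{-2k} \left\{\log\frac{2a}{b}-\gamma_0+\frac{\zeta'(-\gamma-2k)}{\zeta(-\gamma-2k)}+F_*^{(1)}\right\},$$ where $$F_k^{(\mu)}(0;\chi)=\sum_{r=0}^k\frac{(-k)_r (-\chi)^r}{(1-\mu-k)_r\, (r!)^2},\qquad F_*^{(1)}=F_*^{(1)}(k)=\frac{1}{F_k^{(\mu)}(0;\chi)}\sum_{r=1}^k\frac{(-k)_r (-\chi)^r}{(1-k-\mu)_r (r!)^2}\,\bigl(\psi(1+r)-\psi(1)\bigr).$$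
   Context: $K_0$ is the modified Bessel function of the second kind of order $0$, $\zeta$ the Riemann zeta function, $\gamma_0=0.5772\ldots$ the Euler–Mascheroni constant, $\psi=\Gamma'/\Gamma$, $(x)_r=x(x+1)\cdots(x+r-1)$. Powers and logarithms take principal values. The products $\zeta(w)\cdot\frac{\zeta'(w)}{\zeta(w)}$ and $F_k^{(\mu)}(0;\chi)F_*^{(1)}$ are understood after cancellation, i.e. as $\zeta'(w)$ and as the finite sum defining $F_*^{(1)}$ without its prefactor, so zeros of the denominators cause no problem. $H_{0,\gamma}^\mu(1)$ is the value at $s=1$ of the meromorphic continuation in $s$ of $H_{0,\gamma}^\mu(s)=\int_0^\infty \frac{x^{\gamma+s-1}K_0(bx)}{(1+x^2)^\mu}\,dx$, the integral converging for $\Re s>-\gamma$. Meaning of the expansion: for every integer $K\ge0$ and every $\delta\in(0,\frac12\pi)$, the left-hand side minus the terms $0\le k<K$ of the right-hand side is $O(|a|^{-2\mu-2K}\log|a|)$ as $|a|\to\infty$ uniformly in $|\arg a|\le\frac12\pi-\delta$. *)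

(* Defs.v *)
(* Stdlib reals with Coquelicot *)
From Stdlib Require Export Reals Factorial List ClassicalEpsilon.
From Coquelicot Require Export Coquelicot.
Open Scope R_scope.

(** ** Principal branches *)

Definition Cexp (z : C) : C :=
  (exp (Re z) * cos (Im z), exp (Re z) * sin (Im z)).

(* Values in (-PI, PI]; the value at 0 is irrelevant. *)
Definition Carg (z : C) : R :=
  if Rle_dec 0 (Im z) then acos (Re z / Cmod z) else - acos (Re z / Cmod z).

Definition Clog (z : C) : C := (ln (Cmod z), Carg z).

Definition Cpower (z w : C) : C := Cexp (w * Clog z)%C.

(** ** Infinite and finite sums, improper integrals *)

Definition CSeries (u : nat -> C) : C :=
  (Series (fun n => Re (u n)), Series (fun n => Im (u n))).

(* [f 0 + ... + f (K - 1)]; empty when [K = 0]. *)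
Definition Csum (f : nat -> C) (K : nat) : C :=
  fold_right Cplus (RtoC 0) (map f (seq 0 K)).

(* Integral over (0, +oo), improper at both ends. *)
Definition CInt_pos (f : R -> C) : C :=
  RInt_gen (V := C_R_CompleteNormedModule) f (at_right 0) (Rbar_locally p_infty).

Definition RInt_pos (f : R -> R) : R :=
  RInt_gen f (at_right 0) (Rbar_locally p_infty).

(** ** Meromorphic continuation to the whole plane *)

Definition analytic_at (f : C -> C) (p : C) : Prop :=
  exists a : nat -> C,
    locally p (fun s : C =>
      is_pseries (K := C_AbsRing) (V := C_NormedModule) a (s - p)%C (f s)).

(* Laurent expansion with finite principal part; removable singularities are
   allowed and [f p] itself is not constrained. *)
Definition meromorphic_at (f : C -> C) (p : C) : Prop :=
  exists (N : nat) (a : nat -> C),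
    locally' p (fun s : C =>
      is_pseries (K := C_AbsRing) (V := C_NormedModule) a (s - p)%C
        (Cpow (s - p) N * f s)%C).

Definition is_mero_continuation (f0 : C -> C) (sigma : R) (f : C -> C) : Prop :=
  (forall p : C, meromorphic_at f p) /\
  (forall s : C, sigma < Re s -> f s = f0 s).

(* The value at [s] of the meromorphic continuation of [f0], given on
   [Re > sigma].  By the identity theorem there is at most one such value;
   it is unspecified at the poles or if there is no continuation. *)
Definition mero_continuation (f0 : C -> C) (sigma : R) (s : C) : C :=
  epsilon (inhabits (RtoC 0))
    (fun v => exists f : C -> C,
       is_mero_continuation f0 sigma f /\ analytic_at f s /\ f s = v).

(** ** Special functions *)

Definition zeta : C -> C :=
  mero_continuation
    (fun s => CSeries (fun n => Cpower (RtoC (INR (S n))) (- s)%C)) 1.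

Definition zeta' (w : C) : C := C_derive zeta w.

(* K_0(z) = int_0^oo exp (- z cosh t) dt, valid for Re z > 0. *)
Definition BesselK0 (z : C) : C :=
  CInt_pos (fun t => Cexp (- (z * RtoC (cosh t)))%C).

Definition euler_gamma : R :=
  real (Lim_seq (fun n => sum_n_m (fun k => / INR k) 1 n - ln (INR n))).

(* Euler's integral, valid for x > 0. *)
Definition Gamma_fun (x : R) : R :=
  RInt_pos (fun t => Rpower t (x - 1) * exp (- t)).

Definition psi (x : R) : R := Derive Gamma_fun x / Gamma_fun x.

Fixpoint pochhammer (x : R) (r : nat) : R :=
  match r with
  | O => 1
  | S r' => pochhammer x r' * (x + INR r')
  end.

(** ** The Mathieu-type series and its expansion *)

Definition S0 (mu gamma b : R) (a : C) : C :=
  CSeries (fun m =>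
    let n := INR (S m) in
    (RtoC (Rpower n gamma) * BesselK0 (RtoC (n * b) / a)
       / Cpower (RtoC (n ^ 2) + a * a) (RtoC mu))%C).

Definition H0_integral (mu gamma b : R) (s : C) : C :=
  CInt_pos (fun x =>
    (Cpower (RtoC x) (RtoC gamma + s - RtoC 1) * BesselK0 (RtoC (b * x))
       / RtoC (Rpower (1 + x ^ 2) mu))%C).

Definition H0 (mu gamma b : R) : C -> C :=
  mero_continuation (H0_integral mu gamma b) (- gamma).

Definition F_summand (mu chi : R) (k r : nat) : R :=
  pochhammer (- INR k) r * (- chi) ^ r
    / (pochhammer (1 - mu - INR k) r * INR (fact r) ^ 2).

Definition F (mu chi : R) (k : nat) : R :=
  sum_n_m (F_summand mu chi k) 0 k.

(* F_star^(1) without its prefactor, i.e. the product F * F_star^(1). *)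
Definition F_Fstar (mu chi : R) (k : nat) : R :=
  sum_n_m (fun r => F_summand mu chi k r * (psi (1 + INR r) - psi 1)) 1 k.

(* The k-th term, prefactor a^(-2 mu) excluded.  The product
   zeta F {log (2a/b) - gamma_0 + zeta'/zeta + F_star^(1)} is multiplied out, so
   that zeros of zeta and of F cause no division by zero. *)
Definition expansion_term (mu gamma b : R) (a : C) (k : nat) : C :=
  let chi := b ^ 2 / 4 in
  let w := RtoC (- gamma - 2 * INR k) in
  (RtoC ((-1) ^ k / INR (fact k) * pochhammer mu k)
   * (zeta w * RtoC (F mu chi k)
        * (Clog (RtoC 2 * a / RtoC b) - RtoC euler_gamma)
      + zeta' w * RtoC (F mu chi k)
      + zeta w * RtoC (F_Fstar mu chi k))
   * Cpower a (RtoC (- 2 * INR k)))%C.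

(* Main.v *)
Require Import Defs.
From Stdlib Require Import Lra Lia Psatz.

(** Put [f z = K_0(b z) (1 + z^2)^(-mu)] and [g z = z^gamma f z].  Up to the factor [a^(-2 mu)] the series is
    [sum_n n^gamma f(n/a) = a^gamma sum_n g(n/a)].  At the origin
    [f z = sum_(k<N) z^(2k) (A_k + B_k log z) + O(|z|^(2N-1))] on every closed subcone of [Re z > 0], together
    with all derivatives, while [g] and its derivatives decay faster than any power at infinity.  Apply
    Euler-Maclaurin summation to [g(x/a)] minus its expansion: the error terms at [x = 1] and the remainder
    integral are [O(|a|^(1-2N))].  Summing the expansion itself against the same formula yields [zeta] and
    [zeta'] at [-gamma - 2k], because Euler-Maclaurin summation is also what continues [zeta].  The boundary
    terms at infinity leave only the limit [H] of the primitive of [g] whose regular part vanishes at [0];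
    this is a Hadamard finite part, hence the value at [1] of the continued Mellin transform.
    The loss of one power of [|a|] is harmless: take [N > K] and absorb the terms [K <= k < N]. *)

(** The terms [n^gamma (n/a)^(2k) (A_k + B_k (log n - log a))], summed over [n] in the regularised
    sense, give [a^(-2k) ((A_k - B_k log a) zeta(w) - B_k zeta'(w))] with [w = -gamma - 2k]. So
    [log a] and [zeta'] both stem from the logarithm of [K_0], and Euler's constant from the
    constant that accompanies it. The condition on [gamma] acts three times: [w] avoids the pole of
    [zeta], no exponent [gamma + 2k + 1] of a termwise primitive vanishes, and the continued Mellin
    transform is regular at [1]. Euler-Maclaurin summation asks for bounds on derivatives of the
    remainders, on cones, because [n/a] runs along a ray. They come from closure under
    differentiation: by Bessel's equation, and by the shift of [mu] to [mu + 1], the derivative of a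
    remainder is again made of remainders, so that bounding the remainders themselves is enough.
    Both [zeta] and [H0] are specified only as values of some meromorphic continuation. Hence the
    continuations are built explicitly from power series, and an identity theorem shows that any
    other continuation has the same values. *)

(** * Choice and moduli of complex numbers *)

Lemma fun_choice (A B : Type) (P : A -> B -> Prop) :
  (forall x, exists y, P x y) -> exists f, forall x, P x (f x).
Proof.
  intros H. exists (fun x => proj1_sig (constructive_indefinite_description _ (H x))).
  intros x. apply proj2_sig.
Qed.

Lemma C_eq (x y : C) : Re x = Re y -> Im x = Im y -> x = y.
Proof. destruct x, y; simpl; intros -> ->; reflexivity. Qed.

Lemma Re_minus (x y : C) : Re (x - y)%C = Re x - Re y.
Proof. destruct x, y; simpl; ring. Qed.
Lemma Im_minus (x y : C) : Im (x - y)%C = Im x - Im y.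
Proof. destruct x, y; simpl; ring. Qed.
Lemma Re_plus (x y : C) : Re (x + y)%C = Re x + Re y.
Proof. destruct x, y; simpl; ring. Qed.
Lemma Im_plus (x y : C) : Im (x + y)%C = Im x + Im y.
Proof. destruct x, y; simpl; ring. Qed.
Lemma Re_mult (x y : C) : Re (x * y)%C = Re x * Re y - Im x * Im y.
Proof. destruct x, y; simpl; ring. Qed.
Lemma Im_mult (x y : C) : Im (x * y)%C = Re x * Im y + Im x * Re y.
Proof. destruct x, y; simpl; ring. Qed.

Lemma im_le_Cmod (c : C) : Rabs (Im c) <= Cmod c.
Proof. destruct c as [x y]. eapply Rle_trans; [|apply Rmax_Cmod]. apply Rmax_r. Qed.

Lemma Cmod_le_abs (c : C) : Cmod c <= Rabs (Re c) + Rabs (Im c).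
Proof.
  destruct c as [x y]; simpl.
  replace (x, y) with (RtoC x + Ci * RtoC y)%C by (apply C_eq; simpl; ring).
  eapply Rle_trans; [apply Cmod_triangle|].
  rewrite Cmod_mult, Cmod_Ci, !Cmod_R; lra.
Qed.

Lemma Cmod_minus_sym (x y : C) : Cmod (x - y) = Cmod (y - x).
Proof. replace (x - y)%C with (- (y - x))%C by ring. apply Cmod_opp. Qed.

Lemma Cmod_triangle_minus (x y : C) : Cmod (x - y) <= Cmod x + Cmod y.
Proof. unfold Cminus. eapply Rle_trans; [apply Cmod_triangle|]. rewrite Cmod_opp; lra. Qed.

Lemma Cmod_triangle_inv (x y : C) : Cmod x - Cmod y <= Cmod (x - y).
Proof.
  assert (H := Cmod_triangle (x - y) y).
  replace (x - y + y)%C with x in H by ring. lra.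
Qed.

Lemma Cmod_Rpos (x : R) : 0 <= x -> Cmod (RtoC x) = x.
Proof. intros; rewrite Cmod_R; now apply Rabs_pos_eq. Qed.

Lemma norm_C_R (z : C) : @norm R_AbsRing C_R_NormedModule z = Cmod z.
Proof.
  destruct z as [x y].
  change (sqrt ((Rabs x)^2 + (Rabs y)^2) = sqrt (x^2 + y^2)).
  now rewrite !pow2_abs.
Qed.

(** * Differentiation *)

Definition cder (f : C -> C) (z l : C) : Prop :=
  @is_derive C_AbsRing C_NormedModule f z l.

Definition rder (f : R -> C) (t : R) (l : C) : Prop :=
  @is_derive R_AbsRing C_R_NormedModule f t l.

(** Brings the derivative by filters down to an estimate in [Cmod], the norm in which all later
    bounds are stated. *)
Lemma cder_eps (f : C -> C) (z l : C) :
  cder f z l <->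
  forall eps, 0 < eps -> exists d, 0 < d /\
    forall w, Cmod (w - z) < d -> Cmod (f w - f z - (w - z) * l) <= eps * Cmod (w - z).
Proof.
  split.
  - intros [_ H] eps Heps.
    destruct (H z (fun P HP => HP) (mkposreal _ Heps)) as [d Hd].
    exists d; split; [apply cond_pos|].
    intros w Hw. apply (Hd w Hw).
  - intros H. split; [apply is_linear_scal_l|].
    intros x Hx. apply (is_filter_lim_locally_unique (K:=C_AbsRing) (V:=AbsRing_NormedModule C_AbsRing)) in Hx. subst x.
    intros eps. destruct (H eps (cond_pos eps)) as [d [Hd0 Hd]].
    exists (mkposreal _ Hd0). intros w Hw. apply (Hd w Hw).
Qed.

Lemma rder_comp (f : R -> C) (t : R) (l : C) :
  rder f t l <-> is_derive (fun t => Re (f t)) t (Re l) /\ is_derive (fun t => Im (f t)) t (Im l).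
Proof.
  split.
  - intros [_ H]; split; (split; [apply is_linear_scal_l|]); intros x Hx;
      apply (is_filter_lim_locally_unique (K:=R_AbsRing) (V:=R_NormedModule)) in Hx; subst x;
      intros eps; specialize (H t (fun P HP => HP) eps); revert H; apply filter_imp; intros y Hy;
      rewrite norm_C_R in Hy; (eapply Rle_trans; [|apply Hy]).
    + apply (re_le_Cmod (f y - f t - (RtoC (y - t)) * l)%C : _ <= _) || 
      (eapply Rle_trans; [|apply re_le_Cmod]; right; reflexivity).
    + eapply Rle_trans; [|apply im_le_Cmod]; right; reflexivity.
  - intros [[_ H1] [_ H2]]. split; [apply is_linear_scal_l|].
    intros x Hx; apply (is_filter_lim_locally_unique (K:=R_AbsRing) (V:=R_NormedModule)) in Hx; subst x.
    intros eps.
    assert (He : 0 < eps / 2) by (generalize (cond_pos eps); lra).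
    generalize (filter_and _ _ (H1 t (fun P HP => HP) (mkposreal _ He)) (H2 t (fun P HP => HP) (mkposreal _ He))).
    apply filter_imp; intros y [Hy1 Hy2]. rewrite norm_C_R. 
    eapply Rle_trans; [apply Cmod_le_abs|].
    simpl in Hy1, Hy2.
    eapply Rle_trans; [apply Rplus_le_compat; [apply Hy1|apply Hy2]|].
    simpl; lra.
Qed.

Lemma cder_unique f z l1 l2 : cder f z l1 -> cder f z l2 -> l1 = l2.
Proof. intros H1 H2. apply is_C_derive_unique in H1, H2. congruence. Qed.

Lemma cder_eq f z l1 l2 : cder f z l1 -> l1 = l2 -> cder f z l2.
Proof. intros; now subst. Qed.

Lemma cder_ext_loc f g z l d : 0 < d -> (forall w, Cmod (w - z) < d -> f w = g w) ->
  cder f z l -> cder g z l.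
Proof.
  intros Hd He H. rewrite cder_eps in *. intros eps Heps.
  destruct (H eps Heps) as [d' [Hd' H']].
  exists (Rmin d d'); split; [now apply Rmin_pos|].
  intros w Hw.
  rewrite <- !He.
  - apply H'. eapply Rlt_le_trans; [apply Hw|apply Rmin_r].
  - replace (z - z)%C with (RtoC 0) by ring. rewrite Cmod_0; auto.
  - eapply Rlt_le_trans; [apply Hw|apply Rmin_l].
Qed.

Lemma cder_ext f g z l : (forall w, f w = g w) -> cder f z l -> cder g z l.
Proof. intros He. apply (cder_ext_loc f g z l 1); auto; lra. Qed.

Lemma Re_pos_near z w : 0 < Re z -> Cmod (w - z) < Re z -> 0 < Re w.
Proof.
  intros Hz Hw. assert (H := re_le_Cmod (w - z)). 
  rewrite Re_minus in H.
  apply Rabs_le_between in H. lra.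
Qed.

Lemma cder_ext_half f g z l : 0 < Re z -> (forall w, 0 < Re w -> f w = g w) ->
  cder f z l -> cder g z l.
Proof.
  intros Hz He. apply (cder_ext_loc f g z l (Re z)); auto.
  intros w Hw; apply He. eapply Re_pos_near; eauto.
Qed.

Lemma cder_const c z : cder (fun _ => c) z 0.
Proof. apply @is_derive_const. Qed.

Lemma cder_id z : cder (fun w => w) z 1.
Proof.
  apply cder_eps. intros eps He. exists 1; split; [lra|]. intros w _.
  replace (w - z - (w - z) * 1)%C with (RtoC 0) by ring. rewrite Cmod_0.
  apply Rmult_le_pos; [lra|apply Cmod_ge_0].
Qed.

Lemma cder_plus f g z lf lg : cder f z lf -> cder g z lg -> cder (fun w => f w + g w)%C z (lf + lg)%C.
Proof. apply (@is_derive_plus C_AbsRing C_NormedModule). Qed.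

Lemma cder_opp f z lf : cder f z lf -> cder (fun w => - f w)%C z (- lf)%C.
Proof. apply (@is_derive_opp C_AbsRing C_NormedModule). Qed.

Lemma cder_minus f g z lf lg : cder f z lf -> cder g z lg -> cder (fun w => f w - g w)%C z (lf - lg)%C.
Proof. intros; apply cder_plus; [|apply cder_opp]; auto. Qed.

Lemma cder_AbsRing f z l : cder f z l <-> @is_derive C_AbsRing (AbsRing_NormedModule C_AbsRing) f z l.
Proof.
  split; intros [_ H]; (split; [apply is_linear_scal_l|]); exact H.
Qed.

Lemma cder_mult f g z lf lg : cder f z lf -> cder g z lg ->
  cder (fun w => f w * g w)%C z (lf * g z + f z * lg)%C.
Proof.
  rewrite !cder_AbsRing. intros Hf Hg.
  exact (@is_derive_mult C_AbsRing f g z lf lg Hf Hg Cmult_comm).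
Qed.

Lemma cder_scal c f z lf : cder f z lf -> cder (fun w => c * f w)%C z (c * lf)%C.
Proof.
  intros H. eapply cder_eq; [apply cder_mult; [apply cder_const|apply H]|].
  cbv beta; ring.
Qed.

Lemma cder_comp f g z lf lg : cder f (g z) lf -> cder g z lg ->
  cder (fun w => f (g w)) z (lg * lf)%C.
Proof.
  intros Hf Hg. rewrite cder_AbsRing in Hg.
  exact (@is_derive_comp C_AbsRing C_NormedModule f g z lf lg Hf Hg).
Qed.

(** A quadratic error beats every multiple of [|h|]. The derivatives of [Cexp], of [Clog] at [1], of
    the Bessel integrals and of power series are all found in this way. *)
Lemma cder_quad f z l d B : 0 < d ->
  (forall h, Cmod h < d -> Cmod (f (z + h) - f z - h * l)%C <= B * (Cmod h)^2) -> cder f z l.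
Proof.
  intros Hd H. rewrite cder_eps. intros eps Heps.
  assert (HB : 0 <= Rabs B) by apply Rabs_pos.
  exists (Rmin d (eps / (Rabs B + 1))); split.
  { apply Rmin_pos; auto. apply Rdiv_lt_0_compat; lra. }
  intros w Hw.
  assert (Hw1 := Rlt_le_trans _ _ _ Hw (Rmin_l _ _)).
  assert (Hw2 := Rlt_le_trans _ _ _ Hw (Rmin_r _ _)).
  specialize (H (w - z)%C Hw1). replace (z + (w - z))%C with w in H by ring.
  eapply Rle_trans; [apply H|].
  assert (H3 := Cmod_ge_0 (w - z)). assert (B <= Rabs B) by apply Rle_abs.
  assert (Cmod (w - z) * (Rabs B + 1) <= eps).
  { apply Rmult_le_reg_r with (/ (Rabs B + 1)); [apply Rinv_0_lt_compat; lra|].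
    rewrite Rmult_assoc, Rinv_r by lra. rewrite Rmult_1_r. apply Rlt_le, Hw2. }
  simpl. nra.
Qed.

Lemma cder_inv (z : C) : z <> RtoC 0 -> cder Cinv z (- / (z * z))%C.
Proof.
  intros Hz. assert (Hm : 0 < Cmod z) by now apply Cmod_gt_0.
  apply cder_quad with (d := Cmod z / 2) (B := 2 / (Cmod z)^3); [lra|].
  intros h Hh.
  assert (H1 := Cmod_triangle_inv z (- h)). rewrite Cmod_opp in H1.
  replace (z - - h)%C with (z + h)%C in H1 by ring.
  assert (Hzh : (z + h)%C <> 0) by (apply Cmod_gt_0; lra).
  replace (/ (z + h) - / z - h * - / (z * z))%C with (h * h * / (z * z * (z + h)))%C
    by (field; auto).
  rewrite !Cmod_mult, Cmod_inv, !Cmod_mult by (repeat apply Cmult_neq_0; auto).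
  replace (Cmod h ^ 2) with (Cmod h * Cmod h) by ring.
  rewrite Rmult_comm. apply Rmult_le_compat_r; [apply Rmult_le_pos; apply Cmod_ge_0|].
  replace (2 / Cmod z ^ 3) with (/ (Cmod z * Cmod z * (Cmod z / 2))) by (field; lra).
  assert (0 < Cmod z * Cmod z) by (apply Rmult_lt_0_compat; lra).
  apply Rinv_le_contravar; [apply Rmult_lt_0_compat; lra|].
  apply Rmult_le_compat_l; lra.
Qed.

Lemma rder_path f u v t l : cder f (u + RtoC t * v)%C l -> rder (fun t => f (u + RtoC t * v)%C) t (l * v)%C.
Proof.
  intros H. split; [apply is_linear_scal_l|].
  intros x Hx; apply (is_filter_lim_locally_unique (K:=R_AbsRing) (V:=R_NormedModule)) in Hx; subst x.
  intros eps. rewrite cder_eps in H.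
  assert (Hv := Cmod_ge_0 v).
  assert (He : 0 < eps / (Cmod v + 1)) by (apply Rdiv_lt_0_compat; [apply cond_pos|lra]).
  destruct (H _ He) as [d [Hd H1]].
  assert (Hd' : 0 < d / (Cmod v + 1)) by (apply Rdiv_lt_0_compat; lra).
  exists (mkposreal _ Hd'). intros s Hs. rewrite norm_C_R.
  change (Rabs (s - t) < d / (Cmod v + 1)) in Hs.
  assert (E : (u + s * v - (u + t * v) = RtoC (s - t) * v)%C) by (rewrite RtoC_minus; ring).
  assert (Hst := Rabs_pos (s - t)).
  assert (Hs' : Rabs (s - t) * (Cmod v + 1) < d).
  { apply Rmult_lt_reg_r with (/ (Cmod v + 1)); [apply Rinv_0_lt_compat; lra|].
    rewrite Rmult_assoc, Rinv_r by lra. rewrite Rmult_1_r. apply Hs. }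
  specialize (H1 (u + s * v)%C). rewrite E, Cmod_mult, Cmod_R in H1.
  match goal with |- Cmod ?X <= ?Y =>
    replace X with (f (u + s * v) - f (u + t * v) - RtoC (s - t)%R * v * l)%C;
    [replace Y with (eps * Rabs (s - t)) by reflexivity|] end.
  - eapply Rle_trans; [apply H1; nra|].
    apply Rle_trans with (eps / (Cmod v + 1) * (Rabs (s - t) * (Cmod v + 1))).
    + apply Rmult_le_compat_l; nra.
    + right; field; lra.
  - change (f (u + s * v)%C - f (u + t * v)%C - RtoC (s - t)%R * v * l =
      (f (u + s * v)%C - f (u + t * v)%C) - (scal (V:=C_R_NormedModule) (s - t)%R (l * v)%C))%C.
    replace (scal (V:=C_R_NormedModule) (s - t)%R (l * v)%C) with (RtoC (s - t)%R * (l * v))%C.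
    + ring.
    + symmetry. apply scal_R_Cmult.
Qed.

Lemma rder_eq f t l1 l2 : rder f t l1 -> l1 = l2 -> rder f t l2.
Proof. intros; now subst. Qed.

Lemma rder_unique f t l1 l2 : rder f t l1 -> rder f t l2 -> l1 = l2.
Proof.
  intros [H1 H1']%rder_comp [H2 H2']%rder_comp.
  apply is_derive_unique in H1, H1', H2, H2'.
  apply C_eq; congruence.
Qed.

Lemma rder_ext f g t l : (forall s, f s = g s) -> rder f t l -> rder g t l.
Proof. intros He. apply (@is_derive_ext R_AbsRing C_R_NormedModule); auto. Qed.

Lemma rder_const c t : rder (fun _ => c) t 0.
Proof. apply @is_derive_const. Qed.

Lemma rder_plus f g t lf lg : rder f t lf -> rder g t lg -> rder (fun s => f s + g s)%C t (lf + lg)%C.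
Proof. apply (@is_derive_plus R_AbsRing C_R_NormedModule). Qed.

Lemma rder_minus f g t lf lg : rder f t lf -> rder g t lg -> rder (fun s => f s - g s)%C t (lf - lg)%C.
Proof. apply (@is_derive_minus R_AbsRing C_R_NormedModule). Qed.

Lemma rder_mult f g t lf lg : rder f t lf -> rder g t lg ->
  rder (fun s => f s * g s)%C t (lf * g t + f t * lg)%C.
Proof.
  rewrite !rder_comp. intros [H1 H1'] [H2 H2']. split.
  - simpl. eapply (is_derive_ext (fun s => Re (f s) * Re (g s) - Im (f s) * Im (g s))); [reflexivity|].
    evar_last.
    + apply (is_derive_minus (V:=R_NormedModule)); (eapply (is_derive_mult (K:=R_AbsRing)); [eassumption|eassumption|apply Rmult_comm]).
    + unfold Re, Im, minus, plus, opp, mult; simpl; ring.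
  - simpl. eapply (is_derive_ext (fun s => Re (f s) * Im (g s) + Im (f s) * Re (g s))); [reflexivity|].
    evar_last.
    + apply (is_derive_plus (V:=R_NormedModule)); (eapply (is_derive_mult (K:=R_AbsRing)); [eassumption|eassumption|apply Rmult_comm]).
    + unfold Re, Im, minus, plus, opp, mult; simpl; ring.
Qed.

Lemma rder_scal c f t lf : rder f t lf -> rder (fun s => c * f s)%C t (c * lf)%C.
Proof.
  intros H. eapply rder_eq; [apply rder_mult; [apply rder_const|apply H]|]. cbv beta; ring.
Qed.

Lemma rder_RtoC f t l : is_derive f t l -> rder (fun s => RtoC (f s)) t (RtoC l).
Proof. intros H. apply rder_comp; split; simpl; [apply H|apply (@is_derive_const R_AbsRing R_NormedModule)]. Qed.

(* The scalar product with the increment reduces the complex case to the real mean value theorem. *)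
Lemma mean_value_majorant (f f' : R -> C) (psi psi' : R -> R) a b : a <= b ->
  (forall t, a <= t <= b -> rder f t (f' t)) ->
  (forall t, a <= t <= b -> is_derive psi t (psi' t)) ->
  (forall t, a <= t <= b -> Cmod (f' t) <= psi' t) ->
  Cmod (f b - f a) <= psi b - psi a.
Proof.
  intros Hab Hf Hp Hb.
  set (d := (f b - f a)%C).
  set (F := fun t => (Re d * Re (f t) + Im d * Im (f t)) - Cmod d * psi t).
  assert (HF : forall t, a <= t <= b ->
    is_derive F t ((Re d * Re (f' t) + Im d * Im (f' t)) - Cmod d * psi' t)).
  { intros t Ht. destruct (proj1 (rder_comp _ _ _) (Hf t Ht)) as [H1 H2].
    apply (is_derive_minus (V:=R_NormedModule)); [apply (is_derive_plus (V:=R_NormedModule))|];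
    apply is_derive_scal; auto. }
  assert (Hm := MVT_gen F a b (fun t => (Re d * Re (f' t) + Im d * Im (f' t)) - Cmod d * psi' t)).
  cbv zeta in Hm. rewrite Rmin_left, Rmax_right in Hm by auto.
  destruct Hm as [c [Hc Hm]].
  { intros; apply HF; lra. }
  { intros. apply continuity_pt_filterlim. apply (ex_derive_continuous F). eexists; apply HF; auto. }
  assert (Hcs : Re d * Re (f' c) + Im d * Im (f' c) <= Cmod d * Cmod (f' c)).
  { replace (Re d * Re (f' c) + Im d * Im (f' c)) with (Re (Cconj d * f' c)%C) by (rewrite Re_mult; unfold Cconj, Re, Im; simpl; ring).
    rewrite <- (Cmod_conj d), <- Cmod_mult.
    eapply Rle_trans; [apply Rle_abs|apply re_le_Cmod]. }
  assert (Hd0 := Cmod_ge_0 d).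
  assert (Hle : F b - F a <= 0).
  { rewrite Hm. assert (Hcb := Hb c Hc).
    assert (Hcb' := Rmult_le_compat_l _ _ _ Hd0 Hcb).
    apply Ropp_le_cancel. rewrite Ropp_0, <- Ropp_mult_distr_l_reverse.
    apply Rmult_le_pos; lra. }
  assert (E : Re d * Re (f b) + Im d * Im (f b) - (Re d * Re (f a) + Im d * Im (f a)) = Cmod d ^ 2).
  { rewrite Cmod2_alt. unfold d; rewrite Re_minus, Im_minus; ring. }
  unfold F in Hle.
  (* The scalar product gives [|d|^2 <= |d| (psi b - psi a)]. For [d = 0] the factor cannot be
     divided out, and what remains to be shown is that [psi] increases. *)
  destruct (Req_dec (Cmod d) 0) as [E0|E0].
  - rewrite E0.
    destruct (MVT_gen psi a b psi') as [c' [Hc' Hm']].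
    { rewrite Rmin_left, Rmax_right by auto. intros; apply Hp; lra. }
    { rewrite Rmin_left, Rmax_right by auto. intros. apply continuity_pt_filterlim.
      apply (ex_derive_continuous psi). eexists; apply Hp; auto. }
    rewrite Rmin_left, Rmax_right in Hc' by auto.
    assert (H1 := Hb c' Hc'). assert (H2 := Cmod_ge_0 (f' c')).
    rewrite Hm'. apply Rmult_le_pos; lra.
  - apply Rmult_le_reg_l with (Cmod d); [lra|].
    replace (Cmod d * Cmod d) with (Cmod d ^ 2) by ring. lra.
Qed.

Lemma mean_value_seg f f' u v B :
  (forall t, 0 <= t <= 1 -> cder f (u + RtoC t * v)%C (f' t)) ->
  (forall t, 0 <= t <= 1 -> Cmod (f' t) <= B) ->
  Cmod (f (u + v)%C - f u) <= B * Cmod v.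
Proof.
  intros H HB.
  assert (M := mean_value_majorant (fun t => f (u + RtoC t * v)%C) (fun t => f' t * v)%C
    (fun t => B * Cmod v * t) (fun t => B * Cmod v) 0 1).
  simpl in M. replace (u + 1 * v)%C with (u + v)%C in M by ring.
  replace (u + 0 * v)%C with u in M by ring.
  replace (B * Cmod v) with (B * Cmod v * 1 - B * Cmod v * 0) by ring. apply M; [lra| | |].
  - intros; apply rder_path; auto.
  - intros; auto_derive; auto; ring.
  - intros; rewrite Cmod_mult. apply Rmult_le_compat_r; [apply Cmod_ge_0|auto].
Qed.

(** * The complex exponential and its Taylor remainders *)

Lemma Cexp_plus (z w : C) : Cexp (z + w) = (Cexp z * Cexp w)%C.
Proof.
  unfold Cexp. rewrite Re_plus, Im_plus, exp_plus, cos_plus, sin_plus.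
  apply C_eq; simpl; ring.
Qed.

Lemma Cexp_RtoC (x : R) : Cexp (RtoC x) = RtoC (exp x).
Proof. unfold Cexp; simpl. rewrite cos_0, sin_0. apply C_eq; simpl; ring. Qed.

Lemma Cexp_0 : Cexp 0 = 1.
Proof. rewrite Cexp_RtoC, exp_0; reflexivity. Qed.

Lemma Cmod_Cexp (z : C) : Cmod (Cexp z) = exp (Re z).
Proof.
  unfold Cexp, Cmod; simpl.
  replace (_ + _) with (Rsqr (exp (Re z))).
  - rewrite sqrt_Rsqr; [reflexivity|apply Rlt_le, exp_pos].
  - generalize (sin2_cos2 (Im z)). unfold Rsqr. intros H.
    transitivity (exp (Re z) * exp (Re z) * (sin (Im z) * sin (Im z) + cos (Im z) * cos (Im z))); [rewrite H|]; ring.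
Qed.

Lemma Cexp_neq_0 (z : C) : Cexp z <> RtoC 0.
Proof. apply Cmod_gt_0. rewrite Cmod_Cexp. apply exp_pos. Qed.

Lemma Cexp_opp (z : C) : Cexp (- z) = (/ Cexp z)%C.
Proof.
  assert (H : (Cexp z * Cexp (- z))%C = 1).
  { rewrite <- Cexp_plus. replace (z + - z)%C with (RtoC 0) by ring. apply Cexp_0. }
  transitivity (/ Cexp z * (Cexp z * Cexp (- z)))%C.
  - rewrite Cmult_assoc, Cinv_l, Cmult_1_l; auto. apply Cexp_neq_0.
  - rewrite H; ring.
Qed.

Lemma Cexp_scal_nat (z : C) (n : nat) : Cexp (RtoC (INR n) * z) = Cpow (Cexp z) n.
Proof.
  induction n as [|n IH].
  - simpl. replace (0 * z)%C with (RtoC 0) by ring. apply Cexp_0.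
  - rewrite S_INR, RtoC_plus. replace ((INR n + 1) * z)%C with (z + INR n * z)%C by ring.
    rewrite Cexp_plus, IH. reflexivity.
Qed.

Lemma exp_le_mono x y : x <= y -> exp x <= exp y.
Proof. intros [H| ->]; [apply Rlt_le, exp_increasing, H|lra]. Qed.

Lemma rder_Cexp_ray (h : C) t : rder (fun t => Cexp (RtoC t * h)) t (h * Cexp (RtoC t * h))%C.
Proof.
  destruct h as [u v]. apply rder_comp. simpl. split.
  - apply is_derive_ext with (fun t => exp (t * u) * cos (t * v)).
    { intros s. f_equal; f_equal; ring. }
    auto_derive; auto. replace (t * u - 0 * v) with (t * u) by ring.
    replace (t * v + 0 * u) with (t * v) by ring. ring.
  - apply is_derive_ext with (fun t => exp (t * u) * sin (t * v)).
    { intros s. f_equal; f_equal; ring. }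
    auto_derive; auto. replace (t * u - 0 * v) with (t * u) by ring.
    replace (t * v + 0 * u) with (t * v) by ring. ring.
Qed.

Lemma Cmod_Cexp_le (z : C) : Cmod (Cexp z) <= exp (Cmod z).
Proof.
  rewrite Cmod_Cexp. apply exp_le_mono.
  eapply Rle_trans; [apply Rle_abs|apply re_le_Cmod].
Qed.

Definition Cexp_partial (z : C) (K : nat) : C :=
  Csum (fun k => RtoC (/ INR (fact k)) * Cpow z k)%C K.

Lemma Csum_S (f : nat -> C) K : Csum f (S K) = (Csum f K + f K)%C.
Proof.
  unfold Csum. rewrite seq_S, map_app, fold_right_app. simpl.
  generalize (map f (seq 0 K)) as l. induction l as [|a l IH]; simpl; [ring|].
  rewrite IH; ring.
Qed.

Lemma Csum_0 (f : nat -> C) : Csum f 0 = 0.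
Proof. reflexivity. Qed.

Lemma Csum_ext (f g : nat -> C) K : (forall k, (k < K)%nat -> f k = g k) -> Csum f K = Csum g K.
Proof.
  induction K as [|K IH]; intros H; [reflexivity|].
  rewrite !Csum_S, IH, H; auto.
Qed.

Lemma Csum_scal (c : C) (f : nat -> C) K : Csum (fun k => c * f k)%C K = (c * Csum f K)%C.
Proof.
  induction K as [|K IH]; [rewrite !Csum_0; ring|]. rewrite !Csum_S, IH; ring.
Qed.

Lemma Csum_plus (f g : nat -> C) K : Csum (fun k => f k + g k)%C K = (Csum f K + Csum g K)%C.
Proof.
  induction K as [|K IH]; [rewrite !Csum_0; ring|]. rewrite !Csum_S, IH; ring.
Qed.

Lemma Csum_minus (f g : nat -> C) K : Csum (fun k => f k - g k)%C K = (Csum f K - Csum g K)%C.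
Proof.
  induction K as [|K IH]; [rewrite !Csum_0; ring|]. rewrite !Csum_S, IH; ring.
Qed.

Lemma rder_Csum (f f' : nat -> R -> C) t K :
  (forall k, (k < K)%nat -> rder (f k) t (f' k t)) ->
  rder (fun s => Csum (fun k => f k s) K) t (Csum (fun k => f' k t) K).
Proof.
  induction K as [|K IH]; intros H; [exact (rder_const 0 t)|].
  rewrite Csum_S. eapply rder_ext; [intros s; symmetry; apply Csum_S|].
  apply rder_plus; auto.
Qed.

Lemma cder_Csum (f f' : nat -> C -> C) z K :
  (forall k, (k < K)%nat -> cder (f k) z (f' k z)) ->
  cder (fun s => Csum (fun k => f k s) K) z (Csum (fun k => f' k z) K).
Proof.
  induction K as [|K IH]; intros H; [exact (cder_const 0 z)|].
  rewrite Csum_S. eapply cder_ext; [intros s; symmetry; apply Csum_S|].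
  apply cder_plus; auto.
Qed.

Lemma Csum_Sl (f : nat -> C) K : Csum f (S K) = (f O + Csum (fun k => f (S k)) K)%C.
Proof.
  induction K as [|K IH]; [rewrite Csum_S, !Csum_0; ring|].
  rewrite Csum_S, IH, Csum_S; ring.
Qed.

Lemma rder_pow_ray (z : C) (n : nat) t :
  rder (fun s => Cpow (RtoC s * z) n) t (RtoC (INR n) * z * Cpow (RtoC t * z) (pred n))%C.
Proof.
  assert (H1 : rder (fun s => RtoC s * z)%C t z).
  { eapply rder_eq; [apply rder_mult; [apply rder_RtoC, (@is_derive_id R_AbsRing)|apply rder_const]|].
    cbv beta. change (@one R_AbsRing) with 1%R. ring. }
  induction n as [|n IH].
  - simpl. eapply rder_eq; [apply rder_const|]. ring.
  - change (rder (fun s => (RtoC s * z) * Cpow (RtoC s * z) n)%C t (RtoC (INR (S n)) * z * Cpow (RtoC t * z) n)%C).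
    eapply rder_eq; [apply rder_mult; [apply H1|apply IH]|].
    cbv beta. rewrite S_INR, RtoC_plus.
    destruct n as [|n]; [simpl; ring|]. 
    change (pred (S n)) with n. rewrite S_INR, RtoC_plus. 
    change (Cpow (t * z) (S n)) with (t * z * Cpow (t * z) n)%C. ring.
Qed.

(** Along the ray [t z] the remainder of order [K + 1] has [z] times the remainder of order [K] as
    derivative, so the bound follows by induction and integration of [t^K]. The factor [exp |z|] is
    the same for all [K]. *)
Lemma Cexp_remainder (z : C) (K : nat) :
  Cmod (Cexp z - Cexp_partial z K) <= (Cmod z) ^ K / INR (fact K) * exp (Cmod z).
Proof.
  revert z; induction K as [|K IH]; intros z.
  - unfold Cexp_partial. rewrite Csum_0. replace (Cexp z - 0)%C with (Cexp z) by ring.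
    simpl. unfold Rdiv. rewrite Rinv_1, !Rmult_1_l. apply Cmod_Cexp_le.
  - set (f := fun t : R => (Cexp (t * z) - Cexp_partial (t * z) (S K))%C).
    assert (Hf : forall t, rder f t (z * (Cexp (t * z) - Cexp_partial (t * z) K))%C).
    { intros t. unfold f.
      eapply rder_eq.
      - apply rder_minus; [apply rder_Cexp_ray|]. unfold Cexp_partial.
        apply (rder_Csum (fun k s => RtoC (/ INR (fact k)) * Cpow (s * z) k)%C
          (fun k s => RtoC (/ INR (fact k)) * (RtoC (INR k) * z * Cpow (s * z) (pred k)))%C).
        intros k _. apply rder_scal, rder_pow_ray.
      - rewrite Csum_Sl. cbv beta.
        replace (z * (Cexp (t * z) - Cexp_partial (t * z) K))%C with
          (z * Cexp (t * z) - z * Cexp_partial (t * z) K)%C by ring.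
        f_equal. unfold Cexp_partial. rewrite <- Csum_scal.
        change (INR 0) with 0%R.
        match goal with |- Cplus ?A ?B = _ => replace A with (RtoC 0) by ring end.
        rewrite Cplus_0_l. apply Csum_ext. intros k _.
        change (pred (S k)) with k.
        rewrite Cmult_assoc, Cmult_assoc, <- RtoC_mult.
        replace (/ INR (fact (S k)) * INR (S k)) with (/ INR (fact k)).
        2:{ rewrite fact_simpl, mult_INR. field. split; [apply INR_fact_neq_0|now apply not_0_INR]. }
        ring. }
    assert (M := mean_value_majorant f _
      (fun t => t ^ (S K) * (Cmod z ^ S K / INR (fact (S K)) * exp (Cmod z)))
      (fun t => INR (S K) * t ^ K * (Cmod z ^ S K / INR (fact (S K)) * exp (Cmod z))) 0 1 Rle_0_1 (fun t _ => Hf t)).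
    assert (f1 : f 1 = (Cexp z - Cexp_partial z (S K))%C).
    { unfold f. replace (1 * z)%C with z by ring. reflexivity. }
    assert (f0 : f 0 = 0).
    { unfold f. replace (0 * z)%C with (RtoC 0) by ring. rewrite Cexp_0. unfold Cexp_partial.
      rewrite Csum_Sl. rewrite (Csum_ext _ (fun _ => (0 * 0)%C)).
      - rewrite Csum_scal. change (INR (fact 0)) with 1%R. rewrite Rinv_1.
        change (Cpow 0 0) with (RtoC 1). ring.
      - intros k _. simpl. ring. }
    rewrite f1, f0 in M. rewrite pow1, pow_i, Rmult_1_l, Rmult_0_l, Rminus_0_r in M by lia.
    replace (Cexp z - Cexp_partial z (S K) - 0)%C with (Cexp z - Cexp_partial z (S K))%C in M by ring.
    apply M.
    + intros t _. apply (is_derive_ext (fun t => (Cmod z ^ S K / INR (fact (S K)) * exp (Cmod z)) * t ^ (S K))).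
      { intros; apply Rmult_comm. }
      evar_last; [apply is_derive_scal; apply is_derive_pow; apply (@is_derive_id R_AbsRing)|].
      change (@one R_AbsRing) with 1. simpl pred. cbv beta. ring.
    + intros t Ht. rewrite Cmod_mult.
      eapply Rle_trans; [apply Rmult_le_compat_l; [apply Cmod_ge_0|apply IH]|].
      rewrite Cmod_mult, Cmod_R, Rabs_pos_eq by lra.
      rewrite fact_simpl, mult_INR.
      assert (Hk := INR_fact_lt_0 K). assert (HS := lt_0_INR (S K) (Nat.lt_0_succ K)).
      rewrite Rpow_mult_distr.
      apply Rle_trans with (INR (S K) * t ^ K * (Cmod z ^ S K / (INR (S K) * INR (fact K)) * exp (t * Cmod z))).
      * right. simpl pow. field. split; lra.
      * apply Rmult_le_compat_l; [apply Rmult_le_pos; [lra|apply pow_le; lra]|].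
        apply Rmult_le_compat_l.
        -- apply Rmult_le_pos; [apply pow_le, Cmod_ge_0|apply Rlt_le, Rinv_0_lt_compat; nra].
        -- apply exp_le_mono. generalize (Cmod_ge_0 z); nra.
Qed.

Lemma Cexp_rem1 (z : C) : Cmod (Cexp z - 1) <= Cmod z * exp (Cmod z).
Proof.
  assert (H := Cexp_remainder z 1). unfold Cexp_partial in H. rewrite Csum_S, Csum_0 in H.
  simpl in H. rewrite Rinv_1 in H. replace (Cexp z - (0 + 1 * 1))%C with (Cexp z - 1)%C in H by ring.
  lra.
Qed.

Lemma Cexp_rem2 (z : C) : Cmod (Cexp z - 1 - z) <= Cmod z ^ 2 * exp (Cmod z).
Proof.
  assert (H := Cexp_remainder z 2). unfold Cexp_partial in H. rewrite !Csum_S, Csum_0 in H.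
  simpl in H. rewrite Rinv_1 in H. replace (Cexp z - (0 + 1 * 1 + 1 * (z * 1)))%C with (Cexp z - 1 - z)%C in H by ring.
  assert (H0 := Cmod_ge_0 z). assert (He := exp_pos (Cmod z)).
  assert (0 <= Cmod z * Cmod z * exp (Cmod z)) by (repeat apply Rmult_le_pos; lra).
  simpl. lra.
Qed.

Lemma cder_Cexp (z : C) : cder Cexp z (Cexp z).
Proof.
  apply cder_quad with (d := 1) (B := Cmod (Cexp z) * exp 1); [lra|].
  intros h Hh. rewrite Cexp_plus.
  replace (Cexp z * Cexp h - Cexp z - h * Cexp z)%C with (Cexp z * (Cexp h - 1 - h))%C by ring.
  rewrite Cmod_mult, Rmult_assoc. apply Rmult_le_compat_l; [apply Cmod_ge_0|].
  eapply Rle_trans; [apply Cexp_rem2|].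
  rewrite Rmult_comm. apply Rmult_le_compat_r; [apply pow2_ge_0|]. apply exp_le_mono; lra.
Qed.

(** * Logarithm *)

Lemma Re_over_Cmod (z : C) : z <> RtoC 0 -> -1 <= Re z / Cmod z <= 1.
Proof.
  intros Hz. apply Cmod_gt_0 in Hz. assert (H := re_le_Cmod z).
  apply Rabs_le_between in H. split.
  - apply Rmult_le_reg_r with (Cmod z); auto. field_simplify; lra.
  - apply Rmult_le_reg_r with (Cmod z); auto. field_simplify; lra.
Qed.

Lemma cos_sin_Carg (z : C) : z <> RtoC 0 ->
  Cmod z * cos (Carg z) = Re z /\ Cmod z * sin (Carg z) = Im z.
Proof.
  intros Hz. assert (H := Re_over_Cmod z Hz). apply Cmod_gt_0 in Hz.
  assert (Hs : Cmod z * sin (acos (Re z / Cmod z)) = Rabs (Im z)).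
  { rewrite sin_acos by auto.
    rewrite <- (sqrt_Rsqr (Cmod z)) at 1 by lra.
    rewrite <- sqrt_mult_alt by apply Rle_0_sqr.
    rewrite <- sqrt_Rsqr_abs. f_equal. unfold Rsqr.
    assert (E := Cmod2_alt z). field_simplify; [|lra]. lra. }
  unfold Carg. destruct (Rle_dec 0 (Im z)) as [Hi|Hi].
  - split; [rewrite cos_acos by auto; field; lra|].
    rewrite Hs, Rabs_pos_eq; auto.
  - split; [rewrite cos_neg, cos_acos by auto; field; lra|].
    rewrite sin_neg. rewrite Rabs_left in Hs by lra. lra.
Qed.

Lemma Cexp_Clog (z : C) : z <> RtoC 0 -> Cexp (Clog z) = z.
Proof.
  intros Hz. destruct (cos_sin_Carg z Hz) as [H1 H2].
  apply Cmod_gt_0 in Hz. unfold Cexp, Clog; simpl.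
  rewrite exp_ln by auto. apply C_eq; simpl; auto.
Qed.

Lemma Carg_Cexp (w : C) : - PI < Im w < PI -> Carg (Cexp w) = Im w.
Proof.
  intros Hw. assert (He := exp_pos (Re w)).
  unfold Carg. rewrite Cmod_Cexp.
  replace (Re (Cexp w)) with (exp (Re w) * cos (Im w)) by reflexivity.
  replace (Im (Cexp w)) with (exp (Re w) * sin (Im w)) by reflexivity.
  replace (exp (Re w) * cos (Im w) / exp (Re w)) with (cos (Im w)) by (field; lra).
  destruct (Rle_dec 0 (exp (Re w) * sin (Im w))) as [H|H].
  - destruct (Rle_lt_dec 0 (Im w)) as [H0|H0]; [apply acos_cos; lra|].
    assert (H1 := sin_gt_0 (- Im w)). rewrite sin_neg in H1. nra.
  - destruct (Rle_lt_dec 0 (Im w)) as [H0|H0].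
    + assert (H1 := sin_ge_0 (Im w)). nra.
    + rewrite <- cos_neg, acos_cos; lra.
Qed.

Lemma Clog_Cexp (w : C) : - PI < Im w < PI -> Clog (Cexp w) = w.
Proof.
  intros Hw. unfold Clog. rewrite Carg_Cexp, Cmod_Cexp, ln_exp by auto.
  destruct w; reflexivity.
Qed.

Lemma abs_atan_le x : Rabs (atan x) <= Rabs x.
Proof.
  assert (H := bounded_variation atan (fun t => / (1 + t ^ 2)) 1 0 x).
  rewrite atan_0, !Rminus_0_r, Rmult_1_l in H. apply H. intros t _. split.
  - evar_last; [apply is_derive_Reals, derivable_pt_lim_atan|].
    replace (t²) with (t ^ 2) by (unfold Rsqr; ring). try (unfold Rdiv; rewrite Rmult_1_l). reflexivity.
  - assert (0 <= t ^ 2) by apply pow2_ge_0.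
    rewrite Rabs_pos_eq by (apply Rlt_le, Rinv_0_lt_compat; lra).
    rewrite <- Rinv_1. apply Rinv_le_contravar; lra.
Qed.

(** Since [z] is [Cexp] of the number with imaginary part [atan (Im z / Re z)], which lies within
    the principal strip, [Carg_Cexp] identifies the argument. *)
Lemma Carg_atan (z : C) : 0 < Re z -> Carg z = atan (Im z / Re z).
Proof.
  intros Hz.
  assert (Hm : 0 < Cmod z).
  { eapply Rlt_le_trans; [apply Hz|]. eapply Rle_trans; [apply Rle_abs|apply re_le_Cmod]. }
  assert (Hb := atan_bound (Im z / Re z)).
  replace z with (Cexp (ln (Cmod z), atan (Im z / Re z))) at 1.
  { rewrite Carg_Cexp; [reflexivity|]. simpl. assert (H := PI_RGT_0). lra. }
  unfold Cexp; simpl. rewrite exp_ln by auto.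
  rewrite cos_atan, sin_atan.
  assert (E : sqrt (1 + (Im z / Re z)²) = Cmod z / Re z).
  { assert (E2 := Cmod2_alt z).
    replace (1 + (Im z / Re z)²) with ((Cmod z / Re z)²).
    - apply sqrt_Rsqr. apply Rlt_le, Rdiv_lt_0_compat; auto.
    - unfold Rsqr. replace (Cmod z / Re z * (Cmod z / Re z)) with (Cmod z ^ 2 / (Re z) ^ 2) by (field; lra).
      rewrite E2; field; lra. }
  rewrite E. apply C_eq; simpl; field; lra.
Qed.

Lemma Carg_bound (z : C) : z <> RtoC 0 -> - PI <= Carg z <= PI.
Proof.
  intros Hz. unfold Carg. assert (H := acos_bound (Re z / Cmod z)).
  destruct (Rle_dec 0 (Im z)); lra.
Qed.

Lemma Carg_bound_slit (z : C) : z <> RtoC 0 -> (0 < Re z \/ Im z <> 0) -> - PI < Carg z < PI.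
Proof.
  intros Hz Hs. assert (Hb := Carg_bound z Hz). destruct (cos_sin_Carg z Hz) as [H1 H2].
  apply Cmod_gt_0 in Hz.
  split; apply Rnot_le_lt; intros Hle.
  - assert (E : Carg z = - PI) by lra. rewrite E, cos_neg, cos_PI in H1. rewrite E, sin_neg, sin_PI in H2. lra.
  - assert (E : Carg z = PI) by lra. rewrite E, cos_PI in H1. rewrite E, sin_PI in H2. lra.
Qed.

Lemma ln_le_sub1 x : 0 < x -> ln x <= x - 1.
Proof. intros Hx. assert (H := exp_ineq1_le (ln x)). rewrite exp_ln in H; lra. Qed.

(** Needed before [Clog] can be differentiated: inverting [Cexp] near [1] presupposes that the
    logarithm is small. Modulus and argument contribute a factor [2] each. *)
Lemma Clog_1_bound (u : C) : Cmod (u - 1) <= / 2 -> Cmod (Clog u) <= 4 * Cmod (u - 1).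
Proof.
  intros Hu. assert (H0 := Cmod_ge_0 (u - 1)).
  assert (Hr := re_le_Cmod (u - 1)). assert (Hi := im_le_Cmod (u - 1)).
  rewrite Re_minus in Hr. rewrite Im_minus in Hi. simpl in Hr, Hi. rewrite Rminus_0_r in Hi.
  apply Rabs_le_between in Hr.
  assert (Hm1 := Cmod_triangle_inv u 1). assert (Hm2 := Cmod_triangle_inv 1 u).
  rewrite Cmod_1 in *. rewrite (Cmod_minus_sym 1 u) in Hm2.
  eapply Rle_trans; [apply Cmod_le_abs|]. simpl.
  rewrite Carg_atan by lra.
  assert (Ha : Rabs (atan (Im u / Re u)) <= 2 * Cmod (u - 1)).
  { eapply Rle_trans; [apply abs_atan_le|]. unfold Rdiv. rewrite Rabs_mult, Rabs_inv.
    rewrite (Rabs_pos_eq (Re u)) by lra.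
    apply Rmult_le_reg_r with (Re u); [lra|]. rewrite Rmult_assoc, Rinv_l by lra. nra. }
  assert (Hl : Rabs (ln (Cmod u)) <= 2 * Cmod (u - 1)).
  { apply Rabs_le_between; split.
    - assert (H := ln_le_sub1 (/ Cmod u)). rewrite ln_Rinv in H by lra.
      assert (/ Cmod u - 1 <= 2 * Cmod (u - 1)); [|specialize (H ltac:(apply Rinv_0_lt_compat; lra)); lra].
      apply Rmult_le_reg_r with (Cmod u); [lra|]. field_simplify; [|lra]. nra.
    - assert (H := ln_le_sub1 (Cmod u) ltac:(lra)). lra. }
  lra.
Qed.

(** Differentiation of an inverse function: for [v = Clog (1 + h)] the second-order remainder of
    [Cexp] at [v] is [h - v], and it is at most [|v|^2 exp 2 <= 16 |h|^2 exp 2]. *)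
Lemma cder_Clog_1 : cder Clog 1 1.
Proof.
  assert (L1 : Clog 1 = 0).
  { rewrite <- Cexp_0 at 1. rewrite Clog_Cexp; [reflexivity|]. simpl. generalize PI_RGT_0; lra. }
  apply cder_quad with (d := / 2) (B := 16 * exp 2); [lra|].
  intros h Hh. rewrite L1.
  replace (Clog (1 + h) - 0 - h * 1)%C with (Clog (1 + h) - h)%C by ring.
  assert (Hb := Clog_1_bound (1 + h)). replace (1 + h - 1)%C with h in Hb by ring.
  specialize (Hb ltac:(lra)). set (v := Clog (1 + h)) in *.
  assert (E : Cexp v = (1 + h)%C).
  { apply Cexp_Clog. apply Cmod_gt_0. assert (H := Cmod_triangle_inv 1 (- h)).
    rewrite Cmod_opp, Cmod_1 in H. replace (1 - - h)%C with (1 + h)%C in H by ring. lra. }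
  assert (H2 := Cexp_rem2 v). rewrite E in H2. replace (1 + h - 1 - v)%C with (h - v)%C in H2 by ring.
  rewrite Cmod_minus_sym. eapply Rle_trans; [apply H2|].
  assert (Hv := Cmod_ge_0 v). 
  apply Rle_trans with ((4 * Cmod h) ^ 2 * exp 2); [|right; ring].
  apply Rmult_le_compat; [apply pow2_ge_0|apply Rlt_le, exp_pos|apply pow_incr; lra|].
  apply exp_le_mono; lra.
Qed.

Lemma Clog_mult (z w : C) : z <> RtoC 0 -> w <> RtoC 0 -> - PI < Carg z + Carg w < PI ->
  Clog (z * w) = (Clog z + Clog w)%C.
Proof.
  intros Hz Hw H. rewrite <- (Cexp_Clog z Hz) at 1. rewrite <- (Cexp_Clog w Hw) at 1.
  rewrite <- Cexp_plus. apply Clog_Cexp. rewrite Im_plus. simpl. lra.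
Qed.

(** Locally [Clog w = Clog z + Clog (w / z)], which transports the derivative at [1]. Here [e] is
    the distance of [Carg z] from the cut, and [e / 8] together with [Clog_1_bound] keeps the sum of
    the arguments inside [(-PI, PI)]. *)
Lemma cder_Clog_slit (z : C) : z <> RtoC 0 -> (0 < Re z \/ Im z <> 0) -> cder Clog z (/ z)%C.
Proof.
  intros Hz Hs. assert (Hb := Carg_bound_slit z Hz Hs).
  assert (Hm : 0 < Cmod z) by (apply Cmod_gt_0; exact Hz).
  set (e := Rmin (PI - Carg z) (PI + Carg z)).
  assert (He : 0 < e) by (apply Rmin_pos; lra).
  set (d := Cmod z * Rmin (/ 2) (e / 8)).
  assert (Hd : 0 < d) by (apply Rmult_lt_0_compat; auto; apply Rmin_pos; lra).
  apply cder_ext_loc with (f := fun w => (Clog z + Clog (w * / z))%C) (d := d); auto.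
  - intros w Hw.
    assert (H1 : Cmod (w * / z - 1) < Rmin (/ 2) (e / 8)).
    { replace (w * / z - 1)%C with ((w - z) * / z)%C by (field; auto).
      rewrite Cmod_mult, Cmod_inv by auto. apply Rmult_lt_reg_r with (Cmod z); auto.
      rewrite Rmult_assoc, Rinv_l by lra. unfold d in Hw. lra. }
    assert (Ha := Rlt_le_trans _ _ _ H1 (Rmin_l _ _)).
    assert (Hbb := Rlt_le_trans _ _ _ H1 (Rmin_r _ _)).
    assert (Hl := Clog_1_bound (w * / z) (Rlt_le _ _ Ha)).
    assert (Hi := im_le_Cmod (Clog (w * / z))). simpl in Hi.
    assert (Hi' : Rabs (Carg (w * / z)) < e) by lra.
    apply Rabs_lt_between in Hi'.
    assert (e <= PI - Carg z) by apply Rmin_l. assert (e <= PI + Carg z) by apply Rmin_r.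
    assert (Hwz : (w * / z)%C <> RtoC 0).
    { intros E. rewrite E in Ha. replace (0 - 1)%C with (- (1))%C in Ha by ring.
      rewrite Cmod_opp, Cmod_1 in Ha. lra. }
    rewrite <- Clog_mult; auto; [|lra].
    f_equal. field; auto.
  - eapply cder_eq.
    + apply cder_plus; [apply cder_const|]. apply (cder_comp Clog (fun w => w * / z)%C).
      * replace (z * / z)%C with (RtoC 1) by (field; auto). apply cder_Clog_1.
      * apply cder_mult; [apply cder_id|apply cder_const].
    + cbv beta; ring.
Qed.

Lemma Cneq0_Re (z : C) : 0 < Re z -> z <> RtoC 0.
Proof. intros H E. rewrite E in H; simpl in H; lra. Qed.

Lemma cder_Clog (z : C) : 0 < Re z -> cder Clog z (/ z)%C.
Proof. intros Hz. apply cder_Clog_slit; auto. now apply Cneq0_Re. Qed.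

Lemma Clog_RtoC (x : R) : 0 < x -> Clog (RtoC x) = RtoC (ln x).
Proof.
  intros Hx. rewrite <- (exp_ln x) at 1 by auto. rewrite <- Cexp_RtoC.
  apply Clog_Cexp; simpl; generalize PI_RGT_0; lra.
Qed.

Lemma Cpower_RtoC (x p : R) : 0 < x -> Cpower (RtoC x) (RtoC p) = RtoC (Rpower x p).
Proof.
  intros Hx. unfold Cpower, Rpower. rewrite Clog_RtoC, <- RtoC_mult by auto. apply Cexp_RtoC.
Qed.

Lemma Cmod_Cpower_R (z : C) (p : R) : Cmod (Cpower z (RtoC p)) = Rpower (Cmod z) p.
Proof.
  unfold Cpower. rewrite Cmod_Cexp, re_scal_l. reflexivity.
Qed.

Lemma Cpower_plus (z p q : C) : Cpower z (p + q) = (Cpower z p * Cpower z q)%C.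
Proof. unfold Cpower. rewrite <- Cexp_plus. f_equal; ring. Qed.

Lemma Cpower_opp (z p : C) : Cpower z (- p) = (/ Cpower z p)%C.
Proof. unfold Cpower. rewrite <- Cexp_opp. f_equal; ring. Qed.

Lemma Cpower_nat (z : C) (n : nat) : z <> RtoC 0 -> Cpower z (RtoC (INR n)) = Cpow z n.
Proof. intros Hz. unfold Cpower. rewrite Cexp_scal_nat, Cexp_Clog; auto. Qed.

Lemma Cpower_neq_0 (z p : C) : Cpower z p <> RtoC 0.
Proof. apply Cexp_neq_0. Qed.

Lemma cder_Cpower (p z : C) : 0 < Re z ->
  cder (fun w => Cpower w p) z (p * Cpower z (p - 1))%C.
Proof.
  intros Hz. unfold Cpower at 1. eapply cder_eq.
  - apply (cder_comp Cexp (fun w => p * Clog w)%C); [apply cder_Cexp|].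
    apply cder_scal, cder_Clog, Hz.
  - replace (p - 1)%C with (p + - (1))%C by ring. rewrite Cpower_plus, Cpower_opp.
    assert (E : Cpower z 1 = z).
    { unfold Cpower. rewrite Cmult_1_l. apply Cexp_Clog. now apply Cneq0_Re. }
    rewrite E. unfold Cpower. ring.
Qed.

(** * Symbol classes on cones *)

(* [Sm kap m w phi]: on the cone [Re z >= kap |z|] the derivatives of order [j <= m] of [phi]
   are [O(w(|z|) / |z|^j)]; they are derivatives on the whole half-plane [Re z > 0]. *)
Fixpoint Sm (kap : R) (m : nat) (w : R -> R) (phi : C -> C) : Prop :=
  (exists A, 0 <= A /\ forall z, 0 < Re z -> kap * Cmod z <= Re z -> Cmod (phi z) <= A * w (Cmod z)) /\
  match m with
  | O => True
  | S m' => exists phi', (forall z, 0 < Re z -> cder phi z (phi' z)) /\ Sm kap m' (fun r => w r / r) phi'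
  end.

Lemma Cmod_pos_Re (z : C) : 0 < Re z -> 0 < Cmod z.
Proof. intros H. eapply Rlt_le_trans; [apply H|]. eapply Rle_trans; [apply Rle_abs|apply re_le_Cmod]. Qed.

Lemma Sm_bound kap m w phi : Sm kap m w phi ->
  exists A, 0 <= A /\ forall z, 0 < Re z -> kap * Cmod z <= Re z -> Cmod (phi z) <= A * w (Cmod z).
Proof. destruct m; intros [H _]; exact H. Qed.

Lemma Sm_weight kap m (w w' : R -> R) phi B : 0 <= B -> (forall r, 0 < r -> w r <= B * w' r) ->
  Sm kap m w phi -> Sm kap m w' phi.
Proof.
  intros HB. revert w w' phi. induction m as [|m IH]; intros w w' phi Hw [[A [HA H]] H'].
  - split; auto. exists (A * B); split; [now apply Rmult_le_pos|].
    intros z Hz Hk. eapply Rle_trans; [now apply H|]. rewrite Rmult_assoc.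
    apply Rmult_le_compat_l; auto. apply Hw, Cmod_pos_Re, Hz.
  - split.
    + exists (A * B); split; [now apply Rmult_le_pos|].
      intros z Hz Hk. eapply Rle_trans; [now apply H|]. rewrite Rmult_assoc.
      apply Rmult_le_compat_l; auto. apply Hw, Cmod_pos_Re, Hz.
    + destruct H' as [phi' [H1 H2]]. exists phi'; split; auto.
      eapply IH; [|apply H2]. intros r Hr. unfold Rdiv. rewrite <- Rmult_assoc.
      apply Rmult_le_compat_r; [apply Rlt_le, Rinv_0_lt_compat; auto|auto].
Qed.

Lemma Sm_weight_eq kap m (w w' : R -> R) phi : (forall r, 0 < r -> w r = w' r) ->
  Sm kap m w phi -> Sm kap m w' phi.
Proof. intros H. apply Sm_weight with (B := 1); [lra|]. intros r Hr; rewrite H; auto; lra. Qed.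

Lemma Sm_ext kap m w phi psi : (forall z, 0 < Re z -> phi z = psi z) -> Sm kap m w phi -> Sm kap m w psi.
Proof.
  intros He. destruct m; intros [[A [HA H]] H'].
  - split; auto. exists A; split; auto. intros z Hz; rewrite <- He; auto.
  - split.
    + exists A; split; auto. intros z Hz; rewrite <- He; auto.
    + destruct H' as [phi' [H1 H2]]. exists phi'; split; auto.
      intros z Hz. eapply cder_ext_half; eauto.
Qed.

Lemma Sm_pred kap m w phi : Sm kap (S m) w phi -> Sm kap m w phi.
Proof.
  revert w phi; induction m as [|m IH]; intros w phi [H1 [phi' [H2 H3]]]; [split; auto|].
  split; auto. exists phi'; split; auto.
Qed.

Lemma Sm_plus kap m w phi psi : Sm kap m w phi -> Sm kap m w psi -> Sm kap m w (fun z => phi z + psi z)%C.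
Proof.
  revert w phi psi; induction m as [|m IH]; intros w phi psi [[A [HA H1]] H2] [[B [HB H3]] H4].
  all: split; [exists (A + B); split; [lra|];
    intros z Hz Hk; eapply Rle_trans; [apply Cmod_triangle|]; specialize (H1 z Hz Hk); specialize (H3 z Hz Hk); lra|].
  - exact I.
  - destruct H2 as [phi' [H5 H6]], H4 as [psi' [H7 H8]].
    exists (fun z => phi' z + psi' z)%C. split; [intros; apply cder_plus; auto|auto].
Qed.

(** Leibniz' rule: both products in the derivative have weight [w1 r * w2 r / r]. *)
Lemma Sm_mult kap m w1 w2 phi psi : (forall r, 0 < r -> 0 <= w1 r) ->
  Sm kap m w1 phi -> Sm kap m w2 psi -> Sm kap m (fun r => w1 r * w2 r) (fun z => phi z * psi z)%C.
Proof.
  intros Hw1. revert w1 w2 phi psi Hw1; induction m as [|m IH]; intros w1 w2 phi psi Hw1 Hphi Hpsi.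
  all: assert (Hp := Hphi); assert (Hq := Hpsi); destruct Hphi as [[A [HA H1]] H2], Hpsi as [[B [HB H3]] H4].
  all: split; [exists (A * B); split; [now apply Rmult_le_pos|];
    intros z Hz Hk; rewrite Cmod_mult;
    replace (A * B * (w1 (Cmod z) * w2 (Cmod z))) with ((A * w1 (Cmod z)) * (B * w2 (Cmod z))) by ring;
    apply Rmult_le_compat; auto using Cmod_ge_0|].
  - exact I.
  - destruct H2 as [phi' [H5 H6]], H4 as [psi' [H7 H8]].
    exists (fun z => phi' z * psi z + phi z * psi' z)%C. split; [intros; apply cder_mult; auto|].
    apply Sm_plus.
    + eapply Sm_weight_eq; [|apply IH; [|apply H6|apply Sm_pred, Hq]].
      * intros r Hr; cbv beta; field; lra.
      * intros r Hr; cbv beta. apply Rmult_le_pos; auto. apply Rlt_le, Rinv_0_lt_compat; auto.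
    + eapply Sm_weight_eq; [|apply IH; [|apply Sm_pred, Hp|apply H8]].
      * intros r Hr; cbv beta; field; lra.
      * auto.
Qed.

Lemma Sm_zero kap m w : (forall r, 0 < r -> 0 <= w r) -> Sm kap m w (fun _ => 0).
Proof.
  revert w; induction m as [|m IH]; intros w Hw.
  all: split; [exists 0; split; [lra|]; intros z Hz _; rewrite Cmod_0; lra|].
  - exact I.
  - exists (fun _ => 0); split; [intros; apply cder_const|]. apply IH.
    intros r Hr; apply Rmult_le_pos; auto. apply Rlt_le, Rinv_0_lt_compat; auto.
Qed.

Lemma Sm_const kap m c : Sm kap m (fun _ => 1) (fun _ => c).
Proof.
  destruct m as [|m].
  all: split; [exists (Cmod c); split; [apply Cmod_ge_0|]; intros z Hz _; lra|].
  - exact I.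
  - exists (fun _ => 0); split; [intros; apply cder_const|]. apply Sm_zero.
    intros r Hr; apply Rmult_le_pos; [lra|]. apply Rlt_le, Rinv_0_lt_compat; auto.
Qed.

Lemma Sm_scal kap m w c phi : Sm kap m w phi -> Sm kap m w (fun z => c * phi z)%C.
Proof.
  intros H. apply Sm_weight_eq with (fun r => 1 * w r); [intros; ring|].
  apply Sm_mult; [intros; lra|apply Sm_const|auto].
Qed.

Lemma Sm_opp kap m w phi : Sm kap m w phi -> Sm kap m w (fun z => - phi z)%C.
Proof.
  intros H. apply Sm_ext with (fun z => (- (1)) * phi z)%C; [intros; ring|]. now apply Sm_scal.
Qed.

Lemma Sm_Csum kap m w (f : nat -> C -> C) K : (forall r, 0 < r -> 0 <= w r) ->
  (forall k, (k < K)%nat -> Sm kap m w (f k)) -> Sm kap m w (fun z => Csum (fun k => f k z) K).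
Proof.
  intros Hw; induction K as [|K IH]; intros H; [exact (Sm_zero kap m w Hw)|].
  apply Sm_ext with (fun z => Csum (fun k => f k z) K + f K z)%C; [intros; symmetry; apply Csum_S|].
  apply Sm_plus; auto.
Qed.

Lemma Rpower_pos x y : 0 < Rpower x y.
Proof. apply exp_pos. Qed.

Lemma Rpower_sub1 r p : 0 < r -> Rpower r (p - 1) = Rpower r p / r.
Proof.
  intros Hr. unfold Rminus. rewrite Rpower_plus, Rpower_Ropp, Rpower_1; auto.
Qed.

(** The exponent is real, so [|z^p| = |z|^p] whatever the argument of [z]. *)
Lemma Sm_Cpower kap m p : Sm kap m (fun r => Rpower r p) (fun z => Cpower z (RtoC p)).
Proof.
  revert p; induction m as [|m IH]; intros p.
  all: split; [exists 1; split; [lra|]; intros z Hz _; rewrite Cmod_Cpower_R; lra|].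
  - exact I.
  - exists (fun z => p * Cpower z (RtoC (p - 1)))%C. split.
    + intros z Hz. rewrite RtoC_minus. apply cder_Cpower, Hz.
    + apply Sm_scal. eapply Sm_weight_eq; [|apply IH]. intros r Hr. now apply Rpower_sub1.
Qed.

Lemma Sm_Cpow kap m n : Sm kap m (fun r => r ^ n) (fun z => Cpow z n).
Proof.
  apply Sm_ext with (fun z => Cpower z (RtoC (INR n))).
  { intros z Hz. apply Cpower_nat, Cneq0_Re, Hz. }
  eapply Sm_weight_eq; [|apply Sm_Cpower]. intros r Hr. now apply Rpower_pow.
Qed.

Lemma Sm_inv_id kap m : Sm kap m (fun r => / r) Cinv.
Proof.
  apply Sm_ext with (fun z => Cpower z (RtoC (Ropp 1))).
  { intros z Hz. rewrite RtoC_opp, Cpower_opp. f_equal. 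
    unfold Cpower. rewrite Cmult_1_l. apply Cexp_Clog, Cneq0_Re, Hz. }
  eapply Sm_weight_eq; [|apply Sm_Cpower]. intros r Hr. cbv beta. rewrite Rpower_Ropp, Rpower_1; auto.
Qed.

(** An algebraic majorant of both [1] and [|ln r|] at either end, which keeps the weights sums of
    powers. Trading a logarithm for [1/r] near [0] is what costs one power of [|a|] in the end. *)
Definition lam (r : R) : R := r + / r.

Lemma lam_ge_2 r : 0 < r -> 2 <= lam r.
Proof.
  intros Hr. unfold lam. apply Rmult_le_reg_r with r; auto. field_simplify; [|lra].
  assert (H := pow2_ge_0 (r - 1)). nra.
Qed.

Lemma abs_ln_le_lam r : 0 < r -> Rabs (ln r) <= lam r.
Proof.
  intros Hr. assert (Hi := Rinv_0_lt_compat _ Hr). unfold lam. apply Rabs_le_between; split.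
  - assert (H := ln_le_sub1 (/ r) Hi). rewrite ln_Rinv in H by auto. lra.
  - assert (H := ln_le_sub1 r Hr). lra.
Qed.

Lemma Cmod_Clog_le z : 0 < Re z -> Cmod (Clog z) <= 3 * lam (Cmod z).
Proof.
  intros Hz. eapply Rle_trans; [apply Cmod_le_abs|]. simpl.
  assert (Hm := Cmod_pos_Re z Hz).
  assert (H1 := abs_ln_le_lam _ Hm). assert (H2 := lam_ge_2 _ Hm).
  rewrite Carg_atan by auto. assert (Hb := atan_bound (Im z / Re z)).
  assert (HP := PI_4). assert (Rabs (atan (Im z / Re z)) <= 2); [|lra].
  apply Rabs_le_between; lra.
Qed.

Lemma Sm_Clog kap m : Sm kap m lam Clog.
Proof.
  destruct m as [|m].
  all: split; [exists 3; split; [lra|]; intros z Hz _; now apply Cmod_Clog_le|].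
  - exact I.
  - exists Cinv; split; [intros; now apply cder_Clog|].
    apply Sm_weight with (B := 1) (w := fun r => / r); [lra| |apply Sm_inv_id].
    intros r Hr. assert (H := lam_ge_2 r Hr). unfold Rdiv. rewrite Rmult_1_l.
    rewrite <- (Rmult_1_l (/ r)) at 1. apply Rmult_le_compat_r; [apply Rlt_le, Rinv_0_lt_compat; auto|lra].
Qed.

(** Gives names to the derivatives hidden under the nested existentials of [Sm], as Euler-Maclaurin
    summation handles all orders at once. *)
Definition dseq (m : nat) (psi : nat -> C -> C) : Prop :=
  forall j, (j < m)%nat -> forall z, 0 < Re z -> cder (psi j) z (psi (S j) z).

Lemma Sm_dseq kap m w phi : Sm kap m w phi -> exists psi, (forall z, psi O z = phi z) /\ dseq m psi.
Proof.
  revert w phi; induction m as [|m IH]; intros w phi [H H'].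
  - exists (fun _ => phi). split; auto. intros j Hj; lia.
  - destruct H' as [phi' [H1 H2]]. destruct (IH _ _ H2) as [psi [H3 H4]].
    exists (fun j => match j with O => phi | S j => psi j end). split; auto.
    intros j Hj z Hz. destruct j as [|j]; [rewrite H3; auto|]. apply H4; auto; lia.
Qed.

(** Derivatives on the half-plane are unique, so a sequence extracted for one cone obeys the bounds
    of every other cone; [integrand_primitive] relies on this. *)
Lemma Sm_dseq_bound kap m w psi : dseq m psi -> Sm kap m w (psi O) ->
  forall j, (j <= m)%nat -> exists A, 0 <= A /\ forall z, 0 < Re z -> kap * Cmod z <= Re z ->
    Cmod (psi j z) <= A * (w (Cmod z) / (Cmod z) ^ j).
Proof.
  revert w psi; induction m as [|m IH]; intros w psi Hd HS j Hj.
  - replace j with O by lia. destruct (Sm_bound _ _ _ _ HS) as [A [HA H]].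
    exists A; split; auto. intros z Hz Hk. simpl. unfold Rdiv. rewrite Rinv_1, Rmult_1_r. auto.
  - destruct j as [|j].
    + destruct (Sm_bound _ _ _ _ HS) as [A [HA H]].
      exists A; split; auto. intros z Hz Hk. simpl. unfold Rdiv. rewrite Rinv_1, Rmult_1_r. auto.
    + destruct HS as [_ [phi' [H1 H2]]].
      destruct (IH (fun r => w r / r) (fun j => psi (S j))) with (j := j) as [A [HA H]].
      * intros i Hi. apply Hd. lia.
      * eapply Sm_ext; [|apply H2]. intros z Hz. eapply cder_unique; [apply H1, Hz|]. apply Hd; [lia|auto].
      * lia.
      * exists A; split; auto. intros z Hz Hk. eapply Rle_trans; [apply H; auto|].
        right. simpl. assert (Hm := Cmod_pos_Re z Hz). field. split; [apply pow_nonzero|]; lra.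
Qed.

Lemma rder_eps (f : R -> C) (t : R) (l : C) :
  rder f t l <->
  forall eps, 0 < eps -> exists d, 0 < d /\
    forall s, Rabs (s - t) < d -> Cmod (f s - f t - RtoC (s - t)%R * l) <= eps * Rabs (s - t).
Proof.
  assert (E : forall s, (f s - f t - RtoC (s - t)%R * l)%C = 
    @minus C_R_NormedModule (@minus C_R_NormedModule (f s) (f t)) (@scal R_AbsRing C_R_NormedModule (s - t)%R l)).
  { intros s. rewrite <- (scal_R_Cmult (s - t)%R l). reflexivity. }
  split.
  - intros [_ H] eps Heps.
    destruct (H t (fun P HP => HP) (mkposreal _ Heps)) as [d Hd].
    exists d; split; [apply cond_pos|].
    intros s Hs. rewrite E, <- norm_C_R. apply (Hd s Hs).
  - intros H. split; [apply is_linear_scal_l|].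
    intros x Hx. apply (is_filter_lim_locally_unique (K:=R_AbsRing) (V:=R_NormedModule)) in Hx. subst x.
    intros eps. destruct (H eps (cond_pos eps)) as [d [Hd0 Hd]].
    exists (mkposreal _ Hd0). intros s Hs. specialize (Hd s Hs). rewrite E, <- norm_C_R in Hd. apply Hd.
Qed.

(** The outer derivative is over the complex and the inner one over the real scalars, hence the
    direct estimate: [eps] is split evenly between the two errors. *)
Lemma rder_comp_C (phi : C -> C) (g : R -> C) t m l :
  cder phi (g t) m -> rder g t l -> rder (fun s => phi (g s)) t (l * m)%C.
Proof.
  rewrite cder_eps, !rder_eps. intros Hp Hg eps Heps.
  assert (Hl := Cmod_ge_0 l). assert (Hm := Cmod_ge_0 m).
  destruct (Hp (eps / (2 * (Cmod l + 1)))) as [d1 [Hd1 H1]]; [apply Rdiv_lt_0_compat; lra|].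
  destruct (Hg 1 Rlt_0_1) as [d2 [Hd2 H2]].
  destruct (Hg (eps / (2 * (Cmod m + 1)))) as [d3 [Hd3 H3]]; [apply Rdiv_lt_0_compat; lra|].
  exists (Rmin (d1 / (Cmod l + 1)) (Rmin d2 d3)). split.
  { apply Rmin_pos; [apply Rdiv_lt_0_compat; lra|now apply Rmin_pos]. }
  intros s Hs. assert (Hs1 := Rlt_le_trans _ _ _ Hs (Rmin_l _ _)).
  assert (Hs2 := Rlt_le_trans _ _ _ Hs (Rle_trans _ _ _ (Rmin_r _ _) (Rmin_l _ _))).
  assert (Hs3 := Rlt_le_trans _ _ _ Hs (Rle_trans _ _ _ (Rmin_r _ _) (Rmin_r _ _))).
  specialize (H2 s Hs2). specialize (H3 s Hs3).
  assert (Ha := Rabs_pos (s - t)).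
  assert (Hgs : Cmod (g s - g t) <= (Cmod l + 1) * Rabs (s - t)).
  { replace (g s - g t)%C with (g s - g t - RtoC (s - t)%R * l + RtoC (s - t)%R * l)%C by ring.
    eapply Rle_trans; [apply Cmod_triangle|]. rewrite Cmod_mult, Cmod_R. lra. }
  specialize (H1 (g s)).
  replace (phi (g s) - phi (g t) - RtoC (s - t)%R * (l * m))%C with
    ((phi (g s) - phi (g t) - (g s - g t) * m) + (g s - g t - RtoC (s - t)%R * l) * m)%C by ring.
  eapply Rle_trans; [apply Cmod_triangle|]. rewrite Cmod_mult.
  assert (Hd : Cmod (g s - g t) < d1).
  { eapply Rle_lt_trans; [apply Hgs|].
    apply Rmult_lt_reg_r with (/ (Cmod l + 1)); [apply Rinv_0_lt_compat; lra|].
    rewrite Rmult_comm, <- Rmult_assoc, Rinv_l, Rmult_1_l by lra. exact Hs1. }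
  specialize (H1 Hd).
  apply Rle_trans with (eps / 2 * Rabs (s - t) + eps / 2 * Rabs (s - t)); [|lra].
  apply Rplus_le_compat.
  - eapply Rle_trans; [apply H1|].
    eapply Rle_trans; [apply Rmult_le_compat_l; [|apply Hgs]|].
    + apply Rlt_le, Rdiv_lt_0_compat; lra.
    + right; field; lra.
  - eapply Rle_trans; [apply Rmult_le_compat_r; [auto|apply H3]|].
    apply Rle_trans with (eps / 2 * Rabs (s - t) * (Cmod m / (Cmod m + 1))); [right; field; lra|].
    rewrite <- (Rmult_1_r (eps / 2 * Rabs (s - t))) at 2.
    apply Rmult_le_compat_l; [nra|].
    apply Rmult_le_reg_r with (Cmod m + 1); [lra|]. field_simplify; lra.
Qed.

(** * Integrals *)

Definition ccont (f : R -> C) (t : R) : Prop := @continuous R_UniformSpace C_R_NormedModule f t.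

Lemma rder_ccont f t l : rder f t l -> ccont f t.
Proof. intros H. apply (@ex_derive_continuous R_AbsRing C_R_NormedModule). exists l; exact H. Qed.

Lemma ccont_comp f t : ccont f t <-> continuous (fun s => Re (f s)) t /\ continuous (fun s => Im (f s)) t.
Proof.
  split.
  - intros H; split.
    + apply (continuous_comp f fst); [exact H|]. apply continuous_fst.
    + apply (continuous_comp f snd); [exact H|]. apply continuous_snd.
  - intros [H1 H2].
    apply (continuous_ext (U:=C_R_NormedModule) (fun s => (Re (f s), Im (f s)))).
    { intros s. destruct (f s); reflexivity. }
    assert (H3 := @filterlim_pair R R R (locally t) (locally (Re (f t))) (locally (Im (f t))) _ _ _ H1 H2).
    eapply filterlim_filter_le_2; [|apply H3].
    intros P [eps HP]. apply Filter_prod with (Q := ball (Re (f t)) eps) (R := ball (Im (f t)) eps); [now exists eps|now exists eps|].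
    intros x y Hx Hy. apply HP. split; auto.
Qed.

Lemma ccont_plus f g t : ccont f t -> ccont g t -> ccont (fun s => f s + g s)%C t.
Proof. apply (@continuous_plus R_UniformSpace R_AbsRing C_R_NormedModule). Qed.

Lemma ccont_minus f g t : ccont f t -> ccont g t -> ccont (fun s => f s - g s)%C t.
Proof. apply (@continuous_minus R_UniformSpace R_AbsRing C_R_NormedModule). Qed.

Lemma ccont_mult f g t : ccont f t -> ccont g t -> ccont (fun s => f s * g s)%C t.
Proof.
  rewrite !ccont_comp. intros [H1 H2] [H3 H4]. split.
  - apply (continuous_minus (V:=R_NormedModule)); apply (continuous_mult (K:=R_AbsRing)); auto.
  - apply (continuous_plus (V:=R_NormedModule)); apply (continuous_mult (K:=R_AbsRing)); auto.
Qed.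

Lemma ccont_const c t : ccont (fun _ => c) t.
Proof. apply continuous_const. Qed.

Lemma ccont_scal c f t : ccont f t -> ccont (fun s => c * f s)%C t.
Proof. intros H. exact (ccont_mult (fun _ => c) f t (ccont_const c t) H). Qed.

Lemma ccont_RtoC f t : continuous f t -> ccont (fun s => RtoC (f s)) t.
Proof. intros H. apply ccont_comp; split; simpl; [exact H|apply continuous_const]. Qed.

Definition cint (f : R -> C) (a b : R) (l : C) : Prop := @is_RInt C_R_NormedModule f a b l.

Lemma cint_comp f a b l : cint f a b l <->
  is_RInt (fun t => Re (f t)) a b (Re l) /\ is_RInt (fun t => Im (f t)) a b (Im l).
Proof.
  split.
  - intros H; split.
    + apply (@is_RInt_fct_extend_fst R_NormedModule R_NormedModule f a b l H).
    + apply (@is_RInt_fct_extend_snd R_NormedModule R_NormedModule f a b l H).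
  - intros [H1 H2]. destruct l as [x y].
    exact (@is_RInt_fct_extend_pair R_NormedModule R_NormedModule f a b x y H1 H2).
Qed.

Lemma cint_unique f a b l1 l2 : cint f a b l1 -> cint f a b l2 -> l1 = l2.
Proof.
  intros [H1 H2]%cint_comp [H3 H4]%cint_comp.
  apply (is_RInt_unique (V:=R_CompleteNormedModule)) in H1, H2, H3, H4. apply C_eq; congruence.
Qed.

Lemma cint_plus f g a b l m : cint f a b l -> cint g a b m -> cint (fun t => f t + g t)%C a b (l + m)%C.
Proof. apply (@is_RInt_plus C_R_NormedModule). Qed.

Lemma cint_minus f g a b l m : cint f a b l -> cint g a b m -> cint (fun t => f t - g t)%C a b (l - m)%C.
Proof. apply (@is_RInt_minus C_R_NormedModule). Qed.

Lemma cint_scal c f a b l : cint f a b l -> cint (fun t => c * f t)%C a b (c * l)%C.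
Proof.
  rewrite !cint_comp. intros [H1 H2]. split; simpl.
  - apply (is_RInt_minus (V:=R_NormedModule)); apply (is_RInt_scal (V:=R_NormedModule)); auto.
  - apply (is_RInt_plus (V:=R_NormedModule)); apply (is_RInt_scal (V:=R_NormedModule)); auto.
Qed.

Lemma cint_ext f g a b l : (forall t, Rmin a b < t < Rmax a b -> f t = g t) -> cint f a b l -> cint g a b l.
Proof. apply (@is_RInt_ext C_R_NormedModule). Qed.

Lemma cint_bound f (psi : R -> R) a b l m : a <= b ->
  (forall t, a <= t <= b -> Cmod (f t) <= psi t) ->
  cint f a b l -> is_RInt psi a b m -> Cmod l <= m.
Proof.
  intros Hab H Hf Hp. rewrite <- norm_C_R.
  apply (@norm_RInt_le C_R_NormedModule f psi a b l m); auto.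
  intros; rewrite norm_C_R; auto.
Qed.

Lemma cint_bound_const f B a b l : a <= b ->
  (forall t, a <= t <= b -> Cmod (f t) <= B) -> cint f a b l -> Cmod l <= B * (b - a).
Proof.
  intros Hab H Hf. apply (cint_bound f (fun _ => B) a b l); auto.
  replace (B * (b - a)) with (scal (b - a) B) by apply Rmult_comm.
  apply (@is_RInt_const R_NormedModule).
Qed.

Lemma ex_cint f a b : (forall t, Rmin a b <= t <= Rmax a b -> ccont f t) -> exists l, cint f a b l.
Proof. apply (@ex_RInt_continuous C_R_CompleteNormedModule). Qed.

Lemma cint_FTC F f a b : (forall t, Rmin a b <= t <= Rmax a b -> rder F t (f t)) ->
  (forall t, Rmin a b <= t <= Rmax a b -> ccont f t) -> cint f a b (F b - F a)%C.
Proof. apply (@is_RInt_derive C_R_CompleteNormedModule). Qed.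

Definition cont_pos (f : R -> C) := forall t, 0 < t -> ccont f t.

Lemma between_pos a b t : 0 < a -> 0 < b -> Rmin a b <= t <= Rmax a b -> 0 < t.
Proof. intros Ha Hb [H _]. assert (0 < Rmin a b) by now apply Rmin_pos. lra. Qed.

Lemma ex_primitive_pos f : cont_pos f -> exists F, forall t, 0 < t -> rder F t (f t).
Proof.
  intros Hf. exists (fun t => @RInt C_R_CompleteNormedModule f 1 t). intros t Ht.
  apply (@is_derive_RInt C_R_NormedModule f _ 1 t).
  - exists (mkposreal _ Ht). intros s Hs.
    apply (@RInt_correct C_R_CompleteNormedModule). apply ex_cint. intros u Hu. apply Hf.
    apply (between_pos 1 s); auto; [lra|]. change (Rabs (s - t) < t) in Hs. apply Rabs_lt_between in Hs. lra.
  - apply Hf, Ht.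
Qed.

(** * Limits at the ends of the half-line and improper integrals *)

Definition climinf (F : R -> C) (l : C) : Prop :=
  forall eps, 0 < eps -> exists M, forall t, M < t -> Cmod (F t - l) < eps.
Definition clim0 (F : R -> C) (l : C) : Prop :=
  forall eps, 0 < eps -> exists d, 0 < d /\ forall t, 0 < t < d -> Cmod (F t - l) < eps.

Lemma climinf_unique F l1 l2 : climinf F l1 -> climinf F l2 -> l1 = l2.
Proof.
  intros H1 H2. apply Ceq_minus, Cmod_eq_0. apply Rle_antisym; [|apply Cmod_ge_0].
  apply le_epsilon. intros eps He. 
  destruct (H1 (eps/2)) as [M1 K1]; [lra|]. destruct (H2 (eps/2)) as [M2 K2]; [lra|].
  set (t := Rmax M1 M2 + 1).
  specialize (K1 t ltac:(unfold t; generalize (Rmax_l M1 M2); lra)).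
  specialize (K2 t ltac:(unfold t; generalize (Rmax_r M1 M2); lra)).
  replace (l1 - l2)%C with ((F t - l2) - (F t - l1))%C by ring.
  generalize (Cmod_triangle_minus (F t - l2) (F t - l1)); lra.
Qed.

Lemma clim0_unique F l1 l2 : clim0 F l1 -> clim0 F l2 -> l1 = l2.
Proof.
  intros H1 H2. apply Ceq_minus, Cmod_eq_0. apply Rle_antisym; [|apply Cmod_ge_0].
  apply le_epsilon. intros eps He. 
  destruct (H1 (eps/2)) as [M1 [J1 K1]]; [lra|]. destruct (H2 (eps/2)) as [M2 [J2 K2]]; [lra|].
  set (t := Rmin M1 M2 / 2). assert (0 < Rmin M1 M2) by now apply Rmin_pos.
  specialize (K1 t ltac:(unfold t; generalize (Rmin_l M1 M2); lra)).
  specialize (K2 t ltac:(unfold t; generalize (Rmin_r M1 M2); lra)).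
  replace (l1 - l2)%C with ((F t - l2) - (F t - l1))%C by ring.
  generalize (Cmod_triangle_minus (F t - l2) (F t - l1)); lra.
Qed.

Lemma climinf_plus F G l m : climinf F l -> climinf G m -> climinf (fun t => F t + G t)%C (l + m)%C.
Proof.
  intros H1 H2 eps He.
  destruct (H1 (eps/2)) as [M1 K1]; [lra|]. destruct (H2 (eps/2)) as [M2 K2]; [lra|].
  exists (Rmax M1 M2). intros t Ht.
  specialize (K1 t ltac:(generalize (Rmax_l M1 M2); lra)).
  specialize (K2 t ltac:(generalize (Rmax_r M1 M2); lra)).
  replace (F t + G t - (l + m))%C with ((F t - l) + (G t - m))%C by ring.
  generalize (Cmod_triangle (F t - l) (G t - m)); lra.
Qed.

Lemma clim0_plus F G l m : clim0 F l -> clim0 G m -> clim0 (fun t => F t + G t)%C (l + m)%C.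
Proof.
  intros H1 H2 eps He.
  destruct (H1 (eps/2)) as [M1 [J1 K1]]; [lra|]. destruct (H2 (eps/2)) as [M2 [J2 K2]]; [lra|].
  exists (Rmin M1 M2). split; [now apply Rmin_pos|]. intros t Ht.
  specialize (K1 t ltac:(generalize (Rmin_l M1 M2); lra)).
  specialize (K2 t ltac:(generalize (Rmin_r M1 M2); lra)).
  replace (F t + G t - (l + m))%C with ((F t - l) + (G t - m))%C by ring.
  generalize (Cmod_triangle (F t - l) (G t - m)); lra.
Qed.

Lemma clim_scal_aux c x eps : 0 < eps -> Cmod x < eps / (Cmod c + 1) -> Cmod (c * x) < eps.
Proof.
  intros He Hx. rewrite Cmod_mult. assert (H := Cmod_ge_0 c). assert (H' := Cmod_ge_0 x).
  apply Rle_lt_trans with ((Cmod c + 1) * Cmod x); [nra|].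
  apply Rmult_lt_reg_r with (/ (Cmod c + 1)); [apply Rinv_0_lt_compat; lra|].
  rewrite Rmult_comm, <- Rmult_assoc, Rinv_l, Rmult_1_l by lra. exact Hx.
Qed.

Lemma climinf_scal c F l : climinf F l -> climinf (fun t => c * F t)%C (c * l)%C.
Proof.
  intros H eps He. assert (Hc := Cmod_ge_0 c).
  destruct (H (eps / (Cmod c + 1))) as [M K]; [apply Rdiv_lt_0_compat; lra|].
  exists M. intros t Ht. replace (c * F t - c * l)%C with (c * (F t - l))%C by ring.
  apply clim_scal_aux; auto.
Qed.

Lemma clim0_scal c F l : clim0 F l -> clim0 (fun t => c * F t)%C (c * l)%C.
Proof.
  intros H eps He. assert (Hc := Cmod_ge_0 c).
  destruct (H (eps / (Cmod c + 1))) as [M [J K]]; [apply Rdiv_lt_0_compat; lra|].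
  exists M; split; auto. intros t Ht. replace (c * F t - c * l)%C with (c * (F t - l))%C by ring.
  apply clim_scal_aux; auto.
Qed.

Lemma climinf_const c : climinf (fun _ => c) c.
Proof. intros eps He. exists 0. intros. replace (c - c)%C with (RtoC 0) by ring. rewrite Cmod_0; lra. Qed.

Lemma clim0_const c : clim0 (fun _ => c) c.
Proof. intros eps He. exists 1; split; [lra|]. intros. replace (c - c)%C with (RtoC 0) by ring. rewrite Cmod_0; lra. Qed.

Lemma climinf_ext F G l T : (forall t, T <= t -> F t = G t) -> climinf F l -> climinf G l.
Proof.
  intros He H eps Heps. destruct (H eps Heps) as [M K]. exists (Rmax M T). intros t Ht.
  rewrite <- He; [apply K|]; [generalize (Rmax_l M T)|generalize (Rmax_r M T)]; lra.
Qed.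

Lemma clim0_ext F G l T : 0 < T -> (forall t, 0 < t <= T -> F t = G t) -> clim0 F l -> clim0 G l.
Proof.
  intros HT He H eps Heps. destruct (H eps Heps) as [M [J K]]. exists (Rmin M T).
  split; [now apply Rmin_pos|]. intros t Ht.
  rewrite <- He; [apply K|]; [generalize (Rmin_l M T)|generalize (Rmin_r M T)]; lra.
Qed.

(** The hypothesis makes [Psi] increasing. Being bounded it approaches its supremum, which makes [F]
    Cauchy. Letting [b] tend to infinity in the hypothesis yields the rate, with any upper bound [L]
    of [Psi]. *)
Lemma conv_inf (F : R -> C) (Psi : R -> R) T L :
  (forall a b, T <= a -> a <= b -> Cmod (F b - F a) <= Psi b - Psi a) ->
  (forall t, T <= t -> Psi t <= L) ->
  exists l, climinf F l /\ forall t, T <= t -> Cmod (F t - l) <= L - Psi t.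
Proof.
  intros Hinc HL.
  destruct (completeness (fun y => exists t, T <= t /\ y = Psi t)) as [s [Hs1 Hs2]].
  { exists L. intros y [t [Ht ->]]. auto. }
  { exists (Psi T). exists T. split; [lra|auto]. }
  assert (Hmono : forall a b, T <= a -> a <= b -> Psi a <= Psi b).
  { intros a b Ha Hb. generalize (Hinc a b Ha Hb) (Cmod_ge_0 (F b - F a)); lra. }
  assert (HC : forall eps, 0 < eps -> exists M, T <= M /\ forall t, M <= t -> Psi t > s - eps).
  { intros eps He. destruct (classic (exists t, T <= t /\ Psi t > s - eps)) as [[t [Ht1 Ht2]]|Hn].
    - exists t; split; auto. intros u Hu. generalize (Hmono t u Ht1 Hu); lra.
    - exfalso. assert (s <= s - eps); [|lra]. apply Hs2. intros y [t [Ht ->]].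
      apply Rnot_lt_le. intros Hlt. apply Hn. exists t; split; auto. }
  assert (Hcau : exists l : C, filterlim F (Rbar_locally p_infty) (locally (T:=C_R_CompleteNormedModule) l)).
  { apply (@filterlim_locally_cauchy R C_R_CompleteNormedModule (Rbar_locally p_infty) _ F).
    intros eps. destruct (HC eps (cond_pos eps)) as [M [HM1 HM2]].
    exists (fun t => M <= t). split; [exists M; intros; lra|].
    assert (Hw : forall u v, M <= u -> u <= v -> Cmod (F v - F u) < eps).
    { intros u v Hu Hv. assert (H1 := Hinc u v ltac:(lra) Hv). assert (H2 := HM2 u Hu).
      assert (Psi v <= s) by (apply Hs1; exists v; split; auto; lra). lra. }
    assert (Hb : forall u v, M <= u -> M <= v -> Cmod (F v - F u) < eps).
    { intros u v Hu Hv. destruct (Rle_dec u v) as [H|H]; [auto|].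
      rewrite Cmod_minus_sym. apply Hw; lra. }
    intros u v Hu Hv. specialize (Hb u v Hu Hv).
    split.
    - change (Rabs (Re (F v) - Re (F u)) < eps). rewrite <- Re_minus. eapply Rle_lt_trans; [apply re_le_Cmod|auto].
    - change (Rabs (Im (F v) - Im (F u)) < eps). rewrite <- Im_minus. eapply Rle_lt_trans; [apply im_le_Cmod|auto]. }
  destruct Hcau as [l Hl]. exists l.
  assert (HFl : climinf F l).
  { intros eps He. assert (He2 : 0 < eps / 2) by lra.
    destruct (Hl (ball (M:=C_R_CompleteNormedModule) l (mkposreal _ He2)) (locally_ball l _)) as [M HM].
    exists M. intros t Ht. destruct (HM t Ht) as [H1 H2].
    change (Rabs (Re (F t) - Re l) < eps / 2) in H1. change (Rabs (Im (F t) - Im l) < eps / 2) in H2.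
    eapply Rle_lt_trans; [apply Cmod_le_abs|]. rewrite Re_minus, Im_minus. lra. }
  split; auto.
  intros t Ht. apply le_epsilon. intros eps He. destruct (HFl eps He) as [M HM].
  set (u := Rmax t M + 1). assert (Hu1 := Rmax_l t M). assert (Hu2 := Rmax_r t M).
  specialize (HM u ltac:(unfold u; lra)). assert (H1 := Hinc t u Ht ltac:(unfold u; lra)).
  assert (H2 := HL u ltac:(unfold u; lra)).
  replace (F t - l)%C with ((F u - l) - (F u - F t))%C by ring.
  generalize (Cmod_triangle_minus (F u - l) (F u - F t)); lra.
Qed.

(** Reduced to [conv_inf] by the substitution of [1/t] for [t], which turns [Psi] into [- Psi]. *)
Lemma conv_0 (F : R -> C) (Psi : R -> R) T L : 0 < T ->
  (forall a b, 0 < a -> a <= b -> b <= T -> Cmod (F b - F a) <= Psi b - Psi a) ->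
  (forall t, 0 < t -> t <= T -> L <= Psi t) ->
  exists l, clim0 F l /\ forall t, 0 < t -> t <= T -> Cmod (F t - l) <= Psi t - L.
Proof.
  intros HT Hinc HL.
  assert (HT' := Rinv_0_lt_compat _ HT).
  assert (Hinv : forall a, / T <= a -> 0 < / a /\ / a <= T).
  { intros a Ha. split; [apply Rinv_0_lt_compat; lra|]. rewrite <- (Rinv_inv T). apply Rinv_le_contravar; auto. }
  destruct (conv_inf (fun s => F (/ s)) (fun s => - Psi (/ s)) (/ T) (- L)) as [l [H1 H2]].
  - intros a b Ha Hb. rewrite Cmod_minus_sym.
    destruct (Hinv a Ha). destruct (Hinv b ltac:(lra)).
    eapply Rle_trans; [apply Hinc; auto|lra]. apply Rinv_le_contravar; lra.
  - intros t Ht. destruct (Hinv t Ht). specialize (HL (/ t)). lra.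
  - exists l. split.
    + intros eps He. destruct (H1 eps He) as [M HM]. exists (/ (Rmax M 1)).
      assert (0 < Rmax M 1) by (generalize (Rmax_r M 1); lra).
      split; [apply Rinv_0_lt_compat; auto|]. intros t [Ht1 Ht2].
      rewrite <- (Rinv_inv t). apply HM. eapply Rle_lt_trans; [apply (Rmax_l M 1)|].
      rewrite <- (Rinv_inv (Rmax M 1)). apply Rinv_lt_contravar; auto.
      apply Rmult_lt_0_compat; auto. apply Rinv_0_lt_compat; auto.
    + intros t Ht1 Ht2. specialize (H2 (/ t)). rewrite Rinv_inv in H2.
      replace (Psi t - L) with (- L - - Psi t) by ring. apply H2. apply Rinv_le_contravar; auto.
Qed.

Definition isI (f : R -> C) (l : C) : Prop :=
  @is_RInt_gen C_R_NormedModule f (at_right 0) (Rbar_locally p_infty) l.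

Lemma isI_CInt_pos f l : isI f l -> CInt_pos f = l.
Proof.
  intros H. unfold CInt_pos.
  exact (@is_RInt_gen_unique C_R_CompleteNormedModule _ _ (Proper_StrongProper _ _) (Proper_StrongProper _ _) f l H).
Qed.

Lemma isI_unique f l m : isI f l -> isI f m -> l = m.
Proof. intros H1%isI_CInt_pos H2%isI_CInt_pos. congruence. Qed.

Lemma isI_plus f g l m : isI f l -> isI g m -> isI (fun t => f t + g t)%C (l + m)%C.
Proof. intros H1 H2. exact (@is_RInt_gen_plus C_R_NormedModule _ _ _ _ f g l m H1 H2). Qed.

Lemma isI_minus f g l m : isI f l -> isI g m -> isI (fun t => f t - g t)%C (l - m)%C.
Proof. intros H1 H2. exact (@is_RInt_gen_minus C_R_NormedModule _ _ _ _ f g l m H1 H2). Qed.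

Lemma at_right_pos : at_right 0 (fun t => 0 < t).
Proof. exists (mkposreal _ Rlt_0_1). intros; auto. Qed.

Lemma p_infty_gt M : Rbar_locally p_infty (fun t => M < t).
Proof. exists M; auto. Qed.

Lemma at_right_lt d : 0 < d -> at_right 0 (fun t => 0 < t < d).
Proof.
  intros Hd. exists (mkposreal _ Hd). intros y Hy H0. split; auto.
  change (Rabs (y - 0) < d) in Hy. rewrite Rminus_0_r, Rabs_pos_eq in Hy; lra.
Qed.

Lemma isI_ext f g l : (forall t, 0 < t -> f t = g t) -> isI f l -> isI g l.
Proof.
  intros H HI. refine (@is_RInt_gen_ext C_R_NormedModule _ _ _ _ f g l _ HI).
  apply Filter_prod with (Q := fun t => 0 < t) (R := fun t => 0 < t).
  - apply at_right_pos.
  - apply p_infty_gt.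
  - intros a b Ha Hb t [Ht _]. apply H. simpl in Ht. assert (0 < Rmin a b) by now apply Rmin_pos. lra.
Qed.

Lemma isI_intro f l F l0 l1 :
  (forall t, 0 < t -> rder F t (f t)) -> cont_pos f -> clim0 F l0 -> climinf F l1 ->
  l = (l1 - l0)%C -> isI f l.
Proof.
  intros HF Hf H0 H1 ->. intros P [eps HP].
  assert (He : 0 < eps / 4) by (generalize (cond_pos eps); lra).
  destruct (H0 _ He) as [d [Hd K0]]. destruct (H1 _ He) as [M K1].
  apply Filter_prod with (Q := fun t => 0 < t < d) (R := fun t => Rmax M 1 < t).
  - now apply at_right_lt.
  - apply p_infty_gt.
  - intros a b Ha Hb. exists (F b - F a)%C.
    assert (Hb1 := Rmax_l M 1). assert (Hb2 := Rmax_r M 1).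
    split.
    + apply cint_FTC; intros t Ht; [apply HF|apply Hf]; eapply between_pos; try apply Ht; simpl; lra.
    + apply HP. specialize (K0 a Ha). specialize (K1 b ltac:(lra)).
      assert (Hc : Cmod (F b - F a - (l1 - l0)) < eps).
      { replace (F b - F a - (l1 - l0))%C with ((F b - l1) - (F a - l0))%C by ring.
        generalize (Cmod_triangle_minus (F b - l1) (F a - l0)) (cond_pos eps); lra. }
      split.
      * change (Rabs (Re (F b - F a)%C - Re (l1 - l0)%C) < eps). rewrite <- Re_minus. eapply Rle_lt_trans; [apply re_le_Cmod|auto].
      * change (Rabs (Im (F b - F a)%C - Im (l1 - l0)%C) < eps). rewrite <- Im_minus. eapply Rle_lt_trans; [apply im_le_Cmod|auto].
Qed.

Lemma isI_Re f l : isI f l -> is_RInt_gen (fun t => Re (f t)) (at_right 0) (Rbar_locally p_infty) (Re l).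
Proof.
  intros H P [eps HP]. 
  specialize (H (fun z => P (Re z))).
  assert (Hl : locally (T:=C_R_NormedModule) l (fun z => P (Re z))).
  { exists eps. intros z [Hz _]. apply HP, Hz. }
  specialize (H Hl). unfold filtermapi in *. revert H. apply filter_imp.
  intros [a b] [y [Hy1 Hy2]]. exists (Re y). split; auto.
  apply cint_comp in Hy1. apply Hy1.
Qed.

Lemma is_derive_neg_exp B t : is_derive (fun t => - B * exp (- t)) t (B * exp (- t)).
Proof. auto_derive; auto; ring. Qed.

(** The majorant has the primitive [- B exp (-t)], whose total increase over the half-line is
    exactly [B]. Existence and size of all Bessel integrals are read off from this bound. *)
Lemma exp_dominated_isI f B : cont_pos f -> (forall t, 0 < t -> Cmod (f t) <= B * exp (- t)) ->
  exists l, isI f l /\ Cmod l <= B.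
Proof.
  intros Hf HB. destruct (ex_primitive_pos f Hf) as [F HF].
  assert (HB0 : 0 <= B).
  { assert (H := HB 1 Rlt_0_1). assert (H1 := Cmod_ge_0 (f 1)). assert (H2 := exp_pos (- 1)).
    apply Rmult_le_reg_r with (exp (- (1))); auto. lra. }
  assert (Hinc : forall a b, 0 < a -> a <= b -> Cmod (F b - F a) <= - B * exp (- b) - - B * exp (- a)).
  { intros a b Ha Hab. apply (mean_value_majorant F f (fun t => - B * exp (- t)) (fun t => B * exp (- t))); auto.
    - intros t Ht; apply HF; lra.
    - intros; apply is_derive_neg_exp.
    - intros t Ht; apply HB; lra. }
  destruct (conv_inf F (fun t => - B * exp (- t)) 1 0) as [l1 [H1 H1']].
  { intros; apply Hinc; lra. }
  { intros t Ht. generalize (exp_pos (- t)); nra. }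
  destruct (conv_0 F (fun t => - B * exp (- t)) 1 (- B)) as [l0 [H0 H0']]; [lra| | |].
  { intros; apply Hinc; lra. }
  { intros t Ht _. assert (exp (- t) <= 1); [|nra]. rewrite <- exp_0. apply exp_le_mono; lra. }
  exists (l1 - l0)%C. split.
  - eapply isI_intro; eauto.
  - specialize (H1' 1 ltac:(lra)). specialize (H0' 1 ltac:(lra) ltac:(lra)).
    replace (l1 - l0)%C with ((F 1 - l0) - (F 1 - l1))%C by ring.
    generalize (Cmod_triangle_minus (F 1 - l0) (F 1 - l1)); lra.
Qed.

Lemma isI_bound f B l : cont_pos f -> (forall t, 0 < t -> Cmod (f t) <= B * exp (- t)) -> isI f l -> Cmod l <= B.
Proof.
  intros Hf HB H. destruct (exp_dominated_isI f B Hf HB) as [m [Hm1 Hm2]].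
  now rewrite (isI_unique _ _ _ H Hm1).
Qed.

(** The scalar is complex while the integral takes values in a real module, so linearity is carried
    through the filters by hand. *)
Lemma isI_scal c f l : isI f l -> isI (fun t => c * f t)%C (c * l)%C.
Proof.
  intros H P [eps HP].
  set (d := eps / (Cmod c + 1) / 2).
  assert (Hc := Cmod_ge_0 c).
  assert (Hd : 0 < d).
  { unfold d. apply Rdiv_lt_0_compat; [|lra]. apply Rdiv_lt_0_compat; [apply cond_pos|lra]. }
  specialize (H (fun z => Cmod (z - l) < eps / (Cmod c + 1))).
  assert (Hl : locally (T:=C_R_NormedModule) l (fun z => Cmod (z - l) < eps / (Cmod c + 1))).
  { exists (mkposreal _ Hd). intros z [H1 H2].
    change (Rabs (Re z - Re l) < d) in H1. change (Rabs (Im z - Im l) < d) in H2.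
    eapply Rle_lt_trans; [apply Cmod_le_abs|]. rewrite Re_minus, Im_minus. unfold d in *; lra. }
  specialize (H Hl). unfold filtermapi in *. revert H. apply filter_imp.
  intros [a b] [y [Hy1 Hy2]]. exists (c * y)%C. split; [now apply cint_scal|].
  apply HP.
  assert (Hcc : Cmod (c * y - c * l) < eps).
  { replace (c * y - c * l)%C with (c * (y - l))%C by ring. apply clim_scal_aux; auto. apply cond_pos. }
  split.
  - change (Rabs (Re (c * y)%C - Re (c * l)%C) < eps). rewrite <- Re_minus. eapply Rle_lt_trans; [apply re_le_Cmod|auto].
  - change (Rabs (Im (c * y)%C - Im (c * l)%C) < eps). rewrite <- Im_minus. eapply Rle_lt_trans; [apply im_le_Cmod|auto].
Qed.

(** * The Bessel function near the origin and at infinity *)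

Lemma pow_le_fact_exp p u : 0 <= u -> u ^ p <= INR (fact p) * exp u.
Proof.
  revert u; induction p as [|p IH]; intros u Hu.
  - simpl. generalize (exp_ineq1_le u); lra.
  - assert (Hf := INR_fact_lt_0 (S p)).
    assert (M := mean_value_majorant (fun t => RtoC (t ^ S p)) (fun t => RtoC (INR (S p) * t ^ p))
      (fun t => INR (fact (S p)) * exp t) (fun t => INR (fact (S p)) * exp t) 0 u Hu).
    cbv beta in M. rewrite exp_0, pow_i in M by lia.
    rewrite <- RtoC_minus, Cmod_R, Rminus_0_r, Rabs_pos_eq in M by (apply pow_le; lra).
    assert (u ^ S p <= INR (fact (S p)) * exp u - INR (fact (S p)) * 1); [|lra].
    apply M; clear M.
    + intros t Ht. apply rder_RtoC. auto_derive; auto. rewrite S_INR. destruct p; simpl; ring.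
    + intros t Ht. apply is_derive_scal. apply is_derive_Reals, derivable_pt_lim_exp.
    + intros t Ht. rewrite Cmod_R, Rabs_pos_eq.
      * rewrite fact_simpl, mult_INR, Rmult_assoc. apply Rmult_le_compat_l; [apply pos_INR|]. apply IH; lra.
      * apply Rmult_le_pos; [apply pos_INR|apply pow_le; lra].
Qed.

Lemma cosh_ge_1 t : 1 <= cosh t.
Proof.
  unfold cosh. assert (H := exp_pos t). assert (H' := exp_pos (- t)).
  assert (E : exp t * exp (- t) = 1) by (rewrite <- exp_plus, Rplus_opp_r; apply exp_0).
  assert (0 <= (exp t - exp (-t)) ^ 2) by apply pow2_ge_0. nra.
Qed.

Lemma inv_cosh_le t : / cosh t <= 2 * exp (- t).
Proof.
  assert (Hc := cosh_ge_1 t).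
  apply Rmult_le_reg_r with (cosh t); [lra|]. rewrite Rinv_l by lra.
  unfold cosh. assert (E : exp (- t) * exp t = 1) by (rewrite <- exp_plus, Rplus_opp_l; apply exp_0).
  assert (H' := exp_pos (- t)). nra.
Qed.

Lemma is_derive_cosh t : is_derive cosh t (sinh t).
Proof. unfold cosh, sinh. auto_derive; auto. field. Qed.
Lemma is_derive_sinh t : is_derive sinh t (cosh t).
Proof. unfold cosh, sinh. auto_derive; auto. field. Qed.

(* [Kint b j z] is the [j]-th derivative of [K_0] at [b z], up to the sign [(-1)^j]. *)
Definition Kg (b : R) (j : nat) (z : C) (t : R) : C :=
  (RtoC (cosh t ^ j) * Cexp (- (RtoC b * z * RtoC (cosh t))))%C.
Definition Kint (b : R) (j : nat) (z : C) : C := CInt_pos (Kg b j z).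

Lemma rder_exp_cosh b z t : rder (fun t => Cexp (- (RtoC b * z * RtoC (cosh t)))%C) t
  (- (RtoC b * z * RtoC (sinh t)) * Cexp (- (RtoC b * z * RtoC (cosh t))))%C.
Proof.
  apply (rder_comp_C Cexp (fun t => - (RtoC b * z * RtoC (cosh t)))%C).
  - apply cder_Cexp.
  - apply rder_ext with (fun t => (- (RtoC b * z)) * RtoC (cosh t))%C; [intros; ring|].
    eapply rder_eq; [apply rder_scal, rder_RtoC, is_derive_cosh|ring].
Qed.

Lemma Kg_cont b j z : forall t, ccont (Kg b j z) t.
Proof.
  intros t. apply ccont_mult.
  - apply ccont_RtoC. apply (ex_derive_continuous (fun t => cosh t ^ j)). unfold cosh. auto_derive; auto.
  - eapply rder_ccont. apply rder_exp_cosh.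
Qed.

Lemma Cmod_Kg b j z t : Cmod (Kg b j z t) = cosh t ^ j * exp (- (b * Re z * cosh t)).
Proof.
  unfold Kg. rewrite Cmod_mult, Cmod_Cexp, Cmod_R, Rabs_pos_eq.
  - f_equal. f_equal. destruct z; simpl; ring.
  - apply pow_le. generalize (cosh_ge_1 t); lra.
Qed.

(** The bound [u^p <= p! exp u] at [u = b x cosh t] trades the exponential for any power of
    [1/(b x)]. Since [L >= 1], a factor [1/cosh t <= 2 exp (-t)] is left for integration. [L = 1]
    serves near the origin, large [L] gives the decay at infinity. *)
Lemma Kg_bound_real b j L x t : 0 < b -> 0 < x -> (1 <= L)%nat ->
  cosh t ^ j * exp (- (b * x * cosh t)) <= 2 * INR (fact (j + L)) / (b * x) ^ (j + L) * exp (- t).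
Proof.
  intros Hb Hx HL. assert (Hc := cosh_ge_1 t). assert (Hbx : 0 < b * x) by (apply Rmult_lt_0_compat; auto).
  assert (H := pow_le_fact_exp (j + L) (b * x * cosh t) ltac:(apply Rmult_le_pos; lra)).
  rewrite Rpow_mult_distr in H. rewrite exp_Ropp.
  assert (He := exp_pos (b * x * cosh t)). assert (Hp : 0 < (b * x) ^ (j + L)) by (apply pow_lt; auto).
  assert (Hcj : 0 < cosh t ^ j) by (apply pow_lt; lra).
  assert (HcL : cosh t <= cosh t ^ L).
  { destruct L; [lia|]. simpl. rewrite <- (Rmult_1_r (cosh t)) at 1. apply Rmult_le_compat_l; [lra|]. apply pow_R1_Rle; auto. }
  assert (Hic := inv_cosh_le t).
  apply Rle_trans with (INR (fact (j + L)) / (b * x) ^ (j + L) * / cosh t).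
  - apply Rmult_le_reg_r with (exp (b * x * cosh t) * (b * x) ^ (j + L) * cosh t).
    { apply Rmult_lt_0_compat; [apply Rmult_lt_0_compat; auto|lra]. }
    replace (cosh t ^ j * / exp (b * x * cosh t) * (exp (b * x * cosh t) * (b * x) ^ (j + L) * cosh t))
      with ((b * x) ^ (j + L) * (cosh t ^ j * cosh t)) by (field; lra).
    replace (INR (fact (j + L)) / (b * x) ^ (j + L) * / cosh t * (exp (b * x * cosh t) * (b * x) ^ (j + L) * cosh t))
      with (INR (fact (j + L)) * exp (b * x * cosh t)) by (field; lra).
    eapply Rle_trans; [|apply H]. apply Rmult_le_compat_l; [lra|]. rewrite (pow_add (cosh t)).
    apply Rmult_le_compat_l; lra.
  - replace (2 * INR (fact (j + L)) / (b * x) ^ (j + L) * exp (- t)) with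
      (INR (fact (j + L)) / (b * x) ^ (j + L) * (2 * exp (- t))) by (field; lra).
    apply Rmult_le_compat_l; auto. apply Rlt_le, Rdiv_lt_0_compat; auto. apply INR_fact_lt_0.
Qed.

Section bessel.
Variable b : R.
Hypothesis hb : 0 < b.

Lemma Kint_isI j z : 0 < Re z -> isI (Kg b j z) (Kint b j z).
Proof.
  intros Hz. destruct (exp_dominated_isI (Kg b j z) (2 * INR (fact (j + 1)) / (b * Re z) ^ (j + 1))) as [l [Hl _]].
  - intros t _; apply Kg_cont.
  - intros t _. rewrite Cmod_Kg. apply Kg_bound_real; auto.
  - unfold Kint. now rewrite (isI_CInt_pos _ _ Hl).
Qed.

Lemma Kint_bound j L z : 0 < Re z -> (1 <= L)%nat ->
  Cmod (Kint b j z) <= 2 * INR (fact (j + L)) / (b * Re z) ^ (j + L).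
Proof.
  intros Hz HL. apply (isI_bound (Kg b j z)).
  - intros t _; apply Kg_cont.
  - intros t _. rewrite Cmod_Kg. apply Kg_bound_real; auto.
  - apply Kint_isI, Hz.
Qed.

Lemma BesselK0_Kint z : 0 < Re z -> BesselK0 (RtoC b * z) = Kint b 0 z.
Proof.
  intros Hz. apply isI_CInt_pos. eapply isI_ext; [|apply Kint_isI, Hz].
  intros t _. unfold Kg. simpl. ring.
Qed.

(** Differentiation under the integral sign. For [|h| < Re z / 2] the second-order remainder of the
    exponential brings down two factors [cosh t] and spends at most half of the decay, hence the
    bound with [j + 2] and [x / 2]. *)
Lemma cder_Kint j z : 0 < Re z -> cder (Kint b j) z (- (RtoC b * Kint b (S j) z))%C.
Proof.
  intros Hz. set (x := Re z) in *.
  apply cder_quad with (d := x / 2) (B := b ^ 2 * (2 * INR (fact ((j + 2) + 1)) / (b * (x / 2)) ^ ((j + 2) + 1))); [lra|].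
  intros h Hh. assert (Hrh := re_le_Cmod h). apply Rabs_le_between in Hrh.
  assert (Hzh : 0 < Re (z + h)%C) by (rewrite Re_plus; fold x; lra).
  assert (Hh0 := Cmod_ge_0 h).
  assert (HI : isI (fun t => Kg b j (z + h)%C t - Kg b j z t - (- (h * RtoC b)) * Kg b (S j) z t)%C
    (Kint b j (z + h) - Kint b j z - h * - (RtoC b * Kint b (S j) z))%C).
  { replace (h * - (RtoC b * Kint b (S j) z))%C with ((- (h * RtoC b)) * Kint b (S j) z)%C by ring.
    apply isI_minus; [apply isI_minus; apply Kint_isI; auto|]. apply isI_scal, Kint_isI, Hz. }
  eapply isI_bound; [| |apply HI].
  - intros t _. apply ccont_minus; [apply ccont_minus; apply Kg_cont|]. apply ccont_scal, Kg_cont.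
  - intros t Ht. cbv beta. set (c := cosh t). assert (Hc : 1 <= c) by apply cosh_ge_1.
    set (w := (- (RtoC b * h * RtoC c))%C).
    replace (Kg b j (z + h)%C t - Kg b j z t - (- (h * RtoC b)) * Kg b (S j) z t)%C with
      (Kg b j z t * (Cexp w - 1 - w))%C.
    2:{ unfold Kg, w. fold c. replace (- (RtoC b * (z + h) * RtoC c))%C with (- (RtoC b * z * RtoC c) + - (RtoC b * h * RtoC c))%C by ring.
        rewrite Cexp_plus. simpl pow. rewrite RtoC_mult. ring. }
    assert (Ew : Cmod w = b * Cmod h * c).
    { unfold w. rewrite Cmod_opp, !Cmod_mult, !Cmod_R, !Rabs_pos_eq by lra. reflexivity. }
    rewrite Cmod_mult, Cmod_Kg. fold c x.
    apply Rle_trans with (c ^ j * exp (- (b * x * c)) * ((b * Cmod h * c) ^ 2 * exp (b * Cmod h * c))).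
    { apply Rmult_le_compat_l.
      - apply Rmult_le_pos; [apply pow_le; lra|apply Rlt_le, exp_pos].
      - rewrite <- Ew. apply Cexp_rem2. }
    apply Rle_trans with (b ^ 2 * Cmod h ^ 2 * (c ^ (j + 2) * exp (- (b * (x / 2) * c)))).
    { replace (c ^ j * exp (- (b * x * c)) * ((b * Cmod h * c) ^ 2 * exp (b * Cmod h * c))) with
        (b ^ 2 * Cmod h ^ 2 * (c ^ (j + 2) * (exp (- (b * x * c)) * exp (b * Cmod h * c))))
        by (rewrite pow_add; simpl; ring).
      apply Rmult_le_compat_l; [apply Rmult_le_pos; apply pow2_ge_0|].
      apply Rmult_le_compat_l; [apply pow_le; lra|]. rewrite <- exp_plus. apply exp_le_mono.
      assert (b * c * Cmod h <= b * c * (x / 2)); [|lra].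
      apply Rmult_le_compat_l; [apply Rmult_le_pos; lra|lra]. }
    assert (H := Kg_bound_real b (j + 2) 1 (x / 2) t hb ltac:(lra) (Nat.le_refl 1)). fold c in H.
    eapply Rle_trans; [apply Rmult_le_compat_l; [apply Rmult_le_pos; apply pow2_ge_0|apply H]|].
    right; ring.
Qed.

Lemma ccont_clim0 f : ccont f 0 -> clim0 f (f 0).
Proof.
  intros H eps He. assert (He2 : 0 < eps / 2) by lra.
  destruct (H (ball (M:=C_R_NormedModule) (f 0) (mkposreal _ He2)) (locally_ball _ _)) as [d Hd].
  exists d; split; [apply cond_pos|]. intros t Ht.
  assert (Hb : ball 0 d t) by (change (Rabs (t - 0) < d); rewrite Rminus_0_r, Rabs_pos_eq; lra).
  destruct (Hd t Hb) as [H1 H2].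
  change (Rabs (Re (f t) - Re (f 0)) < eps / 2) in H1. change (Rabs (Im (f t) - Im (f 0)) < eps / 2) in H2.
  eapply Rle_lt_trans; [apply Cmod_le_abs|]. rewrite Re_minus, Im_minus. lra.
Qed.

Lemma climinf_exp F B : (forall t, 0 < t -> Cmod (F t) <= B * exp (- t)) -> climinf F 0.
Proof.
  intros H eps He. exists (Rmax 0 (- ln (eps / (Rabs B + 1)))). intros t Ht.
  assert (HB := Rabs_pos B). assert (HB' := Rle_abs B).
  assert (Ht1 := Rmax_l 0 (- ln (eps / (Rabs B + 1)))). assert (Ht2 := Rmax_r 0 (- ln (eps / (Rabs B + 1)))).
  replace (F t - 0)%C with (F t) by ring.
  assert (Hq : 0 < eps / (Rabs B + 1)) by (apply Rdiv_lt_0_compat; lra).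
  assert (Hexp : exp (- t) < eps / (Rabs B + 1)).
  { rewrite <- (exp_ln (eps / (Rabs B + 1))) by auto. apply exp_increasing. lra. }
  assert (He0 := exp_pos (- t)).
  eapply Rle_lt_trans; [apply H; lra|].
  apply Rle_lt_trans with ((Rabs B + 1) * exp (- t)); [nra|].
  apply Rmult_lt_reg_r with (/ (Rabs B + 1)); [apply Rinv_0_lt_compat; lra|].
  rewrite Rmult_comm, <- Rmult_assoc, Rinv_l, Rmult_1_l by lra. exact Hexp.
Qed.

Lemma sinh_le_cosh t : Rabs (sinh t) <= cosh t.
Proof.
  unfold sinh, cosh. generalize (exp_pos t) (exp_pos (- t)). intros. apply Rabs_le_between; lra.
Qed.

Lemma sinh_0' : sinh 0 = 0.
Proof. apply sinh_0. Qed.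

(** Bessel's equation [u K'' + K' = u K] at [u = b z]. By [cosh^2 = 1 + sinh^2] the integrand of the
    difference of both sides is the derivative of [- sinh t exp (- b z cosh t)], which vanishes at
    both ends. *)
Lemma Kint_ODE z : 0 < Re z -> (RtoC b * z * Kint b 2 z - Kint b 1 z = RtoC b * z * Kint b 0 z)%C.
Proof.
  intros Hz. set (F := fun t => (- (RtoC (sinh t) * Cexp (- (RtoC b * z * RtoC (cosh t)))))%C).
  assert (H1 : isI (fun t => RtoC b * z * Kg b 2 z t - Kg b 1 z t - RtoC b * z * Kg b 0 z t)%C (0 - F 0)%C).
  { apply isI_intro with (F := F) (l0 := F 0) (l1 := RtoC 0); auto.
    - intros t Ht. unfold F.
      apply rder_ext with (fun t => (- (1)) * (RtoC (sinh t) * Cexp (- (RtoC b * z * RtoC (cosh t)))))%C; [intros; ring|].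
      eapply rder_eq; [apply rder_scal, rder_mult; [apply rder_RtoC, is_derive_sinh|apply rder_exp_cosh]|].
      unfold Kg. cbv beta. simpl pow.
      assert (E : RtoC (cosh t * (cosh t * 1)) = (1 + RtoC (sinh t) * RtoC (sinh t))%C).
      { rewrite <- RtoC_mult, <- RtoC_plus. f_equal. unfold cosh, sinh.
        assert (E : exp (- t) * exp t = 1) by (rewrite <- exp_plus, Rplus_opp_l; apply exp_0). nra. }
      rewrite E. rewrite Rmult_1_r. ring.
    - intros t _. apply ccont_minus; [apply ccont_minus; [apply ccont_scal|]|apply ccont_scal]; apply Kg_cont.
    - apply ccont_clim0. unfold F.
      apply rder_ccont with (l := (- (RtoC (cosh 0) * Cexp (- (RtoC b * z * RtoC (cosh 0))) + RtoC (sinh 0) * (- (RtoC b * z * RtoC (sinh 0)) * Cexp (- (RtoC b * z * RtoC (cosh 0))))))%C).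
      apply rder_ext with (fun t => (- (1)) * (RtoC (sinh t) * Cexp (- (RtoC b * z * RtoC (cosh t)))))%C; [intros; ring|].
      eapply rder_eq; [apply rder_scal, rder_mult; [apply rder_RtoC, is_derive_sinh|apply rder_exp_cosh]|].
      cbv beta; ring.
    - apply climinf_exp with (B := 2 * INR (fact (1 + 1)) / (b * Re z) ^ (1 + 1)).
      intros t _. eapply Rle_trans; [|apply (Kg_bound_real b 1 1 (Re z) t); auto].
      unfold F. rewrite Cmod_opp, <- (Cmod_Kg b 1 z t). unfold Kg. rewrite !Cmod_mult.
      apply Rmult_le_compat_r; [apply Cmod_ge_0|]. rewrite !Cmod_R, pow_1, (Rabs_pos_eq (cosh t)).
      + apply sinh_le_cosh.
      + generalize (cosh_ge_1 t); lra. }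
  assert (H2 : isI (fun t => RtoC b * z * Kg b 2 z t - Kg b 1 z t - RtoC b * z * Kg b 0 z t)%C
    (RtoC b * z * Kint b 2 z - Kint b 1 z - RtoC b * z * Kint b 0 z)%C).
  { apply isI_minus; [apply isI_minus; [apply isI_scal|]|apply isI_scal]; apply Kint_isI; auto. }
  assert (E := isI_unique _ _ _ H1 H2). unfold F in E. rewrite sinh_0' in E.
  replace (RtoC b * z * Kint b 2 z - Kint b 1 z)%C with
    ((RtoC b * z * Kint b 2 z - Kint b 1 z - RtoC b * z * Kint b 0 z) + RtoC b * z * Kint b 0 z)%C by ring.
  rewrite <- E. ring.
Qed.

(** With [sinh] in place of [cosh] the integral is elementary and equals [exp (- b z)]. The
    replacement costs at most [b |z|], because [cosh t - sinh t = exp (-t)]. *)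
Lemma Kint_1_near_0 z : 0 < Re z ->
  Cmod (RtoC b * z * Kint b 1 z - 1) <= b * Cmod z * (exp (b * Cmod z) + 1).
Proof.
  intros Hz. set (F := fun t => (- Cexp (- (RtoC b * z * RtoC (cosh t))))%C).
  assert (HF : forall t, rder F t (RtoC b * z * RtoC (sinh t) * Cexp (- (RtoC b * z * RtoC (cosh t))))%C).
  { intros t. unfold F.
    apply rder_ext with (fun t => (- (1)) * Cexp (- (RtoC b * z * RtoC (cosh t))))%C; [intros; ring|].
    eapply rder_eq; [apply rder_scal, rder_exp_cosh|]. cbv beta; ring. }
  assert (Hcs : forall t, ccont (fun t => RtoC b * z * RtoC (sinh t) * Cexp (- (RtoC b * z * RtoC (cosh t))))%C t).
  { intros t. apply ccont_mult; [|eapply rder_ccont, rder_exp_cosh].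
    apply ccont_mult; [apply ccont_const|]. apply ccont_RtoC. apply (ex_derive_continuous sinh). eexists; apply is_derive_sinh. }
  assert (H1 : isI (fun t => RtoC b * z * RtoC (sinh t) * Cexp (- (RtoC b * z * RtoC (cosh t))))%C (0 - F 0)%C).
  { apply isI_intro with (F := F) (l0 := F 0) (l1 := RtoC 0); auto.
    - intros t _; apply Hcs.
    - apply ccont_clim0. eapply rder_ccont, HF.
    - apply climinf_exp with (B := 2 * INR (fact (0 + 1)) / (b * Re z) ^ (0 + 1)).
      intros t _. eapply Rle_trans; [|apply (Kg_bound_real b 0 1 (Re z) t); auto].
      rewrite <- (Cmod_Kg b 0 z t). unfold F. rewrite Cmod_opp. right. unfold Kg. simpl pow. rewrite Cmult_1_l. reflexivity. }
  assert (H2 := isI_minus _ _ _ _ (isI_scal (RtoC b * z) _ _ (Kint_isI 1 z Hz)) H1).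
  assert (F0 : (0 - F 0)%C = Cexp (- (RtoC b * z))).
  { unfold F. rewrite cosh_0. replace (- (RtoC b * z * RtoC 1))%C with (- (RtoC b * z))%C by ring. ring. }
  rewrite F0 in H2.
  assert (Hm := Cmod_pos_Re z Hz).
  assert (H3 : Cmod (RtoC b * z * Kint b 1 z - Cexp (- (RtoC b * z))) <= b * Cmod z).
  { eapply isI_bound; [| |apply H2].
    - intros t _. apply ccont_minus; [apply ccont_scal, Kg_cont|apply Hcs].
    - intros t _. cbv beta. unfold Kg. rewrite pow_1.
      replace (RtoC b * z * (RtoC (cosh t) * Cexp (- (RtoC b * z * RtoC (cosh t)))) -
        RtoC b * z * RtoC (sinh t) * Cexp (- (RtoC b * z * RtoC (cosh t))))%C with
        (RtoC b * z * RtoC (cosh t - sinh t)%R * Cexp (- (RtoC b * z * RtoC (cosh t))))%C by (rewrite RtoC_minus; ring).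
      replace (cosh t - sinh t)%R with (exp (- t)) by (unfold cosh, sinh; field).
      rewrite !Cmod_mult, !Cmod_R, Cmod_Cexp, !Rabs_pos_eq; [|apply Rlt_le, exp_pos|lra].
      rewrite <- (Rmult_1_r (b * Cmod z * exp (- t))) at 2.
      apply Rmult_le_compat_l; [repeat apply Rmult_le_pos; try lra; apply Rlt_le, exp_pos|].
      rewrite <- exp_0. apply exp_le_mono.
      replace (Re (- (RtoC b * z * RtoC (cosh t)))%C) with (- (b * Re z * cosh t)) by (destruct z; simpl; ring).
      generalize (cosh_ge_1 t); intros.
      assert (0 <= b * Re z * cosh t) by (apply Rmult_le_pos; [apply Rmult_le_pos; lra|lra]). lra. }
  assert (H4 := Cexp_rem1 (- (RtoC b * z))). rewrite Cmod_opp, Cmod_mult, Cmod_R, Rabs_pos_eq in H4 by lra.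
  replace (RtoC b * z * Kint b 1 z - 1)%C with
    ((RtoC b * z * Kint b 1 z - Cexp (- (RtoC b * z))) + (Cexp (- (RtoC b * z)) - 1))%C by ring.
  eapply Rle_trans; [apply Cmod_triangle|]. lra.
Qed.

End bessel.

(** * The exponential integral and Euler's constant *)

Lemma ex_primitive_all f : (forall t, ccont f t) -> exists F, forall t, rder F t (f t).
Proof.
  intros Hf. exists (fun t => @RInt C_R_CompleteNormedModule f 0 t). intros t.
  apply (@is_derive_RInt C_R_NormedModule f _ 0 t).
  - exists (mkposreal _ Rlt_0_1). intros s Hs.
    apply (@RInt_correct C_R_CompleteNormedModule). apply ex_cint. intros u Hu. apply Hf.
  - apply Hf.
Qed.

(** Its integral over [t > 0] is the exponential integral [E_1(y)], by the substitution
    [u = y exp t]. *)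
Definition E1g (y t : R) : C := RtoC (exp (- (y * exp t))).

(** The remainder of the logarithmic series at [1]. Its derivative [(1 - t)^n / t] makes it an exact
    primitive for the approximation [(1 - u)^n] of the exponential, and for small [t] it is close to
    [ln t] plus the harmonic number: this is how Euler's constant enters. *)
Definition lnpart (n : nat) (t : R) : R := ln t + sum_n_m (fun k => (1 - t) ^ k / INR k) 1 n.

Lemma sum_n_m_S (u : nat -> R) n : sum_n_m u 1 (S n) = sum_n_m u 1 n + u (S n).
Proof. apply (sum_n_Sm u 1 n). lia. Qed.

Lemma is_derive_lnpart n t : 0 < t -> is_derive (lnpart n) t ((1 - t) ^ n / t).
Proof.
  intros Ht. induction n as [|n IH].
  - apply is_derive_ext with (fun t => ln t + 0).
    { intros s. unfold lnpart. rewrite (sum_n_m_zero (G:=R_AbelianMonoid)) by lia. reflexivity. }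
    auto_derive; [exact Ht|]. simpl. field; lra.
  - apply is_derive_ext with (fun t => lnpart n t + (1 - t) ^ S n / INR (S n)).
    { intros s. unfold lnpart. rewrite sum_n_m_S. apply Rplus_assoc. }
    assert (Hn : INR (S n) <> 0) by now apply not_0_INR.
    assert (H2 : is_derive (fun t => (1 - t) ^ S n / INR (S n)) t (- (1 - t) ^ n)).
    { apply is_derive_ext with (fun t => / INR (S n) * (1 - t) ^ S n).
      { intros s. unfold Rdiv. apply Rmult_comm. }
      evar_last; [apply is_derive_scal; apply is_derive_pow|].
      - apply (is_derive_minus (V:=R_NormedModule)); [apply (@is_derive_const R_AbsRing R_NormedModule)|apply (@is_derive_id R_AbsRing)].
      - change (pred (S n)) with n. unfold minus, plus, opp, zero, one; simpl Ring.one; cbv beta.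
        change (/ INR (S n) * (INR (S n) * (0 + - 1) * (1 - t) ^ n) = - (1 - t) ^ n). field; auto. }
    evar_last; [apply (is_derive_plus (V:=R_NormedModule)); [apply IH|apply H2]|].
    unfold plus; simpl. field; lra.
Qed.

Lemma one_minus_pow_le_exp u n : 0 <= u <= 1 -> (1 - u) ^ n <= exp (- (INR n * u)).
Proof.
  intros Hu. replace (- (INR n * u)) with (INR n * (- u)) by ring.
  assert (E : exp (INR n * - u) = exp (- u) ^ n).
  { induction n as [|n IH]; [simpl; rewrite Rmult_0_l; apply exp_0|].
    rewrite S_INR, Rmult_plus_distr_r, exp_plus, IH, Rmult_1_l. simpl; ring. }
  rewrite E. apply pow_incr. split; [lra|]. generalize (exp_ineq1_le (- u)); lra.
Qed.

Lemma rder_E1g_cont y t : ccont (E1g y) t.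
Proof. apply ccont_RtoC. apply (ex_derive_continuous (fun t => exp (- (y * exp t)))). auto_derive; auto. Qed.

(** Integration of [(1 - t/n)^n <= exp (-t)] from [0] to [y]. Taking the zero function in
    [mean_value_majorant] turns it into a monotonicity criterion. *)
Lemma exp_defect_le n y : (1 <= n)%nat -> 0 <= y <= 1 ->
  exp (- y) - INR n / (INR n + 1) * (1 - y / INR n) ^ S n <= / (INR n + 1).
Proof.
  intros Hn Hy. assert (Hn1 : 1 <= INR n) by (change 1 with (INR 1); now apply le_INR).
  assert (M := mean_value_majorant (fun _ => RtoC 0) (fun _ => RtoC 0)
    (fun t => INR n / (INR n + 1) * (1 - t / INR n) ^ S n - exp (- t))
    (fun t => exp (- t) - (1 - t / INR n) ^ n) 0 y (proj1 Hy)).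
  cbv beta in M.
  replace (0 - 0)%C with (RtoC 0) in M by ring. rewrite Cmod_0 in M.
  assert (H : 0 <= INR n / (INR n + 1) * (1 - y / INR n) ^ S n - exp (- y) -
    (INR n / (INR n + 1) * (1 - 0 / INR n) ^ S n - exp (- 0))).
  { apply M; clear M.
    - intros; apply rder_const.
    - intros t Ht.
      assert (H2 : is_derive (fun t => (1 - t / INR n) ^ S n) t (INR (S n) * (- / INR n) * (1 - t / INR n) ^ n)).
      { apply (is_derive_pow (fun t => 1 - t / INR n)). auto_derive; auto. field; lra. }
      evar_last; [apply (is_derive_minus (V:=R_NormedModule)); [apply is_derive_scal, H2|]|].
      + instantiate (1 := - exp (- t)). auto_derive; auto; ring.
      + rewrite S_INR. unfold minus, plus, opp; simpl. field; lra.
    - intros t Ht. 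
      assert (Hu : 0 <= t / INR n <= 1).
      { split; [apply Rmult_le_pos; [lra|apply Rlt_le, Rinv_0_lt_compat; lra]|].
        apply Rmult_le_reg_r with (INR n); [lra|]. field_simplify; lra. }
      assert (H := one_minus_pow_le_exp (t / INR n) n Hu).
      replace (INR n * (t / INR n)) with t in H by (field; lra). lra. }
  replace (1 - 0 / INR n) with 1 in H by (field; lra).
  rewrite pow1, Ropp_0, exp_0 in H.
  replace (/ (INR n + 1)) with (1 - INR n / (INR n + 1) * 1) by (field; lra). lra.
Qed.

(** With [u = y exp s / n], the integrand is compared with [(1 - u)^n] up to [T], where [u = 1], and
    bounded beyond. Multiplying by [exp s >= 1] makes both majorants exactly integrable; their
    contributions at [T] cancel, and [exp_defect_le] bounds what is left at [0]. *)
Lemma E1_harmonic y n l : 0 < y <= 1 -> (1 <= n)%nat -> isI (E1g y) l ->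
  Cmod (l + RtoC (lnpart n (y / INR n))) <= / (y * (INR n + 1)).
Proof.
  intros Hy Hn HI. assert (Hn1 : 1 <= INR n) by (change 1 with (INR 1); now apply le_INR).
  destruct (ex_primitive_all (E1g y) (rder_E1g_cont y)) as [F HF].
  set (T := ln (INR n / y)).
  assert (Hny : 1 <= INR n / y) by (apply Rmult_le_reg_r with y; [lra|]; field_simplify; lra).
  assert (HT : 0 <= T) by (unfold T; rewrite <- ln_1; apply ln_le; lra).
  assert (HeT : exp T = INR n / y) by (apply exp_ln; lra).
  set (Psi2 := fun s => - / y * exp (- (y * exp s))).
  assert (HP2 : forall s, is_derive Psi2 s (exp s * exp (- (y * exp s)))).
  { intros s. unfold Psi2. auto_derive; auto. field; lra. }
  assert (Hg : forall s, Cmod (E1g y s) = exp (- (y * exp s))).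
  { intros s. unfold E1g. apply Cmod_Rpos, Rlt_le, exp_pos. }
  destruct (conv_inf F Psi2 0 0) as [L1 [HL1 HL1']].
  { intros a c Ha Hac. apply (mean_value_majorant F (E1g y) Psi2 (fun s => exp s * exp (- (y * exp s)))); auto.
    intros s Hs. rewrite Hg. assert (1 <= exp s) by (generalize (exp_ineq1_le s); lra).
    generalize (exp_pos (- (y * exp s))); nra. }
  { intros t Ht. unfold Psi2. assert (0 < / y) by (apply Rinv_0_lt_compat; lra).
    generalize (exp_pos (- (y * exp t))); nra. }
  assert (El : l = (L1 - F 0)%C).
  { eapply isI_unique; [apply HI|]. eapply isI_intro with (F := F) (l0 := F 0) (l1 := L1); auto.
    - intros t _; apply rder_E1g_cont.
    - apply ccont_clim0. eapply rder_ccont, HF. }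
  set (u := fun s => y / INR n * exp s).
  assert (Hu : forall s, 0 <= s <= T -> 0 < u s <= 1).
  { intros s Hs. unfold u. assert (0 < y / INR n) by (apply Rdiv_lt_0_compat; lra).
    split; [apply Rmult_lt_0_compat; auto; apply exp_pos|].
    apply Rle_trans with (y / INR n * exp T); [apply Rmult_le_compat_l; [lra|apply exp_le_mono; lra]|].
    rewrite HeT. right; field; lra. }
  assert (Hup : forall s, 0 < u s).
  { intros s. apply Rmult_lt_0_compat; [apply Rdiv_lt_0_compat; lra|apply exp_pos]. }
  assert (Hdu : forall s, is_derive u s (u s)).
  { intros s. unfold u. auto_derive; auto. ring. }
  set (G := fun s => lnpart n (u s)).
  assert (HG : forall s, is_derive G s ((1 - u s) ^ n)).
  { intros s. evar_last; [apply (is_derive_comp (V:=R_NormedModule) (lnpart n) u); [apply is_derive_lnpart, Hup|apply Hdu]|].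
    unfold scal; simpl. unfold mult; simpl. field. generalize (Hup s); lra. }
  set (Psi := fun s => / y * (INR n / (INR n + 1) * (1 - u s) ^ S n - exp (- (y * exp s)))).
  assert (HPsi : forall s, is_derive Psi s (exp s * (exp (- (y * exp s)) - (1 - u s) ^ n))).
  { intros s. assert (H2 : is_derive (fun s => (1 - u s) ^ S n) s (INR (S n) * (- u s) * (1 - u s) ^ n)).
    { apply (is_derive_pow (fun s => 1 - u s)). evar_last.
      - apply (is_derive_minus (V:=R_NormedModule)); [apply (@is_derive_const R_AbsRing R_NormedModule)|apply Hdu].
      - unfold minus, plus, opp, zero; simpl. ring. }
    unfold Psi. evar_last.
    - apply is_derive_scal. apply (is_derive_minus (V:=R_NormedModule)); [apply is_derive_scal, H2|].
      instantiate (1 := - y * exp s * exp (- (y * exp s))). auto_derive; auto; ring.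
    - rewrite S_INR. unfold minus, plus, opp; simpl. unfold u. field; lra. }
  assert (HM : Cmod ((F T - RtoC (G T)) - (F 0 - RtoC (G 0))) <= Psi T - Psi 0).
  { apply (mean_value_majorant (fun s => F s - RtoC (G s))%C (fun s => E1g y s - RtoC ((1 - u s) ^ n))%C
      Psi (fun s => exp s * (exp (- (y * exp s)) - (1 - u s) ^ n))); auto.
    - intros t Ht. apply rder_minus; [apply HF|apply rder_RtoC, HG].
    - intros t Ht. unfold E1g. rewrite <- RtoC_minus, Cmod_R.
      assert (H := one_minus_pow_le_exp (u t) n ltac:(generalize (Hu t Ht); lra)).
      replace (INR n * u t) with (y * exp t) in H by (unfold u; field; lra).
      rewrite Rabs_pos_eq by lra. assert (1 <= exp t) by (generalize (exp_ineq1_le t); lra). nra. }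
  assert (EuT : u T = 1) by (unfold u; rewrite HeT; field; lra).
  assert (Eu0 : u 0 = y / INR n) by (unfold u; rewrite exp_0; ring).
  assert (EG : G T = 0).
  { unfold G. rewrite EuT. unfold lnpart. rewrite ln_1.
    rewrite (sum_n_m_ext_loc _ (fun _ => 0)).
    - rewrite sum_n_m_const. ring.
    - intros k Hk. rewrite Rminus_diag, pow_i by lia. apply Rmult_0_l. }
  assert (EG0 : G 0 = lnpart n (y / INR n)) by (unfold G; rewrite Eu0; auto).
  assert (EyT : y * exp T = INR n) by (rewrite HeT; field; lra).
  assert (HT' := HL1' T HT). unfold Psi2 in HT'. rewrite EyT in HT'.
  assert (EP : Psi T = - / y * exp (- INR n)).
  { unfold Psi. rewrite EuT, EyT, Rminus_diag, pow_i by lia. ring. }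
  assert (EP0 : Psi 0 = - / y * (exp (- y) - INR n / (INR n + 1) * (1 - y / INR n) ^ S n)).
  { unfold Psi. rewrite Eu0, exp_0, Rmult_1_r. ring. }
  rewrite EP, EP0, EG, EG0 in HM.
  assert (HD := exp_defect_le n y Hn ltac:(lra)).
  rewrite El. 
  replace (L1 - F 0 + RtoC (lnpart n (y / INR n)))%C with
    ((F T - RtoC 0 - (F 0 - RtoC (lnpart n (y / INR n)))) - (F T - L1))%C by ring.
  eapply Rle_trans; [apply Cmod_triangle_minus|].
  rewrite Rinv_mult. assert (0 < / y) by (apply Rinv_0_lt_compat; lra).
  assert (/ y * (exp (- y) - INR n / (INR n + 1) * (1 - y / INR n) ^ S n) <= / y * / (INR n + 1)) by (apply Rmult_le_compat_l; lra).
  lra.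
Qed.

Lemma harmonic_defect n e : 0 <= e <= 1 ->
  0 <= sum_n_m (fun k => / INR k) 1 n - sum_n_m (fun k => (1 - e) ^ k / INR k) 1 n <= INR n * e.
Proof.
  intros He. induction n as [|n IH].
  - rewrite !(sum_n_m_zero (G:=R_AbelianMonoid)) by lia. unfold zero; simpl. lra.
  - rewrite !sum_n_m_S.
    assert (Hn : 0 < INR (S n)) by (apply lt_0_INR; lia).
    assert (Hp : 0 <= 1 - (1 - e) ^ S n <= INR (S n) * e).
    { split.
      - assert ((1 - e) ^ S n <= 1 ^ S n) by (apply pow_incr; lra). rewrite pow1 in *. lra.
      - clear IH Hn. induction (S n) as [|m IH]; [simpl; lra|]. rewrite S_INR. simpl. 
        assert (0 <= (1 - e) ^ m) by (apply pow_le; lra). assert ((1 - e) ^ m <= 1 ^ m) by (apply pow_incr; lra). rewrite pow1 in *. nra. }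
    assert (Hi := Rinv_0_lt_compat _ Hn).
    cbv beta. replace (/ INR (S n)) with (1 / INR (S n)) by (unfold Rdiv; ring).
    assert (0 <= 1 / INR (S n) - (1 - e) ^ S n / INR (S n) <= e).
    { replace (1 / INR (S n) - (1 - e) ^ S n / INR (S n)) with ((1 - (1 - e) ^ S n) * / INR (S n)) by (field; lra).
      split; [apply Rmult_le_pos; lra|].
      apply Rmult_le_reg_r with (INR (S n)); auto. rewrite Rmult_assoc, Rinv_l by lra. lra. }
    assert (E : INR (S n) * e = INR n * e + e) by (rewrite S_INR; ring). cbv beta. lra.
Qed.

(** This is [E_1(y) = - ln y - euler_gamma + O(y)]. As [euler_gamma] is a [Lim_seq], convergence of
    [c n] must be proved too; the same estimate does it, for it places [c n] within
    [y + 1/(y (n + 1))] of a number independent of [n]. *)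
Lemma E1_euler y l : 0 < y <= 1 -> isI (E1g y) l ->
  Cmod (l + RtoC (ln y + euler_gamma)) <= y.
Proof.
  set (c := fun n => sum_n_m (fun k => / INR k) 1 n - ln (INR n)).
  assert (Hmain : forall y l n, 0 < y <= 1 -> isI (E1g y) l -> (1 <= n)%nat ->
    Cmod (l + RtoC (ln y + c n)) <= y + / (y * (INR n + 1))).
  { clear y l. intros y l n Hy HI Hn. assert (Hn1 : 1 <= INR n) by (change 1 with (INR 1); now apply le_INR).
    assert (H := E1_harmonic y n l Hy Hn HI).
    assert (He : 0 <= y / INR n <= 1).
    { split; [apply Rmult_le_pos; [lra|apply Rlt_le, Rinv_0_lt_compat; lra]|].
      apply Rmult_le_reg_r with (INR n); [lra|]. field_simplify; lra. }
    assert (Hd := harmonic_defect n _ He).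
    replace (INR n * (y / INR n)) with y in Hd by (field; lra).
    replace (l + RtoC (ln y + c n))%C with ((l + RtoC (lnpart n (y / INR n))) +
      RtoC (sum_n_m (fun k => / INR k)%R 1 n - sum_n_m (fun k => (1 - y / INR n) ^ k / INR k)%R 1 n))%C.
    2:{ rewrite <- Cplus_assoc. f_equal. rewrite <- RtoC_plus. f_equal. unfold lnpart, c, Rdiv.
        rewrite ln_mult, ln_Rinv by (try apply Rinv_0_lt_compat; lra). ring. }
    eapply Rle_trans; [apply Cmod_triangle|]. rewrite Cmod_R, (Rabs_pos_eq (_ - _)) by lra. lra. }
  assert (HE : forall y, 0 < y -> exists l, isI (E1g y) l).
  { clear y l. intros y Hy. destruct (exp_dominated_isI (E1g y) (/ y)) as [l [Hl _]].
    - intros t _; apply rder_E1g_cont.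
    - intros t Ht. unfold E1g. rewrite Cmod_Rpos by (apply Rlt_le, exp_pos).
      rewrite !exp_Ropp, <- Rinv_mult. apply Rinv_le_contravar; [apply Rmult_lt_0_compat; auto; apply exp_pos|].
      generalize (exp_ineq1_le (y * exp t)); lra.
    - now exists l. }
  assert (HNbig : forall y e, 0 < y -> 0 < e -> exists N, (1 <= N)%nat /\ forall n, (N <= n)%nat -> / (y * (INR n + 1)) <= e).
  { clear y l. intros y e Hy He. destruct (nfloor_ex (/ (y * e))) as [N HN].
    { apply Rlt_le, Rinv_0_lt_compat, Rmult_lt_0_compat; auto. }
    exists (S N). split; [lia|]. intros n Hn. apply le_INR in Hn. rewrite S_INR in Hn.
    rewrite <- (Rinv_inv e). apply Rinv_le_contravar; [apply Rinv_0_lt_compat; auto|].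
    apply Rmult_le_reg_l with (/ y); [apply Rinv_0_lt_compat; auto|].
    rewrite <- Rinv_mult, <- Rmult_assoc, Rinv_l by lra. lra. }
  assert (Hc : exists g : R, is_lim_seq c g).
  { apply ex_lim_seq_cauchy_corr. intros eps.
    (* Each of the two indices contributes [y0 + eps / 6 <= eps / 3], together less than [eps]. *)
    assert (He := cond_pos eps). set (y0 := Rmin 1 (eps / 6)).
    assert (Hy0 : 0 < y0 <= 1) by (unfold y0; split; [apply Rmin_pos; lra|apply Rmin_l]).
    assert (Hy0e : y0 <= eps / 6) by apply Rmin_r.
    destruct (HE y0 (proj1 Hy0)) as [l0 Hl0].
    destruct (HNbig y0 (eps / 6) (proj1 Hy0) ltac:(lra)) as [N [HN1 HN]].
    exists N. intros n m Hn Hm.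
    assert (H1 := Hmain y0 l0 n Hy0 Hl0 ltac:(lia)). assert (H2 := Hmain y0 l0 m Hy0 Hl0 ltac:(lia)).
    specialize (HN n Hn) as Hn'. specialize (HN m Hm) as Hm'.
    assert (H3 := Cmod_triangle_minus (l0 + RtoC (ln y0 + c n)) (l0 + RtoC (ln y0 + c m))).
    replace (l0 + RtoC (ln y0 + c n) - (l0 + RtoC (ln y0 + c m)))%C with (RtoC (c n - c m)) in H3
      by (rewrite !RtoC_plus, RtoC_minus; ring).
    rewrite Cmod_R in H3. lra. }
  destruct Hc as [g Hg].
  assert (Eg : euler_gamma = g).
  { unfold euler_gamma. fold c. rewrite (is_lim_seq_unique _ _ Hg). reflexivity. }
  rewrite Eg. intros Hy HI. apply le_epsilon. intros eps He.
  destruct (HNbig y (eps / 2) (proj1 Hy) ltac:(lra)) as [N [HN1 HN]].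
  apply is_lim_seq_spec in Hg. destruct (Hg (mkposreal (eps / 2) ltac:(lra))) as [N' HN'].
  set (n := Nat.max N N'). specialize (HN n ltac:(lia)). specialize (HN' n ltac:(lia)). simpl in HN'.
  assert (H1 := Hmain y l n Hy HI ltac:(lia)).
  replace (l + RtoC (ln y + g))%C with ((l + RtoC (ln y + c n)) - RtoC (c n - g))%C
    by (rewrite !RtoC_plus, RtoC_minus; ring).
  eapply Rle_trans; [apply Cmod_triangle_minus|]. rewrite Cmod_R. lra.
Qed.

(** * The leading logarithm of [K_0] at the origin *)

Section bessel0.
Variable b : R.
Hypothesis hb : 0 < b.

(** [K_0(b z)] minus the first term of its expansion; it becomes [bessel_rem 1] later. *)
Definition k1 (z : C) : C := (Kint b 0 z + (Clog z + RtoC (ln (b / 2) + euler_gamma)))%C.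

(** For [y = b x / 2] the exponent [b x cosh t] is [y exp t + y exp (-t)]. Dropping the second
    summand turns the integrand into [E1g y] at a cost of at most [y exp (-t)]; [E1_euler] costs
    another [y]. *)
Lemma k1_real x : 0 < x -> b * x / 2 <= 1 -> Cmod (k1 (RtoC x)) <= b * x.
Proof.
  intros Hx Hbx. set (y := b * x / 2).
  assert (Hy : 0 < y <= 1) by (unfold y; split; [|lra]; apply Rmult_lt_0_compat; [apply Rmult_lt_0_compat|]; lra).
  assert (HE : exists l, isI (E1g y) l).
  { destruct (exp_dominated_isI (E1g y) (/ y)) as [l [Hl _]].
    - intros t _; apply rder_E1g_cont.
    - intros t Ht. unfold E1g. rewrite Cmod_Rpos by (apply Rlt_le, exp_pos).
      rewrite !exp_Ropp, <- Rinv_mult. apply Rinv_le_contravar; [apply Rmult_lt_0_compat; [lra|apply exp_pos]|].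
      generalize (exp_ineq1_le (y * exp t)); lra.
    - now exists l. }
  destruct HE as [l Hl].
  assert (H1 := E1_euler y l Hy Hl).
  assert (H2 := isI_minus _ _ _ _ (Kint_isI b hb 0 (RtoC x) Hx) Hl).
  assert (H3 : Cmod (Kint b 0 (RtoC x) - l) <= y).
  { eapply isI_bound; [| |apply H2].
    - intros t _. apply ccont_minus; [apply Kg_cont|apply rder_E1g_cont].
    - intros t _. cbv beta. unfold Kg, E1g. rewrite pow_O, Cmult_1_l.
      rewrite <- !RtoC_mult, <- RtoC_opp, Cexp_RtoC, <- RtoC_minus, Cmod_R.
      set (v := y * exp (- t)).
      assert (Hv : 0 <= v) by (apply Rmult_le_pos; [lra|apply Rlt_le, exp_pos]).
      replace (- (b * x * cosh t)) with (- (y * exp t) + - v) by (unfold v, y, cosh; field).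
      rewrite exp_plus. assert (Hw := exp_ineq1_le (- v)).
      assert (exp (- v) <= 1) by (rewrite <- exp_0; apply exp_le_mono; lra).
      assert (0 < exp (- (y * exp t)) <= 1).
      { split; [apply exp_pos|]. rewrite <- exp_0. apply exp_le_mono.
        assert (0 <= y * exp t) by (apply Rmult_le_pos; [lra|apply Rlt_le, exp_pos]). lra. }
      rewrite Rabs_left1 by nra. unfold v in *. nra. }
  unfold k1. rewrite Clog_RtoC by auto.
  replace (Kint b 0 (RtoC x) + (RtoC (ln x) + RtoC (ln (b / 2) + euler_gamma)))%C with
    ((Kint b 0 (RtoC x) - l) + (l + RtoC (ln y + euler_gamma)))%C.
  - eapply Rle_trans; [apply Cmod_triangle|]. unfold y in *; lra.
  - unfold y. replace (b * x / 2) with (x * (b / 2)) by field. rewrite ln_mult by lra.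
    rewrite !RtoC_plus. ring.
Qed.

Lemma cder_k1 z : 0 < Re z -> cder k1 z (/ z - RtoC b * Kint b 1 z)%C.
Proof.
  intros Hz. eapply cder_eq.
  - apply cder_plus; [apply cder_Kint; auto|]. apply cder_plus; [apply cder_Clog, Hz|apply cder_const].
  - ring.
Qed.

Lemma zk1'_near_0 z : 0 < Re z -> Cmod (z * (/ z - RtoC b * Kint b 1 z)) <= b * Cmod z * (exp (b * Cmod z) + 1).
Proof.
  intros Hz. replace (z * (/ z - RtoC b * Kint b 1 z))%C with (- (RtoC b * z * Kint b 1 z - 1))%C.
  - rewrite Cmod_opp. now apply Kint_1_near_0.
  - field. now apply Cneq0_Re.
Qed.

Lemma Re_Cexp_pos (r th : R) : - (PI / 2) < th < PI / 2 -> 0 < Re (Cexp (r, th)).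
Proof. intros H. simpl. apply Rmult_lt_0_compat; [apply exp_pos|]. apply cos_gt_0; lra. Qed.

(* The bound is moved from the positive axis to the ray through [z] along a circular arc. *)
Lemma k1_near_0 z : 0 < Re z -> b * Cmod z / 2 <= 1 -> Cmod (k1 z) <= b * Cmod z * (2 * exp (b * Cmod z) + 3).
Proof.
  intros Hz Hb. set (r := Cmod z) in *. assert (Hr : 0 < r) by now apply Cmod_pos_Re.
  assert (Ha : - (PI / 2) < Carg z < PI / 2) by (rewrite Carg_atan by auto; generalize (atan_bound (Im z / Re z)); lra).
  assert (HP : PI / 2 <= 2) by (generalize PI_4; lra).
  set (u := RtoC (ln r)). set (v := (0, Carg z) : C).
  assert (Ev : forall t, (u + RtoC t * v)%C = (ln r, t * Carg z)).
  { intros t. apply C_eq; simpl; ring. }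
  assert (Hin : forall t, 0 <= t <= 1 -> - (PI / 2) < t * Carg z < PI / 2) by (intros; nra).
  assert (M := mean_value_seg (fun w => k1 (Cexp w))
    (fun t => Cexp (u + RtoC t * v) * (/ Cexp (u + RtoC t * v) - RtoC b * Kint b 1 (Cexp (u + RtoC t * v))))%C u v
    (b * r * (exp (b * r) + 1))).
  assert (Hm : forall t, Cmod (Cexp (u + RtoC t * v)) = r).
  { intros t. rewrite Ev, Cmod_Cexp. simpl. now apply exp_ln. }
  cbv beta in M.
  replace (u + v)%C with (Clog z) in M by (unfold u, v, Clog; fold r; apply C_eq; cbn [Cplus fst snd Re Im RtoC]; ring).
  rewrite Cexp_Clog in M by now apply Cneq0_Re.
  assert (Eu : Cexp u = RtoC r) by (unfold u; rewrite Cexp_RtoC, exp_ln; auto). rewrite Eu in M.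
  assert (Hk : Cmod (k1 z - k1 (RtoC r)) <= b * r * (exp (b * r) + 1) * Cmod v).
  { apply M.
    - intros t Ht. eapply (cder_comp k1 Cexp); [|apply cder_Cexp].
      apply cder_k1. rewrite Ev. apply Re_Cexp_pos, Hin, Ht.
    - intros t Ht. rewrite <- (Hm t). apply zk1'_near_0. rewrite Ev. apply Re_Cexp_pos, Hin, Ht. }
  assert (Hv : Cmod v <= 2).
  { eapply Rle_trans; [apply Cmod_le_abs|]. simpl. rewrite Rabs_R0.
    assert (Rabs (Carg z) <= 2); [|lra]. apply Rabs_le_between; lra. }
  assert (H1 := k1_real r Hr Hb).
  replace (k1 z) with ((k1 z - k1 (RtoC r)) + k1 (RtoC r))%C by ring.
  eapply Rle_trans; [apply Cmod_triangle|].
  assert (He := exp_pos (b * r)). assert (Hbr : 0 < b * r) by (apply Rmult_lt_0_compat; auto).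
  assert (b * r * (exp (b * r) + 1) * Cmod v <= b * r * (exp (b * r) + 1) * 2).
  { apply Rmult_le_compat_l; auto. apply Rmult_le_pos; lra. }
  lra.
Qed.

End bessel0.

(** * Remainders of the expansions at the origin *)

(** The initial condition at the vertex of the cone: it fixes the constant of integration when a
    bound on a derivative is integrated in [growth_from_0]. *)
Definition vanish0 (phi : C -> C) : Prop :=
  exists A r0, 0 <= A /\ 0 < r0 /\ forall z, 0 < Re z -> Cmod z <= r0 -> Cmod (phi z) <= A * Cmod z.

Lemma vanish0_plus f g : vanish0 f -> vanish0 g -> vanish0 (fun z => f z + g z)%C.
Proof.
  intros [A [r [HA [Hr H]]]] [B [s [HB [Hs H']]]].
  exists (A + B), (Rmin r s). split; [lra|]. split; [now apply Rmin_pos|].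
  intros z Hz Hzr. assert (H1 := Rmin_l r s). assert (H2 := Rmin_r r s).
  eapply Rle_trans; [apply Cmod_triangle|]. specialize (H z Hz ltac:(lra)). specialize (H' z Hz ltac:(lra)). lra.
Qed.

Lemma vanish0_scal c f : vanish0 f -> vanish0 (fun z => c * f z)%C.
Proof.
  intros [A [r [HA [Hr H]]]]. exists (Cmod c * A), r.
  split; [apply Rmult_le_pos; [apply Cmod_ge_0|auto]|]. split; auto.
  intros z Hz Hzr. rewrite Cmod_mult, Rmult_assoc. apply Rmult_le_compat_l; [apply Cmod_ge_0|auto].
Qed.

Lemma vanish0_ext f g : (forall z, 0 < Re z -> f z = g z) -> vanish0 f -> vanish0 g.
Proof. intros E [A [r [HA [Hr H]]]]. exists A, r. repeat split; auto. intros z Hz. rewrite <- E; auto. Qed.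

Lemma vanish0_Csum (f : nat -> C -> C) K : (forall k, (k < K)%nat -> vanish0 (f k)) -> vanish0 (fun z => Csum (fun k => f k z) K).
Proof.
  induction K as [|K IH]; intros H.
  - exists 0, 1. repeat split; try lra. intros z _ _. rewrite Csum_0, Cmod_0. lra.
  - apply vanish0_ext with (fun z => Csum (fun k => f k z) K + f K z)%C; [intros; symmetry; apply Csum_S|].
    apply vanish0_plus; auto.
Qed.

Lemma Re_scal (s : R) (z : C) : Re (RtoC s * z)%C = s * Re z.
Proof. destruct z; simpl; ring. Qed.

(** The segment from [t0 z] to [z] stays in the cone, and by monotonicity of [w] the derivative is
    at most [A w(|z|)] on it. The value at [t0 z] is made smaller than [eps] by [vanish0]. *)
Lemma growth_from_0 kap A (w : R -> R) phi phi' :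
  (forall z, 0 < Re z -> cder phi z (phi' z)) ->
  (forall r s, 0 < r -> r <= s -> w r <= w s) -> 0 <= A ->
  (forall z, 0 < Re z -> kap * Cmod z <= Re z -> Cmod (phi' z) <= A * w (Cmod z)) ->
  vanish0 phi ->
  forall z, 0 < Re z -> kap * Cmod z <= Re z -> Cmod (phi z) <= A * (Cmod z * w (Cmod z)).
Proof.
  intros Hd Hw HA HB [V [r0 [HV [Hr0 Hv]]]] z Hz Hk.
  set (r := Cmod z). assert (Hr : 0 < r) by now apply Cmod_pos_Re.
  apply le_epsilon. intros eps He.
  (* The three bounds keep [t0] below [1], bring [t0 z] into the disc of radius [r0], and make
     [V t0 r] at most [eps]. *)
  set (t0 := Rmin (Rmin (/ 2) (r0 / r)) (eps / ((V + 1) * r))).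
  assert (Hq1 : 0 < r0 / r) by (apply Rdiv_lt_0_compat; auto).
  assert (Hq2 : 0 < eps / ((V + 1) * r)) by (apply Rdiv_lt_0_compat; auto; apply Rmult_lt_0_compat; lra).
  assert (Ht0 : 0 < t0) by (unfold t0; repeat apply Rmin_pos; lra).
  assert (Ht1 : t0 <= / 2) by (eapply Rle_trans; [apply Rmin_l|apply Rmin_l]).
  assert (Ht2 : t0 <= r0 / r) by (eapply Rle_trans; [apply Rmin_l|apply Rmin_r]).
  assert (Ht3 : t0 <= eps / ((V + 1) * r)) by apply Rmin_r.
  assert (M := mean_value_seg phi (fun t => phi' (RtoC t0 * z + RtoC t * (RtoC (1 - t0) * z))%C)
    (RtoC t0 * z)%C (RtoC (1 - t0) * z)%C (A * w r)).
  assert (E : forall t, (RtoC t0 * z + RtoC t * (RtoC (1 - t0) * z))%C = (RtoC (t0 + t * (1 - t0)) * z)%C).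
  { intros t. rewrite RtoC_plus, RtoC_mult. ring. }
  assert (E1 : (RtoC t0 * z + RtoC (1 - t0) * z)%C = z) by (rewrite RtoC_minus; ring).
  rewrite E1 in M.
  assert (Hpt : forall t, 0 <= t <= 1 -> 0 < t0 + t * (1 - t0) <= 1) by (intros; nra).
  assert (H1 : Cmod (phi z - phi (RtoC t0 * z)%C) <= A * w r * Cmod (RtoC (1 - t0) * z)).
  { apply M.
    - intros t Ht. apply Hd. rewrite E, Re_scal. apply Rmult_lt_0_compat; [apply Hpt; auto|auto].
    - intros t Ht. rewrite E. specialize (Hpt t Ht). set (s := t0 + t * (1 - t0)) in *.
      assert (Em : Cmod (RtoC s * z) = s * r) by (rewrite Cmod_mult, Cmod_Rpos by lra; reflexivity).
      eapply Rle_trans; [apply HB|].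
      + rewrite Re_scal. apply Rmult_lt_0_compat; lra.
      + rewrite Em, Re_scal. fold r in Hk. nra.
      + rewrite Em. apply Rmult_le_compat_l; auto. apply Hw; nra. }
  rewrite Cmod_mult, Cmod_Rpos in H1 by lra. fold r in H1.
  assert (Em0 : Cmod (RtoC t0 * z) = t0 * r) by (rewrite Cmod_mult, Cmod_Rpos by lra; reflexivity).
  assert (H2 : Cmod (phi (RtoC t0 * z)%C) <= V * (t0 * r)).
  { rewrite <- Em0. apply Hv; [rewrite Re_scal; apply Rmult_lt_0_compat; lra|]. rewrite Em0.
    apply Rmult_le_reg_r with (/ r); [apply Rinv_0_lt_compat; auto|]. rewrite Rmult_assoc, Rinv_r by lra. lra. }
  assert (H3 : V * (t0 * r) <= eps).
  { apply Rle_trans with (t0 * ((V + 1) * r)).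
    - assert (0 < t0 * r) by (apply Rmult_lt_0_compat; lra). lra.
    - apply Rmult_le_reg_r with (/ ((V + 1) * r)); [apply Rinv_0_lt_compat; apply Rmult_lt_0_compat; lra|].
      rewrite Rmult_assoc, Rinv_r by (apply Rgt_not_eq, Rmult_lt_0_compat; lra). lra. }
  assert (Hw0 : 0 <= A * w r).
  { eapply Rle_trans; [apply Cmod_ge_0|]. apply (HB z Hz Hk). }
  replace (phi z) with ((phi z - phi (RtoC t0 * z)%C) + phi (RtoC t0 * z)%C)%C by ring.
  eapply Rle_trans; [apply Cmod_triangle|].
  assert (A * w r * ((1 - t0) * r) <= A * w r * r) by (apply Rmult_le_compat_l; nra). lra.
Qed.

Definition harm (r : nat) : R := sum_n_m (fun k => / INR k) 1 r.

Lemma harm_0 : harm 0 = 0.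
Proof. unfold harm. rewrite (sum_n_m_zero (G:=R_AbelianMonoid)) by lia. reflexivity. Qed.

Lemma harm_S r : harm (S r) = harm r + / INR (S r).
Proof. apply (sum_n_m_S (fun k => / INR k)). Qed.

Definition wlam (N : nat) (r : R) : R := r ^ N * lam r.

Lemma wlam_pos N r : 0 < r -> 0 <= wlam N r.
Proof.
  intros Hr. apply Rmult_le_pos; [apply pow_le; lra|]. generalize (lam_ge_2 r Hr); lra.
Qed.

(** One factor [r] cancels the [1/r] in [lam] and leaves a sum of two nonnegative powers. *)
Lemma wlam_mono N r s : (1 <= N)%nat -> 0 < r -> r <= s -> wlam N r <= wlam N s.
Proof.
  intros HN Hr Hrs. destruct N as [|N]; [lia|]. unfold wlam, lam.
  replace (r ^ S N * (r + / r)) with (r ^ S (S N) + r ^ N) by (simpl; field; lra).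
  replace (s ^ S N * (s + / s)) with (s ^ S (S N) + s ^ N) by (simpl; field; lra).
  apply Rplus_le_compat; apply pow_incr; lra.
Qed.

Lemma wlam_S N r : 0 < r -> r * wlam N r = wlam (S N) r.
Proof. intros Hr. unfold wlam. simpl. ring. Qed.

Lemma wlam_div N r : 0 < r -> wlam (S N) r / r = wlam N r.
Proof. intros Hr. unfold wlam. simpl. field. lra. Qed.

Section besselN.
Variable b : R.
Hypothesis hb : 0 < b.

Definition ell : R := ln (b / 2) + euler_gamma.
Definition kcoef (r : nat) : R := - ((b ^ 2 / 4) ^ r / INR (fact r) ^ 2).
(* [bessel_term r] is the term of degree [2 r] in the expansion of [K_0(b z)] at the origin, and
   [z_bessel_term r] is [z] times its derivative; [bessel_rem N] and [z_bessel_rem N] are the remainders after [N] terms. *)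
Definition bessel_term (r : nat) (z : C) : C :=
  (RtoC (kcoef r) * Cpow z (2 * r) * (Clog z + RtoC (ell - harm r)))%C.
Definition z_bessel_term (r : nat) (z : C) : C :=
  (RtoC (kcoef r) * Cpow z (2 * r) * (RtoC (2 * INR r) * (Clog z + RtoC (ell - harm r)) + 1))%C.
Definition bessel_rem (N : nat) (z : C) : C := (Kint b 0 z - Csum (fun r => bessel_term r z) N)%C.
Definition z_bessel_rem (N : nat) (z : C) : C := (- (RtoC b * z * Kint b 1 z) - Csum (fun r => z_bessel_term r z) N)%C.

Lemma cder_Cpow (n : nat) (z : C) : z <> RtoC 0 -> cder (fun w => Cpow w n) z (RtoC (INR n) * Cpow z n / z)%C.
Proof.
  intros Hz. induction n as [|n IH].
  - eapply cder_eq; [exact (cder_const 1 z)|]. simpl. unfold Cdiv. ring.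
  - eapply cder_eq; [exact (cder_mult _ _ z _ _ (cder_id z) IH)|].
    rewrite S_INR, RtoC_plus. change (Cpow z (S n)) with (z * Cpow z n)%C. field. exact Hz.
Qed.

Lemma cder_bessel_term r z : 0 < Re z -> cder (bessel_term r) z (z_bessel_term r z / z)%C.
Proof.
  intros Hz. assert (Hz0 := Cneq0_Re z Hz). unfold bessel_term, z_bessel_term. eapply cder_eq.
  - apply cder_mult; [apply cder_scal, cder_Cpow, Hz0|]. apply cder_plus; [apply cder_Clog, Hz|apply cder_const].
  - cbv beta. rewrite mult_INR. change (INR 2) with 2%R. field. exact Hz0.
Qed.

Lemma kcoef_S r : kcoef (S r) * (4 * INR (S r) ^ 2) = b ^ 2 * kcoef r.
Proof.
  unfold kcoef. rewrite fact_simpl, mult_INR. assert (H := not_0_INR (S r) (Nat.neq_succ_0 r)).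
  assert (H' := INR_fact_neq_0 r). simpl pow. field. split; auto.
Qed.

Lemma cder_z_bessel_term_0 z : 0 < Re z -> cder (z_bessel_term 0) z 0.
Proof.
  intros Hz. apply cder_ext with (fun _ => RtoC (kcoef 0)); [|apply cder_const].
  intros w. unfold z_bessel_term. simpl. rewrite Rmult_0_r. ring.
Qed.

(** Frobenius' method. The square of [z d/dz] annihilates the term of index [0] and maps the term of
    index [r + 1] to [(b z)^2] times that of index [r]; the increment [1/(r + 1)] of [harm]
    compensates the derivative of the logarithm. *)
Lemma cder_z_bessel_term_S r z : 0 < Re z -> cder (z_bessel_term (S r)) z (RtoC (b ^ 2) * z * bessel_term r z)%C.
Proof.
  intros Hz. assert (Hz0 := Cneq0_Re z Hz). eapply cder_eq.
  - unfold z_bessel_term. apply cder_mult; [apply cder_scal, cder_Cpow, Hz0|].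
    apply cder_plus; [|apply cder_const]. apply cder_scal.
    apply cder_plus; [apply cder_Clog, Hz|apply cder_const].
  - cbv beta. rewrite mult_INR. change (INR 2) with 2%R. unfold bessel_term.
    replace (2 * S r)%nat with (S (S (2 * r))) by lia.
    change (Cpow z (S (S (2 * r)))) with (z * (z * Cpow z (2 * r)))%C.
    rewrite harm_S. assert (Hn := not_0_INR (S r) (Nat.neq_succ_0 r)).
    assert (E := kcoef_S r).
    transitivity (RtoC (kcoef (S r) * (4 * INR (S r) ^ 2)) * z * (Cpow z (2 * r)) * (Clog z + RtoC (ell - harm r)))%C.
    + rewrite !RtoC_mult, !RtoC_minus, !RtoC_plus, !RtoC_pow, RtoC_inv by auto. 
      field. split; [exact Hz0|]. intros E0. apply Hn. now apply RtoC_inj in E0.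
    + rewrite E, RtoC_mult. ring.
Qed.

Lemma cder_bessel_rem N z : 0 < Re z -> cder (bessel_rem N) z (z_bessel_rem N z / z)%C.
Proof.
  intros Hz. assert (Hz0 := Cneq0_Re z Hz). eapply cder_eq.
  - apply cder_minus; [apply cder_Kint; auto|]. apply (cder_Csum bessel_term (fun r z => z_bessel_term r z / z)%C).
    intros; now apply cder_bessel_term.
  - unfold z_bessel_rem. rewrite (Csum_ext _ (fun r => (/ z) * z_bessel_term r z)%C) by (intros; unfold Cdiv; ring).
    rewrite Csum_scal. field. exact Hz0.
Qed.

Lemma cder_z_bessel_rem_S N z : 0 < Re z -> cder (z_bessel_rem (S N)) z (RtoC (b ^ 2) * z * bessel_rem N z)%C.
Proof.
  intros Hz. assert (Hz0 := Cneq0_Re z Hz). eapply cder_eq.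
  - apply cder_minus.
    + apply cder_opp, cder_mult; [apply cder_scal, cder_id|apply cder_Kint; auto].
    + apply (cder_Csum z_bessel_term (fun r z => match r with O => RtoC 0 | S r => RtoC (b ^ 2) * z * bessel_term r z end)%C).
      intros [|k] _; [now apply cder_z_bessel_term_0|now apply cder_z_bessel_term_S].
  - rewrite Csum_Sl, Csum_scal. cbv beta. unfold bessel_rem.
    assert (E := Kint_ODE b hb z Hz).
    transitivity (RtoC b * (RtoC b * z * Kint b 2 z - Kint b 1 z) - RtoC (b ^ 2) * z * Csum (fun r => bessel_term r z) N)%C; [ring|].
    rewrite E. rewrite RtoC_pow. ring.
Qed.

(** Of the at least two factors [z], one absorbs the logarithm and the other provides the linear
    rate. *)
Lemma vanish0_log_pow r (c d e : C) : vanish0 (fun z => Cpow z (2 * S r) * (c * (Clog z + d) + e))%C.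
Proof.
  exists (Cmod c * (6 + Cmod d) + Cmod e), 1.
  assert (Hc := Cmod_ge_0 c). assert (Hd := Cmod_ge_0 d). assert (He := Cmod_ge_0 e).
  split; [nra|]. split; [lra|].
  intros z Hz Hr. assert (H0 := Cmod_pos_Re z Hz).
  replace (2 * S r)%nat with (S (S (2 * r))) by lia.
  rewrite Cmod_mult, Cmod_pow. change (Cmod z ^ S (S (2 * r))) with (Cmod z * (Cmod z * Cmod z ^ (2 * r))).
  assert (Hp : 0 <= Cmod z ^ (2 * r) <= 1).
  { split; [apply pow_le; lra|]. rewrite <- (pow1 (2 * r)). apply pow_incr; lra. }
  assert (HL : Cmod z * Cmod (c * (Clog z + d) + e) <= Cmod c * (6 + Cmod d) + Cmod e).
  { assert (H1 := Cmod_triangle (c * (Clog z + d)) e). rewrite Cmod_mult in H1.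
    assert (H2 := Cmod_triangle (Clog z) d). assert (H3 := Cmod_Clog_le z Hz).
    assert (H4 : Cmod z * Cmod (Clog z) <= 6).
    { apply Rle_trans with (Cmod z * (3 * lam (Cmod z))); [apply Rmult_le_compat_l; lra|].
      unfold lam. replace (Cmod z * (3 * (Cmod z + / Cmod z))) with (3 * Cmod z ^ 2 + 3) by (field; lra). nra. }
    assert (H5 : Cmod z * Cmod (Clog z + d) <= 6 + Cmod d).
    { apply Rle_trans with (Cmod z * (Cmod (Clog z) + Cmod d)); [apply Rmult_le_compat_l; lra|]. nra. }
    apply Rle_trans with (Cmod z * (Cmod c * Cmod (Clog z + d) + Cmod e)); [apply Rmult_le_compat_l; lra|].
    assert (Cmod c * (Cmod z * Cmod (Clog z + d)) <= Cmod c * (6 + Cmod d)) by (apply Rmult_le_compat_l; lra).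
    nra. }
  apply Rle_trans with (Cmod z * 1 * (Cmod z * Cmod (c * (Clog z + d) + e))).
  - replace (Cmod z * (Cmod z * Cmod z ^ (2 * r)) * Cmod (c * (Clog z + d) + e)) with
      (Cmod z * Cmod z ^ (2 * r) * (Cmod z * Cmod (c * (Clog z + d) + e))) by ring.
    apply Rmult_le_compat_r; [apply Rmult_le_pos; [lra|apply Cmod_ge_0]|]. apply Rmult_le_compat_l; lra.
  - rewrite Rmult_1_r. apply Rle_trans with (Cmod z * (Cmod c * (6 + Cmod d) + Cmod e)); [apply Rmult_le_compat_l; [apply Rlt_le, H0|exact HL]|right; ring].
Qed.

Lemma vanish0_small (f : C -> C) (B : R) : 0 <= B ->
  (forall z, 0 < Re z -> b * Cmod z / 2 <= 1 -> Cmod (f z) <= b * Cmod z * B) -> vanish0 f.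
Proof.
  intros HB H. exists (b * B), (2 / b). split; [nra|]. split; [apply Rdiv_lt_0_compat; lra|].
  intros z Hz Hr. replace (b * B * Cmod z) with (b * Cmod z * B) by ring. apply H; auto.
  apply Rmult_le_compat_l with (r := b) in Hr; [|lra]. replace (b * (2 / b)) with 2 in Hr by (field; lra). lra.
Qed.

(** Here the true behaviour of [K_0] at the origin enters, through [k1_near_0]; all subtracted terms
    of positive index vanish by their powers of [z]. *)
Lemma vanish0_bessel_rem_S N : vanish0 (bessel_rem (S N)).
Proof.
  apply vanish0_ext with (fun z => k1 b z + (- (1)) * Csum (fun r => bessel_term (S r) z) N)%C.
  { intros z _. unfold bessel_rem, k1. rewrite Csum_Sl. unfold bessel_term at 2.
    replace (RtoC (kcoef 0)) with (- (1))%C by (unfold kcoef; simpl; rewrite <- RtoC_opp; f_equal; field).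
    rewrite harm_0, Rminus_0_r. simpl Cpow. unfold ell. ring. }
  apply vanish0_plus.
  - apply (vanish0_small _ (2 * exp 2 + 3)).
    + generalize (exp_pos 2); lra.
    + intros z Hz Hb. eapply Rle_trans; [apply k1_near_0; auto|].
      assert (Hm := Cmod_pos_Re z Hz).
      apply Rmult_le_compat_l; [nra|]. assert (exp (b * Cmod z) <= exp 2) by (apply exp_le_mono; lra). lra.
  - apply vanish0_scal, (vanish0_Csum (fun r => bessel_term (S r))). intros k _.
    apply vanish0_ext with (fun z => RtoC (kcoef (S k)) * (Cpow z (2 * S k) * (1 * (Clog z + RtoC (ell - harm (S k))) + 0)))%C.
    { intros z _. unfold bessel_term. ring. }
    apply vanish0_scal, vanish0_log_pow.
Qed.

Lemma vanish0_z_bessel_rem_S N : vanish0 (z_bessel_rem (S N)).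
Proof.
  apply vanish0_ext with (fun z => (- (1)) * (RtoC b * z * Kint b 1 z - 1) + (- (1)) * Csum (fun r => z_bessel_term (S r) z) N)%C.
  { intros z _. unfold z_bessel_rem. rewrite Csum_Sl. unfold z_bessel_term at 2.
    replace (RtoC (kcoef 0)) with (- (1))%C by (unfold kcoef; simpl; rewrite <- RtoC_opp; f_equal; field).
    simpl Cpow. change (INR 0) with 0%R. rewrite Rmult_0_r. ring. }
  apply vanish0_plus.
  - apply vanish0_scal, (vanish0_small _ (exp 2 + 1)).
    + generalize (exp_pos 2); lra.
    + intros z Hz Hb. eapply Rle_trans; [apply Kint_1_near_0; auto|].
      assert (Hm := Cmod_pos_Re z Hz).
      apply Rmult_le_compat_l; [nra|]. assert (exp (b * Cmod z) <= exp 2) by (apply exp_le_mono; lra). lra.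
  - apply vanish0_scal, (vanish0_Csum (fun r => z_bessel_term (S r))). intros k _.
    apply vanish0_ext with (fun z => RtoC (kcoef (S k)) * (Cpow z (2 * S k) * (RtoC (2 * INR (S k)) * (Clog z + RtoC (ell - harm (S k))) + 1)))%C.
    { intros z _. unfold z_bessel_term. ring. }
    apply vanish0_scal, vanish0_log_pow.
Qed.

Variable kp : R.
Hypothesis hkp : 0 < kp.

(** On the cone [Re z >= kp |z|], so the powers of [1 / Re z] in [Kint_bound] become powers of
    [1 / |z|]; each derivative raises [j], hence the exponent, by one. *)
Lemma Sm_Kint m j L : (1 <= L)%nat -> Sm kp m (fun r => / r ^ (j + L)) (Kint b j).
Proof.
  intros HL. revert j; induction m as [|m IH]; intros j.
  all: split; [exists (2 * INR (fact (j + L)) / (b * kp) ^ (j + L)); split|].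
  1, 4: apply Rlt_le, Rdiv_lt_0_compat; [generalize (INR_fact_lt_0 (j + L)); lra|apply pow_lt, Rmult_lt_0_compat; auto].
  1, 3: intros z Hz Hk; assert (Hm := Cmod_pos_Re z Hz);
    (eapply Rle_trans; [apply Kint_bound; eauto|]);
    assert (Hp1 : 0 < (b * kp) ^ (j + L)) by (apply pow_lt, Rmult_lt_0_compat; auto);
    assert (Hp2 : 0 < Cmod z ^ (j + L)) by (apply pow_lt; auto);
    replace (2 * INR (fact (j + L)) / (b * kp) ^ (j + L) * / Cmod z ^ (j + L)) with
      (2 * INR (fact (j + L)) * / (b * kp * Cmod z) ^ (j + L)) by (rewrite (Rpow_mult_distr (b * kp)); field; lra);
    apply Rmult_le_compat_l; [generalize (INR_fact_lt_0 (j + L)); lra|];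
    apply Rinv_le_contravar; [apply pow_lt; repeat apply Rmult_lt_0_compat; auto|];
    apply pow_incr; split; [apply Rlt_le; repeat apply Rmult_lt_0_compat; auto|];
    rewrite Rmult_assoc; apply Rmult_le_compat_l; [lra|exact Hk].
  - exact I.
  - exists (fun z => - (RtoC b * Kint b (S j) z))%C. split; [intros; now apply cder_Kint|].
    apply Sm_opp, Sm_scal. eapply Sm_weight_eq; [|apply IH].
    intros r Hr. cbv beta. simpl. field. split; [|lra]. apply pow_nonzero; lra.
Qed.

(* By the Bessel equation the remainders [k_N] satisfy [z (z k_N')' = (b z)^2 k_(N-1)],
   so two integrations from the vertex of the cone raise the order of vanishing by two. *)
Lemma bessel_rem_bound N : exists A, 0 <= A /\ forall z, 0 < Re z -> kp * Cmod z <= Re z ->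
  Cmod (bessel_rem N z) <= A * wlam (2 * N) (Cmod z).
Proof.
  induction N as [|N [A [HA IH]]].
  - destruct (Sm_bound _ _ _ _ (Sm_Kint 0 0 1 (Nat.le_refl 1))) as [A [HA H]].
    exists A; split; auto. intros z Hz Hk. unfold bessel_rem. rewrite Csum_0.
    replace (Kint b 0 z - 0)%C with (Kint b 0 z) by ring.
    eapply Rle_trans; [apply H; auto|]. apply Rmult_le_compat_l; auto.
    assert (Hm := Cmod_pos_Re z Hz). unfold wlam, lam. simpl. rewrite Rmult_1_r. lra.
  - exists (b ^ 2 * A). assert (Hb2 : 0 <= b ^ 2) by apply pow2_ge_0. split; [now apply Rmult_le_pos|].
    assert (Hz1 : forall z, 0 < Re z -> kp * Cmod z <= Re z -> Cmod (z_bessel_rem (S N) z) <= b ^ 2 * A * (Cmod z * wlam (S (2 * N)) (Cmod z))).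
    { apply growth_from_0 with (phi' := fun z => (RtoC (b ^ 2) * z * bessel_rem N z)%C).
      - intros; now apply cder_z_bessel_rem_S.
      - intros; apply wlam_mono; auto; lia.
      - now apply Rmult_le_pos.
      - intros z Hz Hk. assert (Hm := Cmod_pos_Re z Hz). rewrite !Cmod_mult, Cmod_Rpos by auto.
        rewrite <- wlam_S by auto.
        replace (b ^ 2 * A * (Cmod z * wlam (2 * N) (Cmod z))) with (b ^ 2 * Cmod z * (A * wlam (2 * N) (Cmod z))) by ring.
        apply Rmult_le_compat_l; auto. apply Rmult_le_pos; lra.
      - apply vanish0_z_bessel_rem_S. }
    assert (Hz2 : forall z, 0 < Re z -> kp * Cmod z <= Re z -> Cmod (bessel_rem (S N) z) <= b ^ 2 * A * (Cmod z * wlam (S (2 * N)) (Cmod z))).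
    { apply growth_from_0 with (phi' := fun z => (z_bessel_rem (S N) z / z)%C).
      - intros; now apply cder_bessel_rem.
      - intros; apply wlam_mono; auto; lia.
      - now apply Rmult_le_pos.
      - intros z Hz Hk. assert (Hm := Cmod_pos_Re z Hz). rewrite Cmod_div by (now apply Cneq0_Re).
        apply Rmult_le_reg_r with (Cmod z); auto. unfold Rdiv. rewrite Rmult_assoc, Rinv_l, Rmult_1_r by lra.
        eapply Rle_trans; [apply Hz1; auto|]. right; ring.
      - apply vanish0_bessel_rem_S. }
    intros z Hz Hk. eapply Rle_trans; [apply Hz2; auto|]. rewrite wlam_S by (now apply Cmod_pos_Re).
    replace (S (S (2 * N))) with (2 * S N)%nat by lia. lra.
Qed.

Lemma z_bessel_rem_bound N : exists A, 0 <= A /\ forall z, 0 < Re z -> kp * Cmod z <= Re z ->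
  Cmod (z_bessel_rem (S N) z) <= A * wlam (2 * S N) (Cmod z).
Proof.
  destruct (bessel_rem_bound N) as [A [HA IH]].
  exists (b ^ 2 * A). assert (Hb2 : 0 <= b ^ 2) by apply pow2_ge_0. split; [now apply Rmult_le_pos|].
  intros z Hz Hk. assert (Hm := Cmod_pos_Re z Hz).
  replace (2 * S N)%nat with (S (S (2 * N))) by lia. rewrite <- wlam_S by auto. revert z Hz Hk Hm.
  assert (Hz1 : forall z, 0 < Re z -> kp * Cmod z <= Re z -> Cmod (z_bessel_rem (S N) z) <= b ^ 2 * A * (Cmod z * wlam (S (2 * N)) (Cmod z))); [|auto].
  apply growth_from_0 with (phi' := fun z => (RtoC (b ^ 2) * z * bessel_rem N z)%C).
  - intros; now apply cder_z_bessel_rem_S.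
  - intros; apply wlam_mono; auto; lia.
  - now apply Rmult_le_pos.
  - intros z Hz Hk. assert (Hm := Cmod_pos_Re z Hz). rewrite !Cmod_mult, Cmod_Rpos by auto.
    rewrite <- wlam_S by auto.
    replace (b ^ 2 * A * (Cmod z * wlam (2 * N) (Cmod z))) with (b ^ 2 * Cmod z * (A * wlam (2 * N) (Cmod z))) by ring.
    apply Rmult_le_compat_l; auto. apply Rmult_le_pos; lra.
  - apply vanish0_z_bessel_rem_S.
Qed.

(** The two families are closed under differentiation: [bessel_rem] leads to [z_bessel_rem / z], and
    [z_bessel_rem (S N)] to [b^2 z bessel_rem N]. Treated together, they yield all derivative bounds
    by induction on [m] from the bounds of order [0]. *)
Lemma Sm_bessel_rem_z_bessel_rem m N : Sm kp m (wlam (2 * N)) (bessel_rem N) /\ Sm kp m (wlam (2 * S N)) (z_bessel_rem (S N)).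
Proof.
  revert N; induction m as [|m IH]; intros N.
  - split; (split; [|exact I]); [apply bessel_rem_bound|apply z_bessel_rem_bound].
  - split.
    (* For [N = 0] nothing has been subtracted, and the bound for [K_0] itself with [L = 1] applies,
       as [1/r <= lam r]. *)
    + destruct N as [|N].
      * apply Sm_ext with (Kint b 0).
        { intros z _. unfold bessel_rem. rewrite Csum_0. ring. }
        apply Sm_weight with (w := fun r => / r ^ (0 + 1)) (B := 1); [lra| |now apply Sm_Kint].
        intros r Hr. unfold wlam, lam. simpl. rewrite Rmult_1_r. lra.
      * split; [apply bessel_rem_bound|]. exists (fun z => z_bessel_rem (S N) z / z)%C. split; [intros; now apply cder_bessel_rem|].
        apply Sm_mult; [intros; now apply wlam_pos|apply IH|apply Sm_inv_id].
    + split; [apply z_bessel_rem_bound|]. exists (fun z => RtoC (b ^ 2) * z * bessel_rem N z)%C.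
      split; [intros; now apply cder_z_bessel_rem_S|].
      apply Sm_weight_eq with (fun r => r * wlam (2 * N) r).
      { intros r Hr. replace (2 * S N)%nat with (S (S (2 * N))) by lia. rewrite wlam_div, wlam_S; auto. }
      apply Sm_mult; [intros; lra| |apply IH].
      apply Sm_scal. apply Sm_ext with (fun z => Cpow z 1); [intros; simpl; ring|].
      apply Sm_weight_eq with (fun r => r ^ 1); [intros; ring|]. apply Sm_Cpow.
Qed.

Lemma Sm_bessel_term m r : Sm kp m (wlam (2 * r)) (bessel_term r).
Proof.
  unfold bessel_term, wlam. apply Sm_mult; [intros; apply pow_le; lra|apply Sm_scal, Sm_Cpow|].
  apply Sm_plus; [apply Sm_Clog|].
  apply Sm_weight with (w := fun _ => 1) (B := 1); [lra| |apply Sm_const].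
  intros s Hs. generalize (lam_ge_2 s Hs); lra.
Qed.

End besselN.

(** * The factor [(1 + z^2)^(-mu)] and its binomial expansion *)

Definition binom_factor (mu : R) (z : C) : C := Cpower (1 + z * z) (RtoC (- mu)).

(** The imaginary part is [2 Re z Im z]. It vanishes only for real [z], and then [1 + z^2 > 0]: the
    principal power is never evaluated on its cut. *)
Lemma slit_1_plus_sq (z : C) : 0 < Re z -> (1 + z * z)%C <> RtoC 0 /\ (0 < Re (1 + z * z)%C \/ Im (1 + z * z)%C <> 0).
Proof.
  intros Hz. assert (H : 0 < Re (1 + z * z)%C \/ Im (1 + z * z)%C <> 0).
  { destruct (Req_dec (Im z) 0) as [E|E].
    - left. rewrite Re_plus, Re_mult, E. simpl. nra.
    - right. rewrite Im_plus, Im_mult. simpl. nra. }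
  split; auto. intros E. rewrite E in H. simpl in H. lra.
Qed.

Lemma binom_factor_neq_0 (z : C) : 0 < Re z -> (1 + z * z)%C <> RtoC 0.
Proof. apply slit_1_plus_sq. Qed.

Lemma binom_factor_S mu z : 0 < Re z -> (binom_factor mu z * / (1 + z * z))%C = binom_factor (mu + 1) z.
Proof.
  intros Hz. unfold binom_factor. replace (- (mu + 1)) with (- mu + Ropp 1) by ring.
  rewrite RtoC_plus, Cpower_plus. f_equal. rewrite RtoC_opp, Cpower_opp. f_equal.
  unfold Cpower. rewrite Cmult_1_l. symmetry. apply Cexp_Clog. now apply binom_factor_neq_0.
Qed.

Lemma cder_sq z : cder (fun w => 1 + w * w)%C z (2 * z)%C.
Proof.
  eapply cder_eq; [apply cder_plus; [apply cder_const|apply cder_mult; apply cder_id]|]. cbv beta; ring.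
Qed.

Lemma cder_binom_factor mu z : 0 < Re z -> cder (binom_factor mu) z (RtoC (- 2 * mu) * z * binom_factor (mu + 1) z)%C.
Proof.
  intros Hz. destruct (slit_1_plus_sq z Hz) as [H0 Hs]. eapply cder_eq.
  - unfold binom_factor, Cpower. apply (cder_comp Cexp (fun w => RtoC (- mu) * Clog (1 + w * w))%C); [apply cder_Cexp|].
    apply cder_scal. apply (cder_comp Clog (fun w => 1 + w * w)%C); [apply cder_Clog_slit; auto|apply cder_sq].
  - rewrite <- binom_factor_S by auto. unfold binom_factor, Cpower. rewrite RtoC_mult, !RtoC_opp. ring.
Qed.

Section binom.
Variable kp : R.
Hypothesis hkp : 0 < kp.

(** Both factors [z - i] and [z + i] have modulus at least [Re z]. The uniform constant combines
    this for [|z| > 1/2] with [|1 + z^2| >= 3/4] for [|z| <= 1/2]. *)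
Lemma Cmod_1_plus_sq_lower (z : C) : 0 < Re z -> kp * Cmod z <= Re z ->
  (kp * Cmod z) ^ 2 <= Cmod (1 + z * z) /\ Rmin (3 / 4) (kp ^ 2 / 4) <= Cmod (1 + z * z).
Proof.
  intros Hz Hk. assert (Hm := Cmod_pos_Re z Hz).
  assert (H1 : (kp * Cmod z) ^ 2 <= Cmod (1 + z * z)).
  { replace (1 + z * z)%C with ((z - Ci) * (z + Ci))%C by (apply C_eq; destruct z; simpl; ring).
    rewrite Cmod_mult.
    assert (Ha := re_le_Cmod (z - Ci)). assert (Hb := re_le_Cmod (z + Ci)).
    rewrite Re_minus in Ha. rewrite Re_plus in Hb. simpl in Ha, Hb.
    rewrite Rminus_0_r in Ha. rewrite Rplus_0_r in Hb. rewrite Rabs_pos_eq in Ha, Hb by lra.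
    assert (0 < kp * Cmod z) by now apply Rmult_lt_0_compat.
    simpl. rewrite Rmult_1_r. apply Rmult_le_compat; lra. }
  split; auto.
  destruct (Rle_lt_dec (Cmod z) (1 / 2)) as [H|H].
  - eapply Rle_trans; [apply Rmin_l|].
    assert (H2 := Cmod_triangle_inv 1 (- (z * z))). rewrite Cmod_1, Cmod_opp, Cmod_mult in H2.
    replace (1 - - (z * z))%C with (1 + z * z)%C in H2 by ring. nra.
  - eapply Rle_trans; [apply Rmin_r|]. eapply Rle_trans; [|apply H1].
    rewrite Rpow_mult_distr. assert (0 < kp ^ 2) by (apply pow_lt; auto). 
    assert (1 / 4 <= Cmod z ^ 2) by (simpl; nra). nra.
Qed.

Lemma Sm_id m : Sm kp m (fun r => r) (fun z => z).
Proof.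
  apply Sm_ext with (fun z => Cpow z 1); [intros; simpl; ring|].
  apply Sm_weight_eq with (fun r => r ^ 1); [intros; ring|]. apply Sm_Cpow.
Qed.

Lemma Sm_q m : Sm kp m (fun r => / r ^ 2) (fun z => / (1 + z * z))%C.
Proof.
  induction m as [|m IH].
  all: split; [exists (/ kp ^ 2); split; [apply Rlt_le, Rinv_0_lt_compat, pow_lt; auto|];
    intros z Hz Hk; assert (Hm := Cmod_pos_Re z Hz); rewrite Cmod_inv by (now apply binom_factor_neq_0);
    rewrite <- Rinv_mult, <- Rpow_mult_distr; apply Rinv_le_contravar;
      [apply pow_lt, Rmult_lt_0_compat; auto|now apply Cmod_1_plus_sq_lower]|].
  - exact I.
  - exists (fun z => - (2) * (z * (/ (1 + z * z) * / (1 + z * z))))%C. split.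
    + intros z Hz. eapply cder_eq.
      * apply (cder_comp Cinv (fun w => 1 + w * w)%C); [apply cder_inv; now apply binom_factor_neq_0|apply cder_sq].
      * field. now apply binom_factor_neq_0.
    + apply Sm_scal. apply Sm_weight_eq with (fun r => r * (/ r ^ 2 * / r ^ 2) ).
      { intros r Hr. field. lra. }
      apply Sm_weight_eq with (fun r => r * ((fun r => / r ^ 2 * / r ^ 2) r) ); [auto|].
      apply Sm_mult; [intros; lra|apply Sm_id|].
      apply Sm_mult; auto. intros r Hr. apply Rlt_le, Rinv_0_lt_compat, pow_lt; auto.
Qed.

Lemma binom_factor_bound mu : 0 < mu -> exists A, 0 <= A /\ forall z, 0 < Re z -> kp * Cmod z <= Re z -> Cmod (binom_factor mu z) <= A.
Proof.
  intros Hmu. set (c := Rmin (3 / 4) (kp ^ 2 / 4)).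
  assert (Hc : 0 < c). { unfold c. apply Rmin_pos; [lra|]. assert (0 < kp ^ 2) by (apply pow_lt; auto). lra. }
  exists (Rpower c (- mu)). split; [apply Rlt_le, Rpower_pos|].
  intros z Hz Hk. destruct (Cmod_1_plus_sq_lower z Hz Hk) as [_ H]. fold c in H.
  unfold binom_factor. rewrite Cmod_Cpower_R. rewrite !Rpower_Ropp.
  apply Rinv_le_contravar; [apply Rpower_pos|]. apply Rle_Rpower_l; lra.
Qed.

(** The derivative is written as [z / (1 + z^2)], of weight [1/r], times the same function, so that
    the induction on [m] proceeds for a fixed [mu]. *)
Lemma Sm_binom_factor m mu : 0 < mu -> Sm kp m (fun _ => 1) (binom_factor mu).
Proof.
  intros Hmu. induction m as [|m IH].
  all: split; [destruct (binom_factor_bound mu Hmu) as [A [HA H]]; exists A; split; auto; intros; rewrite Rmult_1_r; auto|].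
  - exact I.
  - exists (fun z => RtoC (- 2 * mu) * (z * (/ (1 + z * z) * binom_factor mu z)))%C. split.
    + intros z Hz. eapply cder_eq; [apply cder_binom_factor, Hz|]. rewrite <- binom_factor_S by auto. ring.
    + apply Sm_scal. apply Sm_weight_eq with (fun r => r * ((fun r => / r ^ 2 * 1) r)).
      { intros r Hr. field. lra. }
      apply Sm_mult; [intros; lra|apply Sm_id|].
      apply Sm_mult; [|apply Sm_q|auto]. intros r Hr. apply Rlt_le, Rinv_0_lt_compat, pow_lt; auto.
Qed.

(** The binomial coefficient of [- mu] over [i]. *)
Definition binom_coef (mu : R) (i : nat) : R := (-1) ^ i * pochhammer mu i / INR (fact i).

Lemma pochhammer_shift mu i : pochhammer mu (S i) = mu * pochhammer (mu + 1) i.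
Proof.
  induction i as [|i IH]; [simpl; ring|].
  change (pochhammer mu (S (S i))) with (pochhammer mu (S i) * (mu + INR (S i))).
  rewrite IH. change (pochhammer (mu + 1) (S i)) with (pochhammer (mu + 1) i * (mu + 1 + INR i)).
  rewrite S_INR. ring.
Qed.

Lemma binom_coef_S mu i : binom_coef mu (S i) * INR (S i) = - mu * binom_coef (mu + 1) i.
Proof.
  unfold binom_coef. rewrite pochhammer_shift, fact_simpl, mult_INR. simpl pow.
  field. split; [apply INR_fact_neq_0|now apply not_0_INR].
Qed.

Definition binom_rem (mu : R) (N : nat) (z : C) : C :=
  (binom_factor mu z - Csum (fun i => RtoC (binom_coef mu i) * Cpow z (2 * i)) N)%C.

Lemma cder_binom_rem_S mu N z : 0 < Re z -> cder (binom_rem mu (S N)) z (RtoC (- 2 * mu) * (z * binom_rem (mu + 1) N z))%C.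
Proof.
  intros Hz. assert (Hz0 := Cneq0_Re z Hz). unfold binom_rem. eapply cder_eq.
  - apply cder_minus; [apply cder_binom_factor, Hz|].
    apply (cder_Csum (fun i z => RtoC (binom_coef mu i) * Cpow z (2 * i))%C
      (fun i z => RtoC (binom_coef mu i) * (RtoC (INR (2 * i)) * Cpow z (2 * i) / z))%C).
    intros k _. apply cder_scal, cder_Cpow, Hz0.
  - rewrite Csum_Sl. cbv beta.
    rewrite (Csum_ext _ (fun i => (RtoC (- 2 * mu) * z) * (RtoC (binom_coef (mu + 1) i) * Cpow z (2 * i)))%C).
    + rewrite Csum_scal. simpl. unfold Cdiv. ring.
    + intros k _. rewrite mult_INR. change (INR 2) with 2%R.
      replace (2 * S k)%nat with (S (S (2 * k))) by lia.
      change (Cpow z (S (S (2 * k)))) with (z * (z * Cpow z (2 * k)))%C.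
      transitivity (RtoC (2 * (binom_coef mu (S k) * INR (S k))) * z * Cpow z (2 * k))%C.
      * rewrite !RtoC_mult. field. exact Hz0.
      * rewrite binom_coef_S, !RtoC_mult, !RtoC_opp. ring.
Qed.

Lemma vanish0_binom_factor mu : 0 < mu -> vanish0 (fun z => binom_factor mu z - 1)%C.
Proof.
  intros Hmu. exists (4 * mu * exp (4 * mu)), (1 / 2).
  assert (He := exp_pos (4 * mu)).
  split; [apply Rmult_le_pos; lra|]. split; [lra|].
  intros z Hz Hr. assert (Hm := Cmod_pos_Re z Hz). unfold binom_factor, Cpower.
  set (w := (RtoC (- mu) * Clog (1 + z * z))%C).
  assert (Hw : Cmod w <= 4 * mu * (Cmod z * Cmod z)).
  { unfold w. rewrite Cmod_mult, Cmod_R, Rabs_Ropp, Rabs_pos_eq by lra.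
    assert (H := Clog_1_bound (1 + z * z)). replace (1 + z * z - 1)%C with (z * z)%C in H by ring.
    rewrite Cmod_mult in H. specialize (H ltac:(nra)). nra. }
  eapply Rle_trans; [apply Cexp_rem1|].
  assert (Hzz : Cmod z * Cmod z <= Cmod z) by nra.
  assert (Hw1 : Cmod w <= 4 * mu * Cmod z) by nra.
  assert (Hw2 : Cmod w <= 4 * mu) by nra.
  assert (H := exp_le_mono _ _ Hw2).
  replace (4 * mu * exp (4 * mu) * Cmod z) with (4 * mu * Cmod z * exp (4 * mu)) by ring.
  apply Rmult_le_compat; auto; [apply Cmod_ge_0|apply Rlt_le, exp_pos].
Qed.

Lemma vanish0_Cpow n : vanish0 (fun z => Cpow z (S n)).
Proof.
  exists 1, 1. repeat split; try lra. intros z Hz Hr. rewrite Cmod_pow. simpl.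
  assert (0 <= Cmod z ^ n <= 1).
  { split; [apply pow_le, Cmod_ge_0|]. rewrite <- (pow1 n). apply pow_incr. split; [apply Cmod_ge_0|lra]. }
  assert (H0 := Cmod_ge_0 z). nra.
Qed.

Lemma vanish0_binom_rem_S mu N : 0 < mu -> vanish0 (binom_rem mu (S N)).
Proof.
  intros Hmu. apply vanish0_ext with (fun z => (binom_factor mu z - 1) + (- (1)) * Csum (fun i => RtoC (binom_coef mu (S i)) * Cpow z (2 * S i)) N)%C.
  { intros z _. unfold binom_rem. rewrite Csum_Sl. replace (binom_coef mu 0) with 1 by (unfold binom_coef; simpl; field). simpl (Cpow z (2 * 0)). ring. }
  apply vanish0_plus; [now apply vanish0_binom_factor|]. apply vanish0_scal.
  apply (vanish0_Csum (fun i z => RtoC (binom_coef mu (S i)) * Cpow z (2 * S i))%C). intros k _.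
  apply vanish0_scal. replace (2 * S k)%nat with (S (S (2 * k))) by lia. apply vanish0_Cpow.
Qed.

(** Differentiation lowers the order [N] and replaces [mu] by [mu + 1], so the induction on [N] runs
    over all [mu] at once; one integration from the vertex restores the two powers. *)
Lemma binom_rem_bound mu N : 0 < mu -> exists A, 0 <= A /\ forall z, 0 < Re z -> kp * Cmod z <= Re z ->
  Cmod (binom_rem mu N z) <= A * Cmod z ^ (2 * N).
Proof.
  revert mu; induction N as [|N IH]; intros mu Hmu.
  - destruct (binom_factor_bound mu Hmu) as [A [HA H]]. exists A; split; auto. intros z Hz Hk.
    unfold binom_rem. rewrite Csum_0. replace (binom_factor mu z - 0)%C with (binom_factor mu z) by ring. simpl. rewrite Rmult_1_r; auto.
  - destruct (IH (mu + 1) ltac:(lra)) as [A [HA H]].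
    exists (2 * mu * A). split; [apply Rmult_le_pos; lra|]. intros z Hz Hk.
    replace (Cmod z ^ (2 * S N)) with (Cmod z * Cmod z ^ (S (2 * N))) by (replace (2 * S N)%nat with (S (S (2 * N))) by lia; simpl; ring).
    revert z Hz Hk.
    apply growth_from_0 with (w := fun r => r ^ (S (2 * N))) (phi' := fun z => (RtoC (- 2 * mu) * (z * binom_rem (mu + 1) N z))%C).
    + intros; now apply cder_binom_rem_S.
    + intros; apply pow_incr; lra.
    + apply Rmult_le_pos; lra.
    + intros z Hz Hk. assert (Hm := Cmod_pos_Re z Hz). rewrite !Cmod_mult, Cmod_R.
      replace (- 2 * mu) with (- (2 * mu)) by ring. rewrite Rabs_Ropp, Rabs_pos_eq by lra.
      specialize (H z Hz Hk). simpl pow in *.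
      replace (2 * mu * A * (Cmod z * Cmod z ^ (N + (N + 0)))) with (2 * mu * (Cmod z * (A * Cmod z ^ (N + (N + 0))))) by ring.
      apply Rmult_le_compat_l; [lra|]. apply Rmult_le_compat_l; lra.
    + now apply vanish0_binom_rem_S.
Qed.

Lemma Sm_binom_rem m mu N : 0 < mu -> Sm kp m (fun r => r ^ (2 * N)) (binom_rem mu N).
Proof.
  revert mu N; induction m as [|m IH]; intros mu N Hmu.
  - split; [now apply binom_rem_bound|exact I].
  - destruct N as [|N].
    + apply Sm_ext with (binom_factor mu); [intros; unfold binom_rem; rewrite Csum_0; ring|].
      apply (Sm_binom_factor (S m) mu Hmu).
    + split; [now apply binom_rem_bound|].
      exists (fun z => RtoC (- 2 * mu) * (z * binom_rem (mu + 1) N z))%C. split; [intros; now apply cder_binom_rem_S|].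
      apply Sm_scal. apply Sm_weight_eq with (fun r => r * r ^ (2 * N)).
      { intros r Hr. replace (2 * S N)%nat with (S (S (2 * N))) by lia. simpl. field. lra. }
      apply Sm_mult; [intros; lra|apply Sm_id|apply IH; lra].
Qed.

(** * The expansion of the product *)

Variables b mu : R.
Hypothesis hb : 0 < b.
Hypothesis hmu : 0 < mu.

Definition bessel_factor (z : C) : C := (Kint b 0 z * binom_factor mu z)%C.
(** Truncated by total degree: the pairs of indices with [r + i < N]. *)
Definition factor_exp (N : nat) (z : C) : C :=
  Csum (fun r => bessel_term b r z * Csum (fun i => RtoC (binom_coef mu i) * Cpow z (2 * i)) (N - r))%C N.
Definition factor_rem (N : nat) (z : C) : C := (bessel_factor z - factor_exp N z)%C.

(** Every summand on the right has total order [2 N] and is a product of symbols already estimated: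
    the degree of the Bessel term and the order of the binomial remainder are complementary. *)
Lemma factor_rem_eq N z : factor_rem N z = (Csum (fun r => bessel_term b r z * binom_rem mu (N - r) z) N + bessel_rem b N z * binom_factor mu z)%C.
Proof.
  unfold factor_rem, factor_exp, bessel_factor, bessel_rem, binom_rem.
  rewrite (Csum_ext (fun r => bessel_term b r z * (binom_factor mu z - _))%C (fun r => binom_factor mu z * bessel_term b r z -
    bessel_term b r z * Csum (fun i => RtoC (binom_coef mu i) * Cpow z (2 * i)) (N - r))%C) by (intros; ring).
  rewrite Csum_minus, Csum_scal. ring.
Qed.

Lemma Sm_factor_rem m N : Sm kp m (wlam (2 * N)) (factor_rem N).
Proof.
  apply Sm_ext with (fun z => Csum (fun r => bessel_term b r z * binom_rem mu (N - r) z) N + bessel_rem b N z * binom_factor mu z)%C.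
  { intros; symmetry; apply factor_rem_eq. }
  apply Sm_plus.
  - apply (Sm_Csum kp m (wlam (2 * N)) (fun r z => bessel_term b r z * binom_rem mu (N - r) z)%C); [intros; now apply wlam_pos|].
    intros k Hk. apply Sm_weight_eq with (fun r => wlam (2 * k) r * r ^ (2 * (N - k))).
    { intros r Hr. unfold wlam. replace (2 * N)%nat with (2 * k + 2 * (N - k))%nat by lia. rewrite pow_add. ring. }
    apply Sm_mult; [intros; now apply wlam_pos|now apply Sm_bessel_term|now apply Sm_binom_rem].
  - apply Sm_weight_eq with (fun r => wlam (2 * N) r * 1); [intros; ring|].
    apply Sm_mult; [intros; now apply wlam_pos|now apply Sm_bessel_rem_z_bessel_rem|now apply Sm_binom_factor].
Qed.

(** Since [L] is free, this expresses decay faster than any power at infinity; the binomial factor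
    is merely bounded. *)
Lemma Sm_bessel_factor m L : (1 <= L)%nat -> Sm kp m (fun r => / r ^ L) bessel_factor.
Proof.
  intros HL. apply Sm_weight_eq with (fun r => / r ^ L * 1); [intros; ring|].
  apply Sm_mult; [intros; apply Rlt_le, Rinv_0_lt_compat, pow_lt; auto| |now apply Sm_binom_factor].
  apply (Sm_Kint b hb kp hkp m 0 L HL).
Qed.

End binom.

(** Summation along antidiagonals [k = r + i], which collects the coefficient of [z^(2k)]. *)
Lemma Csum_triangle (g : nat -> nat -> C) N :
  Csum (fun r => Csum (g r) (N - r)) N = Csum (fun k => Csum (fun r => g r (k - r)%nat) (S k)) N.
Proof.
  induction N as [|N IH]; [reflexivity|].
  rewrite (Csum_S (fun k => Csum (fun r => g r (k - r)%nat) (S k)) N), <- IH.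
  rewrite (Csum_S (fun r => g r (N - r)%nat) N), Cplus_assoc, <- Csum_plus.
  rewrite (Csum_S (fun r => Csum (g r) (S N - r)) N).
  replace (S N - N)%nat with 1%nat by lia. rewrite (Csum_S (g N) 0), Csum_0, Nat.sub_diag, Cplus_0_l.
  f_equal. apply Csum_ext. intros k Hk. replace (S N - k)%nat with (S (N - k)) by lia. now rewrite Csum_S.
Qed.

Lemma RtoC_sum (u : nat -> R) k : RtoC (sum_n_m u 0 k) = Csum (fun r => RtoC (u r)) (S k).
Proof.
  induction k as [|k IH].
  - rewrite sum_n_n, Csum_S, Csum_0. ring.
  - rewrite (sum_n_Sm u) by lia. rewrite Csum_S, <- IH. apply RtoC_plus.
Qed.

(* [Ak + Bk log z] is the coefficient of [z^(2k)] in the expansion of [K_0(b z) (1 + z^2)^(-mu)]. *)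
Definition ek (b mu : R) (k r : nat) : R := binom_coef mu (k - r) * kcoef b r.
Definition Bk (b mu : R) (k : nat) : R := sum_n_m (fun r => ek b mu k r) 0 k.
Definition Ak (b mu : R) (k : nat) : R := sum_n_m (fun r => ek b mu k r * (ell b - harm r)) 0 k.

Lemma factor_exp_eq b mu N z :
  factor_exp b mu N z = Csum (fun k => Cpow z (2 * k) * (RtoC (Ak b mu k) + RtoC (Bk b mu k) * Clog z))%C N.
Proof.
  unfold factor_exp.
  rewrite (Csum_ext _ (fun r => Csum (fun i => bessel_term b r z * (RtoC (binom_coef mu i) * Cpow z (2 * i)))%C (N - r)))
    by (intros; symmetry; apply Csum_scal).
  rewrite (Csum_triangle (fun r i => bessel_term b r z * (RtoC (binom_coef mu i) * Cpow z (2 * i)))%C).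
  apply Csum_ext. intros k _. unfold Ak, Bk. rewrite !RtoC_sum, (Cmult_comm _ (Clog z)), <- Csum_scal, <- Csum_plus, <- Csum_scal.
  apply Csum_ext. intros r Hr. unfold bessel_term, ek.
  replace (Cpow z (2 * k)) with (Cpow z (2 * r) * Cpow z (2 * (k - r)))%C.
  - rewrite !RtoC_mult. ring.
  - rewrite <- Cpow_add_r. f_equal. lia.
Qed.

(** * Euler-Maclaurin summation *)

(* [bf k t] is [B_(k+1)(t) - B_(k+1)(0)] up to a constant factor, [B_j] being the Bernoulli polynomials;
   [cf] collects the means. *)
Fixpoint bf (k : nat) : R -> R :=
  match k with
  | O => fun t => t
  | S k' => fun t => - RInt (fun s => bf k' s - RInt (bf k') 0 1) 0 t
  end.

Definition cf (j : nat) : R := match j with O => 1 | S k => RInt (bf k) 0 1 end.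

Lemma is_derive_bf_S_aux k t : (forall s, continuous (bf k) s) -> is_derive (bf (S k)) t (- (bf k t - cf (S k))).
Proof.
  intros Hc. simpl bf.
  apply (is_derive_opp (V:=R_NormedModule) (fun t => RInt (fun s => bf k s - RInt (bf k) 0 1) 0 t)).
  assert (Hc' : forall s, continuous (fun s => bf k s - RInt (bf k) 0 1) s).
  { intros s. apply (continuous_minus (V:=R_NormedModule)); [apply Hc|apply continuous_const]. }
  apply (is_derive_RInt (V:=R_NormedModule) (fun s => bf k s - RInt (bf k) 0 1) _ 0 t).
  - exists (mkposreal _ Rlt_0_1). intros s _. apply (RInt_correct (V:=R_CompleteNormedModule)).
    apply (ex_RInt_continuous (V:=R_CompleteNormedModule)). intros; apply Hc'.
  - apply Hc'.
Qed.

Lemma bf_cont k t : continuous (bf k) t.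
Proof.
  revert t; induction k as [|k IH]; intros t.
  - apply continuous_id.
  - apply (ex_derive_continuous (bf (S k))). eexists. apply is_derive_bf_S_aux, IH.
Qed.

Lemma is_derive_bf_S k t : is_derive (bf (S k)) t (- (bf k t - cf (S k))).
Proof. apply is_derive_bf_S_aux, bf_cont. Qed.

Lemma bf_S_0 k : bf (S k) 0 = 0.
Proof. simpl. rewrite RInt_point. unfold zero; simpl. apply Ropp_0. Qed.

Lemma bf_S_1 k : bf (S k) 1 = 0.
Proof.
  simpl. rewrite (RInt_minus (V:=R_CompleteNormedModule)).
  - rewrite RInt_const. unfold minus, plus, opp, scal; simpl. unfold mult; simpl. ring.
  - apply (ex_RInt_continuous (V:=R_CompleteNormedModule)). intros; apply bf_cont.
  - apply ex_RInt_const.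
Qed.

Lemma bf_bounded k : exists B, 0 <= B /\ forall t, 0 <= t <= 1 -> Rabs (bf k t) <= B.
Proof.
  destruct (continuity_ab_maj (fun t => Rabs (bf k t)) 0 1 Rle_0_1) as [M [HM _]].
  - intros c _. apply continuity_pt_filterlim. apply (continuous_comp (bf k) Rabs); [apply bf_cont|].
    apply continuous_Rabs.
  - exists (Rabs (bf k M)). split; [apply Rabs_pos|auto].
Qed.

Lemma rder_shift h x t l : rder h (x + t) l -> rder (fun s => h (x + s)) t l.
Proof.
  rewrite !rder_comp. intros [H1 H2]. split.
  - evar_last; [apply (is_derive_comp (V:=R_NormedModule) (fun s => Re (h s)) (fun s => x + s)); [apply H1|]|].
    + auto_derive; auto.
    + unfold scal; simpl; unfold mult; simpl. ring.
  - evar_last; [apply (is_derive_comp (V:=R_NormedModule) (fun s => Im (h s)) (fun s => x + s)); [apply H2|]|].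
    + auto_derive; auto.
    + unfold scal; simpl; unfold mult; simpl. ring.
Qed.

(** [h 1] is the summand and [h 0] a primitive of it, so that the term [j = 0] of the sum is the
    integral and [j = 1] the trapezoidal correction. The number [cf j] is [B_j / j!] with
    [B_1 = 1/2]. Since the same [cf] occur in the continuation of [zeta], they can stay
    unevaluated. *)
Lemma EM_unit k (h : nat -> R -> C) :
  (forall j, (j <= S k)%nat -> forall t, 0 <= t <= 1 -> rder (h j) t (h (S j) t)) ->
  (forall t, 0 <= t <= 1 -> ccont (h (S (S k))) t) ->
  exists I, cint (fun t => RtoC (bf k t) * h (S (S k)) t)%C 0 1 I /\
    h 1%nat 1 = (Csum (fun j => RtoC (cf j) * (h j 1 - h j 0)) (S k) + I)%C.
Proof.
  induction k as [|k IH]; intros Hd Hc.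
  - exists ((1 * h 1%nat 1 - h O 1) - (0 * h 1%nat 0 - h O 0))%C. split.
    + apply cint_ext with (fun t => (1 * h 1%nat t + RtoC t * h 2%nat t - h 1%nat t)%C).
      { intros t _. simpl bf. ring. }
      assert (Hr : forall t, Rmin 0 1 <= t <= Rmax 0 1 -> 0 <= t <= 1) by (rewrite Rmin_left, Rmax_right by lra; auto).
      apply (cint_FTC (fun t => RtoC t * h 1%nat t - h O t)%C).
      * intros t Ht. apply Hr in Ht. apply rder_minus; [|apply Hd; auto].
        apply (rder_mult (fun t => RtoC t)); [apply rder_RtoC, (@is_derive_id R_AbsRing)|apply Hd; auto].
      * intros t Ht. apply Hr in Ht. apply ccont_minus; [apply ccont_plus|].
        -- apply ccont_scal. eapply rder_ccont, Hd; auto.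
        -- apply ccont_mult; [apply ccont_RtoC, continuous_id|auto].
        -- eapply rder_ccont, Hd; auto.
    + rewrite Csum_S, Csum_0. simpl cf. ring.
  - destruct IH as [I [HI E]].
    { intros; apply Hd; auto; lia. }
    { intros t Ht. eapply rder_ccont, Hd; auto. }
    (* Integration by parts against [bf (S k)], which vanishes at [0] and at [1]; the mean
       [cf (S k)] of [bf k] splits off the next correction term. *)
    assert (HJ : cint (fun t => RtoC (bf k t) * h (S (S k)) t - RtoC (cf (S k)) * h (S (S k)) t
      - RtoC (bf (S k) t) * h (S (S (S k))) t)%C 0 1 (- (RtoC (bf (S k) 1) * h (S (S k)) 1) - - (RtoC (bf (S k) 0) * h (S (S k)) 0))%C).
    { assert (Hr : forall t, Rmin 0 1 <= t <= Rmax 0 1 -> 0 <= t <= 1) by (rewrite Rmin_left, Rmax_right by lra; auto).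
      apply (cint_FTC (fun t => - (RtoC (bf (S k) t) * h (S (S k)) t))%C).
      - intros t Ht. apply Hr in Ht.
        apply rder_ext with (fun t => (- (1)) * (RtoC (bf (S k) t) * h (S (S k)) t))%C; [intros; ring|].
        eapply rder_eq; [apply rder_scal, rder_mult; [apply rder_RtoC, is_derive_bf_S|apply Hd; auto]|].
        cbv beta. rewrite RtoC_opp, RtoC_minus. ring.
      - intros t Ht. apply Hr in Ht. 
        assert (ccont (h (S (S k))) t) by (eapply rder_ccont, Hd; auto).
        apply ccont_minus; [apply ccont_minus|].
        + apply ccont_mult; auto. apply ccont_RtoC, bf_cont.
        + apply ccont_scal; auto.
        + apply ccont_mult; auto. apply ccont_RtoC, bf_cont. }
    rewrite bf_S_0, bf_S_1 in HJ.
    assert (HL : cint (h (S (S k))) 0 1 (h (S k) 1 - h (S k) 0)%C).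
    { assert (Hr : forall t, Rmin 0 1 <= t <= Rmax 0 1 -> 0 <= t <= 1) by (rewrite Rmin_left, Rmax_right by lra; auto).
      apply cint_FTC; intros t Ht; apply Hr in Ht; [apply Hd; auto|eapply rder_ccont, Hd; auto]. }
    exists (I - RtoC (cf (S k)) * (h (S k) 1 - h (S k) 0))%C. split.
    + replace (I - RtoC (cf (S k)) * (h (S k) 1 - h (S k) 0))%C with
        (I - RtoC (cf (S k)) * (h (S k) 1 - h (S k) 0) - (- (0 * h (S (S k)) 1) - - (0 * h (S (S k)) 0)))%C by ring.
      assert (H := cint_minus _ _ _ _ _ _ (cint_minus _ _ _ _ _ _ HI (cint_scal (RtoC (cf (S k))) _ _ _ _ HL)) HJ).
      eapply cint_ext; [|apply H]. intros t _. cbv beta. ring.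
    + rewrite E, (Csum_S _ (S k)). ring.
Qed.

Lemma EM_step k (H : nat -> R -> C) x :
  (forall j, (j <= S k)%nat -> forall t, x <= t <= x + 1 -> rder (H j) t (H (S j) t)) ->
  (forall t, x <= t <= x + 1 -> exists l, rder (H (S (S k))) t l) ->
  exists I, cint (fun t => RtoC (bf k t) * H (S (S k)) (x + t)%R)%C 0 1 I /\
    H 1%nat (x + 1) = (Csum (fun j => RtoC (cf j) * (H j (x + 1)%R - H j x)) (S k) + I)%C.
Proof.
  intros Hd Hc. destruct (EM_unit k (fun j t => H j (x + t)%R)) as [I [HI E]].
  - intros j Hj t Ht. apply rder_shift. apply Hd; auto. lra.
  - intros t Ht. destruct (Hc (x + t) ltac:(lra)) as [l Hl]. eapply rder_ccont. apply rder_shift, Hl.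
  - exists I. split; auto. rewrite Rplus_0_r in E. exact E.
Qed.

(** Summing over unit intervals telescopes the corrections, so that only those at [1] and at [n + 1]
    remain; [I i] belongs to the interval from [i + 1] to [i + 2]. *)
Lemma EM_sum k (H : nat -> R -> C) :
  (forall j, (j <= S k)%nat -> forall t, 1 <= t -> rder (H j) t (H (S j) t)) ->
  (forall t, 1 <= t -> exists l, rder (H (S (S k))) t l) ->
  exists I : nat -> C, (forall i, cint (fun t => RtoC (bf k t) * H (S (S k)) (INR (S i) + t)%R)%C 0 1 (I i)) /\
    forall n, Csum (fun i => H 1%nat (INR (S i))) (S n) =
      (H 1%nat 1 + Csum (fun j => RtoC (cf j) * (H j (INR (S n)) - H j 1)) (S k) + Csum I n)%C.
Proof.
  intros Hd Hc.
  assert (HI : forall i, exists I, cint (fun t => RtoC (bf k t) * H (S (S k)) (INR (S i) + t)%R)%C 0 1 I /\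
    H 1%nat (INR (S i) + 1) = (Csum (fun j => RtoC (cf j) * (H j (INR (S i) + 1)%R - H j (INR (S i)))) (S k) + I)%C).
  { intros i. assert (1 <= INR (S i)) by (change 1 with (INR 1); apply le_INR; lia).
    apply EM_step; intros; [apply Hd; auto; lra|apply Hc; lra]. }
  destruct (fun_choice _ _ _ HI) as [I HI']. exists I. split; [intros i; apply HI'|].
  induction n as [|n IH].
  - rewrite Csum_S, !Csum_0. change (INR 1) with 1%R.
    rewrite (Csum_ext _ (fun j => RtoC (cf j) * 0)%C) by (intros; ring).
    rewrite (Csum_ext _ (fun j => 0 * RtoC (cf j))%C) by (intros; ring).
    rewrite Csum_scal. ring.
  - rewrite Csum_S, IH.
    rewrite (Csum_S I n).
    destruct (HI' n) as [_ E]. rewrite (S_INR (S n)). rewrite E.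
    rewrite (Csum_ext (fun j => RtoC (cf j) * (H j (INR (S n) + 1)%R - H j 1))%C
      (fun j => RtoC (cf j) * (H j (INR (S n)) - H j 1) + RtoC (cf j) * (H j (INR (S n) + 1)%R - H j (INR (S n))))%C) by (intros; ring).
    rewrite Csum_plus. ring.
Qed.

(** * Limits of complex sequences and power series *)

Definition clim (u : nat -> C) (l : C) : Prop :=
  forall eps, 0 < eps -> exists N, forall n, (N <= n)%nat -> Cmod (u n - l) < eps.

Lemma clim_unique u l m : clim u l -> clim u m -> l = m.
Proof.
  intros H1 H2. apply Ceq_minus, Cmod_eq_0. apply Rle_antisym; [|apply Cmod_ge_0].
  apply le_epsilon. intros eps He.
  destruct (H1 (eps / 2)) as [N1 K1]; [lra|]. destruct (H2 (eps / 2)) as [N2 K2]; [lra|].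
  specialize (K1 (Nat.max N1 N2) ltac:(lia)). specialize (K2 (Nat.max N1 N2) ltac:(lia)).
  replace (l - m)%C with ((u (Nat.max N1 N2) - m) - (u (Nat.max N1 N2) - l))%C by ring.
  generalize (Cmod_triangle_minus (u (Nat.max N1 N2) - m) (u (Nat.max N1 N2) - l)). lra.
Qed.

Lemma clim_ext u v l : (forall n, u n = v n) -> clim u l -> clim v l.
Proof. intros E H eps He. destruct (H eps He) as [N K]. exists N. intros n Hn. rewrite <- E; auto. Qed.

Lemma clim_plus u v l m : clim u l -> clim v m -> clim (fun n => u n + v n)%C (l + m)%C.
Proof.
  intros H1 H2 eps He.
  destruct (H1 (eps / 2)) as [N1 K1]; [lra|]. destruct (H2 (eps / 2)) as [N2 K2]; [lra|].
  exists (Nat.max N1 N2). intros n Hn. specialize (K1 n ltac:(lia)). specialize (K2 n ltac:(lia)).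
  replace (u n + v n - (l + m))%C with ((u n - l) + (v n - m))%C by ring.
  generalize (Cmod_triangle (u n - l) (v n - m)). lra.
Qed.

Lemma clim_scal c u l : clim u l -> clim (fun n => c * u n)%C (c * l)%C.
Proof.
  intros H eps He. assert (Hc := Cmod_ge_0 c).
  destruct (H (eps / (Cmod c + 1))) as [N K]; [apply Rdiv_lt_0_compat; lra|].
  exists N. intros n Hn. replace (c * u n - c * l)%C with (c * (u n - l))%C by ring.
  apply clim_scal_aux; auto.
Qed.

Lemma clim_const c : clim (fun _ => c) c.
Proof. intros eps He. exists O. intros. replace (c - c)%C with (RtoC 0) by ring. now rewrite Cmod_0. Qed.

Lemma clim_minus u v l m : clim u l -> clim v m -> clim (fun n => u n - v n)%C (l - m)%C.
Proof.
  intros H1 H2. replace (l - m)%C with (l + (- (1)) * m)%C by ring.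
  apply clim_ext with (fun n => u n + (- (1)) * v n)%C; [intros; ring|].
  apply clim_plus; auto. now apply clim_scal.
Qed.

Lemma clim_shift u l : clim (fun n => u (S n)) l -> clim u l.
Proof.
  intros H eps He. destruct (H eps He) as [N K]. exists (S N). intros n Hn.
  destruct n as [|n]; [lia|]. apply K. lia.
Qed.

Lemma clim_shift' u l : clim u l -> clim (fun n => u (S n)) l.
Proof. intros H eps He. destruct (H eps He) as [N K]. exists N. intros n Hn. apply K. lia. Qed.

Lemma clim_dist_le u l c B N : (forall n, (N <= n)%nat -> Cmod (u n - c) <= B) -> clim u l -> Cmod (l - c) <= B.
Proof.
  intros Hb H. apply le_epsilon. intros eps He. destruct (H eps He) as [M K].
  specialize (K (Nat.max N M) ltac:(lia)). specialize (Hb (Nat.max N M) ltac:(lia)).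
  replace (l - c)%C with ((u (Nat.max N M) - c) - (u (Nat.max N M) - l))%C by ring.
  generalize (Cmod_triangle_minus (u (Nat.max N M) - c) (u (Nat.max N M) - l)). lra.
Qed.

Lemma clim_Csum (u : nat -> nat -> C) (l : nat -> C) K :
  (forall k, (k < K)%nat -> clim (fun n => u n k) (l k)) -> clim (fun n => Csum (u n) K) (Csum l K).
Proof.
  induction K as [|K IH]; intros H; [exact (clim_const 0)|].
  rewrite Csum_S. apply clim_ext with (fun n => Csum (u n) K + u n K)%C; [intros; symmetry; apply Csum_S|].
  apply clim_plus; auto.
Qed.

Lemma climinf_clim F l : climinf F l -> clim (fun n => F (INR n)) l.
Proof.
  intros H eps He. destruct (H eps He) as [M K].
  destruct (nfloor_ex (Rabs M) (Rabs_pos M)) as [N HN].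
  exists (S N). intros n Hn. apply K. apply le_INR in Hn. rewrite S_INR in Hn. generalize (Rle_abs M); lra.
Qed.

(** A comparison test in which the majorising series is telescoping and given by its partial sums
    [V]; the tail is then bounded by [L - V n]. *)
Lemma Csum_dominated (f : nat -> C) (V : nat -> R) (L : R) :
  (forall n, Cmod (f n) <= V (S n) - V n) -> (forall n, V n <= L) ->
  exists l, clim (Csum f) l /\ forall n, Cmod (Csum f n - l) <= L - V n.
Proof.
  intros Hf HV.
  assert (Hinc : forall n k, Cmod (Csum f (n + k) - Csum f n) <= V (n + k)%nat - V n).
  { intros n k. induction k as [|k IH].
    - rewrite Nat.add_0_r. replace (Csum f n - Csum f n)%C with (RtoC 0) by ring. rewrite Cmod_0. lra.
    - replace (n + S k)%nat with (S (n + k)) by lia. rewrite Csum_S.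
      replace (Csum f (n + k) + f (n + k)%nat - Csum f n)%C with ((Csum f (n + k) - Csum f n) + f (n + k)%nat)%C by ring.
      eapply Rle_trans; [apply Cmod_triangle|]. specialize (Hf (n + k)%nat). lra. }
  assert (HVmono : forall n, V n <= V (S n)).
  { intros n. generalize (Hf n) (Cmod_ge_0 (f n)). lra. }
  assert (HVl : ex_finite_lim_seq V) by (apply ex_finite_lim_seq_incr with L; auto).
  apply ex_lim_seq_cauchy_corr in HVl.
  assert (HC : forall eps : posreal, exists N, forall n m, (N <= n)%nat -> (N <= m)%nat -> Cmod (Csum f n - Csum f m) < eps).
  { intros eps. destruct (HVl eps) as [N HN]. exists N.
    assert (Hle : forall n m, (N <= n)%nat -> (n <= m)%nat -> Cmod (Csum f m - Csum f n) < eps).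
    { intros n m Hn Hm. specialize (Hinc n (m - n)%nat). replace (n + (m - n))%nat with m in Hinc by lia.
      specialize (HN m n ltac:(lia) Hn). generalize (Rle_abs (V m - V n)). lra. }
    intros n m Hn Hm. destruct (Nat.le_ge_cases n m); [rewrite Cmod_minus_sym|]; auto. }
  assert (H1 : ex_finite_lim_seq (fun n => Re (Csum f n))).
  { apply ex_lim_seq_cauchy_corr. intros eps. destruct (HC eps) as [N HN]. exists N. intros n m Hn Hm.
    rewrite <- Re_minus. eapply Rle_lt_trans; [apply re_le_Cmod|auto]. }
  assert (H2 : ex_finite_lim_seq (fun n => Im (Csum f n))).
  { apply ex_lim_seq_cauchy_corr. intros eps. destruct (HC eps) as [N HN]. exists N. intros n m Hn Hm.
    rewrite <- Im_minus. eapply Rle_lt_trans; [apply im_le_Cmod|auto]. }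
  destruct H1 as [x Hx], H2 as [y Hy]. apply is_lim_seq_spec in Hx, Hy.
  assert (Hl : clim (Csum f) (x, y)).
  { intros eps He. assert (He2 : 0 < eps / 2) by lra.
    destruct (Hx (mkposreal _ He2)) as [N1 K1], (Hy (mkposreal _ He2)) as [N2 K2]. simpl in K1, K2.
    exists (Nat.max N1 N2). intros n Hn. specialize (K1 n ltac:(lia)). specialize (K2 n ltac:(lia)).
    eapply Rle_lt_trans; [apply Cmod_le_abs|]. rewrite Re_minus, Im_minus. simpl. lra. }
  exists (x, y). split; auto. intros n. rewrite Cmod_minus_sym.
  apply clim_dist_le with (Csum f) n; auto. intros m Hm.
  specialize (Hinc n (m - n)%nat). replace (n + (m - n))%nat with m in Hinc by lia. specialize (HV m). lra.
Qed.

Definition pser (a : nat -> C) (z l : C) : Prop := clim (Csum (fun k => a k * Cpow z k)%C) l.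

Lemma pow_n_Cpow (z : C) k : @pow_n C_Ring z k = Cpow z k.
Proof. induction k as [|k IH]; [reflexivity|]. simpl. rewrite IH. reflexivity. Qed.

Lemma pser_is_pseries a z l : is_pseries (K := C_AbsRing) (V := C_NormedModule) a z l <-> pser a z l.
Proof.
  (* [sum_n] up to [n] has [n + 1] terms, whereas [Csum] takes the number of terms; hence the shifts
     of index below. *)
  assert (E : forall n, sum_n (G:=C_AbelianMonoid) (fun k => scal (K:=C_AbsRing) (V:=C_NormedModule) (pow_n (K:=C_AbsRing) z k) (a k)) n
    = Csum (fun k => a k * Cpow z k)%C (S n)).
  { induction n as [|n IH].
    - rewrite sum_O, Csum_S, Csum_0.
      change (Cmult (RtoC 1) (a O) = (0 + a O * 1)%C). ring.
    - rewrite sum_Sn, IH, (Csum_S _ (S n)). unfold plus; simpl. f_equal.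
      change (scal (K:=C_AbsRing) (V:=C_NormedModule) (pow_n (K:=C_AbsRing) z (S n)) (a (S n))) with (Cmult (@pow_n C_Ring z (S n)) (a (S n))).
      rewrite pow_n_Cpow. apply Cmult_comm. }
  split.
  - intros H. apply clim_shift. intros eps He.
    assert (He2 : 0 < eps / 2) by lra.
    destruct (H (ball (M:=C_UniformSpace) l (mkposreal _ He2)) (locally_ball (T:=C_UniformSpace) l _)) as [N HN].
    exists N. intros n Hn. destruct (HN n Hn) as [H1 H2].
    rewrite <- E. change (Rabs (Re (sum_n (G:=C_AbelianMonoid) (fun k => scal (K:=C_AbsRing) (V:=C_NormedModule) (pow_n (K:=C_AbsRing) z k) (a k)) n) - Re l) < eps / 2) in H1.
    change (Rabs (Im (sum_n (G:=C_AbelianMonoid) (fun k => scal (K:=C_AbsRing) (V:=C_NormedModule) (pow_n (K:=C_AbsRing) z k) (a k)) n) - Im l) < eps / 2) in H2.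
    eapply Rle_lt_trans; [apply Cmod_le_abs|]. rewrite Re_minus, Im_minus. lra.
  - intros H. apply clim_shift' in H. intros P [eps HP]. destruct (H eps (cond_pos eps)) as [N HN].
    exists N. intros n Hn. apply HP. specialize (HN n Hn). rewrite <- E in HN. split.
    + change (Rabs (Re (sum_n (G:=C_AbelianMonoid) (fun k => scal (K:=C_AbsRing) (V:=C_NormedModule) (pow_n (K:=C_AbsRing) z k) (a k)) n) - Re l) < eps).
      rewrite <- Re_minus. eapply Rle_lt_trans; [apply re_le_Cmod|auto].
    + change (Rabs (Im (sum_n (G:=C_AbelianMonoid) (fun k => scal (K:=C_AbsRing) (V:=C_NormedModule) (pow_n (K:=C_AbsRing) z k) (a k)) n) - Im l) < eps).
      rewrite <- Im_minus. eapply Rle_lt_trans; [apply im_le_Cmod|auto].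
Qed.

Lemma locally_Cmod (p : C) (P : C -> Prop) :
  locally (T:=C_UniformSpace) p P <-> exists d, 0 < d /\ forall s, Cmod (s - p) < d -> P s.
Proof.
  split.
  - intros [d Hd]. exists d. split; [apply cond_pos|]. intros s Hs. apply Hd. split.
    + change (Rabs (Re s - Re p) < d). rewrite <- Re_minus. eapply Rle_lt_trans; [apply re_le_Cmod|auto].
    + change (Rabs (Im s - Im p) < d). rewrite <- Im_minus. eapply Rle_lt_trans; [apply im_le_Cmod|auto].
  - intros [d [Hd H]]. assert (Hd2 : 0 < d / 2) by lra. exists (mkposreal _ Hd2). intros s [H1 H2].
    change (Rabs (Re s - Re p) < d / 2) in H1. change (Rabs (Im s - Im p) < d / 2) in H2.
    apply H. eapply Rle_lt_trans; [apply Cmod_le_abs|]. rewrite Re_minus, Im_minus. lra.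
Qed.

Definition ana (f : C -> C) (p : C) : Prop :=
  exists (a : nat -> C) d, 0 < d /\ forall s, Cmod (s - p) < d -> pser a (s - p)%C (f s).

Definition mero (f : C -> C) (p : C) : Prop :=
  exists (N : nat) (a : nat -> C) d, 0 < d /\ forall s, s <> p -> Cmod (s - p) < d -> pser a (s - p)%C (Cpow (s - p) N * f s)%C.

Lemma ana_iff f p : analytic_at f p <-> ana f p.
Proof.
  split.
  - intros [a H]. apply (locally_Cmod p) in H. destruct H as [d [Hd H]]. exists a, d. split; auto.
    intros s Hs. apply pser_is_pseries. now apply H.
  - intros [a [d [Hd H]]]. exists a. apply (locally_Cmod p). exists d. split; auto.
    intros s Hs. apply pser_is_pseries. now apply H.
Qed.

Lemma mero_iff f p : meromorphic_at f p <-> mero f p.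
Proof.
  split.
  - intros [N [a H]]. apply (locally_Cmod p) in H. destruct H as [d [Hd H]]. exists N, a, d. split; auto.
    intros s Hsp Hs. apply pser_is_pseries. now apply H.
  - intros [N [a [d [Hd H]]]]. exists N, a. apply (locally_Cmod p). exists d. split; auto.
    intros s Hs Hsp. apply pser_is_pseries. now apply H.
Qed.

Lemma pser_plus a b z l m : pser a z l -> pser b z m -> pser (fun k => a k + b k)%C z (l + m)%C.
Proof.
  intros H1 H2. apply clim_ext with (fun n => Csum (fun k => a k * Cpow z k) n + Csum (fun k => b k * Cpow z k) n)%C.
  - intros n. rewrite <- Csum_plus. apply Csum_ext. intros; ring.
  - now apply clim_plus.
Qed.

Lemma pser_scal c a z l : pser a z l -> pser (fun k => c * a k)%C z (c * l)%C.
Proof.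
  intros H1. apply clim_ext with (fun n => c * Csum (fun k => a k * Cpow z k) n)%C.
  - intros n. rewrite <- Csum_scal. apply Csum_ext. intros; ring.
  - now apply clim_scal.
Qed.

Definition ashift (a : nat -> C) (k : nat) : C := match k with O => RtoC 0 | S k => a k end.

Lemma pser_shift a z l : pser a z l -> pser (ashift a) z (z * l)%C.
Proof.
  intros H. apply clim_shift. apply clim_ext with (fun n => z * Csum (fun k => a k * Cpow z k) n)%C.
  - intros n. rewrite Csum_Sl, <- Csum_scal. simpl ashift at 1. rewrite Cmult_0_l, Cplus_0_l.
    apply Csum_ext. intros k _. simpl. ring.
  - now apply clim_scal.
Qed.

Lemma pser_const c z : pser (fun k => match k with O => c | _ => RtoC 0 end) z c.
Proof.
  apply clim_shift. apply clim_ext with (fun _ => c); [|apply clim_const].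
  intros n. rewrite Csum_Sl. rewrite (Csum_ext _ (fun _ => 0 * 0)%C) by (intros; simpl; ring).
  rewrite Csum_scal. simpl. ring.
Qed.

Lemma pser_eq a z l m : pser a z l -> l = m -> pser a z m.
Proof. intros; now subst. Qed.

Lemma ana_mero f p : ana f p -> mero f p.
Proof.
  intros [a [d [Hd H]]]. exists O, a, d. split; auto. intros s _ Hs. simpl. rewrite Cmult_1_l. auto.
Qed.

Lemma ana_ext_loc f g p d : 0 < d -> (forall s, Cmod (s - p) < d -> f s = g s) -> ana f p -> ana g p.
Proof.
  intros Hd E [a [r [Hr H]]]. exists a, (Rmin d r). split; [now apply Rmin_pos|].
  intros s Hs. rewrite <- E by (eapply Rlt_le_trans; [apply Hs|apply Rmin_l]).
  apply H. eapply Rlt_le_trans; [apply Hs|apply Rmin_r].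
Qed.

Lemma ana_ext f g p : (forall s, f s = g s) -> ana f p -> ana g p.
Proof. intros E. apply ana_ext_loc with 1; auto; lra. Qed.

Lemma mero_ext_loc f g p d : 0 < d -> (forall s, s <> p -> Cmod (s - p) < d -> f s = g s) -> mero f p -> mero g p.
Proof.
  intros Hd E [N [a [r [Hr H]]]]. exists N, a, (Rmin d r). split; [now apply Rmin_pos|].
  intros s Hsp Hs. rewrite <- E by first [exact Hsp|eapply Rlt_le_trans; [apply Hs|apply Rmin_l]].
  apply H; auto. eapply Rlt_le_trans; [apply Hs|apply Rmin_r].
Qed.

Lemma ana_plus f g p : ana f p -> ana g p -> ana (fun s => f s + g s)%C p.
Proof.
  intros [a [r [Hr H]]] [b [t [Ht H']]]. exists (fun k => a k + b k)%C, (Rmin r t). split; [now apply Rmin_pos|].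
  intros s Hs. apply pser_plus; [apply H|apply H']; (eapply Rlt_le_trans; [apply Hs|]); [apply Rmin_l|apply Rmin_r].
Qed.

Lemma ana_scal c f p : ana f p -> ana (fun s => c * f s)%C p.
Proof. intros [a [r [Hr H]]]. exists (fun k => c * a k)%C, r. split; auto. intros s Hs. apply pser_scal; auto. Qed.

Lemma ana_const c p : ana (fun _ => c) p.
Proof. exists (fun k => match k with O => c | _ => RtoC 0 end), 1. split; [lra|]. intros. apply pser_const. Qed.

Lemma ana_lin c f p : ana f p -> ana (fun s => (s + c) * f s)%C p.
Proof.
  intros [a [r [Hr H]]]. exists (fun k => ashift a k + (p + c) * a k)%C, r. split; auto.
  intros s Hs. eapply pser_eq; [apply pser_plus; [apply pser_shift, H, Hs|apply pser_scal, H, Hs]|]. ring.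
Qed.

Lemma ana_Csum (f : nat -> C -> C) p K : (forall k, (k < K)%nat -> ana (f k) p) -> ana (fun s => Csum (fun k => f k s) K) p.
Proof.
  induction K as [|K IH]; intros H; [exact (ana_const 0 p)|].
  apply ana_ext with (fun s => Csum (fun k => f k s) K + f K s)%C; [intros; symmetry; apply Csum_S|].
  apply ana_plus; auto.
Qed.

Lemma pser_shiftn a z l n : pser a z l -> exists b, pser b z (Cpow z n * l)%C /\ b = Nat.iter n ashift a.
Proof.
  intros H. exists (Nat.iter n ashift a). split; auto. induction n as [|n IH].
  - simpl. rewrite Cmult_1_l. exact H.
  - simpl Nat.iter. eapply pser_eq; [apply pser_shift, IH|]. simpl. ring.
Qed.

Lemma mero_plus f g p : mero f p -> mero g p -> mero (fun s => f s + g s)%C p.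
Proof.
  intros [N [a [r [Hr H]]]] [M [b [t [Ht H']]]].
  exists (N + M)%nat, (fun k => Nat.iter M ashift a k + Nat.iter N ashift b k)%C, (Rmin r t). split; [now apply Rmin_pos|].
  intros s Hsp Hs.
  specialize (H s Hsp (Rlt_le_trans _ _ _ Hs (Rmin_l _ _))). specialize (H' s Hsp (Rlt_le_trans _ _ _ Hs (Rmin_r _ _))).
  destruct (pser_shiftn _ _ _ M H) as [a' [Ha ->]]. destruct (pser_shiftn _ _ _ N H') as [b' [Hb ->]].
  eapply pser_eq; [apply pser_plus; [apply Ha|apply Hb]|]. rewrite Cpow_add_r. ring.
Qed.

Lemma mero_scal c f p : mero f p -> mero (fun s => c * f s)%C p.
Proof.
  intros [N [a [r [Hr H]]]]. exists N, (fun k => c * a k)%C, r. split; auto. intros s Hsp Hs.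
  eapply pser_eq; [apply pser_scal, H; auto|]. ring.
Qed.

Lemma mero_Csum (f : nat -> C -> C) p K : (forall k, (k < K)%nat -> mero (f k) p) -> mero (fun s => Csum (fun k => f k s) K) p.
Proof.
  induction K as [|K IH]; intros H; [exact (ana_mero _ _ (ana_const 0 p))|].
  apply mero_ext_loc with (fun s => Csum (fun k => f k s) K + f K s)%C 1; [lra|intros; symmetry; apply Csum_S|].
  apply mero_plus; auto.
Qed.

(** * The identity theorem *)

Lemma pser_terms_bounded a z l : pser a z l -> exists B, 0 <= B /\ forall k, Cmod (a k) * Cmod z ^ k <= B.
Proof.
  intros H.
  destruct (H 1 Rlt_0_1) as [N HN].
  assert (Hb : exists B, 0 <= B /\ forall k, (k < N)%nat -> Cmod (a k) * Cmod z ^ k <= B).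
  { clear HN. induction N as [|N [B [HB IH]]]; [exists 0; split; [lra|intros; lia]|].
    exists (Rmax B (Cmod (a N) * Cmod z ^ N)). split; [eapply Rle_trans; [apply HB|apply Rmax_l]|].
    intros k Hk. destruct (Nat.eq_dec k N) as [->|Hne]; [apply Rmax_r|].
    eapply Rle_trans; [apply IH; lia|apply Rmax_l]. }
  destruct Hb as [B [HB Hb]]. exists (B + 2). split; [lra|]. intros k.
  destruct (Nat.lt_ge_cases k N) as [Hk|Hk]; [specialize (Hb k Hk); lra|].
  assert (H1 := HN k Hk). assert (H2 := HN (S k) ltac:(lia)). rewrite Csum_S in H2.
  rewrite <- Cmod_pow, <- Cmod_mult.
  set (S0 := Csum (fun k => a k * Cpow z k)%C k) in *.
  replace (a k * Cpow z k)%C with ((S0 + a k * Cpow z k - l) - (S0 - l))%C by ring.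
  generalize (Cmod_triangle_minus (S0 + a k * Cpow z k - l) (S0 - l)). lra.
Qed.

Lemma Csum_geom_tail (f : nat -> C) B q m : 0 <= B -> 0 <= q < 1 ->
  (forall k, Cmod (f k) <= B * q ^ k) -> forall j, Cmod (Csum f (m + j) - Csum f m) <= B * q ^ m / (1 - q).
Proof.
  intros HB Hq Hf j.
  assert (H : Cmod (Csum f (m + j) - Csum f m) <= B * q ^ m * (1 - q ^ j) / (1 - q)).
  { induction j as [|j IH].
    - rewrite Nat.add_0_r. replace (Csum f m - Csum f m)%C with (RtoC 0) by ring. rewrite Cmod_0. simpl. unfold Rdiv. lra.
    - replace (m + S j)%nat with (S (m + j)) by lia. rewrite Csum_S.
      replace (Csum f (m + j) + f (m + j)%nat - Csum f m)%C with ((Csum f (m + j) - Csum f m) + f (m + j)%nat)%C by ring.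
      eapply Rle_trans; [apply Cmod_triangle|].
      eapply Rle_trans; [apply Rplus_le_compat; [apply IH|apply Hf]|]. right. rewrite pow_add. simpl. field. lra. }
  eapply Rle_trans; [apply H|]. apply Rmult_le_compat_r; [apply Rlt_le, Rinv_0_lt_compat; lra|].
  assert (0 <= q ^ j) by (apply pow_le; lra). assert (0 <= q ^ m) by (apply pow_le; lra).
  rewrite <- (Rmult_1_r (B * q ^ m)) at 2. apply Rmult_le_compat_l; [apply Rmult_le_pos; auto|lra].
Qed.

(** Zeros are isolated: if [m] is the first index with [a m <> 0], the tail is dominated by a
    geometric series of order [m + 1], and [a m z^m] prevails for small [z]. The value [g 0] is left
    free so that punctured neighbourhoods of poles are covered. *)
Lemma pser_dichotomy a (g : C -> C) d : 0 < d -> (forall z, z <> RtoC 0 -> Cmod z < d -> pser a z (g z)) ->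
  (forall k, a k = RtoC 0) \/ exists e, 0 < e /\ forall z, z <> RtoC 0 -> Cmod z < e -> g z <> RtoC 0.
Proof.
  intros Hd H.
  destruct (classic (forall k, a k = RtoC 0)) as [H0|H0]; [now left|right].
  assert (Hm : exists m, a m <> RtoC 0 /\ forall k, (k < m)%nat -> a k = RtoC 0).
  { apply not_all_ex_not in H0. destruct H0 as [n Hn]. revert Hn. induction n as [n IH] using (well_founded_ind Nat.lt_wf_0). intros Hn.
    destruct (classic (forall k, (k < n)%nat -> a k = RtoC 0)) as [Ha|Ha]; [exists n; auto|].
    apply not_all_ex_not in Ha. destruct Ha as [k Hk]. apply imply_to_and in Hk. destruct Hk as [Hk1 Hk2]. eauto. }
  destruct Hm as [m [Ham Hk]].
  set (r := d / 2). assert (Hr : 0 < r) by (unfold r; lra).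
  assert (Hr1 : Cmod (RtoC r) = r) by (apply Cmod_Rpos; lra).
  destruct (pser_terms_bounded a (RtoC r) (g (RtoC r))) as [B [HB Hb]].
  { apply H; [apply Cmod_gt_0; rewrite Hr1; auto|]. rewrite Hr1. unfold r; lra. }
  rewrite Hr1 in Hb.
  assert (HA : 0 < Cmod (a m)) by (apply Cmod_gt_0; auto).
  set (c := Cmod (a m) * r ^ m).
  assert (Hc : 0 < c) by (apply Rmult_lt_0_compat; auto; apply pow_lt; auto).
  (* A zero at [|z| = q r] would force [c <= 2 B q], where [q <= 1/2] bounds the geometric factor by
     [2]; for [q < q0] this is impossible. *)
  set (q0 := Rmin (/ 2) (c / (4 * (B + 1)))).
  assert (Hq0 : 0 < q0) by (apply Rmin_pos; [lra|apply Rdiv_lt_0_compat; lra]).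
  assert (Hq1 : q0 <= / 2) by apply Rmin_l. assert (Hq2 : q0 <= c / (4 * (B + 1))) by apply Rmin_r.
  exists (q0 * r). split; [apply Rmult_lt_0_compat; auto|].
  intros z Hz Hzr Hg.
  assert (Hz0 : 0 < Cmod z) by (apply Cmod_gt_0; auto).
  set (q := Cmod z / r).
  assert (Hq : 0 < q < q0).
  { unfold q. split; [apply Rdiv_lt_0_compat; auto|]. apply Rmult_lt_reg_r with r; auto. unfold Rdiv. rewrite Rmult_assoc, Rinv_l; lra. }
  assert (Ezq : Cmod z = q * r) by (unfold q; field; lra).
  assert (Hz1 := H z Hz ltac:(rewrite Ezq; unfold r in *; nra)). rewrite Hg in Hz1.
  set (f := fun k => (a k * Cpow z k)%C).
  assert (Hf : forall k, Cmod (f k) <= B * q ^ k).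
  { intros k. unfold f. rewrite Cmod_mult, Cmod_pow, Ezq, Rpow_mult_distr. specialize (Hb k).
    assert (0 <= q ^ k) by (apply pow_le; lra). nra. }
  assert (HS : Csum f (S m) = f m).
  { rewrite Csum_S. rewrite (Csum_ext f (fun _ => 0 * 0)%C).
    - rewrite Csum_scal. ring.
    - intros k Hk'. unfold f. rewrite Hk by auto. ring. }
  assert (Hle : Cmod (0 - Csum f (S m)) <= B * q ^ S m / (1 - q)).
  { apply clim_dist_le with (Csum f) (S m); [|exact Hz1]. intros n Hn.
    replace n with (S m + (n - S m))%nat by lia. apply Csum_geom_tail; auto; lra. }
  rewrite HS in Hle. replace (0 - f m)%C with (- f m)%C in Hle by ring. rewrite Cmod_opp in Hle.
  unfold f in Hle. rewrite Cmod_mult, Cmod_pow, Ezq, Rpow_mult_distr in Hle.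
  assert (Hqm : 0 < q ^ m) by (apply pow_lt; lra).
  assert (H2 : c * q ^ m <= 2 * B * q * q ^ m).
  { replace (c * q ^ m) with (Cmod (a m) * (q ^ m * r ^ m)) by (unfold c; ring).
    eapply Rle_trans; [apply Hle|]. simpl.
    apply Rle_trans with (B * (q * q ^ m) * 2); [|lra]. unfold Rdiv. apply Rmult_le_compat_l.
    - apply Rmult_le_pos; auto. apply Rmult_le_pos; lra.
    - rewrite <- (Rinv_inv 2). apply Rinv_le_contravar; lra. }
  apply Rmult_le_reg_r in H2; auto.
  assert (H3 : q0 * (4 * (B + 1)) <= c).
  { apply Rmult_le_reg_r with (/ (4 * (B + 1))); [apply Rinv_0_lt_compat; lra|]. rewrite Rmult_assoc, Rinv_r by lra. rewrite Rmult_1_r. exact Hq2. }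
  nra.
Qed.

Definition zero_near (h : C -> C) (p : C) : Prop := exists e, 0 < e /\ forall s, s <> p -> Cmod (s - p) < e -> h s = RtoC 0.
Definition nonzero_near (h : C -> C) (p : C) : Prop := exists e, 0 < e /\ forall s, s <> p -> Cmod (s - p) < e -> h s <> RtoC 0.

Lemma mero_dichotomy h p : mero h p -> zero_near h p \/ nonzero_near h p.
Proof.
  intros [N [a [d [Hd H]]]].
  assert (Hdz : forall z, z <> RtoC 0 -> (p + z)%C <> p).
  { intros z Hz E. apply Hz. replace z with (p + z - p)%C by ring. rewrite E. ring. }
  assert (Hpz : forall s, s <> p -> (s - p)%C <> RtoC 0) by (intros s Hs; now apply Cminus_eq_contra).
  destruct (pser_dichotomy a (fun z => Cpow z N * h (p + z)%C)%C d Hd) as [H0|[e [He H1]]].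
  - intros z Hz Hzd. specialize (H (p + z)%C (Hdz z Hz)). replace (p + z - p)%C with z in H by ring. auto.
  - left. exists d. split; auto. intros s Hs Hsd. specialize (H s Hs Hsd).
    assert (E : (Cpow (s - p) N * h s)%C = RtoC 0).
    { eapply clim_unique; [apply H|]. apply clim_ext with (fun _ => RtoC 0); [|apply clim_const].
      intros n. rewrite (Csum_ext _ (fun _ => 0 * 0)%C) by (intros; rewrite H0; ring). rewrite Csum_scal. ring. }
    assert (Hpow : Cpow (s - p) N <> RtoC 0) by (apply Cpow_nz; auto).
    apply Cmod_eq_0. apply (f_equal Cmod) in E. rewrite Cmod_mult, Cmod_0 in E.
    apply Cmod_gt_0 in Hpow. destruct (Rmult_integral _ _ E); lra.
  - right. exists e. split; auto. intros s Hs Hse Hh. apply (H1 (s - p)%C); auto.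
    replace (p + (s - p))%C with s by ring. rewrite Hh. ring.
Qed.

Lemma two_near p e : 0 < e -> exists s, s <> p /\ Cmod (s - p) < e.
Proof.
  intros He. exists (p + RtoC (e / 2))%C. 
  assert (E : (p + RtoC (e / 2) - p)%C = RtoC (e / 2)) by ring.
  assert (Em : Cmod (p + RtoC (e / 2) - p) = e / 2) by (rewrite E; apply Cmod_Rpos; lra).
  split; [|rewrite Em; lra]. intros Ep. rewrite Ep in Em. replace (p - p)%C with (RtoC 0) in Em by ring. rewrite Cmod_0 in Em. lra.
Qed.

Lemma zero_nonzero_disjoint h p : zero_near h p -> nonzero_near h p -> False.
Proof.
  intros [e [He H]] [e' [He' H']]. destruct (two_near p (Rmin e e')) as [s [Hs1 Hs2]]; [now apply Rmin_pos|].
  apply (H' s); auto; [|apply H; auto]; (eapply Rlt_le_trans; [apply Hs2|]); [apply Rmin_r|apply Rmin_l].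
Qed.

(** Stated for an arbitrary property of the values, because both alternatives of the dichotomy have
    to be moved to neighbouring points. *)
Lemma near_propagate (Q : C -> Prop) (h : C -> C) p e s :
  (forall s, s <> p -> Cmod (s - p) < e -> Q (h s)) -> s <> p -> Cmod (s - p) < e ->
  exists e', 0 < e' /\ forall w, w <> s -> Cmod (w - s) < e' -> Q (h w).
Proof.
  intros H Hs He. set (d := Cmod (s - p)) in *.
  assert (Hd : 0 < d) by (apply Cmod_gt_0, Cminus_eq_contra; auto).
  exists (Rmin d (e - d)). split; [apply Rmin_pos; lra|]. intros w _ Hw.
  assert (H1 := Rlt_le_trans _ _ _ Hw (Rmin_l _ _)). assert (H2 := Rlt_le_trans _ _ _ Hw (Rmin_r _ _)).
  apply H.
  - intros E. subst w. rewrite Cmod_minus_sym in H1. fold d in H1. lra.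
  - replace (w - p)%C with ((w - s) + (s - p))%C by ring. eapply Rle_lt_trans; [apply Cmod_triangle|]. fold d. lra.
Qed.

(** Connectedness of a segment: with [T] the supremum of the parameters up to which [h] vanishes
    locally, the dichotomy at [g T] gives vanishing there, and propagation excludes [T < X].
    Horizontal segments suffice to reach a right half-plane. *)
Lemma zero_near_propagate_line (h : C -> C) (X : R) s : 0 <= X -> (forall p, mero h p) ->
  zero_near h (s + RtoC X)%C -> zero_near h s.
Proof.
  intros HX Hm H0. set (g := fun t : R => (s + RtoC (X - t))%C).
  assert (Hg : forall t u, Cmod (g t - g u) = Rabs (t - u)).
  { intros t u. unfold g. replace (s + RtoC (X - t) - (s + RtoC (X - u)))%C with (RtoC (u - t)) by (rewrite !RtoC_minus; ring).
    rewrite Cmod_R. apply Rabs_minus_sym. }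
  assert (Hgne : forall t u, t <> u -> g t <> g u).
  { intros t u Htu E. specialize (Hg t u). rewrite E in Hg. replace (g u - g u)%C with (RtoC 0) in Hg by ring. rewrite Cmod_0 in Hg.
    symmetry in Hg. apply Rabs_eq_0 in Hg. lra. }
  set (E := fun t => 0 <= t <= X /\ forall u, 0 <= u <= t -> zero_near h (g u)).
  assert (E0 : E 0).
  { split; [lra|]. intros u Hu. replace u with 0 by lra. unfold g. rewrite Rminus_0_r. exact H0. }
  destruct (completeness E) as [T [HT1 HT2]].
  { exists X. intros t [Ht _]. lra. }
  { exists 0; auto. }
  assert (HT0 : 0 <= T) by (apply HT1; auto).
  assert (HTX : T <= X) by (apply HT2; intros t [Ht _]; lra).
  assert (Hbelow : forall u, 0 <= u < T -> zero_near h (g u)).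
  { intros u Hu. destruct (classic (exists t, E t /\ u < t)) as [[t [[_ Ht] Hut]]|Hn]; [apply Ht; lra|].
    exfalso. assert (T <= u); [|lra]. apply HT2. intros t Ht. apply Rnot_lt_le. intros Hlt. apply Hn. eauto. }
  assert (HZT : zero_near h (g T)).
  { destruct (mero_dichotomy h (g T) (Hm _)) as [|[e [He Hnz]]]; auto. exfalso.
    destruct (Req_dec T 0) as [->|HTn].
    - apply (zero_nonzero_disjoint h (g 0)); [apply E0; lra|exists e; auto].
    - set (u := Rmax 0 (T - e / 2)). 
      assert (Hu : 0 <= u < T) by (unfold u; split; [apply Rmax_l|apply Rmax_lub_lt; lra]).
      assert (HuT : Rabs (u - T) < e).
      { assert (T - e / 2 <= u) by apply Rmax_r. apply Rabs_lt_between. lra. }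
      apply (zero_nonzero_disjoint h (g u)); [apply Hbelow; auto|].
      apply (near_propagate (fun x => x <> RtoC 0) h (g T) e); auto; [apply Hgne; lra|rewrite Hg; auto]. }
  destruct (Rle_lt_or_eq_dec T X HTX) as [Hlt| ->].
  - exfalso. destruct HZT as [e [He Hz]].
    set (t := Rmin X (T + e / 2)).
    assert (Ht : T < t) by (unfold t; apply Rmin_glb_lt; lra).
    assert (Ht2 : t <= T + e / 2) by apply Rmin_r. assert (Ht3 : t <= X) by apply Rmin_l.
    assert (E t); [|assert (t <= T) by (apply HT1; auto); lra].
    split; [lra|]. intros u Hu. destruct (Rtotal_order u T) as [H1|[->|H1]].
    + apply Hbelow; lra.
    + exists e; auto.
    + apply (near_propagate (fun x => x = RtoC 0) h (g T) e); auto; [apply Hgne; lra|rewrite Hg; apply Rabs_lt_between; lra].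
  - unfold g in HZT. replace (s + RtoC (X - X))%C with s in HZT by (rewrite Rminus_diag; ring). exact HZT.
Qed.

Lemma ana_zero_near h p : ana h p -> zero_near h p -> h p = RtoC 0.
Proof.
  intros [a [d [Hd H]]] Hz.
  assert (Hp : pser a 0 (h p)).
  { specialize (H p). replace (p - p)%C with (RtoC 0) in H by ring. apply H. rewrite Cmod_0; auto. }
  destruct (pser_dichotomy a (fun z => h (p + z)%C) d Hd) as [H0|[e [He H1]]].
  - intros z _ Hzd. specialize (H (p + z)%C). replace (p + z - p)%C with z in H by ring. auto.
  - eapply clim_unique; [apply Hp|]. apply clim_ext with (fun _ => RtoC 0); [|apply clim_const].
    intros n. rewrite (Csum_ext _ (fun _ => 0 * 0)%C) by (intros; rewrite H0; ring). rewrite Csum_scal. ring.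
  - exfalso. apply (zero_nonzero_disjoint h p Hz). exists e. split; auto. intros s Hs Hse.
    specialize (H1 (s - p)%C). replace (p + (s - p))%C with s in H1 by ring. apply H1; auto. now apply Cminus_eq_contra.
Qed.

(** The function picked by [epsilon] agrees with [f] far to the right. The difference is
    meromorphic, so it vanishes near [s], and analyticity of both at [s] carries this over to the
    value at [s]. *)
Lemma mero_continuation_eq f0 sigma f s :
  is_mero_continuation f0 sigma f -> ana f s -> mero_continuation f0 sigma s = f s.
Proof.
  intros [Hm Hf] Ha.
  assert (Hex : exists v, exists f, is_mero_continuation f0 sigma f /\ analytic_at f s /\ f s = v).
  { exists (f s), f. split; [split; auto|]. split; auto. now apply ana_iff. }
  destruct (epsilon_spec (inhabits (RtoC 0)) _ Hex) as [g [[Gm Gf] [Ga Gs]]].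
  unfold mero_continuation. rewrite <- Gs. apply ana_iff in Ga.
  set (h := fun w => (g w + (- (1)) * f w)%C).
  assert (h s = RtoC 0).
  { apply ana_zero_near; [apply ana_plus; [auto|now apply ana_scal]|].
    set (X := Rabs (sigma - Re s) + 1).
    assert (HX : Re s + X > sigma) by (unfold X; generalize (Rle_abs (sigma - Re s)); lra).
    apply zero_near_propagate_line with X.
    - unfold X. generalize (Rabs_pos (sigma - Re s)); lra.
    - intros p. apply mero_plus; [apply mero_iff, Gm|apply mero_scal, mero_iff, Hm].
    - exists (Re s + X - sigma). split; [lra|]. intros w _ Hw. unfold h.
      assert (Hr := re_le_Cmod (w - (s + RtoC X))). rewrite Re_minus, Re_plus in Hr. simpl in Hr.
      apply Rabs_le_between in Hr. rewrite Gf, Hf by lra. ring. }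
  unfold h in H. replace (g s) with ((g s + (- (1)) * f s) + f s)%C by ring. rewrite H. ring.
Qed.

(** * Analyticity of parameter integrals and of their sums *)

Lemma Csum_exchange (f : nat -> nat -> C) n K :
  Csum (fun i => Csum (f i) K) n = Csum (fun k => Csum (fun i => f i k) n) K.
Proof.
  induction n as [|n IH].
  - rewrite Csum_0. rewrite (Csum_ext _ (fun _ => 0 * 0)%C) by (intros; rewrite Csum_0; ring). rewrite Csum_scal. ring.
  - rewrite Csum_S, IH, <- Csum_plus. apply Csum_ext. intros; now rewrite Csum_S.
Qed.

Lemma Cmod_Csum_le (f : nat -> C) (V : nat -> R) n : (forall i, Cmod (f i) <= V (S i) - V i) -> Cmod (Csum f n) <= V n - V O.
Proof.
  intros H. induction n as [|n IH]; [rewrite Csum_0, Cmod_0; lra|].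
  rewrite Csum_S. eapply Rle_trans; [apply Cmod_triangle|]. specialize (H n). lra.
Qed.

Lemma pow_lt_eps q B eps : 0 <= q < 1 -> 0 < eps -> exists N, forall n, (N <= n)%nat -> B * q ^ n < eps.
Proof.
  intros Hq He. destruct (pow_lt_1_zero q ltac:(rewrite Rabs_pos_eq; lra) (eps / (Rabs B + 1))) as [N HN].
  { apply Rdiv_lt_0_compat; auto. generalize (Rabs_pos B); lra. }
  exists N. intros n Hn. specialize (HN n Hn). assert (HB := Rabs_pos B).
  assert (0 <= q ^ n) by (apply pow_le; lra). rewrite Rabs_pos_eq in HN by auto.
  apply Rle_lt_trans with ((Rabs B + 1) * q ^ n).
  - apply Rmult_le_compat_r; auto. generalize (Rle_abs B); lra.
  - apply Rmult_lt_reg_r with (/ (Rabs B + 1)); [apply Rinv_0_lt_compat; lra|].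
    rewrite (Rmult_comm (Rabs B + 1)), Rmult_assoc, Rinv_r, Rmult_1_r by lra. exact HN.
Qed.

Lemma pser_cder f p (a : nat -> C) d : 0 < d -> (forall s, Cmod (s - p) < d -> pser a (s - p)%C (f s)) -> cder f p (a 1%nat).
Proof.
  intros Hd H. set (r := d / 2). assert (Hr : 0 < r) by (unfold r; lra).
  assert (Hr1 : Cmod (RtoC r) = r) by (apply Cmod_Rpos; lra).
  assert (E1 : (p + RtoC r - p)%C = RtoC r) by ring.
  destruct (pser_terms_bounded a (RtoC r) (f (p + RtoC r)%C)) as [B [HB Hb]].
  { assert (HH := H (p + RtoC r)%C). rewrite E1, Hr1 in HH. apply HH. unfold r; lra. }
  rewrite Hr1 in Hb.
  assert (Hfp : f p = a O).
  { assert (Hp := H p). replace (p - p)%C with (RtoC 0) in Hp by ring. rewrite Cmod_0 in Hp.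
    eapply clim_unique; [apply (Hp Hd)|]. apply clim_shift, clim_ext with (fun _ => a O); [|apply clim_const].
    intros n. rewrite Csum_Sl, (Csum_ext _ (fun _ => 0 * 0)%C) by (intros; simpl; ring). rewrite Csum_scal. simpl. ring. }
  apply cder_quad with (d := r / 2) (B := 2 * B / r ^ 2); [lra|].
  intros h Hh. set (q := Cmod h / r).
  assert (Hq : 0 <= q < / 2).
  { unfold q. split; [apply Rmult_le_pos; [apply Cmod_ge_0|apply Rlt_le, Rinv_0_lt_compat; auto]|].
    apply Rmult_lt_reg_r with r; auto. unfold Rdiv. rewrite Rmult_assoc, Rinv_l; lra. }
  assert (Ehq : Cmod h = q * r) by (unfold q; field; lra).
  assert (E2 : (p + h - p)%C = h) by ring.
  assert (Hph : pser a h (f (p + h)%C)).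
  { assert (HH := H (p + h)%C). rewrite E2 in HH. apply HH. unfold r in *; lra. }
  set (g := fun k => (a k * Cpow h k)%C).
  assert (Hf : forall k, Cmod (g k) <= B * q ^ k).
  { intros k. unfold g. rewrite Cmod_mult, Cmod_pow, Ehq, Rpow_mult_distr. specialize (Hb k).
    assert (0 <= q ^ k) by (apply pow_le; lra). nra. }
  replace (f (p + h)%C - f p - h * a 1%nat)%C with (f (p + h)%C - Csum g 2)%C.
  2:{ rewrite !Csum_S, Csum_0, Hfp. unfold g. simpl. ring. }
  apply Rle_trans with (B * q ^ 2 / (1 - q)).
  - apply clim_dist_le with (Csum g) 2%nat; [|exact Hph]. intros n Hn.
    replace n with (2 + (n - 2))%nat by lia. apply Csum_geom_tail; auto; lra.
  - replace (2 * B / r ^ 2 * Cmod h ^ 2) with (B * q ^ 2 * 2) by (rewrite Ehq; field; lra).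
    unfold Rdiv. apply Rmult_le_compat_l; [apply Rmult_le_pos; [auto|apply pow2_ge_0]|].
    rewrite <- (Rinv_inv 2). apply Rinv_le_contravar; lra.
Qed.

(** Weierstrass' theorem at the level of coefficients. The Taylor remainders of all [J n] on a
    common disc are geometric in [K] with a summable factor [V (S n) - V n], which permits summing
    over [n] first. The case [k = 1] is termwise differentiation, used for [zeta']. *)
Lemma ana_sum (J : nat -> C -> C) (p : C) (rho : R) (c : nat -> nat -> C) (V : nat -> R) (L : R) :
  0 < rho -> (forall n, V n <= L) ->
  (forall n k, Cmod (c n k) * rho ^ k <= V (S n) - V n) ->
  (forall n s q K, 0 <= q <= 1 -> Cmod (s - p) = q * rho ->
     Cmod (J n s - Csum (fun k => c n k * Cpow (s - p) k) K)%C <= (V (S n) - V n) * q ^ K) ->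
  exists (F : C -> C) (S : nat -> C),
    (forall s, Cmod (s - p) < rho -> clim (Csum (fun n => J n s)) (F s) /\ pser S (s - p)%C (F s)) /\
    (forall k, clim (Csum (fun n => c n k)) (S k)) /\
    (forall n, cder (J n) p (c n 1%nat)).
Proof.
  intros Hrho HV Hc HJ.
  assert (HF : forall s, exists l, Cmod (s - p) < rho -> clim (Csum (fun n => J n s)) l).
  { intros s. destruct (Rlt_dec (Cmod (s - p)) rho) as [Hs|Hs]; [|exists (RtoC 0); intros; lra].
    destruct (Csum_dominated (fun n => J n s) V L) as [l [Hl _]]; auto; [|exists l; auto].
    intros n. assert (H0 := Cmod_ge_0 (s - p)).
    specialize (HJ n s (Cmod (s - p) / rho) O). rewrite Csum_0 in HJ. replace (J n s - 0)%C with (J n s) in HJ by ring.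
    rewrite pow_O, Rmult_1_r in HJ. apply HJ; [|field; lra]. split.
    - apply Rmult_le_pos; [auto|apply Rlt_le, Rinv_0_lt_compat; auto].
    - apply Rmult_le_reg_r with rho; auto. unfold Rdiv. rewrite Rmult_assoc, Rinv_l; lra. }
  assert (HS : forall k, exists l, clim (Csum (fun n => c n k)) l).
  { intros k. assert (Hp : 0 < rho ^ k) by (apply pow_lt; auto).
    destruct (Csum_dominated (fun n => c n k) (fun n => V n / rho ^ k) (L / rho ^ k)) as [l [Hl _]].
    - intros n. apply Rmult_le_reg_r with (rho ^ k); auto. eapply Rle_trans; [apply Hc|]. right; field; lra.
    - intros n. apply Rmult_le_compat_r; [apply Rlt_le, Rinv_0_lt_compat; auto|apply HV].
    - exists l; auto. }
  destruct (fun_choice _ _ _ HF) as [F HF']. destruct (fun_choice _ _ _ HS) as [T HT].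
  exists F, T. split; [|split; auto].
  - intros s Hs. split; [auto|].
    assert (H0 := Cmod_ge_0 (s - p)). set (q := Cmod (s - p) / rho).
    assert (Hq : 0 <= q < 1).
    { unfold q. split; [apply Rmult_le_pos; [auto|apply Rlt_le, Rinv_0_lt_compat; auto]|].
      apply Rmult_lt_reg_r with rho; auto. unfold Rdiv. rewrite Rmult_assoc, Rinv_l; lra. }
    assert (Eq : Cmod (s - p) = q * rho) by (unfold q; field; lra).
    intros eps He. destruct (pow_lt_eps q (L - V O) eps Hq He) as [N HN]. exists N. intros K HK.
    eapply Rle_lt_trans; [|apply (HN K HK)]. rewrite Cmod_minus_sym.
    apply clim_dist_le with (u := fun n => (Csum (fun i => J i s) n - Csum (fun k => Csum (fun i => c i k) n * Cpow (s - p) k) K +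
      Csum (fun k => T k * Cpow (s - p) k) K)%C) (N := O).
    + intros n _. match goal with |- Cmod ?X <= _ => replace X with (Csum (fun i => J i s - Csum (fun k => c i k * Cpow (s - p) k) K) n)%C end.
      * apply Rle_trans with (V n * q ^ K - V O * q ^ K).
        -- apply (Cmod_Csum_le _ (fun n => V n * q ^ K)). intros i.
           replace (V (S i) * q ^ K - V i * q ^ K) with ((V (S i) - V i) * q ^ K) by ring. apply HJ; auto. lra.
        -- assert (0 <= q ^ K) by (apply pow_le; lra). specialize (HV n). nra.
      * rewrite Csum_minus, Csum_exchange.
        rewrite (Csum_ext (fun k => Csum (fun i => c i k * Cpow (s - p) k)%C n) (fun k => Csum (fun i => c i k) n * Cpow (s - p) k)%C).
        -- ring.
        -- intros k _. rewrite (Csum_ext _ (fun i => Cpow (s - p) k * c i k)%C) by (intros; ring). rewrite Csum_scal. ring.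
    + replace (F s) with (F s - Csum (fun k => T k * Cpow (s - p) k) K + Csum (fun k => T k * Cpow (s - p) k) K)%C at 1 by ring.
      apply clim_plus; [|apply clim_const]. apply clim_minus; [apply HF', Hs|].
      apply clim_Csum. intros k _.
      apply clim_ext with (fun n => Cpow (s - p) k * Csum (fun i => c i k) n)%C; [intros; ring|].
      rewrite Cmult_comm. apply clim_scal, HT.
  - intros n. apply (pser_cder (J n) p (c n) rho Hrho). intros s Hs.
    assert (H0 := Cmod_ge_0 (s - p)). set (q := Cmod (s - p) / rho).
    assert (Hq : 0 <= q < 1).
    { unfold q. split; [apply Rmult_le_pos; [auto|apply Rlt_le, Rinv_0_lt_compat; auto]|].
      apply Rmult_lt_reg_r with rho; auto. unfold Rdiv. rewrite Rmult_assoc, Rinv_l; lra. }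
    assert (Eq : Cmod (s - p) = q * rho) by (unfold q; field; lra).
    intros eps He. destruct (pow_lt_eps q (V (S n) - V n) eps Hq He) as [N HN]. exists N. intros K HK.
    rewrite Cmod_minus_sym. eapply Rle_lt_trans; [apply HJ|apply HN, HK]; [lra|auto].
Qed.

(** Expand [exp ((s - p) lm t)] under the integral. Of the allowance [exp (2 rho |lm|)] one half
    absorbs [(rho |lm|)^k / k!] and the other the exponential in the remainder. Applied with
    [lm = - ln] of a shifted variable for [zeta] and with [lm = ln] for the Mellin transform. *)
Lemma analytic_piece (g : R -> C) (lm : R -> R) al be p rho U :
  al < be -> 0 < rho ->
  (forall t, al <= t <= be -> ccont g t) ->
  (forall t, al <= t <= be -> exists l, is_derive lm t l) ->
  (forall t, al <= t <= be -> Cmod (g t) * (exp (Re p * lm t) * exp (2 * rho * Rabs (lm t))) * (be - al) <= U) ->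
  exists c : nat -> C, (forall k, Cmod (c k) * rho ^ k <= U) /\
    forall s, exists I, cint (fun t => g t * Cexp (s * RtoC (lm t)))%C al be I /\
      forall q K, 0 <= q <= 1 -> Cmod (s - p) = q * rho ->
      Cmod (I - Csum (fun k => c k * Cpow (s - p) k) K)%C <= U * q ^ K.
Proof.
  intros Hab Hrho Hg Hl HU.
  assert (Hmm : forall t, Rmin al be <= t <= Rmax al be -> al <= t <= be) by (rewrite Rmin_left, Rmax_right by lra; auto).
  assert (HE : forall s t, al <= t <= be -> ccont (fun t => Cexp (s * RtoC (lm t)))%C t).
  { intros s t Ht. destruct (Hl t Ht) as [l Hlt]. eapply rder_ccont.
    apply (rder_comp_C Cexp (fun t => s * RtoC (lm t))%C); [apply cder_Cexp|]. apply rder_scal, rder_RtoC, Hlt. }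
  assert (Hlc : forall t, al <= t <= be -> continuous lm t).
  { intros t Ht. destruct (Hl t Ht) as [l Hlt]. apply (ex_derive_continuous lm). now exists l. }
  assert (HcI : forall k, exists I, cint (fun t => g t * Cexp (p * RtoC (lm t)) * (RtoC (/ INR (fact k)) * Cpow (RtoC (lm t)) k))%C al be I).
  { intros k. apply ex_cint. intros t Ht. apply Hmm in Ht.
    apply ccont_mult; [apply ccont_mult; auto|]. apply ccont_scal.
    induction k as [|k IH]; [apply ccont_const|]. apply ccont_mult; [apply ccont_RtoC; auto|exact IH]. }
  destruct (fun_choice _ _ _ HcI) as [c Hc]. exists c. split.
  - intros k. assert (Hp : 0 < rho ^ k) by (apply pow_lt; auto).
    apply Rmult_le_reg_r with (/ rho ^ k); [apply Rinv_0_lt_compat; auto|]. rewrite Rmult_assoc, Rinv_r, Rmult_1_r by lra.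
    replace (U * / rho ^ k) with (U / (be - al) / rho ^ k * (be - al)) by (field; lra).
    eapply cint_bound_const; [lra| |apply Hc]. intros t Ht. cbv beta.
    specialize (HU t Ht). rewrite !Cmod_mult, Cmod_Cexp, Cmod_pow, !Cmod_R.
    rewrite re_scal_r. rewrite (Rabs_pos_eq (/ _)) by (apply Rlt_le, Rinv_0_lt_compat, INR_fact_lt_0).
    set (A := Rabs (lm t)) in *. assert (HA : 0 <= A) by apply Rabs_pos.
    assert (Hpf := pow_le_fact_exp k (rho * A) ltac:(nra)). rewrite Rpow_mult_distr in Hpf.
    assert (Hexp : exp (rho * A) <= exp (2 * rho * A)) by (apply exp_le_mono; nra).
    assert (Hf := INR_fact_lt_0 k). assert (Hg0 := Cmod_ge_0 (g t)). assert (He := exp_pos (Re p * lm t)).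
    apply Rle_trans with (Cmod (g t) * exp (Re p * lm t) * (exp (2 * rho * A) / rho ^ k)).
    + apply Rmult_le_compat_l; [apply Rmult_le_pos; lra|].
      apply Rmult_le_reg_r with (INR (fact k) * rho ^ k); [apply Rmult_lt_0_compat; auto|].
      replace (/ INR (fact k) * A ^ k * (INR (fact k) * rho ^ k)) with (rho ^ k * A ^ k) by (field; lra).
      replace (exp (2 * rho * A) / rho ^ k * (INR (fact k) * rho ^ k)) with (INR (fact k) * exp (2 * rho * A)) by (field; lra). nra.
    + apply Rmult_le_reg_r with ((be - al) * rho ^ k); [apply Rmult_lt_0_compat; lra|].
      replace (U / (be - al) / rho ^ k * ((be - al) * rho ^ k)) with U by (field; lra).
      eapply Rle_trans; [|apply HU]. right; field; lra.
  - intros s. destruct (ex_cint (fun t => g t * Cexp (s * RtoC (lm t)))%C al be) as [I HI].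
    { intros t Ht. apply Hmm in Ht. apply ccont_mult; auto. }
    exists I. split; auto. intros q K Hq Hs.
    set (z := (s - p)%C) in *.
    assert (HS : cint (fun t => g t * Cexp (s * RtoC (lm t)) - g t * Cexp (p * RtoC (lm t)) * Cexp_partial (z * RtoC (lm t)) K)%C al be
      (I - Csum (fun k => c k * Cpow z k) K)%C).
    { apply cint_minus; auto. unfold Cexp_partial. clear - Hc. induction K as [|K IH].
      - rewrite Csum_0. assert (H0 := cint_scal 0 _ _ _ _ (Hc O)). rewrite Cmult_0_l in H0.
        eapply cint_ext; [|apply H0]. intros; cbv beta; rewrite Csum_0; ring.
      - rewrite Csum_S. apply cint_ext with (fun t => g t * Cexp (p * RtoC (lm t)) * Csum (fun k => RtoC (/ INR (fact k)) * Cpow (z * RtoC (lm t)) k) K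
          + Cpow z K * (g t * Cexp (p * RtoC (lm t)) * (RtoC (/ INR (fact K)) * Cpow (RtoC (lm t)) K)))%C.
        + intros t _. rewrite Csum_S, Cpow_mult_l. ring.
        + apply cint_plus; auto. rewrite (Cmult_comm (c K)). apply cint_scal, Hc. }
    replace (U * q ^ K) with (U / (be - al) * q ^ K * (be - al)) by (field; lra).
    eapply cint_bound_const; [lra| |apply HS]. intros t Ht. cbv beta. specialize (HU t Ht).
    replace (g t * Cexp (s * RtoC (lm t)) - g t * Cexp (p * RtoC (lm t)) * Cexp_partial (z * RtoC (lm t)) K)%C with
      (g t * Cexp (p * RtoC (lm t)) * (Cexp (z * RtoC (lm t)) - Cexp_partial (z * RtoC (lm t)) K))%C.
    2:{ replace (s * RtoC (lm t))%C with (p * RtoC (lm t) + z * RtoC (lm t))%C by (unfold z; ring). rewrite Cexp_plus. ring. }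
    assert (HR := Cexp_remainder (z * RtoC (lm t)) K).
    rewrite !Cmod_mult, Cmod_Cexp, re_scal_r. rewrite !Cmod_mult, !Cmod_R, Hs in HR.
    set (A := Rabs (lm t)) in *. assert (HA : 0 <= A) by apply Rabs_pos.
    assert (Hpf := pow_le_fact_exp K (rho * A) ltac:(nra)).
    assert (Hf := INR_fact_lt_0 K). assert (Hg0 := Cmod_ge_0 (g t)). assert (He := exp_pos (Re p * lm t)).
    assert (HqK : 0 <= q ^ K) by (apply pow_le; lra).
    assert (HrA : 0 <= rho * A) by (apply Rmult_le_pos; lra).
    assert (Hexp : exp (q * rho * A) <= exp (rho * A)) by (apply exp_le_mono; nra).
    assert (H1 : (q * rho * A) ^ K / INR (fact K) * exp (q * rho * A) <= q ^ K * exp (2 * rho * A)).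
    { replace (q * rho * A) with (q * (rho * A)) at 1 by ring. rewrite Rpow_mult_distr.
      replace (2 * rho * A) with (rho * A + rho * A) by ring. rewrite exp_plus.
      unfold Rdiv. rewrite !Rmult_assoc. apply Rmult_le_compat_l; auto. rewrite <- Rmult_assoc.
      apply Rmult_le_compat; [apply Rmult_le_pos; [apply pow_le; nra|apply Rlt_le, Rinv_0_lt_compat; auto]|apply Rlt_le, exp_pos| |replace (q * (rho * A)) with (q * rho * A) by ring; exact Hexp].
      apply Rmult_le_reg_r with (INR (fact K)); auto. rewrite Rmult_assoc, Rinv_l by lra. lra. }
    eapply Rle_trans; [apply Rmult_le_compat_l; [apply Rmult_le_pos; lra|eapply Rle_trans; [apply HR|apply H1]]|].
    apply Rmult_le_reg_r with (be - al); [lra|].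
    replace (U / (be - al) * q ^ K * (be - al)) with (U * q ^ K) by (field; lra).
    replace (Cmod (g t) * exp (Re p * lm t) * (q ^ K * exp (2 * rho * A)) * (be - al)) with
      (Cmod (g t) * (exp (Re p * lm t) * exp (2 * rho * A)) * (be - al) * q ^ K) by ring.
    apply Rmult_le_compat_r; auto.
Qed.

Lemma clim_geom (x : C) : Cmod x < 1 -> clim (fun n => Cpow x n) 0.
Proof.
  intros Hx eps He. assert (H0 := Cmod_ge_0 x).
  destruct (pow_lt_eps (Cmod x) 1 eps ltac:(lra) He) as [N HN].
  exists N. intros n Hn. replace (Cpow x n - 0)%C with (Cpow x n) by ring. rewrite Cmod_pow.
  specialize (HN n Hn). lra.
Qed.

Lemma clim_n_geom (x : C) : Cmod x < 1 -> clim (fun n => RtoC (INR n) * Cpow x n)%C 0.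
Proof.
  intros Hx eps He. assert (H0 := Cmod_ge_0 x).
  (* [q] lies between [|x|] and [1], and [1/4] keeps the divisor positive for [x = 0]. The ratio
     [1 + h] of [q] to that divisor exceeds [1], and [(1 + h)^n >= 1 + n h] beats the factor [n]. *)
  set (q := (Cmod x + 1) / 2). set (h := q / Rmax (Cmod x) (/ 4) - 1).
  assert (Hm : 0 < Rmax (Cmod x) (/ 4)) by (generalize (Rmax_r (Cmod x) (/ 4)); lra).
  assert (Hm1 : Rmax (Cmod x) (/ 4) < q) by (unfold q; apply Rmax_lub_lt; lra).
  assert (Hh : 0 < h).
  { unfold h. apply Rmult_lt_reg_r with (Rmax (Cmod x) (/ 4)); auto. field_simplify; lra. }
  destruct (pow_lt_eps q (/ h) eps ltac:(unfold q; lra) He) as [N HN].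
  exists N. intros n Hn. specialize (HN n Hn).
  replace (RtoC (INR n) * Cpow x n - 0)%C with (RtoC (INR n) * Cpow x n)%C by ring.
  rewrite Cmod_mult, Cmod_pow, Cmod_Rpos by apply pos_INR.
  eapply Rle_lt_trans; [|apply HN].
  set (m := Rmax (Cmod x) (/ 4)) in *.
  assert (H1 : Cmod x ^ n <= m ^ n) by (apply pow_incr; split; auto; apply Rmax_l).
  assert (Eq : q = m * (1 + h)) by (unfold h; field; lra).
  assert (H2 : 1 + INR n * h <= (1 + h) ^ n).
  { clear - Hh. induction n as [|n IH]; [simpl; lra|]. rewrite S_INR. simpl. assert (H := pos_INR n). nra. }
  rewrite Eq, Rpow_mult_distr. assert (Hmn : 0 < m ^ n) by (apply pow_lt; auto).
  apply Rmult_le_reg_l with h; auto. rewrite <- Rmult_assoc.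
  replace (h * (/ h * (m ^ n * (1 + h) ^ n))) with (m ^ n * (1 + h) ^ n) by (field; lra).
  assert (H3 := pos_INR n). apply Rle_trans with (h * INR n * m ^ n); [apply Rmult_le_compat_l; [nra|auto]|]. nra.
Qed.

Lemma small_ratio c p s : p <> c -> Cmod (s - p) < Cmod (c - p) -> Cmod ((s - p) / (c - p)) < 1 /\ (c - p)%C <> RtoC 0 /\ (c - s)%C <> RtoC 0.
Proof.
  intros Hp Hs. assert (Hcp : (c - p)%C <> RtoC 0) by (apply Cminus_eq_contra; auto).
  assert (Hm : 0 < Cmod (c - p)) by (apply Cmod_gt_0; auto). split; [|split; auto].
  - rewrite Cmod_div by auto. apply Rmult_lt_reg_r with (Cmod (c - p)); auto. unfold Rdiv. rewrite Rmult_assoc, Rinv_l; lra.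
  - intros E. replace (s - p)%C with ((c - p) - (c - s))%C in Hs by ring. rewrite E in Hs.
    replace (c - p - 0)%C with (c - p)%C in Hs by ring. lra.
Qed.

Lemma Cpow_div (z w : C) k : w <> RtoC 0 -> Cpow (z / w) k = (Cpow z k / Cpow w k)%C.
Proof. intros Hw. unfold Cdiv. rewrite Cpow_mult_l, Cpow_inv; auto. Qed.

Lemma ana_inv_lin c p : p <> c -> ana (fun s => / (c - s))%C p.
Proof.
  intros Hp. exists (fun k => / (c - p) * / Cpow (c - p) k)%C, (Cmod (c - p)).
  split; [apply Cmod_gt_0, Cminus_eq_contra; auto|].
  intros s Hs. destruct (small_ratio c p s Hp Hs) as [Hx [Hcp Hcs]]. set (x := ((s - p) / (c - p))%C) in *.
  assert (E1 : (1 - x)%C <> RtoC 0).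
  { intros E. apply Hcs. replace (c - s)%C with ((c - p) * (1 - x))%C by (unfold x; field; auto). rewrite E; ring. }
  apply clim_ext with (fun n => / (c - s) - / (c - s) * Cpow x n)%C.
  - intros n. rewrite (Csum_ext _ (fun k => / (c - p) * Cpow x k)%C).
    + rewrite Csum_scal. assert (E : Csum (fun k => Cpow x k) n = ((1 - Cpow x n) / (1 - x))%C).
      { induction n as [|n IH]; [rewrite Csum_0; simpl; field; auto|]. rewrite Csum_S, IH. simpl. field; auto. }
      change (fun k => Cpow x k) with (Cpow x) in E. rewrite E. replace (/ (c - s))%C with (/ ((c - p) * (1 - x)))%C by (unfold x; f_equal; field; auto). field. auto.
    + intros k _. unfold x. rewrite Cpow_div by auto. unfold Cdiv. ring.
  - replace (/ (c - s))%C with (/ (c - s) - / (c - s) * 0)%C at 1 by ring.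
    apply clim_minus; [apply clim_const|]. apply clim_scal, clim_geom, Hx.
Qed.

(** For the double poles which the logarithm of [K_0] produces in the Mellin transform. *)
Lemma ana_inv_lin_sq c p : p <> c -> ana (fun s => / ((c - s) * (c - s)))%C p.
Proof.
  intros Hp. exists (fun k => / ((c - p) * (c - p)) * (RtoC (INR k + 1) * / Cpow (c - p) k))%C, (Cmod (c - p)).
  split; [apply Cmod_gt_0, Cminus_eq_contra; auto|].
  intros s Hs. destruct (small_ratio c p s Hp Hs) as [Hx [Hcp Hcs]]. set (x := ((s - p) / (c - p))%C) in *.
  assert (E1 : (1 - x)%C <> RtoC 0).
  { intros E. apply Hcs. replace (c - s)%C with ((c - p) * (1 - x))%C by (unfold x; field; auto). rewrite E; ring. }
  set (D := (/ ((c - s) * (c - s)))%C).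
  apply clim_ext with (fun n => D - (D * Cpow x n + D * (1 - x) * (RtoC (INR n) * Cpow x n)))%C.
  - intros n. rewrite (Csum_ext _ (fun k => / ((c - p) * (c - p)) * (RtoC (INR k + 1) * Cpow x k))%C).
    + rewrite Csum_scal.
      assert (E : Csum (fun k => RtoC (INR k + 1) * Cpow x k)%C n = ((1 - Cpow x n - (1 - x) * (RtoC (INR n) * Cpow x n)) / ((1 - x) * (1 - x)))%C).
      { induction n as [|n IH]; [rewrite Csum_0; simpl; field; auto|]. rewrite Csum_S, IH, S_INR, !RtoC_plus. simpl. field; auto. }
      rewrite E. unfold D. replace (/ ((c - s) * (c - s)))%C with (/ (((c - p) * (1 - x)) * ((c - p) * (1 - x))))%C by (unfold x; f_equal; field; auto). field. auto.
    + intros k _. unfold x. rewrite Cpow_div by auto. unfold Cdiv. ring.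
  - replace D with (D - (D * 0 + D * (1 - x) * 0))%C at 1 by ring.
    apply clim_minus; [apply clim_const|]. apply clim_plus; apply clim_scal; [apply clim_geom, Hx|apply clim_n_geom, Hx].
Qed.

Lemma mero_inv_lin c p : mero (fun s => / (c - s))%C p.
Proof.
  destruct (classic (p = c)) as [->|Hp]; [|now apply ana_mero, ana_inv_lin].
  exists 1%nat, (fun k => match k with O => (- (1))%C | _ => RtoC 0 end), 1. split; [lra|].
  intros s Hs _. eapply pser_eq; [apply pser_const|]. simpl. field. now apply Cminus_eq_contra, not_eq_sym.
Qed.

Lemma mero_inv_lin_sq c p : mero (fun s => / ((c - s) * (c - s)))%C p.
Proof.
  destruct (classic (p = c)) as [->|Hp]; [|now apply ana_mero, ana_inv_lin_sq].
  exists 2%nat, (fun k => match k with O => RtoC 1 | _ => RtoC 0 end), 1. split; [lra|].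
  intros s Hs _. eapply pser_eq; [apply pser_const|]. simpl. field. now apply Cminus_eq_contra, not_eq_sym.
Qed.

Lemma clim_CSeries u l : clim (Csum u) l -> CSeries u = l.
Proof.
  intros H. apply clim_shift' in H.
  assert (E : forall n, Csum u (S n) = (sum_n (fun k => Re (u k)) n, sum_n (fun k => Im (u k)) n)).
  { induction n as [|n IH].
    - rewrite Csum_S, Csum_0, !sum_O. apply C_eq; [rewrite Re_plus|rewrite Im_plus]; simpl; ring.
    - rewrite Csum_S, IH, !sum_Sn. apply C_eq; [rewrite Re_plus|rewrite Im_plus]; reflexivity. }
  unfold CSeries. apply C_eq.
  - simpl. apply is_series_unique. intros P [eps HP]. destruct (H eps (cond_pos eps)) as [N HN].
    exists N. intros n Hn. apply HP. specialize (HN n Hn). rewrite E in HN.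
    change (Rabs (sum_n (fun k => Re (u k)) n - Re l) < eps).
    eapply Rle_lt_trans; [|apply HN]. eapply Rle_trans; [|apply re_le_Cmod]. rewrite Re_minus. right; reflexivity.
  - simpl. apply is_series_unique. intros P [eps HP]. destruct (H eps (cond_pos eps)) as [N HN].
    exists N. intros n Hn. apply HP. specialize (HN n Hn). rewrite E in HN.
    change (Rabs (sum_n (fun k => Im (u k)) n - Im l) < eps).
    eapply Rle_lt_trans; [|apply HN]. eapply Rle_trans; [|apply im_le_Cmod]. rewrite Im_minus. right; reflexivity.
Qed.

(** * The zeta function *)

(** The power of a positive base through the real logarithm, which can be differentiated both in [x]
    and in the exponent without reference to the cut. *)
Definition xp (x : R) (e : C) : C := Cexp (e * RtoC (ln x)).

Lemma xp_Cpower x e : 0 < x -> Cpower (RtoC x) e = xp x e.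
Proof. intros Hx. unfold Cpower. rewrite Clog_RtoC; auto. Qed.

Lemma Cmod_xp x e : Cmod (xp x e) = Rpower x (Re e).
Proof. unfold xp. rewrite Cmod_Cexp, re_scal_r. reflexivity. Qed.

Lemma xp_plus x e e' : xp x (e + e') = (xp x e * xp x e')%C.
Proof. unfold xp. rewrite <- Cexp_plus. f_equal; ring. Qed.

Lemma xp_R x r : xp x (RtoC r) = RtoC (Rpower x r).
Proof. unfold xp. rewrite <- RtoC_mult, Cexp_RtoC. reflexivity. Qed.

Lemma xp_1 e : xp 1 e = 1.
Proof. unfold xp. rewrite ln_1, Cmult_0_r. apply Cexp_0. Qed.

Lemma rder_ln x : 0 < x -> rder (fun x => RtoC (ln x)) x (RtoC (/ x)).
Proof. intros Hx. apply rder_RtoC. apply is_derive_Reals. now apply derivable_pt_lim_ln. Qed.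

Lemma xp_sub1 x e : 0 < x -> xp x (e - 1) = (xp x e * RtoC (/ x))%C.
Proof.
  intros Hx. unfold Cminus. rewrite xp_plus. f_equal. rewrite <- RtoC_opp, xp_R, Rpower_Ropp, Rpower_1; auto.
Qed.

Lemma rder_xp x e : 0 < x -> rder (fun x => xp x e) x (e * xp x (e - 1))%C.
Proof.
  intros Hx. eapply rder_eq.
  - apply (rder_comp_C Cexp (fun x => e * RtoC (ln x))%C); [apply cder_Cexp|apply rder_scal, rder_ln, Hx].
  - rewrite xp_sub1 by auto. unfold xp. ring.
Qed.

Lemma cder_xp x c w : cder (fun w => xp x (c - w)) w (- RtoC (ln x) * xp x (c - w))%C.
Proof.
  eapply cder_eq.
  - apply (cder_comp Cexp (fun w => (c - w) * RtoC (ln x))%C); [apply cder_Cexp|].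
    apply cder_mult; [apply cder_minus; [apply cder_const|apply cder_id]|apply cder_const].
  - cbv beta. unfold xp. ring.
Qed.

(** The factor [(-w)(-w - 1)...(-w - j + 1)] in the [j]-th derivative of [x^(-w)]. *)
Fixpoint pq (j : nat) (w : C) : C :=
  match j with O => RtoC 1 | S j' => ((- w - RtoC (INR j')) * pq j' w)%C end.
Fixpoint pqd (j : nat) (w : C) : C :=
  match j with O => RtoC 0 | S j' => (- pq j' w + (- w - RtoC (INR j')) * pqd j' w)%C end.
Definition qf (j : nat) (w : C) : C := match j with O => (/ (1 - w))%C | S j => pq j w end.
Definition qd (j : nat) (w : C) : C := match j with O => (/ (1 - w) * / (1 - w))%C | S j => pqd j w end.

(* [Hz 0], [Hz 1], [Hz 2], ... are a primitive of [x^(-w)], [x^(-w)] itself and its derivatives;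
   [Hd j] is the derivative of [Hz j] with respect to [w]. *)
Definition Hz (j : nat) (w : C) (x : R) : C := (qf j w * xp x (1 - w - RtoC (INR j)))%C.
Definition Hd (j : nat) (w : C) (x : R) : C := ((qd j w - qf j w * RtoC (ln x)) * xp x (1 - w - RtoC (INR j)))%C.

Lemma qf_S j w : w <> RtoC 1 -> qf (S j) w = ((1 - w - RtoC (INR j)) * qf j w)%C.
Proof.
  intros Hw. assert (H : (1 - w)%C <> RtoC 0) by (apply Cminus_eq_contra; auto).
  destruct j as [|j]; simpl qf.
  - change (INR 0) with 0%R. field. auto.
  - simpl pq. rewrite S_INR, RtoC_plus. ring.
Qed.

Lemma qd_S j w : w <> RtoC 1 -> qd (S j) w = ((1 - w - RtoC (INR j)) * qd j w - qf j w)%C.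
Proof.
  intros Hw. assert (H : (1 - w)%C <> RtoC 0) by (apply Cminus_eq_contra; auto).
  destruct j as [|j]; simpl qd; simpl qf.
  - change (INR 0) with 0%R. field. auto.
  - simpl pqd. rewrite S_INR, RtoC_plus. ring.
Qed.

Lemma xp_next j w x : xp x (1 - w - RtoC (INR j) - 1) = xp x (1 - w - RtoC (INR (S j))).
Proof. f_equal. rewrite S_INR, RtoC_plus. ring. Qed.

Lemma rder_Hz j w x : w <> RtoC 1 -> 0 < x -> rder (Hz j w) x (Hz (S j) w x).
Proof.
  intros Hw Hx. unfold Hz. eapply rder_eq; [apply rder_scal, rder_xp, Hx|].
  rewrite xp_next, qf_S by auto. ring.
Qed.

Lemma rder_Hd j w x : w <> RtoC 1 -> 0 < x -> rder (Hd j w) x (Hd (S j) w x).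
Proof.
  intros Hw Hx. unfold Hd. eapply rder_eq.
  - apply rder_mult; [|apply rder_xp, Hx]. apply rder_minus; [apply rder_const|apply rder_scal, rder_ln, Hx].
  - cbv beta. rewrite <- xp_next, xp_sub1, qf_S, qd_S by auto. ring.
Qed.

Lemma cder_pq j w : cder (pq j) w (pqd j w).
Proof.
  induction j as [|j IH]; [apply cder_const|].
  eapply cder_eq.
  - apply (cder_mult (fun w => - w - RtoC (INR j))%C (pq j)); [|apply IH].
    apply cder_minus; [apply cder_opp, cder_id|apply cder_const].
  - simpl. ring.
Qed.

Lemma cder_qf j w : w <> RtoC 1 -> cder (qf j) w (qd j w).
Proof.
  intros Hw. assert (H : (1 - w)%C <> RtoC 0) by (apply Cminus_eq_contra; auto).
  destruct j as [|j]; [|apply cder_pq]. eapply cder_eq.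
  - apply (cder_comp Cinv (fun w => 1 - w)%C); [apply cder_inv, H|]. apply cder_minus; [apply cder_const|apply cder_id].
  - simpl. field. auto.
Qed.

Lemma cder_Hz j w x : w <> RtoC 1 -> cder (fun w => Hz j w x) w (Hd j w x).
Proof.
  intros Hw. unfold Hz, Hd. eapply cder_eq.
  - apply cder_mult; [apply cder_qf, Hw|].
    apply cder_ext with (fun w => xp x ((1 - RtoC (INR j)) - w)); [intros; f_equal; ring|]. apply cder_xp.
  - cbv beta. replace (1 - RtoC (INR j) - w)%C with (1 - w - RtoC (INR j))%C by ring. ring.
Qed.

Lemma clim_xp_0 e : Re e < 0 -> clim (fun n => xp (INR (S n)) e) 0.
Proof.
  intros He eps Heps. set (M := exp (- ln eps / - Re e)).
  destruct (nfloor_ex M (Rlt_le _ _ (exp_pos _))) as [N HN]. exists N. intros n Hn.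
  replace (xp (INR (S n)) e - 0)%C with (xp (INR (S n)) e) by ring. rewrite Cmod_xp.
  assert (HnM : M < INR (S n)). { rewrite S_INR. apply le_INR in Hn. lra. }
  assert (HM : 0 < M) by apply exp_pos.
  assert (Hl : ln M < ln (INR (S n))) by (apply ln_increasing; lra).
  unfold M in Hl. rewrite ln_exp in Hl. unfold Rpower. rewrite <- (exp_ln eps) by auto. apply exp_increasing.
  apply Rmult_lt_compat_r with (r := - Re e) in Hl; [|lra]. replace (- ln eps / - Re e * - Re e) with (- ln eps) in Hl by (field; lra). lra.
Qed.

(** The partial sum of the Dirichlet series freed of its Euler-Maclaurin boundary terms at the upper
    end; its limit in [n] continues [zeta] to the left. *)
Definition Zpart (k : nat) (w : C) (n : nat) : C :=
  (Csum (fun i => xp (INR (S i)) (- w)) (S n) - Csum (fun j => RtoC (cf j) * Hz j w (INR (S n))) (S k))%C.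
Definition Zlim (k : nat) (w z : C) : Prop := clim (Zpart k w) z.

(** The additional boundary term is a multiple of [x^(-w - k)] and tends to [0]; so the limit is the
    same for every admissible [k]. *)
Lemma Zlim_S k w z : 0 < Re w + INR k -> Zlim k w z -> Zlim (S k) w z.
Proof.
  intros Hk H. unfold Zlim.
  apply clim_ext with (fun n => Zpart k w n - RtoC (cf (S k)) * Hz (S k) w (INR (S n)))%C.
  { intros n. unfold Zpart. rewrite (Csum_S _ (S k)). ring. }
  replace z with (z - RtoC (cf (S k)) * (qf (S k) w * 0))%C by ring.
  apply clim_minus; auto. apply clim_scal. unfold Hz. apply clim_scal, clim_xp_0.
  rewrite !Re_minus, !re_RtoC, S_INR. lra.
Qed.

Lemma Zlim_le k k' w z : (k <= k')%nat -> 0 < Re w + INR k -> Zlim k w z -> Zlim k' w z.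
Proof.
  induction 1 as [|k' Hle IH]; intros Hk H; auto.
  apply Zlim_S; auto. apply le_INR in Hle. lra.
Qed.

Lemma Zlim_unique k k' w z z' : 0 < Re w + INR k -> 0 < Re w + INR k' -> Zlim k w z -> Zlim k' w z' -> z = z'.
Proof.
  intros Hk Hk' H H'. eapply clim_unique.
  - refine (Zlim_le k (Nat.max k k') w z _ Hk H). lia.
  - refine (Zlim_le k' (Nat.max k k') w z' _ Hk' H'). lia.
Qed.

(** No single [k] serves all [w], hence the choice over [k]; [zeta_ext_eq] shows that it is
    unambiguous. *)
Definition zeta_ext (w : C) : C := epsilon (inhabits (RtoC 0)) (fun z => exists k, 0 < Re w + INR k /\ Zlim k w z).

Lemma zeta_ext_eq k w z : 0 < Re w + INR k -> Zlim k w z -> zeta_ext w = z.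
Proof.
  intros Hk H. destruct (epsilon_spec (inhabits (RtoC 0)) (fun z => exists k, 0 < Re w + INR k /\ Zlim k w z)) as [k' [Hk' H']].
  - exists z, k; auto.
  - eapply Zlim_unique; [apply Hk'|apply Hk|apply H'|apply H].
Qed.

(** The part of the remainder integrand that does not depend on [w]; what remains is an exponential
    in [w], as [analytic_piece] requires. *)
Definition Jg (k i : nat) (t : R) : C := (RtoC (bf k t) * RtoC (/ (INR (S i) + t) ^ S k))%C.
Definition Jint (k i : nat) (w : C) : C :=
  @RInt C_R_CompleteNormedModule (fun t => Jg k i t * Cexp (w * RtoC (- ln (INR (S i) + t))))%C 0 1.

Definition Zform (k : nat) (w F : C) : C :=
  (1 - Csum (fun j => RtoC (cf j) * qf j w) (S k) + pq (S k) w * F)%C.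

Lemma INR_S_ge_1 i : 1 <= INR (S i).
Proof. rewrite S_INR. generalize (pos_INR i); lra. Qed.

Lemma is_derive_ln_shift y t : 0 < y + t -> is_derive (fun t => - ln (y + t)) t (- / (y + t)).
Proof. intros H. auto_derive; [exact H|ring]. Qed.

Lemma Jg_cont k i t : 0 <= t -> ccont (Jg k i) t.
Proof.
  intros Ht. assert (Hi := INR_S_ge_1 i). unfold Jg. apply ccont_mult; apply ccont_RtoC; [apply bf_cont|].
  apply (ex_derive_continuous (fun t => / (INR (S i) + t) ^ S k)).
  assert (Hp : (INR (S i) + t) ^ S k <> 0) by (apply pow_nonzero; lra).
  apply ex_derive_inv; auto. apply (ex_derive_pow (fun t => INR (S i) + t)). auto_derive; auto.
Qed.

Lemma Jint_correct k i w : cint (fun t => Jg k i t * Cexp (w * RtoC (- ln (INR (S i) + t))))%C 0 1 (Jint k i w).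
Proof.
  assert (Hi := INR_S_ge_1 i).
  apply (@RInt_correct C_R_CompleteNormedModule). apply ex_cint. intros t Ht. rewrite Rmin_left, Rmax_right in Ht by lra.
  apply ccont_mult; [apply Jg_cont; lra|].
  eapply rder_ccont. apply (rder_comp_C Cexp (fun t => w * RtoC (- ln (INR (S i) + t)))%C); [apply cder_Cexp|].
  apply rder_scal, rder_RtoC, is_derive_ln_shift. lra.
Qed.

(** Euler-Maclaurin summation of [Hz]: the boundary terms at [n + 1] are those which [Zpart]
    subtracts, and at [1] every power of [x] equals [1]. *)
Lemma Zpart_eq k w n : w <> RtoC 1 -> Zpart k w n = Zform k w (Csum (fun i => Jint k i w) n).
Proof.
  intros Hw. destruct (EM_sum k (fun j => Hz j w)) as [I [HI E]].
  { intros j _ t Ht. apply rder_Hz; auto; lra. }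
  { intros t Ht. eexists. apply rder_Hz; auto; lra. }
  assert (EI : forall i, I i = (pq (S k) w * Jint k i w)%C).
  { intros i. assert (Hi := INR_S_ge_1 i). eapply cint_unique; [apply HI|].
    eapply cint_ext; [|apply cint_scal, Jint_correct]. intros t Ht. rewrite Rmin_left, Rmax_right in Ht by lra. cbv beta.
    unfold Hz, Jg. simpl qf. set (x := INR (S i) + t). assert (Hx : 0 < x) by (unfold x; lra).
    replace (1 - w - RtoC (INR (S (S k))))%C with (- w + RtoC (- INR (S k)))%C
      by (rewrite (S_INR (S k)), RtoC_opp, RtoC_plus; ring).
    rewrite xp_plus, xp_R, Rpower_Ropp, Rpower_pow by auto. unfold xp.
    replace (w * RtoC (- ln x))%C with (- w * RtoC (ln x))%C by (rewrite RtoC_opp; ring). simpl pq. ring. }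
  unfold Zpart, Zform.
  rewrite (Csum_ext (fun i => xp (INR (S i)) (- w)) (fun i => Hz 1 w (INR (S i)))).
  2:{ intros i _. unfold Hz. simpl qf. change (INR 1) with 1%R. rewrite Cmult_1_l. f_equal. ring. }
  rewrite E. rewrite (Csum_ext I (fun i => pq (S k) w * Jint k i w)%C) by (intros; apply EI). rewrite Csum_scal.
  rewrite (Csum_ext (fun j => RtoC (cf j) * (Hz j w (INR (S n)) - Hz j w 1))%C (fun j => RtoC (cf j) * Hz j w (INR (S n)) - RtoC (cf j) * qf j w)%C).
  2:{ intros j _. unfold Hz at 2. rewrite xp_1. ring. }
  rewrite Csum_minus. unfold Hz at 1. rewrite xp_1. simpl qf. ring.
Qed.

(** For radius [1/4] the allowance of [analytic_piece] is a factor [x^(1/2)]; against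
    [x^(- Re p - k - 1)] this leaves at most [x^(-2)], so the remainder integrals are summable. *)
Lemma zeta_local k p : 2 <= Re p + INR k -> exists (F : C -> C) (S1 : C) (c1 : nat -> C),
  ana F p /\ cder F p S1 /\
  (forall s, Cmod (s - p) < / 4 -> clim (Csum (fun i => Jint k i s)) (F s)) /\
  (forall i, cder (Jint k i) p (c1 i)) /\ clim (Csum c1) S1.
Proof.
  intros Hk. destruct (bf_bounded k) as [B [HB Hbf]].
  (* Telescoping majorant: [1/(i + 1)^2 <= 2/(i + 1) - 2/(i + 2)]. *)
  set (V := fun i => - (2 * B / (INR i + 1))).
  assert (HV : forall i, B / INR (S i) ^ 2 <= V (S i) - V i).
  { intros i. unfold V. rewrite S_INR. assert (Hi := pos_INR i).
    replace (- (2 * B / (INR i + 1 + 1)) - - (2 * B / (INR i + 1))) with (B * (2 / ((INR i + 1) * (INR i + 1 + 1)))) by (field; lra).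
    unfold Rdiv at 1. apply Rmult_le_compat_l; auto. apply Rmult_le_reg_r with ((INR i + 1) ^ 2 * (INR i + 1 + 1)).
    { apply Rmult_lt_0_compat; [apply pow_lt|]; lra. }
    field_simplify; lra. }
  assert (HP : forall i, exists c : nat -> C, (forall k0, Cmod (c k0) * (/ 4) ^ k0 <= V (S i) - V i) /\
    forall s, exists I, cint (fun t => Jg k i t * Cexp (s * RtoC (- ln (INR (S i) + t))))%C 0 1 I /\
      forall q K, 0 <= q <= 1 -> Cmod (s - p) = q * (/ 4) ->
      Cmod (I - Csum (fun k => c k * Cpow (s - p) k) K)%C <= (V (S i) - V i) * q ^ K).
  { intros i. assert (Hi := INR_S_ge_1 i). apply (analytic_piece (Jg k i) (fun t => - ln (INR (S i) + t)) 0 1 p (/ 4)); try lra.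
    - intros t Ht. apply Jg_cont; lra.
    - intros t Ht. eexists. apply is_derive_ln_shift. lra.
    - intros t Ht. eapply Rle_trans; [|apply HV]. set (x := INR (S i) + t). assert (Hx : INR (S i) <= x) by (unfold x; lra).
      unfold Jg. fold x. rewrite Cmod_mult, !Cmod_R, (Rabs_pos_eq (/ _)) by (apply Rlt_le, Rinv_0_lt_compat, pow_lt; lra).
      assert (Hln : 0 <= ln x) by (rewrite <- ln_1; apply ln_le; lra).
      rewrite Rabs_Ropp, (Rabs_pos_eq (ln x)) by auto.
      rewrite <- exp_plus, <- Rpower_pow, <- Rpower_Ropp by lra. unfold Rpower at 1.
      rewrite Rmult_assoc, Rmult_assoc, <- Rmult_assoc. rewrite Rminus_0_r, Rmult_1_r.
      apply Rle_trans with (B * exp (-2 * ln x)).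
      + rewrite Rmult_assoc. rewrite <- exp_plus. apply Rmult_le_compat; [apply Rabs_pos|apply Rlt_le, exp_pos|apply Hbf; auto|].
        apply exp_le_mono. rewrite S_INR. nra.
      + unfold Rdiv. apply Rmult_le_compat_l; auto. replace (-2 * ln x) with (- (INR 2 * ln x)) by (simpl; ring).
        rewrite exp_Ropp. change (exp (INR 2 * ln x)) with (Rpower x (INR 2)). rewrite Rpower_pow by lra.
        apply Rinv_le_contravar; [apply pow_lt; lra|]. apply pow_incr; lra. }
  destruct (fun_choice _ _ _ HP) as [c Hc].
  destruct (ana_sum (Jint k) p (/ 4) c V 0) as [F [T [HF [HT Hd]]]].
  - lra.
  - intros n. unfold V. assert (Hi := pos_INR n). assert (0 <= 2 * B / (INR n + 1)); [|lra].
    apply Rmult_le_pos; [lra|apply Rlt_le, Rinv_0_lt_compat; lra].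
  - intros n j. apply Hc.
  - intros n s q K Hq Hs. destruct (proj2 (Hc n) s) as [I [HI HI']].
    rewrite (cint_unique _ _ _ _ _ (Jint_correct k n s) HI). now apply HI'.
  - exists F, (T 1%nat), (fun i => c i 1%nat). split; [|split; [|split; [|split]]].
    + exists T, (/ 4). split; [lra|]. intros s Hs. now apply HF.
    + apply (pser_cder F p T (/ 4)); [lra|]. intros s Hs. now apply HF.
    + intros s Hs. now apply HF.
    + apply Hd.
    + apply HT.
Qed.

Lemma near_Re p s k : 2 <= Re p + INR k -> Cmod (s - p) < / 4 -> 0 < Re s + INR k.
Proof.
  intros Hk Hs. assert (H := re_le_Cmod (s - p)). rewrite Re_minus in H. apply Rabs_le_between in H. lra.
Qed.

Lemma zeta_ext_form k p F : 2 <= Re p + INR k -> (forall s, Cmod (s - p) < / 4 -> clim (Csum (fun i => Jint k i s)) (F s)) ->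
  forall s, s <> RtoC 1 -> Cmod (s - p) < / 4 -> Zlim k s (Zform k s (F s)) /\ zeta_ext s = Zform k s (F s).
Proof.
  intros Hk HF s Hs1 Hs. assert (H : Zlim k s (Zform k s (F s))).
  { apply clim_ext with (fun n => Zform k s (Csum (fun i => Jint k i s) n)); [intros; symmetry; now apply Zpart_eq|].
    unfold Zform. apply clim_plus; [apply clim_const|]. apply clim_scal, HF, Hs. }
  split; auto. eapply zeta_ext_eq; [|apply H]. now apply near_Re with p.
Qed.

Lemma ana_pq F p j : ana F p -> ana (fun s => pq j s * F s)%C p.
Proof.
  intros HF. induction j as [|j IH].
  - apply ana_ext with F; auto. intros; simpl; ring.
  - apply ana_ext with (fun s => (- (1)) * ((s + RtoC (INR j)) * (pq j s * F s)))%C; [intros; simpl; ring|].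
    now apply ana_scal, ana_lin.
Qed.

Lemma nat_above r : exists k : nat, r <= INR k.
Proof.
  destruct (nfloor_ex (Rabs r) (Rabs_pos r)) as [N HN]. exists (S N). rewrite S_INR. generalize (Rle_abs r). lra.
Qed.

Lemma Cneq_dist (p c : C) : p <> c -> exists d, 0 < d /\ forall s, Cmod (s - p) < d -> s <> c.
Proof.
  intros H. exists (Cmod (c - p)). split; [apply Cmod_gt_0, Cminus_eq_contra; auto|]. intros s Hs E. subst. lra.
Qed.

Lemma Zform_ana k F p : p <> RtoC 1 -> ana F p -> ana (fun s => Zform k s (F s)) p.
Proof.
  intros Hp HF. apply ana_ext with (fun s => 1 + (- (1)) * Csum (fun j => RtoC (cf j) * qf j s) (S k) + pq (S k) s * F s)%C; [intros; unfold Zform; ring|].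
  apply ana_plus; [apply ana_plus; [apply ana_const|]|now apply ana_pq].
  apply ana_scal, (ana_Csum (fun j s => RtoC (cf j) * qf j s)%C). intros j _. apply ana_scal.
  destruct j as [|j]; [now apply ana_inv_lin|].
  apply ana_ext with (fun s => pq j s * 1)%C; [intros; simpl; ring|]. apply (ana_pq (fun _ => RtoC 1)), ana_const.
Qed.

Lemma Zform_mero k F p : ana F p -> mero (fun s => Zform k s (F s)) p.
Proof.
  intros HF. apply mero_ext_loc with (fun s => 1 + (- (1)) * Csum (fun j => RtoC (cf j) * qf j s) (S k) + pq (S k) s * F s)%C 1; [lra|intros; unfold Zform; ring|].
  apply mero_plus; [apply mero_plus; [apply ana_mero, ana_const|]|now apply ana_mero, ana_pq].
  apply mero_scal, (mero_Csum (fun j s => RtoC (cf j) * qf j s)%C). intros j _. apply mero_scal.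
  destruct j as [|j]; [now apply mero_inv_lin|]. apply ana_mero.
  apply ana_ext with (fun s => pq j s * 1)%C; [intros; simpl; ring|]. apply (ana_pq (fun _ => RtoC 1)), ana_const.
Qed.

Lemma zeta_ext_ana p : p <> RtoC 1 -> ana zeta_ext p.
Proof.
  intros Hp. destruct (nat_above (2 - Re p)) as [k Hk].
  destruct (zeta_local k p ltac:(lra)) as [F [S1 [c1 [HF [_ [Hl _]]]]]].
  destruct (Cneq_dist p 1 Hp) as [d [Hd Hd']].
  apply ana_ext_loc with (fun s => Zform k s (F s)) (Rmin d (/ 4)); [apply Rmin_pos; lra| |now apply Zform_ana].
  intros s Hs. symmetry. apply (zeta_ext_form k p F); auto; [lra| |].
  - apply Hd'. eapply Rlt_le_trans; [apply Hs|apply Rmin_l].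
  - eapply Rlt_le_trans; [apply Hs|apply Rmin_r].
Qed.

Lemma zeta_ext_mero p : mero zeta_ext p.
Proof.
  destruct (classic (p = RtoC 1)) as [->|Hp]; [|now apply ana_mero, zeta_ext_ana].
  destruct (nat_above (2 - Re 1)) as [k Hk].
  destruct (zeta_local k 1 ltac:(lra)) as [F [S1 [c1 [HF [_ [Hl _]]]]]].
  apply mero_ext_loc with (fun s => Zform k s (F s)) (/ 4); [lra| |now apply Zform_mero].
  intros s Hs1 Hs. symmetry. apply (zeta_ext_form k 1 F); auto. lra.
Qed.

Lemma Zlim_zeta k w : w <> RtoC 1 -> 2 <= Re w + INR k -> Zlim k w (zeta_ext w).
Proof.
  intros Hw Hk. destruct (zeta_local k w Hk) as [F [S1 [c1 [HF [_ [Hl _]]]]]].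
  destruct (zeta_ext_form k w F Hk Hl w Hw) as [H1 H2].
  - replace (w - w)%C with (RtoC 0) by ring. rewrite Cmod_0. lra.
  - rewrite H2. exact H1.
Qed.

Lemma zeta_ext_continues : is_mero_continuation
    (fun s => CSeries (fun n => Cpower (RtoC (INR (S n))) (- s)%C)) 1 zeta_ext.
Proof.
  split; [intros p; apply mero_iff, zeta_ext_mero|].
  intros s Hs. symmetry. apply clim_CSeries.
  assert (Hs1 : s <> RtoC 1) by (intros E; rewrite E in Hs; simpl in Hs; lra).
  (* For [Re s > 1] already [k = 1] is admissible, and its two boundary terms, of orders [x^(1 - s)]
     and [x^(-s)], tend to [0]. *)
  assert (H := Zlim_zeta 1 s Hs1 ltac:(simpl; lra)).
  apply clim_shift.
  apply clim_ext with (fun n => Zpart 1 s n + (RtoC (cf 0) * Hz 0 s (INR (S n)) + RtoC (cf 1) * Hz 1 s (INR (S n))))%C.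
  - intros n. unfold Zpart. rewrite (Csum_S _ 1), (Csum_S _ 0), Csum_0.
    rewrite (Csum_ext (fun i => xp (INR (S i)) (- s)) (fun n => Cpower (RtoC (INR (S n))) (- s)%C)); [ring|].
    intros i _. symmetry. apply xp_Cpower. generalize (INR_S_ge_1 i); lra.
  - replace (zeta_ext s) with (zeta_ext s + (RtoC (cf 0) * (qf 0 s * 0) + RtoC (cf 1) * (qf 1 s * 0)))%C at 1 by ring.
    apply clim_plus; [exact H|]. apply clim_plus; apply clim_scal; unfold Hz; apply clim_scal, clim_xp_0; rewrite !Re_minus; simpl; lra.
Qed.

Lemma zeta_zeta_ext w : w <> RtoC 1 -> zeta w = zeta_ext w.
Proof. intros Hw. unfold zeta. apply mero_continuation_eq; [apply zeta_ext_continues|now apply zeta_ext_ana]. Qed.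

Lemma zeta_clim k w : w <> RtoC 1 -> 2 <= Re w + INR k -> clim (Zpart k w) (zeta w).
Proof. intros Hw Hk. rewrite zeta_zeta_ext by auto. now apply Zlim_zeta. Qed.

Definition Zdpart (k : nat) (w : C) (n : nat) : C :=
  (Csum (fun i => - RtoC (ln (INR (S i))) * xp (INR (S i)) (- w)) (S n) - Csum (fun j => RtoC (cf j) * Hd j w (INR (S n))) (S k))%C.

Lemma cder_Zpart k w n : w <> RtoC 1 -> cder (fun w => Zpart k w n) w (Zdpart k w n).
Proof.
  intros Hw. unfold Zpart, Zdpart. apply cder_minus.
  - apply (cder_Csum (fun i w => xp (INR (S i)) (- w)) (fun i w => - RtoC (ln (INR (S i))) * xp (INR (S i)) (- w))%C).
    intros i _. apply cder_ext with (fun w => xp (INR (S i)) (0 - w)); [intros; f_equal; ring|].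
    eapply cder_eq; [apply cder_xp|]. replace (0 - w)%C with (- w)%C by ring. reflexivity.
  - apply (cder_Csum (fun j w => RtoC (cf j) * Hz j w (INR (S n)))%C (fun j w => RtoC (cf j) * Hd j w (INR (S n)))%C).
    intros j _. apply cder_scal, cder_Hz, Hw.
Qed.

Lemma cder_Zform k w G G' : w <> RtoC 1 -> cder G w G' ->
  cder (fun w => Zform k w (G w)) w (- Csum (fun j => RtoC (cf j) * qd j w) (S k) + (pqd (S k) w * G w + pq (S k) w * G'))%C.
Proof.
  intros Hw HG. unfold Zform. eapply cder_eq.
  - apply cder_plus; [apply cder_minus; [apply cder_const|]|].
    + apply (cder_Csum (fun j w => RtoC (cf j) * qf j w)%C (fun j w => RtoC (cf j) * qd j w)%C).
      intros j _. apply cder_scal, cder_qf, Hw.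
    + apply cder_mult; [apply cder_pq|apply HG].
  - ring.
Qed.

(** Interchange of limit and derivative: [Zpart] equals [Zform] of a finite sum for every [n], so
    its derivative contains the sum of the [c1 i], which [zeta_local] proves to converge to the
    derivative of [F]. *)
Lemma zeta'_clim k w : w <> RtoC 1 -> 2 <= Re w + INR k -> clim (Zdpart k w) (zeta' w).
Proof.
  intros Hw Hk. destruct (zeta_local k w Hk) as [F [S1 [c1 [HF [HdF [Hl [Hdc Hc1]]]]]]].
  destruct (Cneq_dist w 1 Hw) as [d [Hd Hd']].
  assert (Hw0 : Cmod (w - w) < / 4) by (replace (w - w)%C with (RtoC 0) by ring; rewrite Cmod_0; lra).
  assert (Hz : cder zeta w (- Csum (fun j => RtoC (cf j) * qd j w) (S k) + (pqd (S k) w * F w + pq (S k) w * S1))%C).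
  { apply cder_ext_loc with (fun s => Zform k s (F s)) (Rmin d (/ 4)); [apply Rmin_pos; lra| |now apply cder_Zform].
    intros s Hs. assert (Hs1 : s <> RtoC 1) by (apply Hd'; eapply Rlt_le_trans; [apply Hs|apply Rmin_l]).
    rewrite zeta_zeta_ext by auto. symmetry. apply (zeta_ext_form k w F); auto. eapply Rlt_le_trans; [apply Hs|apply Rmin_r]. }
  unfold zeta'. rewrite (is_C_derive_unique _ _ _ Hz).
  apply clim_ext with (fun n => - Csum (fun j => RtoC (cf j) * qd j w) (S k) + (pqd (S k) w * Csum (fun i => Jint k i w) n + pq (S k) w * Csum c1 n))%C.
  - intros n. eapply cder_unique; [|apply cder_Zpart, Hw].
    apply cder_ext_loc with (fun s => Zform k s (Csum (fun i => Jint k i s) n)) d; auto.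
    + intros s Hs. symmetry. apply Zpart_eq. auto.
    + apply (cder_Zform k w (fun s => Csum (fun i => Jint k i s) n)); auto.
      apply (cder_Csum (fun i => Jint k i) (fun i _ => c1 i)). intros; apply Hdc.
  - apply clim_plus; [apply clim_const|]. apply clim_plus; apply clim_scal; [apply Hl, Hw0|apply Hc1].
Qed.

(** * Euler's integral and the digamma function *)

Lemma exp_half_dominated_isI f B : cont_pos f -> (forall t, 0 < t -> Cmod (f t) <= B * exp (- t / 2)) ->
  exists l, isI f l /\ Cmod l <= 2 * B.
Proof.
  intros Hf HB. destruct (ex_primitive_pos f Hf) as [F HF].
  assert (HB0 : 0 <= B).
  { assert (H := HB 1 Rlt_0_1). assert (H1 := Cmod_ge_0 (f 1)). assert (H2 := exp_pos (Ropp 1 / 2)).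
    apply Rmult_le_reg_r with (exp (Ropp 1 / 2)); auto. lra. }
  set (Psi := fun t => - (2 * B) * exp (- t / 2)).
  assert (HP : forall t, is_derive Psi t (B * exp (- t / 2))).
  { intros t. unfold Psi. auto_derive; auto. unfold Rdiv. field. }
  assert (Hinc : forall a b, 0 < a -> a <= b -> Cmod (F b - F a) <= Psi b - Psi a).
  { intros a b Ha Hab. apply (mean_value_majorant F f Psi (fun t => B * exp (- t / 2))); auto.
    - intros t Ht; apply HF; lra.
    - intros t Ht; apply HB; lra. }
  destruct (conv_inf F Psi 1 0) as [l1 [H1 H1']].
  { intros; apply Hinc; lra. }
  { intros t Ht. unfold Psi. generalize (exp_pos (- t / 2)); nra. }
  destruct (conv_0 F Psi 1 (- (2 * B))) as [l0 [H0 H0']]; [lra| | |].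
  { intros; apply Hinc; lra. }
  { intros t Ht _. unfold Psi. assert (exp (- t / 2) <= 1); [|nra]. rewrite <- exp_0. apply exp_le_mono; lra. }
  exists (l1 - l0)%C. split.
  - eapply isI_intro; eauto.
  - specialize (H1' 1 ltac:(lra)). specialize (H0' 1 ltac:(lra) ltac:(lra)).
    replace (l1 - l0)%C with ((F 1 - l0) - (F 1 - l1))%C by ring.
    generalize (Cmod_triangle_minus (F 1 - l0) (F 1 - l1)); lra.
Qed.

Definition gamma_integrand (x t : R) : C := RtoC (Rpower t (x - 1) * exp (- t)).

Lemma is_derive_Rpower x t : 0 < t -> is_derive (fun t => Rpower t x) t (x * Rpower t (x - 1)).
Proof.
  intros Ht. apply is_derive_Reals. apply derivable_pt_lim_power. exact Ht.
Qed.

Lemma gamma_integrand_cont x : cont_pos (gamma_integrand x).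
Proof.
  intros t Ht. apply ccont_RtoC. apply (continuous_mult (K:=R_AbsRing)).
  - apply (ex_derive_continuous (fun t => Rpower t (x - 1))). eexists. apply is_derive_Rpower, Ht.
  - apply (ex_derive_continuous (fun t => exp (- t))). auto_derive; auto.
Qed.

(** Two factors [lam] stand for [(ln t)^2] and the third for [t^h] with [|h| <= 1], as they occur in
    the second-order remainder of Gamma; [t^3] cancels their poles at [0]. Hence the arguments
    [n + 4] below. *)
Lemma poly_exp_bound n : exists B, 0 <= B /\ forall t, 0 < t -> t ^ (n + 3) * lam t ^ 3 * exp (- t) <= B * exp (- t / 2).
Proof.
  set (p := (n + 6)%nat). exists (2 ^ p * INR (fact p) * exp (/ 2)).
  assert (Hf := INR_fact_lt_0 p). assert (He := exp_pos (/ 2)). assert (H2 : 0 < 2 ^ p) by (apply pow_lt; lra).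
  split; [apply Rmult_le_pos; [apply Rmult_le_pos; lra|lra]|].
  intros t Ht. assert (H := pow_le_fact_exp p ((1 + t) / 2) ltac:(lra)).
  assert (Ht1 : t ^ (n + 3) * lam t ^ 3 <= (1 + t) ^ p).
  { unfold lam, p. rewrite !pow_add.
    replace (t ^ n * t ^ 3 * (t + / t) ^ 3) with (t ^ n * (t * t + 1) ^ 3) by (field; lra).
    replace ((1 + t) ^ 6) with (((1 + t) * (1 + t)) ^ 3) by ring.
    apply Rmult_le_compat; [apply pow_le; lra|apply pow_le; nra|apply pow_incr; lra|apply pow_incr; nra]. }
  replace (exp (- t)) with (exp (- t / 2) * exp (- t / 2)) by (rewrite <- exp_plus; f_equal; field).
  rewrite <- Rmult_assoc. apply Rmult_le_compat_r; [apply Rlt_le, exp_pos|].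
  apply Rle_trans with ((1 + t) ^ p * exp (- t / 2)); [apply Rmult_le_compat_r; [apply Rlt_le, exp_pos|auto]|].
  replace (1 + t) with (2 * ((1 + t) / 2)) by field. rewrite Rpow_mult_distr.
  apply Rle_trans with (2 ^ p * (INR (fact p) * exp ((1 + t) / 2)) * exp (- t / 2)).
  - apply Rmult_le_compat_r; [apply Rlt_le, exp_pos|]. apply Rmult_le_compat_l; lra.
  - replace (2 ^ p * (INR (fact p) * exp ((1 + t) / 2)) * exp (- t / 2)) with
      (2 ^ p * INR (fact p) * (exp ((1 + t) / 2) * exp (- t / 2))) by ring.
    rewrite <- exp_plus. replace ((1 + t) / 2 + - t / 2) with (/ 2) by field. lra.
Qed.

Lemma exp_abs_ln_le t : 0 < t -> exp (Rabs (ln t)) <= lam t.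
Proof.
  intros Ht. assert (Hi := Rinv_0_lt_compat _ Ht). unfold lam, Rabs. destruct (Rcase_abs (ln t)).
  - rewrite exp_Ropp, exp_ln by auto. lra.
  - rewrite exp_ln by auto. lra.
Qed.

Lemma gamma_integrand_shift n h t : 0 < t -> gamma_integrand (INR n + 4 + h) t = RtoC (t ^ (n + 3) * exp (- t) * exp (h * ln t)).
Proof.
  intros Ht. unfold gamma_integrand. f_equal.
  replace (INR n + 4 + h - 1) with (INR (n + 3) + h) by (rewrite plus_INR; simpl; ring).
  rewrite Rpower_plus, Rpower_pow by auto. unfold Rpower. ring.
Qed.

Lemma exp_h_ln_le h t : 0 < t -> Rabs h <= 1 -> exp (h * ln t) <= lam t.
Proof.
  intros Ht Hh. eapply Rle_trans; [|apply exp_abs_ln_le, Ht]. apply exp_le_mono.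
  eapply Rle_trans; [apply Rle_abs|]. rewrite Rabs_mult. generalize (Rabs_pos (ln t)); nra.
Qed.

Lemma gamma_integrand_ex_large n h : Rabs h <= 1 -> exists l, isI (gamma_integrand (INR n + 4 + h)) l.
Proof.
  intros Hh. destruct (poly_exp_bound n) as [B [HB H]].
  destruct (exp_half_dominated_isI (gamma_integrand (INR n + 4 + h)) B) as [l [Hl _]]; [apply gamma_integrand_cont| |now exists l].
  intros t Ht. rewrite gamma_integrand_shift by auto. eapply Rle_trans; [|apply H, Ht].
  assert (Hp : 0 < t ^ (n + 3)) by (apply pow_lt; auto). assert (He := exp_pos (- t)). assert (He' := exp_pos (h * ln t)).
  assert (Hl := lam_ge_2 t Ht).
  rewrite Cmod_Rpos by (apply Rmult_le_pos; [apply Rmult_le_pos|]; lra).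
  replace (t ^ (n + 3) * lam t ^ 3 * exp (- t)) with (t ^ (n + 3) * exp (- t) * lam t ^ 3) by ring.
  apply Rmult_le_compat_l; [apply Rmult_le_pos; lra|].
  assert (H1 := exp_h_ln_le h t Ht Hh). simpl. nra.
Qed.

Lemma Gamma_fun_isI x l : isI (gamma_integrand x) l -> Gamma_fun x = Re l.
Proof.
  intros H. apply isI_Re in H. unfold Gamma_fun, RInt_pos.
  apply (is_RInt_gen_unique (V:=R_CompleteNormedModule)). exact H.
Qed.

(** Differentiation under the integral where the integrand has room to spare at [0]; the functional
    equation then carries differentiability down to all positive integers. *)
Lemma Gamma_derive_large n : ex_derive Gamma_fun (INR n + 4).
Proof.
  set (x := INR n + 4).
  destruct (poly_exp_bound n) as [B [HB H]].
  set (gL := fun t => (RtoC (ln t) * gamma_integrand x t)%C).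
  assert (Hx : x = INR n + 4 + 0) by (unfold x; ring).
  assert (HgL : cont_pos gL).
  { intros t Ht. apply ccont_mult; [|apply gamma_integrand_cont, Ht]. eapply rder_ccont, rder_RtoC.
    apply is_derive_Reals, derivable_pt_lim_ln, Ht. }
  assert (Hgx : forall t, 0 < t -> gamma_integrand x t = RtoC (t ^ (n + 3) * exp (- t))).
  { intros t Ht. rewrite Hx, gamma_integrand_shift by auto. rewrite Rmult_0_l, exp_0. f_equal; ring. }
  destruct (gamma_integrand_ex_large n 0 ltac:(rewrite Rabs_R0; lra)) as [l Hl]. rewrite <- Hx in Hl.
  destruct (exp_half_dominated_isI gL B HgL) as [m [Hm _]].
  { intros t Ht. eapply Rle_trans; [|apply H, Ht]. unfold gL. rewrite Hgx, Cmod_mult, !Cmod_R by auto.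
    assert (Hp : 0 < t ^ (n + 3)) by (apply pow_lt; auto). assert (He := exp_pos (- t)). assert (Hl2 := lam_ge_2 t Ht).
    rewrite (Rabs_pos_eq (_ * _)) by (apply Rmult_le_pos; lra). assert (Ha := abs_ln_le_lam t Ht).
    replace (t ^ (n + 3) * lam t ^ 3 * exp (- t)) with (lam t ^ 3 * (t ^ (n + 3) * exp (- t))) by ring.
    apply Rmult_le_compat_r; [apply Rmult_le_pos; lra|]. simpl. nra. }
  exists (Re m). apply is_derive_Reals. intros eps Heps.
  assert (Hd : 0 < Rmin 1 (eps / (2 * B + 1))) by (apply Rmin_pos; [lra|apply Rdiv_lt_0_compat; lra]).
  exists (mkposreal _ Hd). intros h Hh0 Hh. simpl in Hh.
  assert (Hh1 := Rlt_le_trans _ _ _ Hh (Rmin_l _ _)). assert (Hh2 := Rlt_le_trans _ _ _ Hh (Rmin_r _ _)).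
  destruct (gamma_integrand_ex_large n h ltac:(lra)) as [lh Hlh]. fold x in Hlh.
  rewrite (Gamma_fun_isI _ _ Hl), (Gamma_fun_isI _ _ Hlh).
  assert (HI : isI (fun t => gamma_integrand (x + h) t - gamma_integrand x t - RtoC h * gL t)%C (lh - l - RtoC h * m)%C).
  { apply isI_minus; [apply isI_minus; auto|]. now apply isI_scal. }
  destruct (exp_half_dominated_isI (fun t => gamma_integrand (x + h) t - gamma_integrand x t - RtoC h * gL t)%C (h ^ 2 * B)) as [l' [Hl'1 Hl'2]].
  { intros t Ht. apply ccont_minus; [apply ccont_minus; apply gamma_integrand_cont, Ht|apply ccont_scal, HgL, Ht]. }
  { intros t Ht. unfold gL. rewrite Hgx by auto. unfold x at 1. rewrite gamma_integrand_shift by auto.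
    assert (Hp : 0 < t ^ (n + 3)) by (apply pow_lt; auto). assert (He := exp_pos (- t)). assert (Hl2 := lam_ge_2 t Ht).
    replace (RtoC (t ^ (n + 3) * exp (- t) * exp (h * ln t)) - RtoC (t ^ (n + 3) * exp (- t)) -
      RtoC h * (RtoC (ln t) * RtoC (t ^ (n + 3) * exp (- t))))%C with
      (RtoC (t ^ (n + 3) * exp (- t)) * (Cexp (RtoC (h * ln t)) - 1 - RtoC (h * ln t)))%C
      by (rewrite Cexp_RtoC, !RtoC_mult; ring).
    rewrite Cmod_mult, Cmod_Rpos by (apply Rmult_le_pos; lra).
    assert (HR := Cexp_rem2 (RtoC (h * ln t))). rewrite Cmod_R, Rabs_mult in HR.
    assert (Ha := abs_ln_le_lam t Ht). assert (Hb := exp_abs_ln_le t Ht). assert (Ha0 := Rabs_pos (ln t)). assert (Hh3 := Rabs_pos h).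
    assert (Hc : exp (Rabs h * Rabs (ln t)) <= lam t) by (eapply Rle_trans; [|apply Hb]; apply exp_le_mono; nra).
    assert (HQ : (Rabs h * Rabs (ln t)) ^ 2 * exp (Rabs h * Rabs (ln t)) <= h ^ 2 * lam t ^ 3).
    { rewrite Rpow_mult_distr. rewrite pow2_abs. rewrite Rmult_assoc. apply Rmult_le_compat_l; [apply pow2_ge_0|].
      replace (lam t ^ 3) with (lam t ^ 2 * lam t) by ring. apply Rmult_le_compat; auto; [apply pow2_ge_0|apply Rlt_le, exp_pos|].
      apply pow_incr; lra. }
    apply Rle_trans with (h ^ 2 * (t ^ (n + 3) * lam t ^ 3 * exp (- t))); [|rewrite (Rmult_assoc (h ^ 2)); apply Rmult_le_compat_l; [apply pow2_ge_0|apply H, Ht]].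
    replace (h ^ 2 * (t ^ (n + 3) * lam t ^ 3 * exp (- t))) with (t ^ (n + 3) * exp (- t) * (h ^ 2 * lam t ^ 3)) by ring.
    apply Rmult_le_compat_l; [apply Rmult_le_pos; lra|]. lra. }
  rewrite (isI_unique _ _ _ Hl'1 HI) in Hl'2.
  assert (Hre := re_le_Cmod (lh - l - RtoC h * m)). rewrite !Re_minus, Re_scal in Hre.
  replace ((Re lh - Re l) / h - Re m) with ((Re lh - Re l - h * Re m) / h) by (field; auto).
  unfold Rdiv. rewrite Rabs_mult, Rabs_inv.
  assert (Hha : 0 < Rabs h) by now apply Rabs_pos_lt.
  apply Rle_lt_trans with (2 * B * Rabs h).
  - apply Rmult_le_reg_r with (Rabs h); auto. rewrite Rmult_assoc, Rinv_l by lra. rewrite <- pow2_abs in Hl'2. lra.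
  - apply Rle_lt_trans with ((2 * B + 1) * Rabs h); [nra|].
    apply Rmult_lt_reg_r with (/ (2 * B + 1)); [apply Rinv_0_lt_compat; lra|].
    rewrite (Rmult_comm (2 * B + 1)), Rmult_assoc, Rinv_r, Rmult_1_r by lra. exact Hh2.
Qed.

Lemma clim0_Rpower x : 0 < x -> clim0 (fun t => RtoC (Rpower t x * exp (- t))) 0.
Proof.
  intros Hx eps He. exists (exp (ln eps / x)). split; [apply exp_pos|]. intros t [Ht Htd].
  replace (RtoC (Rpower t x * exp (- t)) - 0)%C with (RtoC (Rpower t x * exp (- t))) by ring.
  rewrite Cmod_Rpos by (apply Rmult_le_pos; apply Rlt_le, exp_pos).
  assert (H1 : Rpower t x < eps).
  { unfold Rpower. rewrite <- (exp_ln eps) by auto. apply exp_increasing.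
    apply ln_increasing in Htd; auto. rewrite ln_exp in Htd.
    apply Rmult_lt_compat_l with (r := x) in Htd; auto. replace (x * (ln eps / x)) with (ln eps) in Htd by (field; lra). lra. }
  assert (H2 : exp (- t) <= 1) by (rewrite <- exp_0; apply exp_le_mono; lra).
  assert (H3 := Rpower_pos t x). assert (H4 := exp_pos (- t)). nra.
Qed.

Lemma climinf_Rpower x : climinf (fun t => RtoC (Rpower t x * exp (- t))) 0.
Proof.
  assert (Hp : exists p : nat, x <= INR p).
  { destruct (nfloor_ex (Rabs x) (Rabs_pos x)) as [N HN]. exists (S N). rewrite S_INR. generalize (Rle_abs x). lra. }
  destruct Hp as [p Hp]. intros eps He.
  assert (Hf := INR_fact_lt_0 (S p)). exists (Rmax 1 (INR (fact (S p)) / eps)). intros t Ht.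
  assert (Ht1 := Rle_lt_trans _ _ _ (Rmax_l _ _) Ht). assert (Ht2 := Rle_lt_trans _ _ _ (Rmax_r _ _) Ht).
  replace (RtoC (Rpower t x * exp (- t)) - 0)%C with (RtoC (Rpower t x * exp (- t))) by ring.
  rewrite Cmod_Rpos by (apply Rmult_le_pos; apply Rlt_le, exp_pos).
  assert (H1 : Rpower t x <= t ^ p).
  { rewrite <- Rpower_pow by lra. apply Rle_Rpower; lra. }
  assert (H2 := pow_le_fact_exp (S p) t ltac:(lra)). simpl pow in H2.
  rewrite exp_Ropp. assert (H3 := exp_pos t).
  apply Rle_lt_trans with (t ^ p * / exp t); [apply Rmult_le_compat_r; [apply Rlt_le, Rinv_0_lt_compat|]; auto|].
  apply Rmult_lt_reg_r with (t * exp t); [apply Rmult_lt_0_compat; lra|].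
  replace (t ^ p * / exp t * (t * exp t)) with (t * t ^ p) by (field; lra).
  eapply Rle_lt_trans; [apply H2|].
  replace (eps * (t * exp t)) with (eps * t * exp t) by ring. apply Rmult_lt_compat_r; auto.
  apply Rmult_lt_reg_r with (/ eps); [apply Rinv_0_lt_compat; auto|]. replace (eps * t * / eps) with t by (field; lra). exact Ht2.
Qed.

(** Integration by parts: the difference of the integrands is the derivative of [t^x exp (-t) / x],
    which vanishes at both ends. In this direction the step also proves that the integral converges
    at [x]. *)
Lemma gamma_integrand_step x l : 0 < x -> isI (gamma_integrand (x + 1)) l -> isI (gamma_integrand x) (RtoC (/ x) * l)%C.
Proof.
  intros Hx H.
  assert (Hd : isI (fun t => gamma_integrand x t - RtoC (/ x) * gamma_integrand (x + 1) t)%C (0 - 0)%C).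
  { apply isI_intro with (F := fun t => (RtoC (/ x) * RtoC (Rpower t x * exp (- t)))%C) (l0 := RtoC 0) (l1 := RtoC 0); auto.
    - intros t Ht. eapply rder_eq.
      + apply rder_scal, rder_RtoC. apply (is_derive_mult (K:=R_AbsRing) (fun t => Rpower t x) (fun t => exp (- t))).
        * apply is_derive_Rpower, Ht.
        * instantiate (1 := - exp (- t)). auto_derive; auto; ring.
        * intros; apply Rmult_comm.
      + unfold gamma_integrand, plus, mult; simpl. replace (x + 1 - 1) with x by ring.
        rewrite <- !RtoC_mult, <- RtoC_minus. f_equal. field. lra.
    - intros t Ht. apply ccont_minus; [|apply ccont_scal]; apply gamma_integrand_cont, Ht.
    - replace (RtoC 0) with (RtoC (/ x) * 0)%C by ring. now apply clim0_scal, clim0_Rpower.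
    - replace (RtoC 0) with (RtoC (/ x) * 0)%C by ring. now apply climinf_scal, climinf_Rpower. }
  replace (RtoC (/ x) * l)%C with ((0 - 0) + RtoC (/ x) * l)%C by ring.
  eapply isI_ext; [|apply isI_plus; [apply Hd|apply isI_scal, H]]. intros t _. cbv beta. ring.
Qed.

Lemma gamma_integrand_ex x : 0 < x -> exists l, isI (gamma_integrand x) l.
Proof.
  intros Hx.
  assert (Hlarge : forall y, 4 <= y -> exists l, isI (gamma_integrand y) l).
  { intros y Hy. destruct (nfloor_ex (y - 4)) as [n Hn]; [lra|].
    replace y with (INR n + 4 + (y - 4 - INR n)) by ring. apply gamma_integrand_ex_large. rewrite Rabs_pos_eq; lra. }
  assert (H : forall N x, 0 < x -> 4 <= x + INR N -> exists l, isI (gamma_integrand x) l).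
  { clear x Hx. induction N as [|N IH]; intros x Hx HN.
    - apply Hlarge. simpl in HN; lra.
    - destruct (IH (x + 1)) as [l Hl]; [lra|rewrite S_INR in HN; lra|]. eexists. apply gamma_integrand_step; eauto. }
  apply (H 4%nat x Hx). simpl; lra.
Qed.

Lemma Gamma_step x : 0 < x -> Gamma_fun (x + 1) = x * Gamma_fun x.
Proof.
  intros Hx. destruct (gamma_integrand_ex (x + 1)) as [l Hl]; [lra|].
  rewrite (Gamma_fun_isI _ _ Hl), (Gamma_fun_isI _ _ (gamma_integrand_step x l Hx Hl)), Re_scal. field. lra.
Qed.

Lemma Gamma_1 : Gamma_fun 1 = 1.
Proof.
  assert (H : isI (gamma_integrand 1) (0 - - (1))%C).
  { apply isI_intro with (F := fun t => RtoC (- exp (- t))) (l0 := (- (1))%C) (l1 := RtoC 0); auto.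
    - intros t Ht. apply rder_RtoC. unfold Rminus. rewrite Rplus_opp_r, Rpower_O by auto. auto_derive; auto; ring.
    - apply gamma_integrand_cont.
    - replace (- (1))%C with (RtoC (- exp (- 0))) by (rewrite Ropp_0, exp_0, RtoC_opp; ring).
      apply (ccont_clim0 (fun t => RtoC (- exp (- t)))). apply ccont_RtoC.
      apply (ex_derive_continuous (fun t => - exp (- t))). auto_derive; auto.
    - apply climinf_exp with (B := 1). intros t _. rewrite Cmod_R, Rabs_Ropp, Rabs_pos_eq; [lra|apply Rlt_le, exp_pos]. }
  rewrite (Gamma_fun_isI _ _ H). simpl. ring.
Qed.

Lemma Gamma_nat_pos r : 0 < Gamma_fun (1 + INR r).
Proof.
  induction r as [|r IH]; [simpl; rewrite Rplus_0_r, Gamma_1; lra|].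
  rewrite S_INR. replace (1 + (INR r + 1)) with (1 + INR r + 1) by ring.
  assert (H := pos_INR r). rewrite Gamma_step by lra. apply Rmult_lt_0_compat; lra.
Qed.

Lemma Gamma_derive_down y : 0 < y -> ex_derive Gamma_fun (y + 1) -> ex_derive Gamma_fun y.
Proof.
  intros Hy H. apply ex_derive_ext_loc with (fun s => Gamma_fun (s + 1) / s).
  - exists (mkposreal _ Hy). intros s Hs. change (Rabs (s - y) < y) in Hs. apply Rabs_lt_between in Hs.
    rewrite Gamma_step by lra. change (@eq R (s * Gamma_fun s / s) (Gamma_fun s)). field. lra.
  - apply (ex_derive_mult (fun s => Gamma_fun (s + 1)) (fun s => / s)).
    + apply (ex_derive_comp Gamma_fun (fun s => s + 1)); auto. auto_derive; auto.
    + auto_derive; lra.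
Qed.

Lemma Gamma_derive_nat r : ex_derive Gamma_fun (1 + INR r).
Proof.
  assert (H0 := pos_INR r). do 3 (apply Gamma_derive_down; [lra|]).
  replace (1 + INR r + 1 + 1 + 1) with (INR r + 4) by ring. apply Gamma_derive_large.
Qed.

Lemma psi_step r : psi (1 + INR (S r)) = psi (1 + INR r) + / INR (S r).
Proof.
  assert (H0 := pos_INR r). set (y := 1 + INR r). assert (Hy : 0 < y) by (unfold y; lra).
  assert (HG := Gamma_nat_pos r). fold y in HG.
  replace (1 + INR (S r)) with (y + 1) by (unfold y; rewrite S_INR; ring).
  replace (INR (S r)) with y by (unfold y; rewrite S_INR; ring).
  assert (Hd : Derive Gamma_fun (y + 1) = Gamma_fun y + y * Derive Gamma_fun y).
  { assert (H1 : is_derive (fun s => Gamma_fun (s + 1)) y (Derive Gamma_fun (y + 1))).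
    { evar_last; [apply (is_derive_comp (V:=R_NormedModule) Gamma_fun (fun s => s + 1))|].
      - apply Derive_correct. replace (y + 1) with (1 + INR (S r)) by (unfold y; rewrite S_INR; ring). apply Gamma_derive_nat.
      - instantiate (1 := 1). auto_derive; auto.
      - unfold scal; simpl; unfold mult; simpl. ring. }
    assert (H2 : is_derive (fun s => Gamma_fun (s + 1)) y (Gamma_fun y + y * Derive Gamma_fun y)).
    { apply is_derive_ext_loc with (fun s => s * Gamma_fun s).
      - exists (mkposreal _ Hy). intros s Hs. change (Rabs (s - y) < y) in Hs. apply Rabs_lt_between in Hs.
        symmetry; apply Gamma_step. lra.
      - evar_last; [apply (is_derive_mult (K:=R_AbsRing) (fun s => s) Gamma_fun)|].
        + apply (@is_derive_id R_AbsRing).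
        + apply Derive_correct, Gamma_derive_nat.
        + intros; apply Rmult_comm.
        + unfold plus, mult, one; simpl. ring. }
    apply is_derive_unique in H1, H2. congruence. }
  unfold psi. rewrite Hd, Gamma_step by auto. field. lra.
Qed.

(** Links the digamma differences of the statement with the harmonic numbers in the expansion of
    [K_0]. *)
Lemma psi_harm r : psi (1 + INR r) - psi 1 = harm r.
Proof.
  induction r as [|r IH].
  - rewrite harm_0. simpl. rewrite Rplus_0_r. ring.
  - rewrite psi_step, harm_S, <- IH. ring.
Qed.

(** * Primitives on the right half-plane *)

Lemma taylor2 (g g1 g2 : C -> C) u k B :
  (forall t, 0 <= t <= 1 -> cder g (u + RtoC t * k)%C (g1 (u + RtoC t * k)%C)) ->
  (forall t, 0 <= t <= 1 -> cder g1 (u + RtoC t * k)%C (g2 (u + RtoC t * k)%C)) ->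
  (forall t, 0 <= t <= 1 -> Cmod (g2 (u + RtoC t * k)%C) <= B) ->
  Cmod (g (u + k) - g u - k * g1 u)%C <= B * Cmod k ^ 2.
Proof.
  intros H1 H2 HB.
  assert (HB0 : 0 <= B).
  { eapply Rle_trans; [apply Cmod_ge_0|]. apply (HB 0); lra. }
  assert (Hg1 : forall t, 0 <= t <= 1 -> Cmod (g1 (u + RtoC t * k)%C - g1 u) <= B * Cmod k).
  { intros t Ht.
    eapply Rle_trans; [apply (mean_value_seg g1 (fun s => g2 (u + RtoC s * (RtoC t * k))%C) u (RtoC t * k) B)|].
    - intros s Hs. replace (RtoC s * (RtoC t * k))%C with (RtoC (s * t) * k)%C by (rewrite RtoC_mult; ring). apply H2. nra.
    - intros s Hs. replace (RtoC s * (RtoC t * k))%C with (RtoC (s * t) * k)%C by (rewrite RtoC_mult; ring). apply HB. nra.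
    - rewrite Cmod_mult, Cmod_Rpos by lra. generalize (Cmod_ge_0 k). intros. apply Rmult_le_compat_l; nra. }
  assert (M := mean_value_seg (fun v => g v - v * g1 u)%C (fun t => g1 (u + RtoC t * k)%C - g1 u)%C u k (B * Cmod k)).
  cbv beta in M.
  replace (g (u + k) - (u + k) * g1 u - (g u - u * g1 u))%C with (g (u + k)%C - g u - k * g1 u)%C in M by ring.
  replace (B * Cmod k ^ 2) with (B * Cmod k * Cmod k) by ring. apply M; auto.
  intros t Ht. apply cder_minus; [apply H1, Ht|]. eapply cder_eq; [apply cder_mult; [apply cder_id|apply cder_const]|]. cbv beta; ring.
Qed.

(** The primitive is the integral along the segment from [1] to [z], which stays in the convex
    half-plane; it is differentiated under the integral with Taylor's formula, controlled by the
    local bounds on [g1] and [g2]. *)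
Lemma half_plane_primitive (g g1 g2 : C -> C) :
  (forall z, 0 < Re z -> cder g z (g1 z)) ->
  (forall z, 0 < Re z -> cder g1 z (g2 z)) ->
  (forall e M, 0 < e -> 0 < M -> exists B, forall z, e <= Re z -> Cmod z <= M -> Cmod (g1 z) <= B /\ Cmod (g2 z) <= B) ->
  exists G, forall z, 0 < Re z -> cder G z (g z).
Proof.
  intros H1 H2 HB.
  set (u := fun z t => (1 + RtoC t * (z - 1))%C).
  assert (Hu : forall z t, Re (u z t) = 1 + t * (Re z - 1)).
  { intros z t. unfold u. rewrite Re_plus, Re_scal, Re_minus, re_RtoC. reflexivity. }
  assert (Hupos : forall z t, 0 < Re z -> 0 <= t <= 1 -> 0 < Re (u z t)).
  { intros z t Hz Ht. rewrite Hu. nra. }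
  assert (Hr : forall z t, 0 < Re z -> 0 <= t <= 1 -> rder (fun t => g (u z t)) t ((z - 1) * g1 (u z t))%C).
  { intros z t Hz Ht. eapply rder_eq; [apply rder_path; apply H1; apply (Hupos z t); auto|]. unfold u; ring. }
  assert (Hr1 : forall z t, 0 < Re z -> 0 <= t <= 1 -> rder (fun t => g1 (u z t)) t ((z - 1) * g2 (u z t))%C).
  { intros z t Hz Ht. eapply rder_eq; [apply rder_path; apply H2; apply (Hupos z t); auto|]. unfold u; ring. }
  assert (Hmm : forall t, Rmin 0 1 <= t <= Rmax 0 1 -> 0 <= t <= 1) by (rewrite Rmin_left, Rmax_right by lra; auto).
  assert (HG : forall z, exists I, 0 < Re z -> cint (fun t => (z - 1) * g (u z t))%C 0 1 I).
  { intros z. destruct (Rlt_dec 0 (Re z)) as [Hz|Hz]; [|exists (RtoC 0); lra].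
    destruct (ex_cint (fun t => (z - 1) * g (u z t))%C 0 1) as [I HI]; [|now exists I].
    intros t Ht. apply Hmm in Ht. apply ccont_scal. eapply rder_ccont, Hr; auto. }
  destruct (fun_choice _ _ _ HG) as [G HG']. exists G. intros z Hz.
  (* For [|h| < e] all segments from [1] to [z + h] keep real part at least [e] and modulus at most
     [M]. *)
  set (e := Rmin 1 (Re z) / 2). assert (He : 0 < e) by (unfold e; assert (0 < Rmin 1 (Re z)) by (apply Rmin_pos; lra); lra).
  assert (He1 : 2 * e <= 1) by (unfold e; generalize (Rmin_l 1 (Re z)); lra).
  assert (He2 : 2 * e <= Re z) by (unfold e; generalize (Rmin_r 1 (Re z)); lra).
  set (M := Cmod z + 3). assert (Hz0 := Cmod_ge_0 z). assert (HM : 0 < M) by (unfold M; lra).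
  destruct (HB e M He HM) as [B Hb].
  assert (Hn : forall t s h, 0 <= t <= 1 -> 0 <= s <= 1 -> Cmod h < e -> e <= Re (u z t + RtoC s * (RtoC t * h))%C /\ Cmod (u z t + RtoC s * (RtoC t * h)) <= M).
  { intros t s h Ht Hs Hh. assert (Hh0 := Cmod_ge_0 h). assert (Hrh := re_le_Cmod h). apply Rabs_le_between in Hrh. split.
    - rewrite Re_plus, Hu, !Re_scal.
      assert (Q1 : 2 * e <= 1 + t * (Re z - 1)) by nra.
      assert (Q2 : 0 <= s * t <= 1) by nra.
      assert (Q3 : - e <= s * t * Re h) by nra. lra.
    - eapply Rle_trans; [apply Cmod_triangle|]. rewrite !Cmod_mult, !Cmod_Rpos by lra.
      assert (Cmod (u z t) <= 2 + Cmod z).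
      { unfold u. eapply Rle_trans; [apply Cmod_triangle|]. rewrite Cmod_1, Cmod_mult, Cmod_Rpos by lra.
        assert (H := Cmod_triangle_minus z 1). rewrite Cmod_1 in H. generalize (Cmod_ge_0 (z - 1)). nra. }
      unfold M. assert (s * (t * Cmod h) <= 1); [|lra]. assert (0 <= t * Cmod h <= 1) by nra. nra. }
  assert (HB0 : 0 <= B).
  { destruct (Hn 0 0 0 ltac:(lra) ltac:(lra) ltac:(rewrite Cmod_0; auto)) as [Ha Hc]. destruct (Hb _ Ha Hc) as [Hd _].
    eapply Rle_trans; [apply Cmod_ge_0|apply Hd]. }
  assert (Hn0 : forall t s h, 0 <= t <= 1 -> 0 <= s <= 1 -> Cmod h < e -> 0 < Re (u z t + RtoC s * (RtoC t * h))%C).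
  { intros. destruct (Hn t s h); auto. lra. }
  apply cder_quad with (d := e) (B := Cmod (z - 1) * B + B); auto. intros h Hh. assert (Hh0 := Cmod_ge_0 h).
  assert (Hzh : 0 < Re (z + h)%C).
  { rewrite Re_plus. assert (Hrh := re_le_Cmod h). apply Rabs_le_between in Hrh. lra. }
  assert (Euh : forall t, u (z + h)%C t = (u z t + RtoC t * h)%C) by (intros; unfold u; ring).
  (* The formal derivative in [z] under the integral is the derivative in [t] of [t g(u z t)], hence
     integrates to [g z]. *)
  assert (HF : cint (fun t => g (u z t) + RtoC t * ((z - 1) * g1 (u z t)))%C 0 1 (g z)).
  { assert (HF0 := cint_FTC (fun t => RtoC t * g (u z t))%C (fun t => g (u z t) + RtoC t * ((z - 1) * g1 (u z t)))%C 0 1).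
    cbv beta in HF0. replace (RtoC 1 * g (u z 1) - RtoC 0 * g (u z 0))%C with (g z) in HF0.
    - apply HF0; intros t Ht; apply Hmm in Ht.
      + eapply rder_eq; [apply rder_mult; [apply rder_RtoC, (@is_derive_id R_AbsRing)|apply Hr; auto]|].
        cbv beta. change (@one R_AbsRing) with 1%R. ring.
      + apply ccont_plus; [eapply rder_ccont, Hr; auto|]. apply ccont_mult; [apply ccont_RtoC, continuous_id|].
        apply ccont_scal. eapply rder_ccont, Hr1; auto.
    - replace (u z 1) with z by (unfold u; ring). ring. }
  assert (HT := cint_minus _ _ _ _ _ _ (cint_minus _ _ _ _ _ _ (HG' _ Hzh) (HG' _ Hz)) (cint_scal h _ _ _ _ HF)).
  replace ((Cmod (z - 1) * B + B) * Cmod h ^ 2) with ((Cmod (z - 1) * B + B) * Cmod h ^ 2 * (1 - 0)) by ring.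
  eapply cint_bound_const; [lra| |apply HT]. intros t Ht. cbv beta. rewrite Euh.
  replace ((z + h - 1) * g (u z t + RtoC t * h)%C - (z - 1) * g (u z t) - h * (g (u z t) + RtoC t * ((z - 1) * g1 (u z t))))%C with
    ((z - 1) * (g (u z t + RtoC t * h)%C - g (u z t) - (RtoC t * h) * g1 (u z t)) + h * (g (u z t + RtoC t * h)%C - g (u z t)))%C by ring.
  eapply Rle_trans; [apply Cmod_triangle|]. rewrite !Cmod_mult.
  assert (HTa : Cmod (g (u z t + RtoC t * h)%C - g (u z t) - (RtoC t * h) * g1 (u z t)) <= B * Cmod (RtoC t * h) ^ 2).
  { apply (taylor2 g g1 g2).
    - intros s Hs. apply H1, Hn0; auto.
    - intros s Hs. apply H2, Hn0; auto.
    - intros s Hs. destruct (Hn t s h Ht Hs Hh) as [Ha Hc]. apply (Hb _ Ha Hc). }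
  assert (HM1 : Cmod (g (u z t + RtoC t * h)%C - g (u z t)) <= B * Cmod (RtoC t * h)).
  { apply (mean_value_seg g (fun s => g1 (u z t + RtoC s * (RtoC t * h))%C)).
    - intros s Hs. apply H1, Hn0; auto.
    - intros s Hs. destruct (Hn t s h Ht Hs Hh) as [Ha Hc]. apply (Hb _ Ha Hc). }
  rewrite Cmod_mult, Cmod_Rpos in HTa, HM1 by lra.
  assert (Ht1 : (t * Cmod h) ^ 2 <= Cmod h ^ 2) by (apply pow_incr; nra).
  assert (Hz1 := Cmod_ge_0 (z - 1)).
  assert (P1 : Cmod (z - 1) * Cmod (g (u z t + RtoC t * h)%C - g (u z t) - (RtoC t * h) * g1 (u z t)) <= Cmod (z - 1) * (B * Cmod h ^ 2)).
  { apply Rmult_le_compat_l; auto. eapply Rle_trans; [apply HTa|]. apply Rmult_le_compat_l; auto. }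
  assert (P2 : Cmod h * Cmod (g (u z t + RtoC t * h)%C - g (u z t)) <= Cmod h * (B * Cmod h)).
  { apply Rmult_le_compat_l; auto. eapply Rle_trans; [apply HM1|]. apply Rmult_le_compat_l; nra. }
  replace ((Cmod (z - 1) * B + B) * Cmod h ^ 2) with (Cmod (z - 1) * (B * Cmod h ^ 2) + Cmod h * (B * Cmod h)) by ring. lra.
Qed.

(* The circular arc from [|z|] to [z] stays in the cone of [z]. *)
Lemma arc_bound kp (phi phi' : C -> C) B z : 0 < Re z -> kp * Cmod z <= Re z ->
  (forall w, 0 < Re w -> cder phi w (phi' w)) ->
  (forall w, 0 < Re w -> kp * Cmod w <= Re w -> Cmod w = Cmod z -> Cmod (phi' w) <= B) ->
  Cmod (phi z - phi (RtoC (Cmod z))) <= 2 * (Cmod z * B).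
Proof.
  intros Hz Hk Hd HB. set (r := Cmod z) in *. assert (Hr : 0 < r) by now apply Cmod_pos_Re.
  assert (Ha : - (PI / 2) < Carg z < PI / 2) by (rewrite Carg_atan by auto; generalize (atan_bound (Im z / Re z)); lra).
  assert (HP : PI / 2 <= 2) by (generalize PI_4; lra).
  assert (HB0 : 0 <= B) by (eapply Rle_trans; [apply Cmod_ge_0|apply (HB z); auto]).
  set (u := RtoC (ln r)). set (v := (0, Carg z) : C).
  assert (Ev : forall t, (u + RtoC t * v)%C = (ln r, t * Carg z)).
  { intros t. apply C_eq; simpl; ring. }
  assert (Hin : forall t, 0 <= t <= 1 -> - (PI / 2) < t * Carg z < PI / 2) by (intros; nra).
  assert (Hm : forall t, Cmod (Cexp (u + RtoC t * v)) = r).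
  { intros t. rewrite Ev, Cmod_Cexp. simpl. now apply exp_ln. }
  assert (Hre : forall t, 0 <= t <= 1 -> Re z <= Re (Cexp (u + RtoC t * v))).
  { intros t Ht. rewrite Ev. rewrite <- (Cexp_Clog z) at 1 by (now apply Cneq0_Re). unfold Clog. fold r. simpl.
    apply Rmult_le_compat_l; [apply Rlt_le, exp_pos|]. specialize (Hin t Ht).
    destruct (Rle_lt_dec 0 (Carg z)).
    - apply cos_decr_1; nra.
    - rewrite <- (cos_neg (Carg z)), <- (cos_neg (t * Carg z)). apply cos_decr_1; nra. }
  assert (M := mean_value_seg (fun w => phi (Cexp w))
    (fun t => Cexp (u + RtoC t * v) * phi' (Cexp (u + RtoC t * v)))%C u v (r * B)).
  cbv beta in M.
  replace (u + v)%C with (Clog z) in M by (unfold u, v, Clog; fold r; apply C_eq; cbn [Cplus fst snd Re Im RtoC]; ring).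
  rewrite Cexp_Clog in M by now apply Cneq0_Re.
  assert (Eu : Cexp u = RtoC r) by (unfold u; rewrite Cexp_RtoC, exp_ln; auto). rewrite Eu in M.
  assert (Hk1 : Cmod (phi z - phi (RtoC r)) <= r * B * Cmod v).
  { apply M.
    - intros t Ht. eapply (cder_comp phi Cexp); [|apply cder_Cexp]. apply Hd. generalize (Hre t Ht). lra.
    - intros t Ht. rewrite Cmod_mult, Hm. apply Rmult_le_compat_l; [lra|].
      apply HB; [generalize (Hre t Ht); lra| |apply Hm]. rewrite Hm. generalize (Hre t Ht). lra. }
  assert (Hv : Cmod v <= 2).
  { eapply Rle_trans; [apply Cmod_le_abs|]. simpl. rewrite Rabs_R0.
    assert (Rabs (Carg z) <= 2); [|lra]. apply Rabs_le_between; lra. }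
  assert (0 <= r * B) by (apply Rmult_le_pos; lra). nra.
Qed.

Lemma rder_real phi x l : cder phi (RtoC x) l -> rder (fun x => phi (RtoC x)) x l.
Proof.
  intros H. apply rder_ext with (fun t => phi (0 + RtoC t * 1)%C); [intros; f_equal; ring|].
  eapply rder_eq; [apply rder_path|].
  - replace (0 + RtoC x * 1)%C with (RtoC x) by ring. exact H.
  - ring.
Qed.

Lemma Rpower_le_pow_le r s p : 0 < r -> r <= s -> 0 <= p -> Rpower r p <= Rpower s p.
Proof. intros Hr Hs Hp. apply Rle_Rpower_l; auto. Qed.

Lemma Rpower_between e M r p : 0 < e -> e <= r -> r <= M -> Rpower r p <= Rpower e p + Rpower M p.
Proof.
  intros He H1 H2. assert (Ha := Rpower_pos e p). assert (Hb := Rpower_pos M p).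
  destruct (Rle_lt_dec 0 p).
  - assert (Rpower r p <= Rpower M p) by (apply Rpower_le_pow_le; lra). lra.
  - assert (Rpower r p <= Rpower e p); [|lra]. unfold Rpower. apply exp_le_mono.
    assert (ln e <= ln r) by (apply ln_le; lra). nra.
Qed.

(** * The primitive of the summand, normalised at the origin *)

Section G.
Variables b mu gamma : R.
Hypothesis hb : 0 < b.
Hypothesis hmu : 0 < mu.

Definition integrand (z : C) : C := (Cpower z (RtoC gamma) * bessel_factor b mu z)%C.

Lemma Sm_integrand kp m L : 0 < kp -> (1 <= L)%nat -> Sm kp m (fun r => Rpower r (gamma - INR L)) integrand.
Proof.
  intros Hkp HL. apply Sm_weight_eq with (fun r => Rpower r gamma * / r ^ L).
  { intros r Hr. unfold Rminus. rewrite Rpower_plus, Rpower_Ropp, Rpower_pow; auto. }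
  apply Sm_mult; [intros; apply Rlt_le, Rpower_pos|apply Sm_Cpower|apply Sm_bessel_factor; auto].
Qed.

Lemma integrand_primitive : exists G, forall z, 0 < Re z -> cder G z (integrand z).
Proof.
  destruct (Sm_dseq 1 2 _ _ (Sm_integrand 1 2 1 Rlt_0_1 (Nat.le_refl 1))) as [psi [H0 Hd]].
  assert (E : forall z, 0 < Re z -> psi O z = integrand z) by auto.
  apply (half_plane_primitive integrand (psi 1%nat) (psi 2%nat)).
  - intros z Hz. eapply cder_ext_half; [auto|intros; apply E; auto|]. apply (Hd O); auto.
  - intros z Hz. apply (Hd 1%nat); auto.
  - intros e M He HM. 
    (* The cone with constant [e / M] contains all [z] with [Re z >= e] and [|z| <= M]. *)
    assert (Hkp : 0 < e / M) by (apply Rdiv_lt_0_compat; auto).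
    assert (HS : Sm (e / M) 2 (fun r => Rpower r (gamma - INR 1)) (psi O)).
    { eapply Sm_ext; [|apply (Sm_integrand (e / M) 2 1 Hkp (Nat.le_refl 1))]. intros; symmetry; auto. }
    destruct (Sm_dseq_bound (e / M) 2 _ psi Hd HS 1%nat ltac:(lia)) as [A1 [HA1 H1]].
    destruct (Sm_dseq_bound (e / M) 2 _ psi Hd HS 2%nat ltac:(lia)) as [A2 [HA2 H2]].
    set (W := Rpower e (gamma - INR 1) + Rpower M (gamma - INR 1)).
    assert (HW : 0 <= W) by (unfold W; generalize (Rpower_pos e (gamma - INR 1)) (Rpower_pos M (gamma - INR 1)); lra).
    exists (A1 * (W / e ^ 1) + A2 * (W / e ^ 2)).
    intros z Hz HzM. assert (Hz0 : 0 < Re z) by lra. assert (Hm := Cmod_pos_Re z Hz0).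
    assert (Hem : e <= Cmod z) by (eapply Rle_trans; [apply Hz|]; eapply Rle_trans; [apply Rle_abs|apply re_le_Cmod]).
    assert (Hc : e / M * Cmod z <= Re z).
    { apply Rle_trans with e; auto. unfold Rdiv. rewrite Rmult_assoc. rewrite <- (Rmult_1_r e) at 2. apply Rmult_le_compat_l; [lra|].
      apply Rmult_le_reg_l with M; auto. rewrite <- Rmult_assoc, Rinv_r by lra. lra. }
    assert (Hw : forall j, Rpower (Cmod z) (gamma - INR 1) / Cmod z ^ j <= W / e ^ j).
    { intros j. unfold Rdiv. apply Rmult_le_compat; [apply Rlt_le, Rpower_pos|apply Rlt_le, Rinv_0_lt_compat, pow_lt; auto| |].
      - apply Rpower_between; auto.
      - apply Rinv_le_contravar; [apply pow_lt; auto|apply pow_incr; lra]. }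
    assert (Hp : forall j, 0 <= W / e ^ j).
    { intros j. apply Rmult_le_pos; auto. apply Rlt_le, Rinv_0_lt_compat, pow_lt; auto. }
    assert (Q1 := Rmult_le_compat_l A1 _ _ HA1 (Hw 1%nat)). assert (Q2 := Rmult_le_compat_l A2 _ _ HA2 (Hw 2%nat)).
    assert (Q3 := Rmult_le_pos _ _ HA1 (Hp 1%nat)). assert (Q4 := Rmult_le_pos _ _ HA2 (Hp 2%nat)).
    specialize (H1 z Hz0 Hc). specialize (H2 z Hz0 Hc). lra.
Qed.

Variable N : nat.
Hypothesis hN : 1 <= gamma + 2 * INR N.
Hypothesis hgam : forall k : nat, gamma + 2 * INR k + 1 <> 0.

(** The two powers come from [lam]; by [hN] neither exponent is negative, so the weight
    increases. *)
Definition rem_weight (r : R) : R := Rpower r (gamma + 2 * INR N + 1) + Rpower r (gamma + 2 * INR N - 1).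

Lemma rem_weight_eq r : 0 < r -> Rpower r gamma * wlam (2 * N) r = rem_weight r.
Proof.
  intros Hr. unfold rem_weight, wlam, lam. rewrite <- Rpower_pow by auto.
  replace (INR (2 * N)) with (2 * INR N) by (rewrite mult_INR; simpl; ring).
  unfold Rminus. rewrite (Rpower_plus (gamma + 2 * INR N) 1), (Rpower_plus (gamma + 2 * INR N) (- (1))), Rpower_Ropp, Rpower_1 by auto.
  rewrite Rpower_plus. ring.
Qed.

Lemma rem_weight_mono r s : 0 < r -> r <= s -> rem_weight r <= rem_weight s.
Proof. intros Hr Hs. unfold rem_weight. apply Rplus_le_compat; apply Rpower_le_pow_le; lra. Qed.

Lemma rem_weight_pos r : 0 < rem_weight r.
Proof. unfold rem_weight. generalize (Rpower_pos r (gamma + 2 * INR N + 1)) (Rpower_pos r (gamma + 2 * INR N - 1)). lra. Qed.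

Definition integrand_rem (z : C) : C := (Cpower z (RtoC gamma) * factor_rem b mu N z)%C.

Lemma Sm_integrand_rem kp m : 0 < kp -> Sm kp m rem_weight integrand_rem.
Proof.
  intros Hkp. apply Sm_weight_eq with (fun r => Rpower r gamma * wlam (2 * N) r); [intros; now apply rem_weight_eq|].
  apply Sm_mult; [intros; apply Rlt_le, Rpower_pos|apply Sm_Cpower|apply Sm_factor_rem; auto].
Qed.

(* Termwise primitive of [z^gamma factor_exp z], without constant of integration; no exponent is [-1]
   because [gamma] is not a negative odd integer. *)
Definition expansion_prim_term (k : nat) (z : C) : C :=
  (Cpower z (RtoC (gamma + 2 * INR k + 1)) *
   (RtoC (Ak b mu k / (gamma + 2 * INR k + 1)) + RtoC (Bk b mu k / (gamma + 2 * INR k + 1)) * Clog z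
    - RtoC (Bk b mu k / (gamma + 2 * INR k + 1) ^ 2)))%C.
Definition expansion_prim (z : C) : C := Csum (fun k => expansion_prim_term k z) N.

Lemma Cpower_shift z (p q : R) : Cpower z (RtoC (p + q)) = (Cpower z (RtoC p) * Cpower z (RtoC q))%C.
Proof. rewrite RtoC_plus. apply Cpower_plus. Qed.

Lemma cder_expansion_prim z : 0 < Re z -> cder expansion_prim z (Cpower z (RtoC gamma) * factor_exp b mu N z)%C.
Proof.
  intros Hz. assert (Hz0 := Cneq0_Re z Hz). eapply cder_eq.
  - apply (cder_Csum expansion_prim_term (fun k z => Cpower z (RtoC gamma) * (Cpow z (2 * k) * (RtoC (Ak b mu k) + RtoC (Bk b mu k) * Clog z)))%C).
    intros k _. unfold expansion_prim_term. set (e := gamma + 2 * INR k + 1). assert (He : e <> 0) by apply hgam.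
    eapply cder_eq.
    + apply cder_mult; [apply cder_Cpower, Hz|]. apply cder_minus; [|apply cder_const].
      apply cder_plus; [apply cder_const|apply cder_scal, cder_Clog, Hz].
    + cbv beta. replace (RtoC e - 1)%C with (RtoC (gamma + INR (2 * k))).
      2:{ unfold e. rewrite mult_INR, !RtoC_plus, !RtoC_mult. change (INR 2) with 2%R. ring. }
      replace (Cpower z (RtoC e)) with (Cpower z (RtoC (gamma + INR (2 * k))) * z)%C.
      2:{ unfold e. replace (gamma + 2 * INR k + 1) with (gamma + INR (2 * k) + 1) by (rewrite mult_INR; simpl; ring).
          rewrite (Cpower_shift z (gamma + INR (2 * k)) 1). f_equal. unfold Cpower. rewrite Cmult_1_l. symmetry. now apply Cexp_Clog. }
      rewrite (Cpower_shift z gamma), Cpower_nat by auto.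
      assert (HeC : RtoC e <> RtoC 0) by (intros E; apply He; now apply RtoC_inj).
      rewrite !RtoC_div, RtoC_pow by (auto; apply pow_nonzero; auto). field. split; auto.
  - rewrite Csum_scal, <- factor_exp_eq. reflexivity.
Qed.

(* The limit [Hinf] is the continued integral at [s = 1]: see [H0_value]. *)
Lemma normalised_primitive : exists (G : C -> C) (Hinf : C),
  (forall z, 0 < Re z -> cder G z (integrand z)) /\
  clim0 (fun x => G (RtoC x) - expansion_prim (RtoC x))%C 0 /\
  climinf (fun x => G (RtoC x)) Hinf /\
  (forall kp, 0 < kp -> exists A, 0 <= A /\ forall z, 0 < Re z -> kp * Cmod z <= Re z ->
     Cmod (G z - expansion_prim z) <= A * (Cmod z * rem_weight (Cmod z))) /\
  (forall a, 0 < Re a -> climinf (fun x => G (RtoC x / a)%C) Hinf).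
Proof.
  destruct integrand_primitive as [G0 HG0].
  assert (HR : forall z, 0 < Re z -> cder (fun z => G0 z - expansion_prim z)%C z (integrand_rem z)).
  { intros z Hz. eapply cder_eq; [apply cder_minus; [apply HG0, Hz|apply cder_expansion_prim, Hz]|].
    unfold integrand, integrand_rem, factor_rem. ring. }
  destruct (Sm_bound _ _ _ _ (Sm_integrand_rem 1 0 Rlt_0_1)) as [A1 [HA1 HB1]].
  assert (Hreal : forall x, 0 < x -> 1 * Cmod (RtoC x) <= Re (RtoC x)).
  { intros x Hx. rewrite Cmod_Rpos by lra. simpl. lra. }
  assert (Hinc0 : forall s t, 0 < s -> s <= t -> Cmod ((G0 (RtoC t) - expansion_prim (RtoC t)) - (G0 (RtoC s) - expansion_prim (RtoC s))) <= A1 * rem_weight t * t - A1 * rem_weight t * s).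
  { intros s t Hs Hst.
    apply (mean_value_majorant (fun x => G0 (RtoC x) - expansion_prim (RtoC x))%C (fun x => integrand_rem (RtoC x)) (fun x => A1 * rem_weight t * x) (fun x => A1 * rem_weight t)); auto.
    - intros x Hx. apply (rder_real (fun z => G0 z - expansion_prim z)%C). apply HR. simpl. lra.
    - intros x Hx. auto_derive; auto; ring.
    - intros x Hx. eapply Rle_trans; [apply HB1; [simpl; lra|apply Hreal; lra]|]. rewrite Cmod_Rpos by lra.
      apply Rmult_le_compat_l; auto. apply rem_weight_mono; lra. }
  (* The derivative of the difference is [integrand_rem], bounded on [(0, 1]], so the difference has
     a limit at [0]; subtracting it normalises the primitive. *)
  destruct (conv_0 (fun x => G0 (RtoC x) - expansion_prim (RtoC x))%C (fun x => A1 * rem_weight 1 * x) 1 0) as [c0 [Hc0 _]].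
  { lra. }
  { intros s t Hs Hst Ht1. eapply Rle_trans; [apply Hinc0; auto|].
    assert (rem_weight t <= rem_weight 1) by (apply rem_weight_mono; lra). assert (A1 * rem_weight t <= A1 * rem_weight 1) by (apply Rmult_le_compat_l; auto). nra. }
  { intros t Ht _. generalize (rem_weight_pos 1). intros. apply Rmult_le_pos; [apply Rmult_le_pos; lra|lra]. }
  set (G := fun z => (G0 z - c0)%C).
  assert (HG : forall z, 0 < Re z -> cder G z (integrand z)).
  { intros z Hz. eapply cder_eq; [apply cder_minus; [apply HG0, Hz|apply cder_const]|]. ring. }
  assert (HG0lim : clim0 (fun x => G (RtoC x) - expansion_prim (RtoC x))%C 0).
  { replace (RtoC 0) with (c0 + - c0)%C by ring.
    eapply (clim0_ext (fun x => (G0 (RtoC x) - expansion_prim (RtoC x)) + - c0)%C _ _ 1); [lra|intros; unfold G; ring|].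
    apply clim0_plus; [exact Hc0|apply clim0_const]. }
  (* Makes the integrand [O(|z|^(-2))] at infinity: integrable along rays, and small on arcs. *)
  destruct (nat_above (Rabs gamma + 3)) as [k0 Hk0]. set (L := S k0).
  assert (HL : gamma - INR L <= - 2).
  { unfold L. rewrite S_INR. assert (H2 := Rle_abs gamma). lra. }
  assert (HL1 : (1 <= L)%nat) by (unfold L; lia).
  assert (Hdec : forall kp, 0 < kp -> exists A, 0 <= A /\ forall z, 0 < Re z -> kp * Cmod z <= Re z -> 1 <= Cmod z -> Cmod (integrand z) <= A * (/ Cmod z ^ 2)).
  { intros kp Hkp. destruct (Sm_bound _ _ _ _ (Sm_integrand kp 0 L Hkp HL1)) as [A [HA HB]]. exists A; split; auto.
    intros z Hz Hk Hz1. eapply Rle_trans; [apply HB; auto|]. apply Rmult_le_compat_l; auto.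
    rewrite <- Rpower_pow, <- Rpower_Ropp by lra. apply Rle_Rpower; auto. }
  destruct (Hdec 1 Rlt_0_1) as [A2 [HA2 HB2]].
  assert (Hconv : exists l, climinf (fun x => G (RtoC x)) l).
  { destruct (conv_inf (fun x => G (RtoC x)) (fun x => - (A2 / x)) 1 0) as [l [Hl _]]; [| |now exists l].
    - intros s t Hs Hst.
      apply (mean_value_majorant (fun x => G (RtoC x)) (fun x => integrand (RtoC x)) (fun x => - (A2 / x)) (fun x => A2 * / x ^ 2)); auto.
      + intros x Hx. apply rder_real, HG. simpl; lra.
      + intros x Hx. auto_derive; [lra|field; lra].
      + intros x Hx. eapply Rle_trans; [apply HB2; [simpl; lra|apply Hreal; lra|rewrite Cmod_Rpos; lra]|]. rewrite Cmod_Rpos; lra.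
    - intros t Ht. assert (0 <= A2 / t); [|lra]. apply Rmult_le_pos; [auto|apply Rlt_le, Rinv_0_lt_compat; lra]. }
  destruct Hconv as [Hinf Hlim]. exists G, Hinf. split; [auto|]. split; [auto|]. split; [auto|]. split.
  - intros kp Hkp. destruct (Sm_bound _ _ _ _ (Sm_integrand_rem kp 0 Hkp)) as [A [HA HB]].
    exists (2 * A + A1). split; [lra|]. intros z Hz Hk. set (r := Cmod z). assert (Hr : 0 < r) by now apply Cmod_pos_Re.
    assert (HRG : forall w, 0 < Re w -> cder (fun z => G z - expansion_prim z)%C w (integrand_rem w)).
    { intros w Hw. apply (cder_ext (fun z => (G0 z - expansion_prim z) - c0)%C); [intros; unfold G; ring|].
      eapply cder_eq; [apply cder_minus; [apply HR, Hw|apply cder_const]|]. ring. }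
    assert (Harc := arc_bound kp (fun z => G z - expansion_prim z)%C integrand_rem (A * rem_weight r) z Hz Hk HRG).
    cbv beta in Harc. fold r in Harc.
    assert (H1 : Cmod (G z - expansion_prim z - (G (RtoC r) - expansion_prim (RtoC r))) <= 2 * (r * (A * rem_weight r))).
    { apply Harc. intros w Hw Hkw Hwr. rewrite <- Hwr. apply HB; auto. }
    assert (H2 : Cmod (G (RtoC r) - expansion_prim (RtoC r)) <= A1 * rem_weight r * r).
    { apply le_epsilon. intros eps He. destruct (HG0lim eps He) as [d [Hd Hd']].
      set (s := Rmin d r / 2). assert (Hm : 0 < Rmin d r) by (apply Rmin_pos; auto).
      assert (Hs : 0 < s < d) by (unfold s; generalize (Rmin_l d r); lra). assert (Hsr : s <= r) by (unfold s; generalize (Rmin_r d r); lra).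
      specialize (Hd' s Hs). specialize (Hinc0 s r (proj1 Hs) Hsr).
      replace (G (RtoC r) - expansion_prim (RtoC r))%C with ((G0 (RtoC r) - expansion_prim (RtoC r) - (G0 (RtoC s) - expansion_prim (RtoC s))) + (G (RtoC s) - expansion_prim (RtoC s) - 0))%C
        by (unfold G; ring).
      eapply Rle_trans; [apply Cmod_triangle|]. assert (0 <= A1 * rem_weight r * s).
      { apply Rmult_le_pos; [apply Rmult_le_pos; [auto|apply Rlt_le, rem_weight_pos]|lra]. } lra. }
    replace (G z - expansion_prim z)%C with ((G z - expansion_prim z - (G (RtoC r) - expansion_prim (RtoC r))) + (G (RtoC r) - expansion_prim (RtoC r)))%C by ring.
    eapply Rle_trans; [apply Cmod_triangle|]. lra.
  - intros a Ha. assert (Hma := Cmod_pos_Re a Ha). assert (Ha0 := Cneq0_Re a Ha).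
    set (kp := Re a / Cmod a). assert (Hkp : 0 < kp) by (apply Rdiv_lt_0_compat; auto).
    destruct (Hdec kp Hkp) as [A [HA HB]].
    assert (Hza : forall x, 0 < x -> Re (RtoC x / a)%C = x * Re a / Cmod a ^ 2 /\ Cmod (RtoC x / a) = x / Cmod a).
    { intros x Hx. split.
      - rewrite Cmod2_alt. destruct a as [p q]. simpl. simpl in Ha. field. nra.
      - rewrite Cmod_div, Cmod_Rpos by (auto; lra). reflexivity. }
    intros eps He. destruct (Hlim (eps / 2)) as [M HM]; [lra|].
    exists (Rmax (Cmod a * (Rabs M + 1)) (Cmod a * (4 * A / eps + 1))). intros x Hx.
    assert (Hx1 := Rle_lt_trans _ _ _ (Rmax_l _ _) Hx). assert (Hx2 := Rle_lt_trans _ _ _ (Rmax_r _ _) Hx).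
    assert (HM0 := Rabs_pos M). assert (HM1 := Rle_abs M).
    assert (Hx0 : 0 < x) by nra. destruct (Hza x Hx0) as [E1 E2]. set (z := (RtoC x / a)%C) in *.
    assert (Hz : 0 < Re z).
    { rewrite E1. apply Rdiv_lt_0_compat; [apply Rmult_lt_0_compat; auto|apply pow_lt; auto]. }
    assert (Hk : kp * Cmod z <= Re z) by (rewrite E1, E2; unfold kp; right; field; lra).
    set (r := Cmod z) in *.
    assert (Hr1 : Rabs M + 1 < r).
    { rewrite E2. apply Rmult_lt_reg_l with (Cmod a); auto. replace (Cmod a * (x / Cmod a)) with x by (field; lra). auto. }
    assert (Hr2 : 4 * A / eps + 1 < r).
    { rewrite E2. apply Rmult_lt_reg_l with (Cmod a); auto. replace (Cmod a * (x / Cmod a)) with x by (field; lra). auto. }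
    (* The arc of radius [r] contributes at most [2 A / r], so the limit along the ray of [1/a] is
       the one along the positive axis. *)
    assert (Harc := arc_bound kp G integrand (A * / r ^ 2) z Hz Hk HG). fold r in Harc.
    assert (H1 : Cmod (G z - G (RtoC r)) <= 2 * (r * (A * / r ^ 2))).
    { apply Harc. intros w Hw Hkw Hwr. rewrite <- Hwr. apply HB; auto. rewrite Hwr; lra. }
    assert (H2 : 2 * (r * (A * / r ^ 2)) < eps / 2).
    { replace (2 * (r * (A * / r ^ 2))) with (2 * A / r) by (field; lra).
      apply Rmult_lt_reg_r with (r * / eps * 2); [apply Rmult_lt_0_compat; [apply Rmult_lt_0_compat; [lra|apply Rinv_0_lt_compat; auto]|lra]|].
      replace (2 * A / r * (r * / eps * 2)) with (4 * A / eps) by (field; lra).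
      replace (eps / 2 * (r * / eps * 2)) with r by (field; lra). lra. }
    specialize (HM r ltac:(lra)).
    replace (G z - Hinf)%C with ((G z - G (RtoC r)) + (G (RtoC r) - Hinf))%C by ring.
    eapply Rle_lt_trans; [apply Cmod_triangle|]. lra.
Qed.

End G.

(** * The Mellin transform and its continuation *)

Lemma Csum_telescope (u : nat -> C) n : Csum (fun i => u (S i) - u i)%C n = (u n - u O)%C.
Proof. induction n as [|n IH]; [rewrite Csum_0; ring|]. rewrite Csum_S, IH. ring. Qed.

(** The integral is cut into compact pieces to which [analytic_piece] applies. Stating the sum
    through an arbitrary primitive [Phi] lets the pieces telescope to boundary values afterwards. *)
Lemma mellin_pieces (g : R -> C) (al be : nat -> R) p (V : nat -> R) L :
  cont_pos g -> (forall n, 0 < al n < be n) -> (forall n, V n <= L) ->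
  (forall n t, al n <= t <= be n ->
    Cmod (g t) * (exp (Re p * ln t) * exp (/ 2 * Rabs (ln t))) * (be n - al n) <= V (S n) - V n) ->
  exists F : C -> C, ana F p /\ forall s, Cmod (s - p) < / 4 ->
    forall Phi, (forall x, 0 < x -> rder Phi x (g x * xp x s)%C) ->
    clim (Csum (fun n => Phi (be n) - Phi (al n))%C) (F s).
Proof.
  intros Hg Hab HV HB.
  assert (HP : forall n, exists c : nat -> C, (forall k, Cmod (c k) * (/ 4) ^ k <= V (S n) - V n) /\
    forall s, exists I, cint (fun t => g t * Cexp (s * RtoC (ln t)))%C (al n) (be n) I /\
      forall q K, 0 <= q <= 1 -> Cmod (s - p) = q * (/ 4) ->
      Cmod (I - Csum (fun k => c k * Cpow (s - p) k) K)%C <= (V (S n) - V n) * q ^ K).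
  { intros n. destruct (Hab n) as [Ha Hb]. apply analytic_piece; try lra.
    - intros t Ht. apply Hg. lra.
    - intros t Ht. exists (/ t). apply is_derive_Reals, derivable_pt_lim_ln. lra.
    - intros t Ht. replace (2 * / 4) with (/ 2) by field. now apply HB. }
  destruct (fun_choice _ _ _ HP) as [c Hc].
  assert (HJ : exists J : nat -> C -> C, forall n s, cint (fun t => g t * Cexp (s * RtoC (ln t)))%C (al n) (be n) (J n s) /\
      forall q K, 0 <= q <= 1 -> Cmod (s - p) = q * (/ 4) ->
      Cmod (J n s - Csum (fun k => c n k * Cpow (s - p) k) K)%C <= (V (S n) - V n) * q ^ K).
  { destruct (fun_choice (nat * C) C (fun ns I => cint (fun t => g t * Cexp (snd ns * RtoC (ln t)))%C (al (fst ns)) (be (fst ns)) I /\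
      forall q K, 0 <= q <= 1 -> Cmod (snd ns - p) = q * (/ 4) ->
      Cmod (I - Csum (fun k => c (fst ns) k * Cpow (snd ns - p) k) K)%C <= (V (S (fst ns)) - V (fst ns)) * q ^ K)) as [J HJ].
    - intros [n s]. apply (proj2 (Hc n) s).
    - exists (fun n s => J (n, s)). intros n s. apply (HJ (n, s)). }
  destruct HJ as [J HJ].
  destruct (ana_sum J p (/ 4) c V L) as [F [T [HF _]]]; auto; [lra|intros; apply Hc|intros; apply HJ; auto|].
  exists F. split.
  - exists T, (/ 4). split; [lra|]. intros s Hs. now apply HF.
  - intros s Hs Phi HPhi. destruct (HF s Hs) as [HT _]. clear HF.
    eapply clim_ext; [|apply HT]. intros n. apply Csum_ext. intros i _. cbv beta.
    destruct (Hab i) as [Ha Hb]. eapply cint_unique; [apply HJ|].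
    assert (Hmm : forall t, Rmin (al i) (be i) <= t <= Rmax (al i) (be i) -> 0 < t) by (rewrite Rmin_left by lra; intros; lra).
    apply (cint_FTC Phi (fun t => g t * Cexp (s * RtoC (ln t)))%C).
    + intros t Ht. apply HPhi. auto.
    + intros t Ht. apply ccont_mult; [apply Hg; auto|]. eapply rder_ccont. apply (rder_xp t s). auto.
Qed.

Lemma clim0_small (F : R -> C) A d : 0 < d -> 0 <= A -> (forall x, 0 < x -> x <= 1 -> Cmod (F x) <= A * Rpower x d) -> clim0 F 0.
Proof.
  intros Hd HA H eps He. exists (Rmin 1 (exp (ln (eps / (A + 1)) / d))). split; [apply Rmin_pos; [lra|apply exp_pos]|].
  intros x [Hx Hx1]. assert (Ha := Rlt_le_trans _ _ _ Hx1 (Rmin_l _ _)). assert (Hb := Rlt_le_trans _ _ _ Hx1 (Rmin_r _ _)).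
  replace (F x - 0)%C with (F x) by ring. eapply Rle_lt_trans; [apply H; lra|].
  assert (Hq : 0 < eps / (A + 1)) by (apply Rdiv_lt_0_compat; lra).
  assert (H1 : Rpower x d < eps / (A + 1)).
  { unfold Rpower. rewrite <- (exp_ln (eps / (A + 1))) by auto. apply exp_increasing.
    apply ln_increasing in Hb; auto. rewrite ln_exp in Hb.
    apply Rmult_lt_compat_l with (r := d) in Hb; auto. replace (d * (ln (eps / (A + 1)) / d)) with (ln (eps / (A + 1))) in Hb by (field; lra). lra. }
  assert (H2 := Rpower_pos x d). apply Rle_lt_trans with ((A + 1) * Rpower x d); [nra|].
  apply Rmult_lt_reg_r with (/ (A + 1)); [apply Rinv_0_lt_compat; lra|].
  rewrite (Rmult_comm (A + 1)), Rmult_assoc, Rinv_r, Rmult_1_r by lra. exact H1.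
Qed.

(** Half of the exponent pays for the logarithm: [1 + v <= exp v] at [v = - d ln x]. *)
Lemma ln_Rpower_le x d : 0 < d -> 0 < x <= 1 -> Rabs (ln x) * Rpower x (2 * d) <= / d * Rpower x d.
Proof.
  intros Hd [Hx Hx1]. assert (Hl : ln x <= 0) by (rewrite <- ln_1; apply ln_le; lra).
  rewrite Rabs_left1 by auto. replace (2 * d) with (d + d) by ring. rewrite Rpower_plus, <- Rmult_assoc.
  apply Rmult_le_compat_r; [apply Rlt_le, Rpower_pos|].
  assert (H := exp_ineq1_le (- (d * ln x))). rewrite exp_Ropp in H. fold (Rpower x d) in H.
  assert (Hp := Rpower_pos x d).
  apply Rmult_le_reg_l with d; auto. rewrite Rinv_r by lra.
  apply Rmult_le_reg_r with (/ Rpower x d); [apply Rinv_0_lt_compat; auto|].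
  replace (d * (- ln x * Rpower x d) * / Rpower x d) with (- (d * ln x)) by (field; lra). lra.
Qed.

Section H.
Variables b mu gamma : R.
Hypothesis hb : 0 < b.
Hypothesis hmu : 0 < mu.

Definition mellin_integrand (s : C) (x : R) : C := (xp x (RtoC gamma + s - 1) * bessel_factor b mu (RtoC x))%C.
Definition mellin_exponent (k : nat) (s : C) : C := (RtoC gamma + s + RtoC (2 * INR k))%C.
(** The primitive in [x] of the [k]-th term of the expansion at the origin. As a function of [s] it
    carries the possible poles at the zero of [mellin_exponent k], the double one being due to the
    logarithm. *)
Definition mellin_poles_term (k : nat) (s : C) (x : R) : C :=
  (xp x (mellin_exponent k s) * (RtoC (Ak b mu k) * / mellin_exponent k s + RtoC (Bk b mu k) * / mellin_exponent k s * RtoC (ln x)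
    - RtoC (Bk b mu k) * / (mellin_exponent k s * mellin_exponent k s)))%C.
Definition mellin_poles (N : nat) (s : C) (x : R) : C := Csum (fun k => mellin_poles_term k s x) N.

Lemma Cpow_xp x n : 0 < x -> Cpow (RtoC x) n = xp x (RtoC (INR n)).
Proof. intros Hx. rewrite xp_R, <- RtoC_pow, Rpower_pow; auto. Qed.

Lemma rder_mellin_poles N s x : (forall k, (k < N)%nat -> mellin_exponent k s <> RtoC 0) -> 0 < x ->
  rder (mellin_poles N s) x (xp x (RtoC gamma + s - 1) * factor_exp b mu N (RtoC x))%C.
Proof.
  intros He Hx. eapply rder_eq.
  - apply (rder_Csum (fun k x => mellin_poles_term k s x) (fun k x => xp x (RtoC gamma + s - 1) *
      (Cpow (RtoC x) (2 * k) * (RtoC (Ak b mu k) + RtoC (Bk b mu k) * Clog (RtoC x))))%C).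
    intros k Hk. specialize (He k Hk). unfold mellin_poles_term. eapply rder_eq.
    + apply rder_mult; [apply rder_xp, Hx|]. apply rder_minus; [|apply rder_const].
      apply rder_plus; [apply rder_const|apply rder_scal, rder_ln, Hx].
    + cbv beta. rewrite Cpow_xp, Clog_RtoC by auto.
      replace (xp x (mellin_exponent k s - 1)) with (xp x (RtoC gamma + s - 1) * xp x (RtoC (INR (2 * k))))%C.
      2:{ rewrite <- xp_plus. f_equal. unfold mellin_exponent. rewrite mult_INR. change (INR 2) with 2%R. ring. }
      replace (xp x (mellin_exponent k s)) with (xp x (RtoC gamma + s - 1) * xp x (RtoC (INR (2 * k))) * RtoC x)%C.
      2:{ rewrite <- xp_plus. rewrite <- (Rpower_1 x Hx) at 2. rewrite <- xp_R, <- xp_plus. f_equal. unfold mellin_exponent. rewrite mult_INR. change (INR 2) with 2%R. ring. }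
      assert (Hx0 : RtoC x <> RtoC 0) by (intros E; apply RtoC_inj in E; lra).
      rewrite RtoC_inv by lra. field. auto.
  - rewrite Csum_scal, <- factor_exp_eq. reflexivity.
Qed.

(* The Hadamard finite part of the integral of [mellin_integrand s] is [v]. *)
Definition finite_part (N : nat) (s v : C) : Prop := exists Phi l0 l1,
  (forall x, 0 < x -> rder Phi x (mellin_integrand s x)) /\ clim0 (fun x => Phi x - mellin_poles N s x)%C l0 /\ climinf Phi l1 /\ v = (l1 - l0)%C.

Lemma finite_part_unique N s v v' : finite_part N s v -> finite_part N s v' -> v = v'.
Proof.
  intros [Phi [l0 [l1 [Hd [H0 [H1 ->]]]]]] [Psi [m0 [m1 [Hd' [H0' [H1' ->]]]]]].
  set (c := (Phi 1 - Psi 1)%C).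
  assert (Hc : forall x, 0 < x -> Phi x = (Psi x + c)%C).
  { assert (Hcst : forall x y, 0 < x -> x <= y -> (Phi y - Psi y)%C = (Phi x - Psi x)%C).
    { intros x y Hx Hxy. apply Ceq_minus, Cmod_eq_0, Rle_antisym; [|apply Cmod_ge_0].
      assert (M := mean_value_majorant (fun x => Phi x - Psi x)%C (fun x => 0)%C (fun _ => 0) (fun _ => 0) x y Hxy).
      cbv beta in M. rewrite Rminus_diag in M. apply M.
      - intros t Ht. eapply rder_eq; [apply rder_minus; [apply Hd|apply Hd']; lra|]. ring.
      - intros t _. apply (@is_derive_const R_AbsRing R_NormedModule).
      - intros t _. rewrite Cmod_0. lra. }
    intros x Hx. unfold c. destruct (Rle_lt_dec x 1) as [H|H].
    - rewrite (Hcst x 1); auto. ring.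
    - rewrite <- (Hcst 1 x); try lra. ring. }
  assert (E0 : l0 = (m0 + c)%C).
  { eapply clim0_unique; [apply H0|]. eapply (clim0_ext (fun x => Psi x - mellin_poles N s x + c)%C _ _ 1); [lra| |].
    - intros t Ht. rewrite Hc by lra. ring.
    - apply clim0_plus; auto. apply clim0_const. }
  assert (E1 : l1 = (m1 + c)%C).
  { eapply climinf_unique; [apply H1|]. eapply (climinf_ext (fun x => Psi x + c)%C _ _ 1).
    - intros t Ht. rewrite Hc by lra. ring.
    - apply climinf_plus; auto. apply climinf_const. }
  rewrite E0, E1. ring.
Qed.

Lemma mellin_poles_term_clim0 k s : 0 < gamma + Re s + 2 * INR k -> clim0 (mellin_poles_term k s) 0.
Proof.
  intros He. set (d := (gamma + Re s + 2 * INR k) / 2).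
  assert (Hd : 0 < d) by (unfold d; lra).
  assert (Ee : Re (mellin_exponent k s) = 2 * d) by (unfold mellin_exponent, d; rewrite !Re_plus, !re_RtoC; field).
  set (c1 := (RtoC (Ak b mu k) * / mellin_exponent k s - RtoC (Bk b mu k) * / (mellin_exponent k s * mellin_exponent k s))%C).
  set (c2 := (RtoC (Bk b mu k) * / mellin_exponent k s)%C).
  assert (Hc1 := Cmod_ge_0 c1). assert (Hc2 := Cmod_ge_0 c2).
  apply (clim0_small _ (Cmod c1 + Cmod c2 * / d) d Hd).
  { apply Rplus_le_le_0_compat; auto. apply Rmult_le_pos; auto. apply Rlt_le, Rinv_0_lt_compat; auto. }
  intros x Hx Hx1. unfold mellin_poles_term.
  replace (RtoC (Ak b mu k) * / mellin_exponent k s + RtoC (Bk b mu k) * / mellin_exponent k s * RtoC (ln x) - RtoC (Bk b mu k) * / (mellin_exponent k s * mellin_exponent k s))%C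
    with (c1 + c2 * RtoC (ln x))%C by (unfold c1, c2; ring).
  rewrite Cmod_mult, Cmod_xp, Ee.
  assert (H1 := Cmod_triangle c1 (c2 * RtoC (ln x))). rewrite Cmod_mult, Cmod_R in H1.
  assert (H2 := ln_Rpower_le x d Hd (conj Hx Hx1)).
  assert (H3 : Rpower x (2 * d) <= Rpower x d).
  { unfold Rpower. apply exp_le_mono. assert (ln x <= 0) by (rewrite <- ln_1; apply ln_le; lra). nra. }
  assert (Hp := Rpower_pos x (2 * d)).
  apply Rle_trans with (Rpower x (2 * d) * (Cmod c1 + Cmod c2 * Rabs (ln x))); [apply Rmult_le_compat_l; lra|].
  replace (Rpower x (2 * d) * (Cmod c1 + Cmod c2 * Rabs (ln x))) with (Cmod c1 * Rpower x (2 * d) + Cmod c2 * (Rabs (ln x) * Rpower x (2 * d))) by ring.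
  rewrite Rmult_plus_distr_r, Rmult_assoc. apply Rplus_le_compat; apply Rmult_le_compat_l; auto.
Qed.

(** In this range the additional term tends to [0] with [x], so that the finite part does not depend
    on how many terms are subtracted. *)
Lemma finite_part_S N s v : 0 < gamma + Re s + 2 * INR N -> finite_part N s v -> finite_part (S N) s v.
Proof.
  intros He [Phi [l0 [l1 [Hd [H0 [H1 Hv]]]]]]. exists Phi, l0, l1. refine (conj Hd (conj _ (conj H1 Hv))).
  replace l0 with (l0 + (- (1)) * 0)%C by ring.
  eapply (clim0_ext (fun x => (Phi x - mellin_poles N s x) + (- (1)) * mellin_poles_term N s x)%C _ _ 1); [lra| |].
  - intros t _. unfold mellin_poles. rewrite Csum_S. ring.
  - apply clim0_plus; auto. apply clim0_scal, mellin_poles_term_clim0, He.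
Qed.

Lemma finite_part_le N N' s v : (N <= N')%nat -> 0 < gamma + Re s + 2 * INR N -> finite_part N s v -> finite_part N' s v.
Proof.
  induction 1 as [|N' Hle IH]; intros He H; auto. apply finite_part_S; auto. apply le_INR in Hle. lra.
Qed.

(** The further left [s] lies, the more terms have to be subtracted; [mellin_ext_eq] shows that
    every admissible [N] gives the same value. *)
Definition mellin_ext (s : C) : C := epsilon (inhabits (RtoC 0)) (fun v => exists N, 0 < gamma + Re s + 2 * INR N /\ finite_part N s v).

Lemma mellin_ext_eq N s v : 0 < gamma + Re s + 2 * INR N -> finite_part N s v -> mellin_ext s = v.
Proof.
  intros He H. destruct (epsilon_spec (inhabits (RtoC 0)) (fun v => exists N, 0 < gamma + Re s + 2 * INR N /\ finite_part N s v)) as [M [HM HlM]].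
  - exists v, N; auto.
  - apply (finite_part_unique (Nat.max N M) s).
    + refine (finite_part_le M (Nat.max N M) s _ _ HM HlM). lia.
    + refine (finite_part_le N (Nat.max N M) s _ _ He H). lia.
Qed.

Lemma bessel_factor_cont_pos : cont_pos (fun x => bessel_factor b mu (RtoC x)).
Proof.
  intros x Hx. eapply rder_ccont. apply rder_real. unfold bessel_factor. apply cder_mult; [apply cder_Kint; auto|apply cder_binom_factor; simpl; auto].
Qed.

Lemma factor_exp_cont_pos N : cont_pos (fun x => factor_exp b mu N (RtoC x)).
Proof.
  intros x Hx. eapply rder_ccont. apply rder_real.
  apply (cder_ext (fun z => Csum (fun k => Cpow z (2 * k) * (RtoC (Ak b mu k) + RtoC (Bk b mu k) * Clog z))%C N)); [intros; now rewrite factor_exp_eq|].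
  apply (cder_Csum (fun k z => Cpow z (2 * k) * (RtoC (Ak b mu k) + RtoC (Bk b mu k) * Clog z))%C
    (fun k z => (RtoC (INR (2 * k)) * Cpow z (2 * k) / z) * (RtoC (Ak b mu k) + RtoC (Bk b mu k) * Clog z) + Cpow z (2 * k) * (0 + RtoC (Bk b mu k) * / z))%C).
  intros k _. apply (cder_mult (fun z => Cpow z (2 * k)) (fun z => RtoC (Ak b mu k) + RtoC (Bk b mu k) * Clog z)%C); [apply cder_Cpow, Cneq0_Re; auto|].
  apply (cder_plus (fun _ => RtoC (Ak b mu k)) (fun z => RtoC (Bk b mu k) * Clog z)%C); [apply cder_const|apply cder_scal, cder_Clog; auto].
Qed.

Lemma factor_rem_cont_pos N : cont_pos (fun x => factor_rem b mu N (RtoC x)).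
Proof. intros x Hx. unfold factor_rem. apply ccont_minus; [apply bessel_factor_cont_pos, Hx|apply factor_exp_cont_pos, Hx]. Qed.

Lemma Rpower_cont_pos q : cont_pos (fun x => RtoC (Rpower x q)).
Proof. intros x Hx. eapply rder_ccont. apply (rder_ext (fun x => xp x (RtoC q))); [intros; apply xp_R|apply rder_xp, Hx]. Qed.

Lemma mellin_integrand_split s x : mellin_integrand s x = (RtoC (Rpower x (gamma - 1)) * bessel_factor b mu (RtoC x) * xp x s)%C.
Proof.
  unfold mellin_integrand. replace (RtoC gamma + s - 1)%C with (RtoC (gamma - 1) + s)%C by (rewrite RtoC_minus; ring).
  rewrite xp_plus, xp_R. ring.
Qed.

Lemma cone_real x : 0 < x -> 1 * Cmod (RtoC x) <= Re (RtoC x).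
Proof. intros Hx. rewrite Cmod_Rpos by lra. simpl. lra. Qed.

Lemma exp_Rpower_ge1 q x : 1 <= x -> exp (q * ln x) * exp (/ 2 * Rabs (ln x)) = Rpower x (q + / 2).
Proof.
  intros Hx. assert (0 <= ln x) by (rewrite <- ln_1; apply ln_le; lra).
  rewrite Rabs_pos_eq, <- exp_plus by auto. unfold Rpower. f_equal. ring.
Qed.

Lemma exp_Rpower_le1 q x : 0 < x <= 1 -> exp (q * ln x) * exp (/ 2 * Rabs (ln x)) = Rpower x (q - / 2).
Proof.
  intros Hx. assert (ln x <= 0) by (rewrite <- ln_1; apply ln_le; lra).
  rewrite Rabs_left1, <- exp_plus by auto. unfold Rpower. f_equal. ring.
Qed.

Lemma Rpower_le_1 x q : 0 < x <= 1 -> 0 <= q -> Rpower x q <= 1.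
Proof.
  intros Hx Hq. assert (ln x <= 0) by (rewrite <- ln_1; apply ln_le; lra).
  unfold Rpower. rewrite <- exp_0. apply exp_le_mono. nra.
Qed.

(** The factor [exp (|ln x| / 2)] is the allowance of [analytic_piece] for the disc of radius [1/4];
    the decay of [K_0] absorbs it together with all powers. *)
Lemma bound_inf p : exists A, 0 <= A /\ forall x, 1 <= x ->
  Cmod (RtoC (Rpower x (gamma - 1)) * bessel_factor b mu (RtoC x)) * (exp (Re p * ln x) * exp (/ 2 * Rabs (ln x))) <= A * / x ^ 2.
Proof.
  destruct (nat_above (gamma + Re p + 3 / 2)) as [k0 Hk0].
  destruct (Sm_bound _ _ _ _ (Sm_bessel_factor 1 Rlt_0_1 b mu hb hmu 0 (S k0) ltac:(lia))) as [A [HA HB]].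
  exists A; split; auto. intros x Hx. rewrite exp_Rpower_ge1 by auto.
  rewrite Cmod_mult, Cmod_Rpos by apply Rlt_le, Rpower_pos.
  specialize (HB (RtoC x) ltac:(simpl; lra) (cone_real x ltac:(lra))). rewrite Cmod_Rpos in HB by lra.
  apply Rle_trans with (Rpower x (gamma - 1) * (A * / x ^ S k0) * Rpower x (Re p + / 2)).
  - apply Rmult_le_compat_r; [apply Rlt_le, Rpower_pos|]. apply Rmult_le_compat_l; [apply Rlt_le, Rpower_pos|auto].
  - rewrite <- !Rpower_pow, <- !Rpower_Ropp by lra.
    replace (Rpower x (gamma - 1) * (A * Rpower x (- INR (S k0))) * Rpower x (Re p + / 2)) with
      (A * (Rpower x (gamma - 1) * Rpower x (- INR (S k0)) * Rpower x (Re p + / 2))) by ring.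
    rewrite <- !Rpower_plus. apply Rmult_le_compat_l; auto. apply Rle_Rpower; auto. rewrite S_INR. simpl INR. lra.
Qed.

(** The exponents [gamma - 1], [2 N - 1] and [Re p - 1/2] add up to at least [1/2]; one unit is lost
    to [lam] and one half to the disc around [p]. *)
Lemma bound_0 N p : 3 <= gamma + Re p + 2 * INR N -> exists A, 0 <= A /\ forall x, 0 < x <= 1 ->
  Cmod (RtoC (Rpower x (gamma - 1)) * factor_rem b mu N (RtoC x)) * (exp (Re p * ln x) * exp (/ 2 * Rabs (ln x))) <= A.
Proof.
  intros HN. destruct (Sm_bound _ _ _ _ (Sm_factor_rem 1 Rlt_0_1 b mu hb hmu 0 N)) as [A [HA HB]].
  exists (2 * A); split; [lra|]. intros x Hx. rewrite exp_Rpower_le1 by auto.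
  rewrite Cmod_mult, Cmod_Rpos by apply Rlt_le, Rpower_pos.
  specialize (HB (RtoC x) ltac:(simpl; lra) (cone_real x ltac:(lra))). rewrite Cmod_Rpos in HB by lra.
  assert (Hlam : lam x <= 2 * / x).
  { unfold lam. apply Rmult_le_reg_r with x; [lra|]. field_simplify; [nra|lra..]. }
  apply Rle_trans with (Rpower x (gamma - 1) * (A * (x ^ (2 * N) * (2 * / x))) * Rpower x (Re p - / 2)).
  - apply Rmult_le_compat_r; [apply Rlt_le, Rpower_pos|]. apply Rmult_le_compat_l; [apply Rlt_le, Rpower_pos|].
    eapply Rle_trans; [apply HB|]. apply Rmult_le_compat_l; auto. unfold wlam. apply Rmult_le_compat_l; auto. apply pow_le; lra.
  - rewrite <- Rpower_pow by lra. rewrite <- (Rpower_1 x) at 3 by lra. rewrite <- Rpower_Ropp.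
    replace (Rpower x (gamma - 1) * (A * (Rpower x (INR (2 * N)) * (2 * Rpower x (Ropp 1)))) * Rpower x (Re p - / 2)) with
      (2 * A * (Rpower x (gamma - 1) * Rpower x (INR (2 * N)) * Rpower x (Ropp 1) * Rpower x (Re p - / 2))) by ring.
    rewrite <- !Rpower_plus. rewrite <- (Rmult_1_r (2 * A)) at 2. apply Rmult_le_compat_l; [lra|].
    apply Rpower_le_1; auto. rewrite mult_INR. simpl INR. lra.
Qed.

Lemma Cmod_near p s x (g : C) : Cmod (s - p) < / 4 ->
  Cmod (g * xp x s) <= Cmod g * (exp (Re p * ln x) * exp (/ 2 * Rabs (ln x))).
Proof.
  intros Hs. assert (Hr := re_le_Cmod (s - p)). rewrite Re_minus in Hr. rewrite <- exp_plus, Cmod_mult, Cmod_xp. unfold Rpower.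
  apply Rmult_le_compat_l; [apply Cmod_ge_0|]. apply exp_le_mono.
  assert (Re s * ln x - Re p * ln x <= / 2 * Rabs (ln x)); [|lra].
  rewrite <- Rmult_minus_distr_r. eapply Rle_trans; [apply Rle_abs|]. rewrite Rabs_mult.
  apply Rmult_le_compat_r; [apply Rabs_pos|lra].
Qed.

(** The finite part is split at [x = 1]: [I1] integrates the function over [(1, oo)] and [I0] its
    remainder over [(0, 1)], both analytic in [s]; all singularities sit in the explicit
    [mellin_poles N s 1]. *)
Lemma H_local N p : 3 <= gamma + Re p + 2 * INR N -> exists I0 I1 : C -> C, ana I0 p /\ ana I1 p /\
  forall s, Cmod (s - p) < / 4 -> (forall k, (k < N)%nat -> mellin_exponent k s <> RtoC 0) -> finite_part N s (I1 s + I0 s + mellin_poles N s 1)%C.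
Proof.
  intros HN. destruct (bound_inf p) as [A [HA HB]]. destruct (bound_0 N p HN) as [A0 [HA0 HB0]].
  assert (Hi := pos_INR).
  assert (Hlow : forall A i, 0 <= A -> - (A / (INR i + 1)) <= 0).
  { intros A' i HA'. specialize (Hi i). assert (0 <= A' / (INR i + 1)); [|lra]. apply Rmult_le_pos; [auto|apply Rlt_le, Rinv_0_lt_compat; lra]. }
  destruct (mellin_pieces (fun x => RtoC (Rpower x (gamma - 1)) * bessel_factor b mu (RtoC x))%C (fun n => INR (S n)) (fun n => INR (S (S n))) p
    (fun n => - (2 * A / (INR n + 1))) 0) as [I1 [HI1 HI1']].
  { intros x Hx. apply ccont_mult; [apply Rpower_cont_pos, Hx|apply bessel_factor_cont_pos, Hx]. }
  { intros n. rewrite !S_INR. specialize (Hi n). lra. }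
  { intros n. apply Hlow. lra. }
  { intros n t Ht. rewrite !S_INR in *. specialize (Hi n).
    replace (INR n + 1 + 1 - (INR n + 1)) with 1 by ring. rewrite Rmult_1_r.
    eapply Rle_trans; [apply HB; lra|].
    apply Rle_trans with (A * / (INR n + 1) ^ 2).
    - apply Rmult_le_compat_l; auto. apply Rinv_le_contravar; [apply pow_lt; lra|apply pow_incr; lra].
    - replace (- (2 * A / (INR n + 1 + 1)) - - (2 * A / (INR n + 1))) with (A * (2 / ((INR n + 1) * (INR n + 1 + 1)))) by (field; lra).
      apply Rmult_le_compat_l; auto. apply Rmult_le_reg_r with ((INR n + 1) ^ 2 * (INR n + 1 + 1)).
      { apply Rmult_lt_0_compat; [apply pow_lt|]; lra. }
      field_simplify; lra. }
  destruct (mellin_pieces (fun x => RtoC (Rpower x (gamma - 1)) * factor_rem b mu N (RtoC x))%C (fun n => / INR (S (S n))) (fun n => / INR (S n)) p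
    (fun n => - (A0 / (INR n + 1))) 0) as [I0 [HI0 HI0']].
  { intros x Hx. apply ccont_mult; [apply Rpower_cont_pos, Hx|apply factor_rem_cont_pos, Hx]. }
  { intros n. rewrite !S_INR. specialize (Hi n). split; [apply Rinv_0_lt_compat; lra|apply Rinv_lt_contravar; [nra|lra]]. }
  { intros n. apply Hlow. lra. }
  { intros n t Ht. rewrite !S_INR in *. specialize (Hi n).
    assert (Hpos : 0 < / (INR n + 1 + 1)) by (apply Rinv_0_lt_compat; lra).
    assert (H1 : / (INR n + 1) <= 1) by (rewrite <- Rinv_1; apply Rinv_le_contravar; lra).
    assert (Hlen : / (INR n + 1) - / (INR n + 1 + 1) = / ((INR n + 1) * (INR n + 1 + 1))) by (field; lra).
    eapply Rle_trans; [apply Rmult_le_compat_r; [|apply HB0; lra]|].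
    - rewrite Hlen. apply Rlt_le, Rinv_0_lt_compat. nra.
    - rewrite Hlen. right. field. lra. }
  exists I0, I1. split; [auto|]. split; [auto|]. intros s Hs He.
  assert (Hhc : cont_pos (mellin_integrand s)).
  { intros x Hx. apply ccont_mult; [eapply rder_ccont, rder_xp, Hx|apply bessel_factor_cont_pos, Hx]. }
  destruct (ex_primitive_pos (mellin_integrand s) Hhc) as [Phi HPhi].
  specialize (HI1' s Hs Phi). specialize (HI0' s Hs (fun x => Phi x - mellin_poles N s x)%C).
  assert (HdR : forall x, 0 < x -> rder (fun x => Phi x - mellin_poles N s x)%C x (RtoC (Rpower x (gamma - 1)) * factor_rem b mu N (RtoC x) * xp x s)%C).
  { intros x Hx. eapply rder_eq; [apply rder_minus; [apply HPhi, Hx|apply rder_mellin_poles; auto]|].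
    rewrite mellin_integrand_split. unfold factor_rem. replace (RtoC gamma + s - 1)%C with (RtoC (gamma - 1) + s)%C by (rewrite RtoC_minus; ring).
    rewrite xp_plus, xp_R. ring. }
  specialize (HI0' HdR).
  assert (HI1'' := HI1' (fun x Hx => rder_eq _ _ _ _ (HPhi x Hx) (mellin_integrand_split s x))).
  destruct (conv_inf Phi (fun x => - (A / x)) 1 0) as [l1 [Hl1 _]].
  { intros x y Hx Hxy. apply (mean_value_majorant Phi (mellin_integrand s) (fun x => - (A / x)) (fun x => A * / x ^ 2)); auto.
    - intros t Ht. apply HPhi. lra.
    - intros t Ht. auto_derive; [lra|field; lra].
    - intros t Ht. rewrite mellin_integrand_split. eapply Rle_trans; [apply (Cmod_near p); auto|]. apply HB. lra. }
  { intros t Ht. assert (0 <= A / t); [|lra]. apply Rmult_le_pos; [auto|apply Rlt_le, Rinv_0_lt_compat; lra]. }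
  destruct (conv_0 (fun x => Phi x - mellin_poles N s x)%C (fun x => A0 * x) 1 0) as [l0 [Hl0 Hl0']].
  { lra. }
  { intros x y Hx Hxy Hy. apply (mean_value_majorant (fun x => Phi x - mellin_poles N s x)%C (fun x => RtoC (Rpower x (gamma - 1)) * factor_rem b mu N (RtoC x) * xp x s)%C
      (fun x => A0 * x) (fun x => A0)); auto.
    - intros t Ht. apply HdR. lra.
    - intros t Ht. auto_derive; auto; ring.
    - intros t Ht. eapply Rle_trans; [apply (Cmod_near p); auto|]. apply HB0. lra. }
  { intros t Ht _. nra. }
  exists Phi, l0, l1. refine (conj HPhi (conj Hl0 (conj Hl1 _))).
  assert (E1 : I1 s = (l1 - Phi 1)%C).
  { eapply clim_unique; [apply HI1''|].
    apply clim_ext with (fun n => Phi (INR (S n)) - Phi 1)%C.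
    - intros n. rewrite (Csum_telescope (fun n => Phi (INR (S n)))). simpl. reflexivity.
    - apply clim_minus; [|apply clim_const]. apply (clim_shift' (fun n => Phi (INR n))). apply climinf_clim, Hl1. }
  assert (E0 : I0 s = (Phi 1 - mellin_poles N s 1 - l0)%C).
  { eapply clim_unique; [apply HI0'|].
    apply clim_ext with (fun n => (Phi 1 - mellin_poles N s 1) - (Phi (/ INR (S n))%R - mellin_poles N s (/ INR (S n))%R))%C.
    - intros n. rewrite (Csum_ext _ (fun i => (- (Phi (/ INR (S (S i)))%R - mellin_poles N s (/ INR (S (S i)))%R)) - (- (Phi (/ INR (S i))%R - mellin_poles N s (/ INR (S i))%R))))%C by (intros; ring).
      rewrite (Csum_telescope (fun n => - (Phi (/ INR (S n))%R - mellin_poles N s (/ INR (S n))%R))%C). simpl (INR 1). rewrite Rinv_1. ring.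
    - apply clim_minus; [apply clim_const|].
      intros eps Heps. destruct (Hl0 eps Heps) as [d [Hd Hd']]. destruct (nat_above (/ d)) as [n0 Hn0].
      exists n0. intros n Hn. apply Hd'. assert (Hsn := INR_S_ge_1 n). split; [apply Rinv_0_lt_compat; lra|].
      rewrite <- (Rinv_inv d). apply Rinv_lt_contravar.
      + apply Rmult_lt_0_compat; [apply Rinv_0_lt_compat; auto|lra].
      + rewrite S_INR. apply le_INR in Hn. lra. }
  rewrite E1, E0. ring.
Qed.

Lemma mellin_exponent_root k s : mellin_exponent k s = (s - RtoC (- (gamma + 2 * INR k)))%C.
Proof. unfold mellin_exponent. rewrite RtoC_opp, RtoC_plus. ring. Qed.

Lemma mellin_exponent_nonzero_near N p : exists d, 0 < d /\ forall s, s <> p -> Cmod (s - p) < d -> forall k, (k < N)%nat -> mellin_exponent k s <> RtoC 0.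
Proof.
  induction N as [|N [d [Hd IH]]]; [exists 1; split; [lra|intros; lia]|].
  set (c := RtoC (- (gamma + 2 * INR N))).
  assert (Hc : exists d', 0 < d' /\ forall s, s <> p -> Cmod (s - p) < d' -> s <> c).
  { destruct (classic (p = c)) as [->|Hp]; [exists 1; split; [lra|auto]|].
    destruct (Cneq_dist p c Hp) as [d' [Hd1 Hd2]]. exists d'. split; auto. }
  destruct Hc as [d' [Hd1 Hd2]]. exists (Rmin d d'). split; [apply Rmin_pos; auto|].
  intros s Hsp Hs k Hk. destruct (Nat.eq_dec k N) as [->|Hne].
  - rewrite mellin_exponent_root. apply Cminus_eq_contra. apply Hd2; auto. eapply Rlt_le_trans; [apply Hs|apply Rmin_r].
  - apply (IH s); auto; [|lia]. eapply Rlt_le_trans; [apply Hs|apply Rmin_l].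
Qed.

Lemma mellin_poles_1 N s : (forall k, (k < N)%nat -> mellin_exponent k s <> RtoC 0) -> mellin_poles N s 1 =
  Csum (fun k => (- RtoC (Ak b mu k)) * / (RtoC (- (gamma + 2 * INR k)) - s) + (- RtoC (Bk b mu k)) * / ((RtoC (- (gamma + 2 * INR k)) - s) * (RtoC (- (gamma + 2 * INR k)) - s)))%C N.
Proof.
  intros He. unfold mellin_poles. apply Csum_ext. intros k Hk. specialize (He k Hk). unfold mellin_poles_term. rewrite xp_1, ln_1. rewrite mellin_exponent_root in *.
  set (c := RtoC (- (gamma + 2 * INR k))) in *.
  assert (Hc : (c - s)%C <> RtoC 0).
  { intros E. apply He. replace (s - c)%C with (- (c - s))%C by ring. rewrite E. ring. }
  field. auto.
Qed.

(** The disjunction covers both uses: a punctured neighbourhood for meromorphy at a pole, and a full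
    one for analyticity where no exponent vanishes. *)
Lemma mellin_ext_near N p : 3 <= gamma + Re p + 2 * INR N -> exists (I0 I1 : C -> C) d, ana I0 p /\ ana I1 p /\ 0 < d /\
  forall s, Cmod (s - p) < d -> (s <> p \/ forall k, (k < N)%nat -> mellin_exponent k p <> RtoC 0) ->
    mellin_ext s = (I1 s + I0 s + Csum (fun k => (- RtoC (Ak b mu k)) * / (RtoC (- (gamma + 2 * INR k)) - s) + (- RtoC (Bk b mu k)) * / ((RtoC (- (gamma + 2 * INR k)) - s) * (RtoC (- (gamma + 2 * INR k)) - s))) N)%C.
Proof.
  intros HN. destruct (H_local N p HN) as [I0 [I1 [H0 [H1 HL]]]]. destruct (mellin_exponent_nonzero_near N p) as [d [Hd Hd']].
  exists I0, I1, (Rmin d (/ 4)). split; [auto|]. split; [auto|]. split; [apply Rmin_pos; lra|].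
  intros s Hs Hsp. assert (Hs1 := Rlt_le_trans _ _ _ Hs (Rmin_l _ _)). assert (Hs2 := Rlt_le_trans _ _ _ Hs (Rmin_r _ _)).
  assert (He : forall k, (k < N)%nat -> mellin_exponent k s <> RtoC 0).
  { destruct (classic (s = p)) as [->|Hne].
    - destruct Hsp as [Hsp|Hsp]; [now elim Hsp|auto].
    - apply Hd'; auto. }
  rewrite <- mellin_poles_1 by auto. apply (mellin_ext_eq N); [|apply HL; auto].
  assert (Hr := re_le_Cmod (s - p)). rewrite Re_minus in Hr. apply Rabs_le_between in Hr. lra.
Qed.

Lemma mellin_ext_mero p : mero mellin_ext p.
Proof.
  destruct (nat_above (3 - gamma - Re p)) as [N HN].
  destruct (mellin_ext_near N p) as [I0 [I1 [d [H0 [H1 [Hd H]]]]]]; [generalize (pos_INR N); lra|].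
  eapply (mero_ext_loc _ _ p d Hd); [intros s Hsp Hs; symmetry; apply H; auto|].
  apply (mero_plus (fun s => I1 s + I0 s)%C); [apply mero_plus; now apply ana_mero|].
  apply (mero_Csum (fun k s => (- RtoC (Ak b mu k)) * / (RtoC (- (gamma + 2 * INR k)) - s) + (- RtoC (Bk b mu k)) * / ((RtoC (- (gamma + 2 * INR k)) - s) * (RtoC (- (gamma + 2 * INR k)) - s)))%C).
  intros k _. apply mero_plus; apply mero_scal; [apply mero_inv_lin|apply mero_inv_lin_sq].
Qed.

Lemma mellin_ext_ana p : (forall k, mellin_exponent k p <> RtoC 0) -> ana mellin_ext p.
Proof.
  intros Hp. destruct (nat_above (3 - gamma - Re p)) as [N HN].
  destruct (mellin_ext_near N p) as [I0 [I1 [d [H0 [H1 [Hd H]]]]]]; [generalize (pos_INR N); lra|].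
  eapply (ana_ext_loc _ _ p d Hd); [intros s Hs; symmetry; apply H; auto|].
  apply (ana_plus (fun s => I1 s + I0 s)%C); [apply ana_plus; auto|].
  apply (ana_Csum (fun k s => (- RtoC (Ak b mu k)) * / (RtoC (- (gamma + 2 * INR k)) - s) + (- RtoC (Bk b mu k)) * / ((RtoC (- (gamma + 2 * INR k)) - s) * (RtoC (- (gamma + 2 * INR k)) - s)))%C).
  intros k _. assert (Hpk : p <> RtoC (- (gamma + 2 * INR k))).
  { intros E. apply (Hp k). rewrite mellin_exponent_root, <- E. ring. }
  apply ana_plus; apply ana_scal; [now apply ana_inv_lin|now apply ana_inv_lin_sq].
Qed.

Lemma binom_factor_real x : binom_factor mu (RtoC x) = RtoC (/ Rpower (1 + x ^ 2) mu).
Proof.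
  unfold binom_factor. replace (1 + RtoC x * RtoC x)%C with (RtoC (1 + x ^ 2)).
  - rewrite Cpower_RtoC, Rpower_Ropp; auto. assert (0 <= x ^ 2) by apply pow2_ge_0. lra.
  - rewrite RtoC_plus, RtoC_pow. ring.
Qed.

Lemma mellin_ext_continues : is_mero_continuation (H0_integral mu gamma b) (- gamma) mellin_ext.
Proof.
  split; [intros p; apply mero_iff, mellin_ext_mero|]. intros s Hs.
  destruct (nat_above (3 - gamma - Re s)) as [N HN]. assert (HNp := pos_INR N).
  destruct (H_local N s) as [I0 [I1 [_ [_ HL]]]]; [lra|].
  assert (Hre : forall k, 0 < gamma + Re s + 2 * INR k) by (intros k; generalize (pos_INR k); lra).
  assert (H := HL s). specialize (H ltac:(replace (s - s)%C with (RtoC 0) by ring; rewrite Cmod_0; lra)).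
  specialize (H ltac:(intros k _ E; apply (f_equal Re) in E; unfold mellin_exponent in E; rewrite !Re_plus, !re_RtoC in E; generalize (Hre k); lra)).
  rewrite (mellin_ext_eq N s _ (Hre N) H). destruct H as [Phi [l0 [l1 [Hd [H0 [H1 Hv]]]]]].
  (* In the half-plane of convergence every subtracted term tends to [0], so the finite part is the
     improper integral itself. *)
  assert (H0' : clim0 Phi l0).
  { replace l0 with (l0 + Csum (fun _ => RtoC 0) N)%C.
    - eapply (clim0_ext (fun x => (Phi x - mellin_poles N s x) + mellin_poles N s x)%C _ _ 1); [lra|intros; ring|].
      apply clim0_plus; auto. unfold mellin_poles. clear - Hre. induction N as [|N IH]; [exact (clim0_const 0)|].
      rewrite Csum_S. eapply (clim0_ext (fun x => Csum (fun k => mellin_poles_term k s x) N + mellin_poles_term N s x)%C _ _ 1); [lra|intros; symmetry; apply Csum_S|].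
      apply clim0_plus; auto. apply mellin_poles_term_clim0, Hre.
    - rewrite (Csum_ext _ (fun _ => 0 * 0)%C) by (intros; ring). rewrite Csum_scal. ring. }
  assert (HI : isI (mellin_integrand s) (l1 - l0)%C).
  { eapply isI_intro with (F := Phi); eauto.
    intros x Hx. apply ccont_mult; [eapply rder_ccont, rder_xp, Hx|apply bessel_factor_cont_pos, Hx]. }
  rewrite Hv. symmetry. apply isI_CInt_pos. eapply isI_ext; [|apply HI]. intros x Hx. unfold mellin_integrand, bessel_factor.
  rewrite RtoC_mult, BesselK0_Kint by auto. rewrite binom_factor_real, xp_Cpower by auto. unfold Cdiv.
  rewrite RtoC_inv by (apply Rgt_not_eq, Rpower_pos). ring.
Qed.

(** At [s = 1] the function [mellin_poles] is [expansion_prim] on the positive axis, so the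
    normalisation of [G] says that the limit [l0] in [finite_part] is [0]. The condition on [gamma]
    makes [1] a regular point. *)
Lemma H0_value N (G : C -> C) Hinf : 1 <= gamma + 2 * INR N -> (forall k : nat, gamma + 2 * INR k + 1 <> 0) ->
  (forall z, 0 < Re z -> cder G z (integrand b mu gamma z)) ->
  clim0 (fun x => G (RtoC x) - expansion_prim b mu gamma N (RtoC x))%C 0 ->
  climinf (fun x => G (RtoC x)) Hinf -> H0 mu gamma b (RtoC 1) = Hinf.
Proof.
  intros HN Hg HG HG0 HGi.
  assert (Hee : forall k, mellin_exponent k 1 <> RtoC 0).
  { intros k E. apply (Hg k). unfold mellin_exponent in E. rewrite <- !RtoC_plus in E. apply RtoC_inj in E. lra. }
  unfold H0. rewrite (mero_continuation_eq _ _ mellin_ext 1 mellin_ext_continues (mellin_ext_ana 1 Hee)).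
  apply (mellin_ext_eq N); [simpl; lra|]. exists (fun x => G (RtoC x)), (RtoC 0), Hinf.
  split; [|split; [|split; [auto|ring]]].
  - intros x Hx. eapply rder_eq; [apply rder_real, HG; simpl; auto|]. unfold integrand, mellin_integrand. f_equal.
    rewrite xp_Cpower by auto. f_equal. ring.
  - eapply (clim0_ext _ _ _ 1); [lra| |apply HG0]. intros x Hx. cbv beta. f_equal. f_equal.
    unfold expansion_prim, mellin_poles. apply Csum_ext. intros k _. unfold expansion_prim_term, mellin_poles_term.
    assert (Ee : mellin_exponent k 1 = RtoC (gamma + 2 * INR k + 1)) by (unfold mellin_exponent; rewrite !RtoC_plus; ring).
    rewrite Ee, xp_Cpower, Clog_RtoC by lra. specialize (Hg k). set (e := gamma + 2 * INR k + 1) in *.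
    f_equal. assert (HeC : RtoC e <> RtoC 0) by (intros E; apply Hg; now apply RtoC_inj).
    rewrite !RtoC_div, RtoC_pow by (auto; apply pow_nonzero; auto). field. auto.
Qed.

End H.

(** * The cone and the terms of the two series *)

Lemma Carg_nonneg z : 0 <= Im z -> 0 <= Carg z.
Proof. intros H. unfold Carg. destruct (Rle_dec 0 (Im z)); [apply acos_bound|lra]. Qed.

Lemma Carg_nonpos z : Im z < 0 -> Carg z <= 0.
Proof. intros H. unfold Carg. destruct (Rle_dec 0 (Im z)); [lra|]. generalize (acos_bound (Re z / Cmod z)). lra. Qed.

Lemma Carg_half_plane z : 0 < Re z -> - (PI / 2) < Carg z < PI / 2.
Proof. intros H. rewrite Carg_atan by auto. generalize (atan_bound (Im z / Re z)). lra. Qed.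

Lemma cone_Re a delta : 0 < delta < PI / 2 -> a <> RtoC 0 -> Rabs (Carg a) <= PI / 2 - delta -> sin delta * Cmod a <= Re a.
Proof.
  intros Hd Ha H. destruct (cos_sin_Carg a Ha) as [<- _]. rewrite Rmult_comm. apply Rmult_le_compat_l; [apply Cmod_ge_0|].
  rewrite <- cos_shift.
  assert (E : cos (Carg a) = cos (Rabs (Carg a))).
  { unfold Rabs. destruct (Rcase_abs (Carg a)); [now rewrite cos_neg|auto]. }
  rewrite E. apply cos_decr_1; auto; generalize (Rabs_pos (Carg a)); lra.
Qed.

Lemma div_a_parts x a : a <> RtoC 0 ->
  Re (RtoC x / a)%C * Cmod a ^ 2 = x * Re a /\ Im (RtoC x / a)%C * Cmod a ^ 2 = - (x * Im a).
Proof.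
  intros Ha. rewrite Cmod2_alt.
  assert (E : (RtoC x / a * a)%C = RtoC x) by (field; auto).
  set (z := (RtoC x / a)%C) in *.
  assert (E1 := f_equal Re E). assert (E2 := f_equal Im E). rewrite Re_mult, re_RtoC in E1. rewrite Im_mult, im_RtoC in E2.
  split.
  - rewrite <- E1. assert (E3 : Re z * Im a = - (Im z * Re a)) by lra.
    replace (Re z * (Re a ^ 2 + Im a ^ 2)) with (Re z * Re a * Re a + Re z * Im a * Im a) by ring. rewrite E3. ring.
  - rewrite <- E1. assert (E3 : Im z * Re a = - (Re z * Im a)) by lra.
    replace (Im z * (Re a ^ 2 + Im a ^ 2)) with (Im z * Re a * Re a + Im z * Im a * Im a) by ring. rewrite E3. ring.
Qed.

Section A.
Variable a : C.
Hypothesis ha : 0 < Re a.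

Let ha0 : a <> RtoC 0 := Cneq0_Re a ha.
Let hca : 0 < Cmod a := Cmod_pos_Re a ha.

Lemma Re_div_a_pos x : 0 < x -> 0 < Re (RtoC x / a)%C.
Proof.
  intros Hx. destruct (div_a_parts x a ha0) as [E _].
  assert (0 < Cmod a ^ 2) by (apply pow_lt; auto).
  apply Rmult_lt_reg_r with (Cmod a ^ 2); auto. rewrite E, Rmult_0_l. apply Rmult_lt_0_compat; auto.
Qed.

Lemma Cmod_div_a x : 0 < x -> Cmod (RtoC x / a) = x / Cmod a.
Proof. intros Hx. rewrite Cmod_div by auto. now rewrite Cmod_Rpos by lra. Qed.

Lemma cone_div_a kp x : 0 < x -> kp * Cmod a <= Re a -> kp * Cmod (RtoC x / a) <= Re (RtoC x / a)%C.
Proof.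
  intros Hx Hk. destruct (div_a_parts x a ha0) as [E _]. rewrite Cmod_div_a by auto.
  assert (0 < Cmod a ^ 2) by (apply pow_lt; auto).
  apply Rmult_le_reg_r with (Cmod a ^ 2); auto. rewrite E.
  replace (kp * (x / Cmod a) * Cmod a ^ 2) with (x * (kp * Cmod a)) by (field; lra).
  apply Rmult_le_compat_l; lra.
Qed.

Lemma Clog_div_a x : 0 < x -> Clog (RtoC x / a) = (RtoC (ln x) - Clog a)%C.
Proof.
  intros Hx. replace (RtoC x / a)%C with (Cexp (RtoC (ln x) - Clog a)).
  - apply Clog_Cexp. rewrite Im_minus, im_RtoC. change (Im (Clog a)) with (Carg a).
    generalize (Carg_half_plane a ha) PI_RGT_0. lra.
  - unfold Cminus. rewrite Cexp_plus, Cexp_opp, Cexp_Clog, Cexp_RtoC, exp_ln by auto. reflexivity.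
Qed.

Lemma Cpower_div_a x (p : C) : 0 < x -> Cpower (RtoC x / a) p = (Cpower (RtoC x) p * / Cpower a p)%C.
Proof.
  intros Hx. unfold Cpower. rewrite Clog_div_a, Clog_RtoC by auto. rewrite <- Cexp_opp, <- Cexp_plus. f_equal. ring.
Qed.

Lemma Clog_sq : Clog (a * a) = (Clog a + Clog a)%C.
Proof. apply Clog_mult; auto. generalize (Carg_half_plane a ha). lra. Qed.

(** To take [a^2] out of a principal power, the arguments of [a^2] and [1 + z^2] must add up to less
    than [PI] in modulus. Since [z = x/a], the imaginary parts of [a] and [z] have opposite signs,
    and so the two arguments do not reinforce each other. *)
Lemma Cpower_sum_squares x (p : C) : 0 < x ->
  Cpower (RtoC (x ^ 2) + a * a) p = (Cpower a (2 * p) * Cpower (1 + (RtoC x / a) * (RtoC x / a)) p)%C.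
Proof.
  intros Hx. set (z := (RtoC x / a)%C).
  assert (Hz : 0 < Re z) by (apply Re_div_a_pos; auto).
  destruct (slit_1_plus_sq z Hz) as [H1 H2].
  assert (E : (RtoC (x ^ 2) + a * a)%C = (a * a * (1 + z * z))%C) by (unfold z; rewrite RtoC_pow; simpl; field; auto).
  unfold Cpower. rewrite E, Clog_mult, Clog_sq.
  - rewrite <- Cexp_plus. f_equal. ring.
  - now apply Cmult_neq_0.
  - exact H1.
  - change (Carg (a * a)%C) with (Im (Clog (a * a)%C)). rewrite Clog_sq, Im_plus. change (Im (Clog a)) with (Carg a).
    assert (Ha := Carg_half_plane a ha). assert (Hb := Carg_bound_slit _ H1 H2). assert (Hpi := PI_RGT_0).
    destruct (div_a_parts x a ha0) as [E1 E2]. fold z in E1, E2.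
    assert (Hc2 : 0 < Cmod a ^ 2) by (apply pow_lt; auto).
    assert (Ei : Im (1 + z * z)%C = 2 * Re z * Im z) by (rewrite Im_plus, Im_mult; simpl; ring).
    destruct (Rle_lt_dec 0 (Im a)) as [Hi|Hi].
    + assert (Pa := Carg_nonneg a Hi). destruct (Req_dec (Im a) 0) as [H0|H0].
      * assert (Carg a = 0) by (rewrite Carg_atan, H0 by auto; unfold Rdiv; rewrite Rmult_0_l; apply atan_0). lra.
      * assert (Im z < 0).
        { apply Rmult_lt_reg_r with (Cmod a ^ 2); auto. rewrite E2, Rmult_0_l. assert (0 < x * Im a) by (apply Rmult_lt_0_compat; lra). lra. }
        assert (Carg (1 + z * z) <= 0) by (apply Carg_nonpos; rewrite Ei; nra). lra.
    + assert (Pa := Carg_nonpos a Hi).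
      assert (0 < Im z).
      { apply Rmult_lt_reg_r with (Cmod a ^ 2); auto. rewrite E2, Rmult_0_l. assert (0 < x * - Im a) by (apply Rmult_lt_0_compat; lra). lra. }
      assert (0 <= Carg (1 + z * z)) by (apply Carg_nonneg; rewrite Ei; nra). lra.
Qed.

Lemma series_term mu gamma b x : 0 < b -> 0 < x ->
  (RtoC (Rpower x gamma) * BesselK0 (RtoC (x * b) / a) / Cpower (RtoC (x ^ 2) + a * a) (RtoC mu))%C =
  (Cpower a (RtoC (- 2 * mu)) * (Cpower a (RtoC gamma) * integrand b mu gamma (RtoC x / a)))%C.
Proof.
  intros Hb Hx. unfold integrand, bessel_factor, binom_factor. rewrite Cpower_sum_squares by auto.
  rewrite <- BesselK0_Kint by (auto using Re_div_a_pos).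
  replace (RtoC (x * b) / a)%C with (RtoC b * (RtoC x / a))%C by (rewrite RtoC_mult; field; auto).
  rewrite Cpower_div_a, Cpower_RtoC by auto.
  replace (-2 * mu) with (Ropp (2 * mu)) by ring. rewrite !RtoC_opp, RtoC_mult.
  rewrite !Cpower_opp. field. repeat split; apply Cpower_neq_0.
Qed.

End A.

(** * Matching the coefficients with the terminating hypergeometric sums *)

Lemma pochhammer_neq_0 mu k r : 0 < mu -> (r <= k)%nat -> pochhammer (1 - mu - INR k) r <> 0.
Proof.
  intros H. induction r as [|r IH]; intros Hr; simpl; [lra|]. apply le_INR in Hr as Hr'. rewrite S_INR in Hr'.
  apply Rmult_integral_contrapositive_currified; [apply IH; lia|lra].
Qed.

(** Reversal of Pochhammer symbols: dividing [(mu)_k / k!] by [(1 - mu - k)_r] and multiplying by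
    [(- k)_r] leaves, up to sign, [(mu)_(k-r) / (k-r)!]. The induction on [r] compares the ratios of
    consecutive terms. *)
Lemma F_summand_eq mu chi k r : 0 < mu -> (r <= k)%nat ->
  (-1) ^ k / INR (fact k) * pochhammer mu k * F_summand mu chi k r = binom_coef mu (k - r) * (chi ^ r / INR (fact r) ^ 2).
Proof.
  intros Hmu. assert (Hf := INR_fact_neq_0).
  induction r as [|r IH]; intros Hr.
  - rewrite Nat.sub_0_r. unfold F_summand, binom_coef. simpl. field. apply Hf.
  - specialize (IH ltac:(lia)). remember (k - S r)%nat as i eqn:Ei.
    replace (k - r)%nat with (S i) in IH by lia.
    assert (Ek : INR k = INR r + INR i + 1) by (replace k with (S (r + i)) by lia; rewrite S_INR, plus_INR; ring).
    assert (Hp := pochhammer_neq_0 mu k r Hmu ltac:(lia)). assert (Hi := pos_INR i). assert (Hr0 := pos_INR r).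
    assert (E : F_summand mu chi k (S r) = F_summand mu chi k r * ((INR i + 1) * chi / (- (mu + INR i) * (INR r + 1) ^ 2))).
    { unfold F_summand. rewrite fact_simpl, mult_INR, S_INR. simpl pochhammer. rewrite <- tech_pow_Rmult.
      replace (- INR k + INR r) with (- (INR i + 1)) by lra.
      replace (1 - mu - INR k + INR r) with (- (mu + INR i)) by lra.
      field. repeat split; try lra; try apply Hf; exact Hp. }
    rewrite E, <- Rmult_assoc, IH. unfold binom_coef. rewrite !fact_simpl, !mult_INR, !S_INR. simpl pochhammer. rewrite <- !tech_pow_Rmult.
    field. repeat split; try apply Hf; lra.
Qed.

Lemma sum_n_m_scal (c : R) u m n : sum_n_m (fun r => c * u r) m n = c * sum_n_m u m n.
Proof. exact (sum_n_m_mult_l (K := R_Ring) c u m n). Qed.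

Lemma sum_n_m_eq (u v : nat -> R) m n : (forall r, (m <= r <= n)%nat -> u r = v r) -> sum_n_m u m n = sum_n_m v m n.
Proof. exact (sum_n_m_ext_loc (G := R_AbelianMonoid) u v m n). Qed.

Lemma sum_n_m_Rplus (u v : nat -> R) m n : sum_n_m (fun r => u r + v r) m n = sum_n_m u m n + sum_n_m v m n.
Proof. exact (sum_n_m_plus (G := R_AbelianMonoid) u v m n). Qed.

Lemma Bk_eq mu b k : 0 < mu -> (-1) ^ k / INR (fact k) * pochhammer mu k * F mu (b ^ 2 / 4) k = - Bk b mu k.
Proof.
  intros Hmu. unfold F, Bk. rewrite <- sum_n_m_scal.
  replace (- sum_n_m (fun r => ek b mu k r) 0 k) with (Ropp 1 * sum_n_m (fun r => ek b mu k r) 0 k) by ring.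
  rewrite <- sum_n_m_scal. apply sum_n_m_eq. intros r Hr. rewrite F_summand_eq by (auto; lia). unfold ek, kcoef. ring.
Qed.

(** Once the constant [ell b] is split off, [Ak] keeps only the harmonic numbers; since
    [harm 0 = 0], its sum may start at [1] like that of [F_Fstar]. *)
Lemma Ak_eq mu b k : 0 < mu ->
  (-1) ^ k / INR (fact k) * pochhammer mu k * F_Fstar mu (b ^ 2 / 4) k = Ak b mu k - ell b * Bk b mu k.
Proof.
  intros Hmu. unfold F_Fstar, Ak, Bk. rewrite <- !sum_n_m_scal.
  rewrite (sum_n_m_eq (fun r => ek b mu k r * (ell b - harm r)) (fun r => ell b * ek b mu k r + - (ek b mu k r * harm r)))
    by (intros; ring).
  rewrite sum_n_m_Rplus, (sum_n_m_scal (ell b) (fun r => ek b mu k r)).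
  assert (Hpq : forall p q : R, q = p + q - p) by (intros; ring). rewrite <- Hpq.
  assert (E : sum_n_m (fun r => - (ek b mu k r * harm r)) 0 k = sum_n_m (fun r => - (ek b mu k r * harm r)) 1 k).
  { rewrite (sum_Sn_m (G := R_AbelianMonoid)) by lia. rewrite harm_0. change (- (ek b mu k 0 * 0) + sum_n_m (fun r => - (ek b mu k r * harm r)) 1 k = sum_n_m (fun r => - (ek b mu k r * harm r)) 1 k). ring. }
  etransitivity; [|symmetry; exact E]. apply sum_n_m_eq. intros r Hr.
  rewrite <- Rmult_assoc, F_summand_eq by (auto; lia). rewrite psi_harm. unfold ek, kcoef. ring.
Qed.

(** What summing [n^gamma (n/a)^(2k) (A_k + B_k log (n/a))] produces; the minus sign before [zeta']
    is that of [sum n^(-w) log n = - zeta'(w)]. *)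
Definition zterm (b mu gamma : R) (a : C) (k : nat) : C :=
  (Cpow (/ a) (2 * k) * ((RtoC (Ak b mu k) - RtoC (Bk b mu k) * Clog a) * zeta (RtoC (- gamma - 2 * INR k))
    - RtoC (Bk b mu k) * zeta' (RtoC (- gamma - 2 * INR k))))%C.

Lemma Cpow_inv_even a k : 0 < Re a -> Cpower a (RtoC (-2 * INR k)) = Cpow (/ a) (2 * k).
Proof.
  intros Ha. replace (-2 * INR k) with (Ropp (INR (2 * k))) by (rewrite mult_INR; change (INR 2) with 2%R; ring).
  rewrite RtoC_opp, Cpower_opp, Cpower_nat by (now apply Cneq0_Re).
  symmetry. apply Cpow_inv. now apply Cneq0_Re.
Qed.

(** Rests on [log (2a/b) - euler_gamma = log a - ell b]: the constant [ell b] in [Ak] accounts for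
    the rest of the brace in the statement. *)
Lemma expansion_term_eq b mu gamma a k : 0 < b -> 0 < mu -> 0 < Re a ->
  expansion_term mu gamma b a k = zterm b mu gamma a k.
Proof.
  intros Hb Hmu Ha. unfold expansion_term, zterm. cbv zeta. rewrite Cpow_inv_even by auto.
  assert (EL : Clog (RtoC 2 * a / RtoC b) = (Clog a - RtoC (ln (b / 2)))%C).
  { replace (RtoC 2 * a / RtoC b)%C with (RtoC (2 / b) * a)%C by (unfold Rdiv; rewrite RtoC_mult, RtoC_inv by lra; unfold Cdiv; ring).
    assert (H2 : 0 < 2 / b) by (apply Rdiv_lt_0_compat; lra).
    assert (E0 : Carg (RtoC (2 / b)) = 0) by (change (Im (Clog (RtoC (2 / b))) = 0); rewrite Clog_RtoC by auto; reflexivity).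
    rewrite Clog_mult; [|intros E; apply RtoC_inj in E; lra|now apply Cneq0_Re|rewrite E0; generalize (Carg_half_plane a Ha) PI_RGT_0; lra].
    rewrite Clog_RtoC by auto. replace (ln (b / 2)) with (- ln (2 / b)); [rewrite RtoC_opp; ring|].
    rewrite <- ln_Rinv by auto. f_equal. field; lra. }
  rewrite EL. set (c := ((-1) ^ k / INR (fact k) * pochhammer mu k)).
  assert (E1 : (RtoC c * RtoC (F mu (b ^ 2 / 4) k))%C = (- RtoC (Bk b mu k))%C) by (rewrite <- RtoC_mult, <- RtoC_opp; f_equal; now apply Bk_eq).
  assert (E2 : (RtoC c * RtoC (F_Fstar mu (b ^ 2 / 4) k))%C = (RtoC (Ak b mu k) - (RtoC (ln (b / 2)) + RtoC euler_gamma) * RtoC (Bk b mu k))%C).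
  { rewrite <- RtoC_plus, <- !RtoC_mult, <- RtoC_minus. f_equal. now apply Ak_eq. }
  set (w := RtoC (- gamma - 2 * INR k)).
  match goal with |- (RtoC c * (zeta w * ?f * ?l + zeta' w * ?f + zeta w * ?g) * ?p)%C = _ =>
    transitivity ((RtoC c * f) * (zeta w * l + zeta' w) * p + (RtoC c * g) * zeta w * p)%C; [ring|] end.
  rewrite E1, E2. ring.
Qed.

(** * Euler-Maclaurin summation of the series *)

Lemma rder_ext_pos (f g : R -> C) x l : 0 < x -> (forall s, 0 < s -> f s = g s) -> rder f x l -> rder g x l.
Proof.
  intros Hx E. apply (@is_derive_ext_loc R_AbsRing C_R_NormedModule).
  exists (mkposreal x Hx). intros y Hy. apply E. change (Rabs (y - x) < x) in Hy. apply Rabs_lt_between in Hy. lra.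
Qed.

Lemma rder_div_a (phi : C -> C) a x l : cder phi (RtoC x / a) l -> rder (fun x => phi (RtoC x / a)%C) x (l * / a)%C.
Proof.
  intros H. apply (rder_ext (fun t => phi (0 + RtoC t * / a)%C)); [intros; f_equal; unfold Cdiv; ring|].
  apply rder_path. replace (0 + RtoC x * / a)%C with (RtoC x / a)%C by (unfold Cdiv; ring). exact H.
Qed.

Lemma uniform_const (P : nat -> R -> Prop) m : (forall j A B, A <= B -> P j A -> P j B) ->
  (forall j, (j <= m)%nat -> exists A, P j A) -> exists A, 0 <= A /\ forall j, (j <= m)%nat -> P j A.
Proof.
  intros HP H. induction m as [|m IH].
  - destruct (H O (le_n _)) as [A HA]. exists (Rmax 0 A). split; [apply Rmax_l|].
    intros j Hj. replace j with O by lia. eapply HP; [apply Rmax_r|exact HA].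
  - destruct IH as [A [HA HA']]; [intros; apply H; lia|]. destruct (H (S m) (le_n _)) as [B HB].
    exists (Rmax A B). split; [eapply Rle_trans; [exact HA|apply Rmax_l]|]. intros j Hj.
    destruct (Nat.eq_dec j (S m)) as [->|Hne]; [eapply HP; [apply Rmax_r|exact HB]|].
    eapply HP; [apply Rmax_l|apply HA'; lia].
Qed.

Lemma Csum_scaled_bound (c : nat -> R) K : exists B, 0 <= B /\ forall (u : nat -> C) M,
  (forall j, (j < K)%nat -> Cmod (u j) <= M) -> Cmod (Csum (fun j => RtoC (c j) * u j)%C K) <= B * M.
Proof.
  induction K as [|K [B [HB IH]]].
  - exists 0. split; [lra|]. intros u M _. rewrite Csum_0, Cmod_0. lra.
  - exists (B + Rabs (c K)). assert (Hc := Rabs_pos (c K)). split; [lra|]. intros u M H. rewrite Csum_S.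
    eapply Rle_trans; [apply Cmod_triangle|]. rewrite Rmult_plus_distr_r, Cmod_mult, Cmod_R.
    apply Rplus_le_compat; [apply IH; intros; apply H; lia|]. apply Rmult_le_compat_l; auto.
Qed.

Section Final.
Variables b mu gamma : R.
Hypothesis hb : 0 < b.
Hypothesis hmu : 0 < mu.
Variable N : nat.
Hypothesis hN : 1 <= gamma + 2 * INR N.
Hypothesis hgam : forall k : nat, gamma + 2 * INR k + 1 <> 0.

Definition zeta_arg (k : nat) : C := RtoC (- gamma - 2 * INR k).

(* [summand_exp a 1] is the expansion of the summand at the origin, [summand_exp a 0] its primitive and
   [summand_exp a j] its derivative of order [j - 1]; likewise for the summand itself ([summand_full]) and for its
   remainder ([summand_rem]). *)
Definition summand_exp (a : C) (j : nat) (x : R) : C :=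
  Csum (fun k => Cpow (/ a) (2 * k) *
    ((RtoC (Ak b mu k) - RtoC (Bk b mu k) * Clog a) * Hz j (zeta_arg k) x - RtoC (Bk b mu k) * Hd j (zeta_arg k) x))%C N.

Lemma zeta_arg_neq_1 k : zeta_arg k <> RtoC 1.
Proof. intros E. apply RtoC_inj in E. apply (hgam k). lra. Qed.

Lemma rder_summand_exp a j x : 0 < x -> rder (summand_exp a j) x (summand_exp a (S j) x).
Proof.
  intros Hx. apply (rder_Csum (fun k x => Cpow (/ a) (2 * k) *
    ((RtoC (Ak b mu k) - RtoC (Bk b mu k) * Clog a) * Hz j (zeta_arg k) x - RtoC (Bk b mu k) * Hd j (zeta_arg k) x))%C
    (fun k x => Cpow (/ a) (2 * k) *
    ((RtoC (Ak b mu k) - RtoC (Bk b mu k) * Clog a) * Hz (S j) (zeta_arg k) x - RtoC (Bk b mu k) * Hd (S j) (zeta_arg k) x))%C).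
  intros k _. assert (Hw := zeta_arg_neq_1 k).
  apply (rder_scal _ (fun x => (RtoC (Ak b mu k) - RtoC (Bk b mu k) * Clog a) * Hz j (zeta_arg k) x - RtoC (Bk b mu k) * Hd j (zeta_arg k) x)%C).
  apply rder_minus; apply rder_scal; [apply rder_Hz|apply rder_Hd]; auto.
Qed.

(** Reconciles the primitive used in the continuation of [zeta] with the one subtracted at the
    origin. Neither contains a constant of integration, so the decomposition in [summand_full_split]
    is exact at [j = 0]. *)
Lemma summand_exp_0 a x : 0 < Re a -> 0 < x -> summand_exp a 0 x = (Cpower a (RtoC gamma) * a * expansion_prim b mu gamma N (RtoC x / a))%C.
Proof.
  intros Ha Hx. assert (Ha0 := Cneq0_Re a Ha). unfold summand_exp, expansion_prim. rewrite <- Csum_scal. apply Csum_ext. intros k _.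
  unfold expansion_prim_term. set (e := gamma + 2 * INR k + 1). assert (He : e <> 0) by apply hgam.
  rewrite Cpower_div_a, Clog_div_a by auto.
  assert (E1 : (Cpower a (RtoC gamma) * a * / Cpower a (RtoC e))%C = Cpow (/ a) (2 * k)).
  { rewrite <- Cpow_inv_even by auto. unfold e. rewrite Rplus_assoc, !Cpower_shift.
    assert (Ea : Cpower a (RtoC 1) = a) by (change 1 with (INR 1); rewrite Cpower_nat by auto; simpl; ring). rewrite Ea.
    replace (-2 * INR k) with (Ropp (2 * INR k)) by ring. rewrite RtoC_opp, Cpower_opp.
    field. repeat split; auto; apply Cpower_neq_0. }
  rewrite <- E1. unfold Hz, Hd. simpl qf. simpl qd. simpl INR.
  assert (Ew : (1 - zeta_arg k)%C = RtoC e) by (unfold zeta_arg, e; rewrite <- RtoC_minus; f_equal; ring).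
  replace (1 - zeta_arg k - 0)%C with (1 - zeta_arg k)%C by ring. rewrite Ew, xp_Cpower by auto.
  assert (Hec : RtoC e <> RtoC 0) by (intros E; apply RtoC_inj in E; auto).
  unfold Rdiv. rewrite !RtoC_mult, !RtoC_inv by (try apply pow_nonzero; auto). rewrite RtoC_pow. simpl Cpow.
  field. split; auto. apply Cpower_neq_0.
Qed.

(** After exchanging the sums, the left side is a finite combination of [Zpart] and [Zdpart], with
    limits [zeta] and [zeta']. *)
Lemma clim_summand_exp k a : (forall j, (j < N)%nat -> 2 <= - gamma - 2 * INR j + INR k) ->
  clim (fun n => Csum (fun i => summand_exp a 1 (INR (S i))) (S n) - Csum (fun j => cf j * summand_exp a j (INR (S n))) (S k))%C
    (Csum (zterm b mu gamma a) N).
Proof.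
  intros Hk.
  apply clim_ext with (fun n => Csum (fun j => Cpow (/ a) (2 * j) *
    ((RtoC (Ak b mu j) - RtoC (Bk b mu j) * Clog a) * Zpart k (zeta_arg j) n - RtoC (Bk b mu j) * Zdpart k (zeta_arg j) n))%C N).
  - intros n. unfold summand_exp. rewrite (Csum_ext (fun j => cf j * _)%C (fun j => Csum (fun l => cf j * (Cpow (/ a) (2 * l) *
    ((RtoC (Ak b mu l) - RtoC (Bk b mu l) * Clog a) * Hz j (zeta_arg l) (INR (S n)) - RtoC (Bk b mu l) * Hd j (zeta_arg l) (INR (S n)))))%C N))
      by (intros; symmetry; apply Csum_scal).
    rewrite !(Csum_exchange _ _ N). rewrite <- Csum_minus. apply Csum_ext. intros l _. unfold Zpart, Zdpart.
    set (c := Cpow (/ a) (2 * l)). set (A := (RtoC (Ak b mu l) - RtoC (Bk b mu l) * Clog a)%C). set (B := RtoC (Bk b mu l)).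
    rewrite (Csum_ext (fun i => c * (A * Hz 1 (zeta_arg l) (INR (S i)) - B * Hd 1 (zeta_arg l) (INR (S i))))%C
      (fun i => c * A * xp (INR (S i)) (- zeta_arg l) - c * B * (- ln (INR (S i)) * xp (INR (S i)) (- zeta_arg l)))%C).
    2:{ intros i _. unfold Hz, Hd. simpl qf. simpl qd. simpl (INR 1). replace (1 - zeta_arg l - 1)%C with (- zeta_arg l)%C by ring. ring. }
    rewrite (Csum_ext (fun j => cf j * (c * (A * Hz j (zeta_arg l) (INR (S n)) - B * Hd j (zeta_arg l) (INR (S n)))))%C
      (fun j => c * A * (cf j * Hz j (zeta_arg l) (INR (S n))) - c * B * (cf j * Hd j (zeta_arg l) (INR (S n))))%C) by (intros; ring).
    rewrite !Csum_minus, !Csum_scal. ring.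
  - apply (clim_Csum (fun n j => Cpow (/ a) (2 * j) *
    ((RtoC (Ak b mu j) - RtoC (Bk b mu j) * Clog a) * Zpart k (zeta_arg j) n - RtoC (Bk b mu j) * Zdpart k (zeta_arg j) n))%C).
    intros j Hj. unfold zterm. apply clim_scal, clim_minus; apply clim_scal.
    + apply zeta_clim; [apply zeta_arg_neq_1|]. unfold zeta_arg. rewrite re_RtoC. auto.
    + apply zeta'_clim; [apply zeta_arg_neq_1|]. unfold zeta_arg. rewrite re_RtoC. auto.
Qed.

Section Regular.
Variables (G : C -> C) (psi' psiR : nat -> C -> C) (m : nat).
Hypothesis hG : forall z, 0 < Re z -> cder G z (integrand b mu gamma z).
Hypothesis hpsi0 : forall z, psi' 0%nat z = integrand b mu gamma z.
Hypothesis hpsiR0 : forall z, psiR 0%nat z = integrand_rem b mu gamma N z.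
Hypothesis hpsi : dseq m psi'.
Hypothesis hpsiR : dseq m psiR.

Definition summand_full (a : C) (j : nat) (x : R) : C :=
  (Cpower a (RtoC gamma) * a * Cpow (/ a) j * match j with O => G (RtoC x / a) | S i => psi' i (RtoC x / a) end)%C.
Definition summand_rem (a : C) (j : nat) (x : R) : C :=
  (Cpower a (RtoC gamma) * a * Cpow (/ a) j *
    match j with O => G (RtoC x / a) - expansion_prim b mu gamma N (RtoC x / a) | S i => psiR i (RtoC x / a) end)%C.

Lemma rder_summand_full a j x : (j <= m)%nat -> 0 < Re a -> 0 < x -> rder (summand_full a j) x (summand_full a (S j) x).
Proof.
  intros Hj Ha Hx. assert (Hz := Re_div_a_pos a Ha x Hx). unfold summand_full. eapply rder_eq.
  - apply (rder_scal (Cpower a (RtoC gamma) * a * Cpow (/ a) j)%C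
      (fun x => match j with O => G (RtoC x / a) | S i => psi' i (RtoC x / a) end)%C).
    apply (rder_div_a (fun z => match j with O => G z | S i => psi' i z end) a x (psi' j (RtoC x / a)%C)).
    destruct j as [|j]; [rewrite hpsi0; auto|apply hpsi; auto].
  - simpl Cpow. ring.
Qed.

Lemma rder_summand_rem a j x : (j <= m)%nat -> 0 < Re a -> 0 < x -> rder (summand_rem a j) x (summand_rem a (S j) x).
Proof.
  intros Hj Ha Hx. assert (Hz := Re_div_a_pos a Ha x Hx). unfold summand_rem. eapply rder_eq.
  - apply (rder_scal (Cpower a (RtoC gamma) * a * Cpow (/ a) j)%C
      (fun x => match j with O => G (RtoC x / a) - expansion_prim b mu gamma N (RtoC x / a) | S i => psiR i (RtoC x / a) end)%C).
    apply (rder_div_a (fun z => match j with O => G z - expansion_prim b mu gamma N z | S i => psiR i z end)%C a x (psiR j (RtoC x / a)%C)).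
    destruct j as [|j]; [|apply hpsiR; auto]. rewrite hpsiR0. eapply cder_eq; [apply cder_minus; [apply hG, Hz|apply cder_expansion_prim; auto]|].
    unfold integrand, integrand_rem, factor_rem. ring.
  - simpl Cpow. ring.
Qed.

(** From [j = 0] the identity is differentiated repeatedly; uniqueness of derivatives matches three
    sequences that were chosen independently. *)
Lemma summand_full_split a j x : (j <= m)%nat -> 0 < Re a -> 0 < x -> summand_full a j x = (summand_rem a j x + summand_exp a j x)%C.
Proof.
  intros Hj Ha. revert x. induction j as [|j IH]; intros x Hx.
  - rewrite summand_exp_0 by auto. unfold summand_full, summand_rem. ring.
  - apply (rder_unique (summand_full a j) x); [apply rder_summand_full; auto; lia|].
    apply (rder_ext_pos (fun x => summand_rem a j x + summand_exp a j x)%C); [auto|intros; symmetry; apply IH; auto; lia|].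
    apply rder_plus; [apply rder_summand_rem; auto; lia|apply rder_summand_exp; auto].
Qed.

(** Separates the variables by keeping the worse of the two powers for each: the higher one in [x],
    the slower decay in [r]. *)
Lemma rem_weight_scale x r : 1 <= x -> 1 <= r -> rem_weight gamma N (x / r) <= 2 * (Rpower x (gamma + 2 * INR N + 1) * Rpower r (1 - gamma - 2 * INR N)).
Proof.
  intros Hx Hr.
  assert (E : forall e, Rpower (x / r) e = Rpower x e * Rpower r (- e)).
  { intros e. unfold Rdiv. unfold Rpower. rewrite <- exp_plus. f_equal.
    rewrite ln_mult, ln_Rinv by (try apply Rinv_0_lt_compat; lra). ring. }
  unfold rem_weight. rewrite !E.
  assert (H1 : Rpower x (gamma + 2 * INR N - 1) <= Rpower x (gamma + 2 * INR N + 1)) by (apply Rle_Rpower; lra).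
  assert (H2 : Rpower r (- (gamma + 2 * INR N + 1)) <= Rpower r (1 - gamma - 2 * INR N)) by (apply Rle_Rpower; lra).
  replace (- (gamma + 2 * INR N - 1)) with (1 - gamma - 2 * INR N) by ring.
  assert (P1 := Rpower_pos x (gamma + 2 * INR N + 1)). assert (P2 := Rpower_pos r (1 - gamma - 2 * INR N)). nra.
Qed.

Lemma Cmod_c0 a j : 0 < Re a -> Cmod (Cpower a (RtoC gamma) * a * Cpow (/ a) j) = Rpower (Cmod a) gamma * Cmod a / Cmod a ^ j.
Proof.
  intros Ha. assert (Ha0 := Cneq0_Re a Ha). assert (Hc := Cmod_pos_Re a Ha).
  rewrite !Cmod_mult, Cmod_Cpower_R, Cmod_pow, Cmod_inv by auto. unfold Rdiv. rewrite pow_inv. reflexivity.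
Qed.

(** The powers of [|a|] from the chain rule cancel those hidden in [x / |a|], so [|a|^(1 - 2N)]
    comes out for every order [j], while the exponent of [x] drops by one with each derivative. *)
Lemma summand_rem_bound kp A a j x :
  (forall z, 0 < Re z -> kp * Cmod z <= Re z -> Cmod (G z - expansion_prim b mu gamma N z) <= A * (Cmod z * rem_weight gamma N (Cmod z))) ->
  (forall j, (j <= m)%nat -> forall z, 0 < Re z -> kp * Cmod z <= Re z -> Cmod (psiR j z) <= A * (rem_weight gamma N (Cmod z) / Cmod z ^ j)) ->
  0 <= A -> 0 < Re a -> kp * Cmod a <= Re a -> 1 <= Cmod a -> 1 <= x -> (j <= S m)%nat ->
  Cmod (summand_rem a j x) <= 2 * A * Rpower (Cmod a) (1 - 2 * INR N) * (Rpower x (gamma + 2 * INR N + 1) * (x / x ^ j)).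
Proof.
  intros HG HA HA0 Ha Hk Ha1 Hx Hj.
  assert (Hz := Re_div_a_pos a Ha x ltac:(lra)). assert (Hkz := cone_div_a a Ha kp x ltac:(lra) Hk).
  assert (Hmz := Cmod_div_a a Ha x ltac:(lra)). set (z := (RtoC x / a)%C) in *. set (r := Cmod a) in *.
  assert (Hw := rem_weight_scale x r Hx Ha1). set (W := rem_weight gamma N (x / r)) in *.
  assert (HB : Cmod (summand_rem a j x) <= A * Rpower r gamma * W * (x / x ^ j)).
  { unfold summand_rem. rewrite Cmod_mult, Cmod_c0 by auto. fold r. fold z.
    assert (Hp : 0 <= Rpower r gamma * r / r ^ j).
    { apply Rmult_le_pos; [apply Rmult_le_pos; [apply Rlt_le, Rpower_pos|lra]|apply Rlt_le, Rinv_0_lt_compat, pow_lt; lra]. }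
    destruct j as [|j].
    - eapply Rle_trans; [apply Rmult_le_compat_l; [auto|apply HG; auto]|]. rewrite Hmz. fold W. right. simpl. field. lra.
    - eapply Rle_trans; [apply Rmult_le_compat_l; [auto|apply HA; auto; lia]|]. rewrite Hmz. fold W. right.
      unfold Rdiv. rewrite Rpow_mult_distr, pow_inv. rewrite <- !tech_pow_Rmult. field. repeat split; try lra; apply pow_nonzero; lra. }
  eapply Rle_trans; [exact HB|].
  assert (Hxj : 0 <= x / x ^ j) by (apply Rmult_le_pos; [lra|apply Rlt_le, Rinv_0_lt_compat, pow_lt; lra]).
  assert (Hrg := Rpower_pos r gamma).
  apply Rle_trans with (A * Rpower r gamma * (2 * (Rpower x (gamma + 2 * INR N + 1) * Rpower r (1 - gamma - 2 * INR N))) * (x / x ^ j)).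
  - apply Rmult_le_compat_r; auto. apply Rmult_le_compat_l; [apply Rmult_le_pos; lra|exact Hw].
  - right. replace (1 - 2 * INR N) with (gamma + (1 - gamma - 2 * INR N)) by ring. rewrite (Rpower_plus gamma). ring.
Qed.

(** Of the boundary terms at infinity only that of the primitive survives; the summand and its
    derivatives are [O(1/x)] by the choice of [L]. *)
Lemma summand_full_limit Hinf a k L A : (k <= m)%nat -> 0 < Re a -> climinf (fun x => G (RtoC x / a)%C) Hinf ->
  gamma + 1 <= INR L -> 0 <= A ->
  (forall j, (j <= m)%nat -> forall x, 0 < x -> Cmod (psi' j (RtoC x / a)%C) <= A * (Rpower (x / Cmod a) (gamma - INR L) / (x / Cmod a) ^ j)) ->
  clim (fun n => Csum (fun j => cf j * summand_full a j (INR (S n)))%C (S k)) (Cpower a (RtoC gamma) * a * Hinf).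
Proof.
  intros Hk Ha HGi HL HA0 HA. assert (Hc := Cmod_pos_Re a Ha).
  set (c0 := (Cpower a (RtoC gamma) * a)%C).
  replace (c0 * Hinf)%C with (Csum (fun j => match j with O => c0 * Hinf | S _ => 0 end)%C (S k)).
  2:{ rewrite Csum_Sl. rewrite (Csum_ext _ (fun _ => 0 * 0)%C) by (intros; ring). rewrite Csum_scal. ring. }
  apply (clim_Csum (fun n j => cf j * summand_full a j (INR (S n)))%C). intros j Hj.
  destruct j as [|j].
  - replace (c0 * Hinf)%C with (RtoC (cf 0) * (c0 * Cpow (/ a) 0 * Hinf))%C by (simpl; ring).
    apply clim_scal. unfold summand_full. fold c0. apply clim_scal. apply (clim_shift' (fun n => G (RtoC (INR n) / a)%C)).
    apply (climinf_clim (fun x => G (RtoC x / a)%C)), HGi.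
  - replace (RtoC 0) with (RtoC (cf (S j)) * (c0 * Cpow (/ a) (S j) * 0))%C by ring.
    apply clim_scal. unfold summand_full. fold c0. apply clim_scal. apply (clim_shift' (fun n => psi' j (RtoC (INR n) / a)%C)).
    apply (climinf_clim (fun x => psi' j (RtoC x / a)%C)).
    intros eps He. exists (Rmax (Cmod a) (Cmod a * (A + 1) / eps)). intros t Ht.
    assert (H1 := Rle_lt_trans _ _ _ (Rmax_l _ _) Ht). assert (H2 := Rle_lt_trans _ _ _ (Rmax_r _ _) Ht).
    replace (psi' j (RtoC t / a) - 0)%C with (psi' j (RtoC t / a)%C) by ring.
    eapply Rle_lt_trans; [apply HA; [lia|lra]|]. set (r := t / Cmod a).
    assert (Hr : 1 < r) by (unfold r; apply Rmult_lt_reg_r with (Cmod a); auto; field_simplify; lra).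
    assert (Hr2 : A + 1 < eps * r).
    { unfold r. apply Rmult_lt_reg_r with (Cmod a / eps); [apply Rdiv_lt_0_compat; lra|].
      replace (eps * (t / Cmod a) * (Cmod a / eps)) with t by (field; lra). unfold Rdiv in *. lra. }
    assert (HR1 : Rpower r (gamma - INR L) / r ^ j <= / r).
    { rewrite <- (Rmult_1_r (/ r)). apply Rmult_le_compat; [apply Rlt_le, Rpower_pos|apply Rlt_le, Rinv_0_lt_compat, pow_lt; lra| |].
      - rewrite <- (Rpower_1 r) at 2 by lra. rewrite <- Rpower_Ropp. apply Rle_Rpower; lra.
      - rewrite <- Rinv_1. apply Rinv_le_contravar; [lra|apply pow_R1_Rle; lra]. }
    apply Rle_lt_trans with (A * / r); [apply Rmult_le_compat_l; auto|].
    apply Rmult_lt_reg_r with r; [lra|]. rewrite Rmult_assoc, Rinv_l by lra. lra.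
Qed.

End Regular.
End Final.

Lemma EM_remainder k (h : R -> C) (I : nat -> C) M p : 0 <= M ->
  (forall i, cint (fun t => RtoC (bf k t) * h (INR (S i) + t)%R)%C 0 1 (I i)) ->
  (forall x, 1 <= x -> Cmod (h x) <= M * / x ^ 2) -> 0 <= p -> (forall t, 0 <= t <= 1 -> Rabs (bf k t) <= p) ->
  exists l, clim (Csum I) l /\ Cmod l <= 2 * (p * M).
Proof.
  intros HM HI Hh Hp Hbf. set (D := p * M). assert (HD : 0 <= D) by (unfold D; apply Rmult_le_pos; lra).
  assert (Hi := pos_INR).
  destruct (Csum_dominated I (fun i => - (2 * D / (INR i + 1))) 0) as [l [Hl Hl']].
  - intros i. specialize (Hi i). apply Rle_trans with (D * / (INR i + 1) ^ 2 * (1 - 0)).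
    + eapply cint_bound_const; [lra| |apply HI]. intros t Ht. cbv beta. rewrite Cmod_mult, Cmod_R, S_INR.
      unfold D. rewrite Rmult_assoc. apply Rmult_le_compat; [apply Rabs_pos|apply Cmod_ge_0|apply Hbf, Ht|].
      eapply Rle_trans; [apply Hh; lra|]. apply Rmult_le_compat_l; auto.
      apply Rinv_le_contravar; [apply pow_lt; lra|apply pow_incr; lra].
    + rewrite S_INR. replace (- (2 * D / (INR i + 1 + 1)) - - (2 * D / (INR i + 1))) with (D * (2 / ((INR i + 1) * (INR i + 1 + 1)))) by (field; lra).
      rewrite Rminus_0_r, Rmult_1_r. apply Rmult_le_compat_l; auto.
      apply Rmult_le_reg_r with ((INR i + 1) ^ 2 * (INR i + 1 + 1)).
      { apply Rmult_lt_0_compat; [apply pow_lt|]; lra. }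
      field_simplify; lra.
  - intros i. specialize (Hi i). assert (0 <= 2 * D / (INR i + 1)); [|lra].
    apply Rmult_le_pos; [lra|apply Rlt_le, Rinv_0_lt_compat; lra].
  - exists l. split; auto. specialize (Hl' O). rewrite Csum_0 in Hl'. simpl INR in Hl'.
    replace (0 - l)%C with (- l)%C in Hl' by ring. rewrite Cmod_opp in Hl'.
    eapply Rle_trans; [exact Hl'|]. right. unfold D. field.
Qed.

(** Euler-Maclaurin summation is applied to the remainder of the summand only; the expansion is
    summed by [clim_summand_exp], and [r] gathers the terms at [1] and the remainder integral. The
    sequences of derivatives and all constants are fixed before [a], which gives uniformity on the
    cone. *)
Lemma series_asymptotics b mu gamma N : 0 < b -> 0 < mu -> 1 <= gamma + 2 * INR N ->
  (forall k : nat, gamma + 2 * INR k + 1 <> 0) -> forall kp, 0 < kp ->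
  exists C0, 0 <= C0 /\ forall a, 0 < Re a -> kp * Cmod a <= Re a -> 1 <= Cmod a ->
  exists r : C, Cmod r <= C0 * Rpower (Cmod a) (1 - 2 * INR N) /\
    S0 mu gamma b a = (Cpower a (RtoC (-2 * mu)) * (Cpower a (RtoC gamma) * a * H0 mu gamma b 1 + Csum (zterm b mu gamma a) N + r))%C.
Proof.
  intros Hb Hmu HN Hgam kp Hkp.
  destruct (normalised_primitive b mu gamma Hb Hmu N HN Hgam) as [G [Hinf [HG [HG0 [HGi [HGP HGa]]]]]].
  rewrite (H0_value b mu gamma Hb Hmu N G Hinf HN Hgam HG HG0 HGi).
  (* Large enough for two purposes: [H (S (S k))] is then [O(x^(-2))], and [k] is admissible for
     [zeta] at every [- gamma - 2 j] with [j < N]. *)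
  destruct (nat_above (gamma + 2 * INR N + 2)) as [k Hk].
  destruct (nat_above (gamma + 1)) as [L0 HL0]. set (L := S L0). assert (HL : gamma + 1 <= INR L) by (unfold L; rewrite S_INR; lra).
  set (m := S (S k)).
  destruct (Sm_dseq _ _ _ _ (Sm_integrand b mu gamma Hb Hmu kp m L Hkp ltac:(unfold L; lia))) as [ps [Hps0 Hps]].
  destruct (Sm_dseq _ _ _ _ (Sm_integrand_rem b mu gamma Hb Hmu N kp m Hkp)) as [pR [HpR0 HpR]].
  assert (HSg : Sm kp m (fun r => Rpower r (gamma - INR L)) (ps O)).
  { eapply Sm_ext; [intros; symmetry; apply Hps0|]. apply Sm_integrand; auto. unfold L; lia. }
  assert (HSR : Sm kp m (rem_weight gamma N) (pR O)).
  { eapply Sm_ext; [intros; symmetry; apply HpR0|]. apply Sm_integrand_rem; auto. }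
  destruct (HGP kp Hkp) as [A0 [HA0 HA0']].
  destruct (uniform_const (fun j A => forall z, 0 < Re z -> kp * Cmod z <= Re z -> Cmod (pR j z) <= A * (rem_weight gamma N (Cmod z) / Cmod z ^ j)) m) as [A1 [HA1 HA1']].
  { intros j A B HAB H z Hz Hkz. eapply Rle_trans; [apply H; auto|]. apply Rmult_le_compat_r; auto.
    apply Rmult_le_pos; [apply Rlt_le, rem_weight_pos|apply Rlt_le, Rinv_0_lt_compat, pow_lt, Cmod_pos_Re, Hz]. }
  { intros j Hj. destruct (Sm_dseq_bound _ _ _ _ HpR HSR j Hj) as [A [_ H]]. exists A; auto. }
  destruct (uniform_const (fun j A => forall z, 0 < Re z -> kp * Cmod z <= Re z -> Cmod (ps j z) <= A * (Rpower (Cmod z) (gamma - INR L) / Cmod z ^ j)) m) as [A2 [HA2 HA2']].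
  { intros j A B HAB H z Hz Hkz. eapply Rle_trans; [apply H; auto|]. apply Rmult_le_compat_r; auto.
    apply Rmult_le_pos; [apply Rlt_le, Rpower_pos|apply Rlt_le, Rinv_0_lt_compat, pow_lt, Cmod_pos_Re, Hz]. }
  { intros j Hj. destruct (Sm_dseq_bound _ _ _ _ Hps HSg j Hj) as [A [_ H]]. exists A; auto. }
  set (A := Rmax A0 A1). assert (HA : 0 <= A) by (eapply Rle_trans; [exact HA0|apply Rmax_l]).
  destruct (bf_bounded k) as [p [Hp Hbf]]. destruct (Csum_scaled_bound cf (S k)) as [B [HB HBc]].
  exists (2 * A + B * (2 * A) + 2 * (p * (2 * A))). split.
  { assert (0 <= B * (2 * A)) by (apply Rmult_le_pos; lra). assert (0 <= p * (2 * A)) by (apply Rmult_le_pos; lra). lra. }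
  intros a Ha Hka Ha1. set (rr := Rpower (Cmod a) (1 - 2 * INR N)). assert (Hrr : 0 < rr) by apply Rpower_pos.
  set (H := summand_rem b mu gamma N G pR a). set (F := summand_full gamma G ps a).
  assert (HHd : forall j x, (j <= m)%nat -> 0 < x -> rder (H j) x (H (S j) x)).
  { intros j x Hj Hx. apply rder_summand_rem with (m := m); auto. }
  assert (HHb : forall j x, (j <= S m)%nat -> 1 <= x ->
    Cmod (H j x) <= 2 * A * rr * (Rpower x (gamma + 2 * INR N + 1) * (x / x ^ j))).
  { intros j x Hj Hx. apply summand_rem_bound with (m := m) (kp := kp); auto.
    - intros z Hz Hkz. eapply Rle_trans; [apply HA0'; auto|]. apply Rmult_le_compat_r; [|apply Rmax_l].
      apply Rmult_le_pos; [apply Cmod_ge_0|apply Rlt_le, rem_weight_pos].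
    - intros i Hi z Hz Hkz. eapply Rle_trans; [apply HA1'; auto|]. apply Rmult_le_compat_r; [|apply Rmax_r].
      apply Rmult_le_pos; [apply Rlt_le, rem_weight_pos|apply Rlt_le, Rinv_0_lt_compat, pow_lt, Cmod_pos_Re, Hz]. }
  assert (HH1 : forall j, (j <= S m)%nat -> Cmod (H j 1) <= 2 * A * rr).
  { intros j Hj. eapply Rle_trans; [apply HHb; [auto|lra]|]. right. unfold Rpower. rewrite ln_1, pow1, Rmult_0_r, exp_0. field. }
  destruct (EM_sum k H) as [I [HI HEM]].
  { intros j Hj t Ht. apply HHd; [unfold m; lia|lra]. }
  { intros t Ht. exists (H (S (S (S k))) t). apply HHd; [unfold m; lia|lra]. }
  destruct (EM_remainder k (H (S (S k))) I (2 * A * rr) p) as [Il [HIl HIb]]; auto.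
  { apply Rmult_le_pos; lra. }
  { intros x Hx. eapply Rle_trans; [apply HHb; [unfold m; lia|auto]|].
    apply Rmult_le_compat_l; [apply Rmult_le_pos; lra|].
    assert (Hx0 : 0 < x) by lra.
    replace (x / x ^ S (S k)) with (Rpower x (- INR (S k))) by (rewrite Rpower_Ropp, Rpower_pow by auto; simpl; field; split; [apply pow_nonzero|]; lra).
    rewrite <- Rpower_plus. rewrite <- Rpower_pow, <- Rpower_Ropp by auto. apply Rle_Rpower; auto. rewrite S_INR. simpl INR. lra. }
  set (r := (H 1%nat 1 - Csum (fun j => cf j * H j 1) (S k) + Il)%C).
  exists r. split.
  { unfold r. eapply Rle_trans; [apply Cmod_triangle|]. 
    assert (Q1 := Cmod_triangle_minus (H 1%nat 1) (Csum (fun j => cf j * H j 1)%C (S k))).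
    assert (Q2 := HH1 1%nat ltac:(lia)).
    assert (Q3 := HBc (fun j => H j 1) (2 * A * rr) ltac:(intros; apply HH1; unfold m; lia)).
    replace ((2 * A + B * (2 * A) + 2 * (p * (2 * A))) * rr) with (2 * A * rr + B * (2 * A * rr) + 2 * (p * (2 * A * rr))) by ring.
    cbv beta in Q3. lra. }
  unfold S0. apply clim_CSeries.
  set (c0 := (Cpower a (RtoC gamma) * a)%C).
  assert (HF1 : forall x, 0 < x -> F 1%nat x = (Cpower a (RtoC gamma) * integrand b mu gamma (RtoC x / a))%C).
  { intros x Hx. unfold F, summand_full. rewrite Hps0. simpl Cpow. field. now apply Cneq0_Re. }
  apply clim_ext with (fun n => Cpower a (RtoC (-2 * mu)) * Csum (fun i => F 1%nat (INR (S i))) n)%C.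
  { intros n. rewrite <- Csum_scal. apply Csum_ext. intros i _. cbv zeta.
    assert (Hi := INR_S_ge_1 i). rewrite series_term by (auto; lra). rewrite HF1 by lra. reflexivity. }
  apply clim_scal. apply clim_shift.
  (* As [F] is [H] plus the expansion, the boundary terms at [n + 1] from both summations recombine
     into those of [F], which have a limit although the separate ones need not. *)
  apply clim_ext with (fun n => Csum (fun j => cf j * F j (INR (S n))) (S k)
     + (Csum (fun i => summand_exp b mu gamma N a 1 (INR (S i))) (S n) - Csum (fun j => cf j * summand_exp b mu gamma N a j (INR (S n))) (S k))
     + (H 1%nat 1 - Csum (fun j => cf j * H j 1) (S k) + Csum I n))%C.
  - intros n. assert (HFs : forall j x, (j <= m)%nat -> 0 < x -> F j x = (H j x + summand_exp b mu gamma N a j x)%C).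
    { intros j x Hj Hx. apply summand_full_split with (m := m); auto. }
    assert (Hpos : forall i, 0 < INR (S i)) by (intros i; generalize (INR_S_ge_1 i); lra).
    rewrite (Csum_ext (fun i => F 1%nat (INR (S i))) (fun i => H 1%nat (INR (S i)) + summand_exp b mu gamma N a 1 (INR (S i)))%C)
      by (intros; apply HFs; [unfold m; lia|apply Hpos]).
    rewrite Csum_plus, HEM.
    rewrite (Csum_ext (fun j => cf j * F j (INR (S n)))%C (fun j => cf j * H j (INR (S n)) + cf j * summand_exp b mu gamma N a j (INR (S n)))%C)
      by (intros; rewrite HFs; [ring|unfold m; lia|apply Hpos]).
    rewrite (Csum_ext (fun j => cf j * (H j (INR (S n)) - H j 1))%C (fun j => cf j * H j (INR (S n)) - cf j * H j 1)%C) by (intros; ring).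
    rewrite Csum_plus, Csum_minus. ring.
  - apply clim_plus; [apply clim_plus|].
    + apply summand_full_limit with (m := m) (L := L) (A := A2); auto; [unfold m; lia|].
      intros j Hj x Hx. rewrite <- Cmod_div_a by auto. apply HA2'; auto; [apply Re_div_a_pos; auto|apply cone_div_a; auto].
    + apply clim_summand_exp; auto. intros j Hj. apply (lt_INR) in Hj. lra.
    + apply clim_plus; [apply clim_const|exact HIl].
Qed.

(** * Truncation of the expansion *)

Lemma ln_ge_1 r : exp 1 <= r -> 1 <= ln r.
Proof. intros H. rewrite <- (ln_exp 1). apply ln_le; [apply exp_pos|exact H]. Qed.

Lemma exp_1_ge_1 : 1 <= exp 1.
Proof. generalize (exp_ineq1_le 1). lra. Qed.

(** From [|a| >= e] on, [ln |a| >= 1] absorbs the constants, the bounded argument of [a]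
    included. *)
Lemma zterm_bound b mu gamma K k : (K <= k)%nat -> exists D, 0 <= D /\ forall a, 0 < Re a -> exp 1 <= Cmod a ->
  Cmod (zterm b mu gamma a k) <= D * (Rpower (Cmod a) (-2 * INR K) * ln (Cmod a)).
Proof.
  intros Hk. set (z0 := zeta (RtoC (- gamma - 2 * INR k))). set (z1 := zeta' (RtoC (- gamma - 2 * INR k))).
  set (A := RtoC (Ak b mu k)). set (B := RtoC (Bk b mu k)).
  exists ((Cmod A + Cmod B * (1 + PI)) * Cmod z0 + Cmod B * Cmod z1).
  assert (HA := Cmod_ge_0 A). assert (HB := Cmod_ge_0 B). assert (H0 := Cmod_ge_0 z0). assert (H1 := Cmod_ge_0 z1).
  assert (Hpi := PI_RGT_0).
  assert (HB' : 0 <= Cmod B * (1 + PI)) by (apply Rmult_le_pos; lra).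
  split.
  { apply Rplus_le_le_0_compat; apply Rmult_le_pos; lra. }
  intros a Ha Ha1. assert (Hl := ln_ge_1 _ Ha1). assert (He := exp_1_ge_1). set (r := Cmod a) in *.
  unfold zterm. fold z0 z1 A B. rewrite Cmod_mult, <- Cpow_inv_even, Cmod_Cpower_R by auto. fold r.
  assert (Hr : Rpower r (-2 * INR k) <= Rpower r (-2 * INR K)) by (apply Rle_Rpower; [lra|]; apply le_INR in Hk; lra).
  assert (HL : Cmod (Clog a) <= (1 + PI) * ln r).
  { eapply Rle_trans; [apply Cmod_le_abs|]. change (Re (Clog a)) with (ln r). change (Im (Clog a)) with (Carg a).
    rewrite (Rabs_pos_eq (ln r)) by lra. assert (Hc := Carg_half_plane a Ha).
    assert (Rabs (Carg a) <= PI) by (apply Rabs_le; lra). nra. }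
  assert (HT : Cmod ((A - B * Clog a) * z0 - B * z1)%C <= ((Cmod A + Cmod B * (1 + PI)) * Cmod z0 + Cmod B * Cmod z1) * ln r).
  { eapply Rle_trans; [apply Cmod_triangle_minus|]. rewrite !Cmod_mult.
    assert (Q1 : Cmod (A - B * Clog a) <= (Cmod A + Cmod B * (1 + PI)) * ln r).
    { eapply Rle_trans; [apply Cmod_triangle_minus|]. rewrite Cmod_mult.
      assert (Cmod B * Cmod (Clog a) <= Cmod B * ((1 + PI) * ln r)) by (apply Rmult_le_compat_l; auto). nra. }
    apply Rmult_le_compat_r with (r := Cmod z0) in Q1; auto.
    assert (Q2 : 0 <= Cmod B * Cmod z1) by (apply Rmult_le_pos; auto). nra. }
  eapply Rle_trans; [apply Rmult_le_compat; [apply Rlt_le, Rpower_pos|apply Cmod_ge_0|exact Hr|exact HT]|]. right. ring.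
Qed.

Lemma zterm_tail b mu gamma K n : exists D, 0 <= D /\ forall a, 0 < Re a -> exp 1 <= Cmod a ->
  Cmod (Csum (zterm b mu gamma a) (K + n) - Csum (zterm b mu gamma a) K) <= D * (Rpower (Cmod a) (-2 * INR K) * ln (Cmod a)).
Proof.
  induction n as [|n [D [HD IH]]].
  - exists 0. split; [lra|]. intros a _ _. rewrite Nat.add_0_r. replace (Csum (zterm b mu gamma a) K - Csum (zterm b mu gamma a) K)%C with (RtoC 0) by ring.
    rewrite Cmod_0. lra.
  - destruct (zterm_bound b mu gamma K (K + n) ltac:(lia)) as [E [HE H]]. exists (D + E). split; [lra|].
    intros a Ha Ha1. rewrite Nat.add_succ_r, Csum_S.
    replace (Csum (zterm b mu gamma a) (K + n) + zterm b mu gamma a (K + n) - Csum (zterm b mu gamma a) K)%C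
      with (Csum (zterm b mu gamma a) (K + n) - Csum (zterm b mu gamma a) K + zterm b mu gamma a (K + n)%nat)%C by ring.
    eapply Rle_trans; [apply Cmod_triangle|]. rewrite Rmult_plus_distr_r. apply Rplus_le_compat; auto.
Qed.

Theorem theorem2 (mu b gamma : R) (hmu : 0 < mu) (hb : 0 < b)
    (hgamma : forall m : nat, gamma <> - (2 * INR m + 1)) :
  forall (K : nat) (delta : R), 0 < delta < PI / 2 ->
  exists A M : R, forall a : C,
    M <= Cmod a -> Rabs (Carg a) <= PI / 2 - delta ->
    Cmod (S0 mu gamma b a
          - Cpower a (RtoC (gamma - 2 * mu + 1)) * H0 mu gamma b (RtoC 1)
          - Cpower a (RtoC (- 2 * mu)) * Csum (expansion_term mu gamma b a) K)%C
    <= A * (Rpower (Cmod a) (- 2 * mu - 2 * INR K) * ln (Cmod a)).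
Proof.
  intros K delta Hd.
  assert (Hkp : 0 < sin delta) by (apply sin_gt_0; lra).
  (* With [N = K + n + 1] both [1 <= gamma + 2 N] and [1 - 2 N <= - 2 K] hold, whatever the sign of
     [gamma]. *)
  destruct (nat_above (1 - gamma)) as [n Hn].
  assert (HN : 1 <= gamma + 2 * INR (K + S n)).
  { rewrite plus_INR, S_INR. generalize (pos_INR K) (pos_INR n). lra. }
  destruct (series_asymptotics b mu gamma (K + S n) hb hmu HN ltac:(intros k E; apply (hgamma k); lra) (sin delta) Hkp) as [C0 [HC0 H]].
  destruct (zterm_tail b mu gamma K (S n)) as [D [HD HT]].
  (* [D] bounds the terms between [K] and [N], [C0] the remainder of the longer expansion;
     [|a| >= e] ensures [ln |a| >= 1]. *)
  exists (D + C0), (exp 1). intros a Ha1 Harg.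
  assert (He := exp_1_ge_1). assert (Hl := ln_ge_1 _ Ha1).
  assert (Ha0 : a <> RtoC 0) by (intros ->; rewrite Cmod_0 in Ha1; lra).
  assert (Hka := cone_Re a delta Hd Ha0 Harg).
  assert (Ha : 0 < Re a) by (eapply Rlt_le_trans; [apply (Rmult_lt_0_compat (sin delta) (Cmod a)); lra|exact Hka]).
  destruct (H a Ha Hka ltac:(lra)) as [r [Hr ->]]. specialize (HT a Ha Ha1).
  rewrite (Csum_ext (expansion_term mu gamma b a) (zterm b mu gamma a)) by (intros; now apply expansion_term_eq).
  set (T := Csum (zterm b mu gamma a) (K + S n)) in *. set (T0 := Csum (zterm b mu gamma a) K) in *.
  replace (Cpower a (RtoC (gamma - 2 * mu + 1))) with (Cpower a (RtoC (-2 * mu)) * (Cpower a (RtoC gamma) * a))%C.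
  2:{ replace (gamma - 2 * mu + 1) with (-2 * mu + (gamma + INR 1)) by (simpl; ring).
      rewrite !Cpower_shift, Cpower_nat by auto. simpl. ring. }
  match goal with |- Cmod ?e <= _ => replace e with (Cpower a (RtoC (-2 * mu)) * ((T - T0) + r))%C by ring end.
  rewrite Cmod_mult, Cmod_Cpower_R.
  replace (-2 * mu - 2 * INR K) with (-2 * mu + -2 * INR K) by ring. rewrite Rpower_plus.
  set (q := Rpower (Cmod a) (-2 * INR K)) in *.
  assert (Hq : 0 < q) by apply Rpower_pos.
  assert (Hr' : Cmod r <= C0 * (q * ln (Cmod a))).
  { eapply Rle_trans; [exact Hr|]. apply Rmult_le_compat_l; auto.
    apply Rle_trans with q; [|nra]. apply Rle_Rpower; [lra|]. rewrite plus_INR, S_INR. generalize (pos_INR n). lra. }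
  replace ((D + C0) * (Rpower (Cmod a) (-2 * mu) * q * ln (Cmod a))) with
    (Rpower (Cmod a) (-2 * mu) * (D * (q * ln (Cmod a)) + C0 * (q * ln (Cmod a)))) by ring.
  apply Rmult_le_compat_l; [apply Rlt_le, Rpower_pos|].
  eapply Rle_trans; [apply Cmod_triangle|]. lra.
Qed.
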